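(* Let $p\in(1,\infty)\setminus\{2\}$, let $q$ be the Hölder conjugate of $p$ ($\frac1p+\frac1q=1$), and let $(\mathbb{H},d,\mathcal{L}^3)$ be the $\ell^p$-Heisenberg group equipped with its sub-Finsler distance and the Lebesgue measure. 1) If $p\in(1,2)$, then the curvature exponent $N_p$ of $(\mathbb{H},d,\mathcal{L}^3)$ is finite and $N_p>2q+1$. In other words, $(\mathbb{H},d,\mathcal{L}^3)$ satisfies $\mathsf{MCP}(K,N)$ if and only if $K\le 0$ and $N\ge N_p$, where $2q+1<N_p<+\infty$. 2) If $p\in(2,\infty)$, then $(\mathbb{H},d,\mathcal{L}^3)$ does not satisfy $\mathsf{MCP}(K,N)$ for any $K\in\mathbb{R}$ and any $N\ge 1$ (for which $\mathsf{MCP}(K,N)$ is defined).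
   Context: **The $\ell^p$-Heisenberg group.** The Heisenberg group $\mathbb{H}$ is $\mathbb{R}^3$ with group law $(x,y,z)\cdot(x',y',z')=(x+x',y+y',z+z'+\frac12(xy'-x'y))$ and left-invariant vector fields $X=\partial_x-\frac y2\partial_z$, $Y=\partial_y+\frac x2\partial_z$. An absolutely continuous curve $\gamma:[0,1]\to\mathbb{H}$ is horizontal if $\dot\gamma(t)=u_1(t)X(\gamma(t))+u_2(t)Y(\gamma(t))$ for a.e. $t$; its length is $\mathrm{L}(\gamma)=\int_0^1(|u_1|^p+|u_2|^p)^{1/p}\,dt$. The distance $d(g_0,g_1)$ is the infimum of the lengths of horizontal curves joining $g_0$ to $g_1$. $\mathcal{L}^3$ is the Lebesgue measure on $\mathbb{R}^3$. **Measure contraction property.** Let $(X,d,\mathfrak{m})$ be a geodesic metric measure space with negligible cut locus: for every $x\in X$ there are an $\mathfrak{m}$-negligible set $\mathcal{C}(x)$ and a measurable map $\Phi_x:(X\setminus\mathcal{C}(x))\times[0,1]\to X$ such that $t\mapsto\Phi_x(y,t)$ is the unique minimising constant speed geodesic from $x$ to $y$. (The $\ell^p$-Heisenberg groups with $1<p<\infty$ have negligible cut locus.) For $x\in X$, a Borel set $\Omega\subseteq X$ and $t\in[0,1]$, the $t$-intermediate set of $\Omega$ from $x$ is $$\Omega_t=\{\gamma(t)\mid \gamma:[0,1]\to X\text{ constant speed minimising geodesic},\ \gamma(0)=x,\ \gamma(1)\in\Omega\}.$$ Let $\mathsf{s}_K(t)=\sin(\sqrt Kt)/\sqrt K$ if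 $K>0$, $\mathsf{s}_0(t)=t$, and $\mathsf{s}_K(t)=\sinh(\sqrt{-K}t)/\sqrt{-K}$ if $K<0$. Let $K\in\mathbb{R}$ and $N>1$, or $K\le0$ and $N=1$ ($\mathsf{MCP}(K,N)$ is defined only for such pairs). The space satisfies $\mathsf{MCP}(K,N)$ if for all $x\in X$, all Borel $\Omega\subseteq X$ with $0<\mathfrak{m}(\Omega)<+\infty$ (and $\Omega\subseteq B(x,\pi\sqrt{(N-1)/K})$ if $K>0$), and all $t\in[0,1]$, $$\mathfrak{m}(\Omega_t)\ge\int_\Omega t\left[\frac{\mathsf{s}_K(t\,d(x,y)/\sqrt{N-1})}{\mathsf{s}_K(d(x,y)/\sqrt{N-1})}\right]^{N-1}d\mathfrak{m}(y),$$ with the convention $0/0=1$ and where the term in square brackets (to the power $N-1$) is $1$ if $K\le0$ and $N=1$. In particular, $\mathsf{MCP}(0,N)$ means $\mathfrak{m}(\Omega_t)\ge t^N\mathfrak{m}(\Omega)$ for all such $x,\Omega,t$. **Curvature exponent.** $N_{\mathrm{curv}}=\inf\{N>1\mid\mathsf{MCP}(0,N)\text{ is satisfied}\}$. *)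

(* Defs.v *)
From HB Require Import structures.
From mathcomp Require Import all_boot all_order all_algebra.
From mathcomp Require Import all_classical all_reals all_analysis.
From mathcomp Require Import ring.

Set Implicit Arguments.
Unset Strict Implicit.
Unset Printing Implicit Defensive.

Import Order.TTheory GRing.Theory Num.Theory.
Import numFieldNormedType.Exports.

Local Open Scope classical_set_scope.
Local Open Scope ring_scope.

Section MCP.
Context {R : realType} {disp : measure_display} {T : measurableType disp}.
Variables (d : T -> T -> R) (m : {measure set T -> \bar R}).

(* Curves on [0, 1] are represented by total functions on R; no definition
   depends on their values outside [0, 1] (up to a null set of times, for
   derivatives). *)
Definition min_geodesic (gamma : R -> T) : Prop :=
  forall s t, 0 <= s <= 1 -> 0 <= t <= 1 ->
    d (gamma s) (gamma t) = `|s - t| * d (gamma 0) (gamma 1).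

Definition intermediate_set (x : T) (Omega : set T) (t : R) : set T :=
  [set y | exists gamma : R -> T,
    [/\ min_geodesic gamma, gamma 0 = x, Omega (gamma 1) & gamma t = y]].

Definition sinh (t : R) : R := (expR t - expR (- t)) / 2.

Definition s_ (K t : R) : R :=
  if 0 < K then sin (Num.sqrt K * t) / Num.sqrt K
  else if K == 0 then t
  else sinh (Num.sqrt (- K) * t) / Num.sqrt (- K).

(* Quotient with the convention 0 / 0 = 1. *)
Definition quot01 (a b : R) : R := if (a == 0) && (b == 0) then 1 else a / b.

Definition mcp_bracket (K N t r : R) : R :=
  if (K <= 0) && (N == 1) then 1
  else quot01 (s_ K (t * r / Num.sqrt (N - 1))) (s_ K (r / Num.sqrt (N - 1)))
         `^ (N - 1).

Definition MCP_defined (K N : R) : Prop := 1 < N \/ (K <= 0 /\ N = 1).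

(* Intermediate sets of Borel sets need not be Borel, hence the outer measure
   [mu_ext m], which agrees with the completion of [m] on the sets that are
   measurable for it. *)
Definition MCP (K N : R) : Prop :=
  forall (x : T) (Omega : set T) (t : R),
    measurable Omega -> (0 < m Omega < +oo)%E ->
    (0 < K -> Omega `<=` [set y | d x y < pi * Num.sqrt ((N - 1) / K)]) ->
    0 <= t <= 1 ->
    (\int[m]_(y in Omega) (t * mcp_bracket K N t (d x y))%:E
       <= mu_ext m (intermediate_set x Omega t))%E.

Definition curvature_exponent : \bar R :=
  ereal_inf [set N%:E | N in [set N : R | 1 < N /\ MCP 0 N]].

End MCP.

Definition abs_continuous01 {R : realType} {V : normedModType R}
    (f : R -> V) : Prop :=
  forall e : R, 0 < e -> exists2 delta : R, 0 < delta &
    forall (n : nat) (a b : 'I_n -> R),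
      (forall i, 0 <= a i /\ a i <= b i /\ b i <= 1) ->
      trivIset setT (fun i => `]a i, b i[%classic) ->
      \sum_i (b i - a i) < delta ->
      \sum_i `|f (b i) - f (a i)| < e.

Section Heisenberg.
Context {R : realType}.
Local Notation H := (R * R * R)%type.

Definition heis_mul (g h : H) : H :=
  let: (x, y, z) := g in let: (x', y', z') := h in
  (x + x', y + y', z + z' + 2^-1 * (x * y' - x' * y)).

Definition Xfield (g : H) : H := let: (x, y, z) := g in (1, 0, - (y / 2)).
Definition Yfield (g : H) : H := let: (x, y, z) := g in (0, 1, x / 2).

Lemma heis_mul_expX (g : H) (s : R) : heis_mul g (s, 0, 0) = g + s *: Xfield g.
Proof.
case: g => [[x y] z]; rewrite /heis_mul /Xfield.
by congr (_, _, _) => /=; rewrite /GRing.scale/=; ring.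
Qed.

Lemma heis_mul_expY (g : H) (s : R) : heis_mul g (0, s, 0) = g + s *: Yfield g.
Proof.
case: g => [[x y] z]; rewrite /heis_mul /Yfield.
by congr (_, _, _) => /=; rewrite /GRing.scale/=; ring.
Qed.

(* The controls are determined a.e. by the curve; as derivatives they can
   always be chosen Borel. *)
Definition horizontal (gamma : R -> H) (u1 u2 : R -> R) : Prop :=
  [/\ abs_continuous01 gamma,
      measurable_fun (`[0, 1] : set R) u1, measurable_fun (`[0, 1] : set R) u2 &
      {ae (@lebesgue_measure R), forall t : R, 0 <= t <= 1 ->
        is_derive t 1 gamma
          (u1 t *: Xfield (gamma t) + u2 t *: Yfield (gamma t))}].

Definition lp_length (p : R) (u1 u2 : R -> R) : \bar R :=
  (\int[@lebesgue_measure R]_(t in `[0%R, 1%R])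
     ((`|u1 t| `^ p + `|u2 t| `^ p) `^ p^-1)%:E)%E.

(* The infimum is finite, since any two points are joined by a horizontal
   curve. *)
Definition heis_dist (p : R) (g0 g1 : H) : R :=
  fine (ereal_inf [set l | exists gamma u1 u2,
    [/\ horizontal gamma u1 u2, gamma 0 = g0, gamma 1 = g1 &
        l = lp_length p u1 u2]]).

(* [lebesgue_measure] lives on [measurableTypeR R], which is convertible to R. *)
Local Notation HM :=
  (measurableTypeR R * measurableTypeR R * measurableTypeR R)%type.

Definition lebesgue3 : {measure set HM -> \bar R} :=
  ((@lebesgue_measure R \x @lebesgue_measure R) \x @lebesgue_measure R)%E.

Definition heis_MCP (p K N : R) : Prop := MCP (heis_dist p : HM -> HM -> R) lebesgue3 K N.

Definition heis_curv (p : R) : \bar R :=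
  curvature_exponent (heis_dist p : HM -> HM -> R) lebesgue3.

End Heisenberg.

(* Main.v *)
Require Import Defs.
From HB Require Import structures.
From mathcomp Require Import all_boot all_order all_algebra.
From mathcomp Require Import all_classical all_reals all_analysis.
From mathcomp Require Import measurable_realfun.
From mathcomp Require Import ring lra.

(* Let e(f) = (C f, S f) run through the unit l^q circle, with f twice the area
   swept from (1, 0), so that e x e' = 1 and |e'|_p = 1; Pi is the area of the
   unit l^q disc.  For a closed horizontal curve whose x-coordinate covers an
   interval of half-width r, E. Schmidt's proof of the isoperimetric inequality
   gives z + Pi r^2 <= r L for its length L and its height z, and the equality
   case forces the curve to be an arc of the l^q circle.  Hence the unique
   geodesics from 0 to points outside the plane z = 0 are, up to the symmetry
   (x, y, z) -> (x, - y, - z), the curves t |-> F(f, t s, r) with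
     F(f, s, r) = (r (e(f + s) - e(f)), r^2 / 2 (s - e(f) x e(f + s)))
   and 0 < s < 2 Pi.  F is a chart of the half-space z > 0 with Jacobian
   r^3 D(f, f + s), and taking t-intermediate points is (f, s, r) |-> (f, t s, r).
   So MCP(0, N) means t^(N - 1) D(f, f + s) <= D(f, f + t s).  Small balls show
   that MCP(K, N) with K <= 0 implies MCP(0, N), and K > 0 is excluded because
   the distortion coefficient is unbounded near distance pi sqrt((N - 1) / K).

   With kap = (q - 1) |C S|^(q - 2) one has dD(f, g)/dg = kap(g) fq(f, g), where
   fq(f, f + s) = e(f) x e(f + s) - s e(f + s) x e'(f).
   - If q < 2, kap is infinite at g = 0, where D stays bounded, so no N works.
   - If q > 2, the doubling property of kap (for short arcs) and compactness (for
     long ones) bound s kap fq by a multiple of D, so some N works; N = 2 q + 1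
     does not, since D(- h, h) / (2 h)^(2 q) and D(0, g) / g^(2 q) have limits in
     the ratio q^2 : 4^(q - 1) < 1 as h and g tend to 0. *)

Set Implicit Arguments.
Unset Strict Implicit.
Unset Printing Implicit Defensive.

Import Order.TTheory GRing.Theory Num.Theory.
Import numFieldNormedType.Exports.

Local Open Scope classical_set_scope.
Local Open Scope ring_scope.

(** * Real calculus *)

Section Calculus.
Context {R : realType}.
Implicit Types (f g : R -> R) (x y a b l : R).

(** Neither existence of minimisers nor a first-order optimality condition is used. An arc of the
    circle is minimal because completing it to a full turn gives a shortest loop, which leaves no
    slack in the triangle inequality for either piece. Uniqueness is needed only for broken curves:
    every point is reached by an explicit arc or line, so an intermediate point is joined to both
    ends by known pieces, and closing the loop gives an equality case of the isoperimetric
    inequality. That case is tested only along known arcs, so the regularity of general minimisers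
    never arises. The area formula is assembled from one-dimensional substitutions and Tonelli's
    theorem: with m = y / x, the parameter f replaces z / x^2 and then the second endpoint g of the
    chord replaces m, one variable at a time. The inequality for D does not contain r; this freedom
    lets the length of an arc be taken small when K < 0 and close to the critical distance when K >
    0. The inequality is closed in N, so the least exponent is attained and the failure at 2 q + 1
    gives a strict bound. *)

Lemma is_derive_epsP f x l : is_derive x 1 f l <->
  forall e, 0 < e -> exists2 d, 0 < d & forall h, `|h| < d ->
    `|f (x + h) - f x - l * h| <= e * `|h|.
Proof.
have E h : h != 0 -> `|f (x + h) - f x - l * h| =
    `|h| * `|l - h^-1 *: ((f \o shift x) (h *: 1) - f x)|.
  move=> h0; rewrite -normrM -normrN; congr (`|_|).
  rewrite /GRing.scale/= mulr1 (addrC h x); field.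
  exact: h0.
split=> [[dfx dl] e e0|H].
  move/cvgrPdist_le: dfx => /(_ _ e0) /nbhs_ballP[d /= d0 H].
  exists d => // h hd; have [->|h0] := eqVneq h 0.
    by rewrite addr0 subrr mulr0 subrr normr0 mulr0.
  have := H h; rewrite /ball/= sub0r normrN -[X in `|X - _|]/(derive f x 1) dl => /(_ hd h0) => K.
  rewrite E// /derive mulrC ler_wpM2r//.
have cv : h^-1 *: ((f \o shift x) (h *: 1) - f x) @[h --> 0^'] --> l.
  apply/cvgrPdist_le => e e0; have [d d0 Hd] := H e e0.
  apply/nbhs_ballP; exists d => //= h; rewrite /ball/= sub0r normrN => hd h0.
  have := Hd h hd; rewrite E// mulrC ler_pM2r// normr_gt0 //.
split; first by apply/cvg_ex; exists l.
by apply/cvg_lim => //; exact: Rhausdorff.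
Qed.

Lemma cts_epsP f x : {for x, continuous f} <->
  forall e, 0 < e -> exists2 d, 0 < d & forall y, `|y - x| < d -> `|f y - f x| <= e.
Proof.
split=> [/cvgrPdist_le H e e0|H].
  have /nbhs_ballP[d /= d0 Hd] := H e e0.
  exists d => // y xy; rewrite distrC; apply: Hd; rewrite /ball/= distrC//.
apply/cvgrPdist_le => e e0; have [d d0 Hd] := H e e0.
apply/nbhs_ballP; exists d => //= y; rewrite /ball/= => xy.
by rewrite distrC; apply: Hd; rewrite distrC.
Qed.

Lemma dEq f x a b : is_derive x 1 f a -> a = b -> is_derive x 1 f b.
Proof. by move=> ? <-. Qed.
Lemma dcst x a : is_derive x 1 (fun=> a) 0. Proof. exact: is_derive_cst. Qed.
Lemma did x : is_derive x 1 (fun t : R => t) 1. Proof. exact: is_derive_id. Qed.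
Lemma dD f g x a b : is_derive x 1 f a -> is_derive x 1 g b ->
  is_derive x 1 (fun t => f t + g t) (a + b).
Proof. by move=> ? ?; exact: is_deriveD. Qed.
Lemma dN f x a : is_derive x 1 f a -> is_derive x 1 (fun t => - f t) (- a).
Proof. by move=> ?; exact: is_deriveN. Qed.
Lemma dB f g x a b : is_derive x 1 f a -> is_derive x 1 g b ->
  is_derive x 1 (fun t => f t - g t) (a - b).
Proof. by move=> ? ?; exact: is_deriveB. Qed.
Lemma dM f g x a b : is_derive x 1 f a -> is_derive x 1 g b ->
  is_derive x 1 (fun t => f t * g t) (a * g x + f x * b).
Proof.
move=> hf hg; have h : is_derive x 1 (fun t => f t * g t) _ := is_deriveM hf hg.
by apply: dEq h _; rewrite /GRing.scale/=; ring.
Qed.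
Lemma dZ (k : R) f x a : is_derive x 1 f a -> is_derive x 1 (fun t => k * f t) (k * a).
Proof. by move=> h; apply: (dEq (dM (dcst x k) h)); ring. Qed.
Lemma dcomp f g x a b : is_derive (g x) 1 f a -> is_derive x 1 g b ->
  is_derive x 1 (fun t => f (g t)) (a * b).
Proof.
move=> hf hg; apply: (dEq (@is_derive1_comp R f g x a b hf hg)).
by rewrite /GRing.scale/= mulrC.
Qed.
Lemma dcontinuous f x a : is_derive x 1 f a -> {for x, continuous f}.
Proof. by move=> [df _]; apply: differentiable_continuous; exact/derivable1_diffP. Qed.

Lemma dunique f x a b : is_derive x 1 f a -> is_derive x 1 f b -> a = b.
Proof. by move=> [_ <-] [_ <-]. Qed.

Lemma dnear f g x a : is_derive x 1 f a -> (exists2 d, 0 < d & forall y, `|y - x| < d -> f y = g y) ->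
  is_derive x 1 g a.
Proof.
move=> /is_derive_epsP H [d d0 fg]; apply/is_derive_epsP => e e0.
have [d' d'0 H'] := H e e0; exists (Num.min d d'); first by rewrite lt_min d0.
move=> h; rewrite lt_min => /andP[hd hd'].
by rewrite -!fg ?H' ?subrr ?normr0// addrAC subrr add0r.
Qed.

Lemma dV f x a : f x != 0 -> is_derive x 1 f a ->
  is_derive x 1 (fun t => (f t)^-1) (- a / f x ^+ 2).
Proof.
move=> fx hf; apply: (dEq (@is_deriveV R f x a 1 fx hf)).
by rewrite /GRing.scale/= mulNr mulrC mulNr.
Qed.

Lemma dpowR c f x a : 0 < f x -> is_derive x 1 f a ->
  is_derive x 1 (fun t => f t `^ c) (c * f x `^ (c - 1) * a).
Proof. by move=> f0 hf; exact: (dcomp (is_derive1_powR c f0) hf). Qed.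

Lemma ivt f a b v : a <= b -> (forall x, {for x, continuous f}) -> f a <= v <= f b ->
  exists2 c, a <= c <= b & f c = v.
Proof.
move=> ab cf vab; have [||c] := @IVT _ f a b v ab.
- by apply: continuous_subspaceT => x; exact: cf.
- by case/andP: vab => va vb; rewrite ge_min va/= le_max vb orbT.
- by rewrite in_itv/= => ? ?; exists c.
Qed.

Lemma mvt f (df : R -> R) a b : a < b ->
  (forall x, a <= x <= b -> {for x, continuous f}) ->
  (forall x, a < x < b -> is_derive x 1 f (df x)) ->
  exists2 c, a < c < b & f b - f a = df c * (b - a).
Proof.
move=> ab cf hf.
have h1 x : x \in `]a, b[ -> is_derive x 1 f (df x) by rewrite in_itv => /hf.
have h2 : {within `[a, b], continuous f}.
  by apply: continuous_in_subspaceT => x; rewrite inE/= in_itv/= => /cf.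
by have [c] := MVT ab h1 h2; rewrite in_itv/= => ? ?; exists c.
Qed.

Lemma is_derive_incr f (df : R -> R) a b : a < b ->
  (forall x, a <= x <= b -> {for x, continuous f}) ->
  (forall x, a < x < b -> is_derive x 1 f (df x)) ->
  (forall x, a < x < b -> 0 < df x) -> f a < f b.
Proof.
move=> ab cf hf df0; have [c cab E] := mvt ab cf hf.
by rewrite -subr_gt0 E mulr_gt0 ?df0// subr_gt0.
Qed.

Lemma is_derive_nondecr f (df : R -> R) a b : a <= b ->
  (forall x, a <= x <= b -> {for x, continuous f}) ->
  (forall x, a < x < b -> is_derive x 1 f (df x)) ->
  (forall x, a < x < b -> 0 <= df x) -> f a <= f b.
Proof.
rewrite le_eqVlt => /predU1P[->//|ab] cf hf df0; have [c cab E] := mvt ab cf hf.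
by rewrite -subr_ge0 E mulr_ge0 ?df0// subr_ge0 ltW.
Qed.

Lemma is_derive_const f a b : (forall x, is_derive x 1 f 0) -> f a = f b.
Proof. by move=> h; exact: (@is_derive_0_is_cst _ f). Qed.

End Calculus.

(** * Signed powers *)

Section SignedPower.
Context {R : realType}.
Implicit Types (a b x y : R).

(** The odd power function sgn(x) |x|^a. For conjugate exponents [sp (q - 1)] and [sp (p - 1)] are
    inverse to each other, and both are multiplicative and increasing. The definition is locked so
    that simplification does not unfold it. *)
Fact sp_key : unit. Proof. exact: tt. Qed.
Definition sp : R -> R -> R := locked_with sp_key (fun a x => Num.sg x * `|x| `^ a).

Lemma spE a x : sp a x = Num.sg x * `|x| `^ a.
Proof. by rewrite /sp unlock. Qed.

Lemma sp_gt0E a x : 0 < x -> sp a x = x `^ a.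
Proof. by move=> x0; rewrite !spE gtr0_sg// mul1r gtr0_norm. Qed.

Lemma spN a x : sp a (- x) = - sp a x.
Proof. by rewrite !spE sgrN normrN mulNr. Qed.

Lemma sp0 a : sp a 0 = 0.
Proof. by rewrite !spE sgr0 mul0r. Qed.

Lemma spM a x y : sp a (x * y) = sp a x * sp a y.
Proof. by rewrite !spE sgrM normrM powRM//; ring. Qed.

Lemma sp_gt0 a x : 0 < x -> 0 < sp a x.
Proof. by move=> x0; rewrite sp_gt0E// powR_gt0. Qed.

Lemma sp_ge0 a x : 0 <= x -> 0 <= sp a x.
Proof. by rewrite le_eqVlt => /predU1P[<-|/(sp_gt0 a)/ltW//]; rewrite sp0. Qed.

Lemma abs_sp a x : a != 0 -> `|sp a x| = `|x| `^ a.
Proof.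
move=> a0; rewrite !spE normrM (ger0_norm (powR_ge0 _ _)) normr_sg.
by have [->|] := eqVneq x 0; rewrite ?normr0 ?powR0 ?mulr0 ?mul1r.
Qed.

Lemma sp_sp a b x : a != 0 -> sp b (sp a x) = sp (a * b) x.
Proof.
move=> a0; rewrite {1}spE abs_sp// -powRrM !spE; congr (_ * _).
rewrite sgrM sgr_id; have [->|x0] := eqVneq x 0; first by rewrite sgr0 mul0r.
by rewrite (@gtr0_sg _ (_ `^ _)) ?mulr1// powR_gt0// normr_gt0.
Qed.

Lemma sp1 x : sp 1 x = x.
Proof. by rewrite !spE powRr1// -numEsg. Qed.

Lemma mul_sp a x : 0 < a -> x * sp (a - 1) x = `|x| `^ a.
Proof.
by move=> a0; rewrite !spE mulrA [x * Num.sg x]mulrC -normrEsg mulr_powRB1.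
Qed.

Lemma sp_lt a x y : 0 < a -> x < y -> sp a x < sp a y.
Proof.
move=> a0; wlog : x y / 0 < y => [H xy|y0 xy].
  have [y0|y0] := ltP 0 y; first exact: H.
  rewrite -(opprK x) -(opprK y) spN (spN _ (- y)) ltrN2.
  by apply: H; rewrite ?ltrN2// oppr_gt0 (lt_le_trans xy).
have [x0|x0] := ltP 0 x.
  by rewrite !sp_gt0E// gt0_ltr_powR// nnegrE ltW.
apply: le_lt_trans (sp_gt0 a y0).
by rewrite -oppr_ge0 -spN sp_ge0// oppr_ge0.
Qed.

Lemma sp_le a x y : 0 < a -> x <= y -> sp a x <= sp a y.
Proof. by move=> a0; rewrite le_eqVlt => /predU1P[->//|/(sp_lt a0)/ltW]. Qed.

Lemma powR_small a e : 0 < a -> 0 < e ->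
  exists2 d, 0 < d & forall h : R, `|h| < d -> `|h| `^ a <= e.
Proof.
move=> a0 e0; exists (e `^ a^-1); first exact: powR_gt0.
move=> h hd; have := @ge0_ler_powR _ a (ltW a0) `|h| (e `^ a^-1).
rewrite !nnegrE normr_ge0 powR_ge0 => /(_ isT isT (ltW hd)).
by rewrite -powRrM mulVf ?gt_eqF// powRr1// ltW.
Qed.

Lemma is_derive_abs_powR_neq0 a x : x != 0 ->
  is_derive x 1 (fun t => `|t| `^ a) (a * sp (a - 1) x).
Proof.
move=> x0; have sx : Num.sg x * x = `|x| by rewrite normrEsg.
have H : is_derive x 1 (fun t => (Num.sg x * t) `^ a)
    (a * (Num.sg x * x) `^ (a - 1) * (Num.sg x * 1)).
  apply: (@dpowR R a (fun t => Num.sg x * t)); first by rewrite sx normr_gt0.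
apply: (dEq (dnear H _)); last by rewrite sx !spE mulr1; ring.
exists `|x|; first by rewrite normr_gt0.
move=> y yx; congr (_ `^ _); have [x1|x1] := ltP 0 x.
  rewrite gtr0_sg// mul1r ger0_norm//; move: yx; rewrite (gtr0_norm x1) ltr_norml; lra.
have {}x1 : x < 0 by rewrite lt_neqAle x0.
rewrite ltr0_sg// mulN1r ltr0_norm//; move: yx; rewrite (ltr0_norm x1) ltr_norml; lra.
Qed.

Lemma is_derive_sp_neq0 a x : x != 0 -> is_derive x 1 (sp a) (a * `|x| `^ (a - 1)).
Proof.
move=> x0; have H := dZ (Num.sg x) (is_derive_abs_powR_neq0 a x0).
apply: (dEq (dnear H _)).
  exists `|x|; first by rewrite normr_gt0.
  move=> y yx; rewrite !spE; congr (_ * _); have [x1|x1] := ltP 0 x.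
    by rewrite !gtr0_sg//; move: yx; rewrite (gtr0_norm x1) ltr_norml; lra.
  have {}x1 : x < 0 by rewrite lt_neqAle x0.
  by rewrite !ltr0_sg//; move: yx; rewrite (ltr0_norm x1) ltr_norml; lra.
have := sqr_sg x; rewrite x0 expr2 !spE /= => s2.
transitivity (Num.sg x * Num.sg x * (a * `|x| `^ (a - 1))); first ring.
by rewrite s2 mul1r.
Qed.

Lemma is_derive_abs_powR a x : 1 < a ->
  is_derive x 1 (fun t => `|t| `^ a) (a * sp (a - 1) x).
Proof.
move=> a1; have [->|] := eqVneq x 0; last exact: is_derive_abs_powR_neq0.
apply/is_derive_epsP => e e0.
have a10 : 0 < a - 1 by lra.
have [d d0 H] := powR_small a10 e0; exists d => // h hd.
rewrite sp0 mulr0 mul0r subr0 add0r normr0 powR0 ?subr0; last by rewrite gt_eqF//; lra.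
rewrite ger0_norm ?powR_ge0// -mulr_powRB1//; last lra.
by rewrite mulrC ler_wpM2r// H.
Qed.

Lemma is_derive_sp a x : 1 < a -> is_derive x 1 (sp a) (a * `|x| `^ (a - 1)).
Proof.
move=> a1; have [->|] := eqVneq x 0; last exact: is_derive_sp_neq0.
apply/is_derive_epsP => e e0.
have a10 : 0 < a - 1 by lra.
have [d d0 H] := powR_small a10 e0; exists d => // h hd.
rewrite sp0 normr0 powR0 ?mulr0 ?mul0r ?subr0 ?add0r; last by rewrite gt_eqF.
rewrite abs_sp ?gt_eqF//; last lra.
rewrite -mulr_powRB1//; last lra.
by rewrite mulrC ler_wpM2r// H.
Qed.

Lemma continuous_sp a x : 0 < a -> {for x, continuous (sp a)}.
Proof.
move=> a0; have [->|x0] := eqVneq x 0; last exact: dcontinuous (is_derive_sp_neq0 a x0).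
apply/cts_epsP => e e0; have [d d0 H] := powR_small a0 e0; exists d => // y.
by rewrite sp0 !subr0 abs_sp ?gt_eqF//; exact: H.
Qed.

Lemma continuous_abs_powR a x : 0 < a -> {for x, continuous (fun t => `|t| `^ a)}.
Proof.
move=> a0; have [->|x0] := eqVneq x 0; last exact: dcontinuous (is_derive_abs_powR_neq0 a x0).
apply/cts_epsP => e e0; have [d d0 H] := powR_small a0 e0; exists d => // y.
by rewrite normr0 powR0 ?gt_eqF// !subr0 (ger0_norm (powR_ge0 _ _)); exact: H.
Qed.

End SignedPower.

(** * Primitives of continuous functions *)

Section Primitive.
Context {R : realType}.

(** The fundamental theorem needs a base point to the left of [x], so the primitive that vanishes at
    0 is written with base [- M] for varying [M]. *)
Let FM (f : R -> R) (M x : R) : R := \int[@lebesgue_measure R]_(t in `[- M, x]) f t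
   - \int[@lebesgue_measure R]_(t in `[- M, 0]) f t.

Lemma primitive_exists (f : R -> R) : (forall x, {for x, continuous f}) ->
  exists F : R -> R, F 0 = 0 /\ forall x : R, is_derive x 1 F (f x).
Proof.
move=> cf.
have H (M x : R) : - M < x -> is_derive x 1 (FM f M) (f x).
  move=> Mx; have [||||dF eF] := @continuous_FTC1_closed R f (- M) x (x + 1).
  - by rewrite ltrDl.
  - apply: continuous_compact_integrable; first exact: segment_compact.
    by apply: continuous_subspaceT => y; exact: cf.
  - exact: Mx.
  - exact: cf.
  apply: (dEq (dB _ (dcst _ _))); last by rewrite subr0.
  by split; [exact: dF|rewrite -derive1E; exact: eF].
have FM0 M : FM f M 0 = 0 by rewrite /FM subrr.
(* Independence of [M]: the difference of two choices has zero derivative and vanishes at 0. *)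
have E M M' x : 0 < M -> 0 < M' -> - M < x -> - M' < x -> FM f M x = FM f M' x.
  move=> M0 M'0 Mx M'x; apply/eqP; rewrite -subr_eq0; apply/eqP.
  pose g t := FM f M t - FM f M' t.
  have dg (t : R) : - M < t -> - M' < t -> is_derive t 1 g 0.
    by move=> ? ?; apply: (dEq (dB (H _ _ _) (H _ _ _))) => //; rewrite subrr.
  have g0 : g 0 = 0 by rewrite /g !FM0 subrr.
  change (g x = 0).
  have [x0|x0|->//] := ltgtP x 0.
    have [||c] := @mvt R g (fun=> 0) x 0 x0.
    - by move=> t /andP[xt _]; apply: dcontinuous (dg _ _ _); lra.
    - by move=> t /andP[xt _]; apply: dg; lra.
    - by rewrite mul0r g0 => _ /eqP; rewrite sub0r oppr_eq0 => /eqP.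
  have [||c] := @mvt R g (fun=> 0) 0 x x0.
  - by move=> t /andP[xt _]; apply: dcontinuous (dg _ _ _); lra.
  - by move=> t /andP[xt _]; apply: dg; lra.
  - by rewrite mul0r g0 => _ /eqP; rewrite subr0 => /eqP.
(* The base point moves with [x]; near a given [x] it can be frozen at [- (|x| + 2)], where the
   derivative is known. *)
exists (fun x => FM f (`|x| + 1) x); split; first exact: FM0.
move=> x; have xx := ler_norm (- x); rewrite normrN in xx.
have Mx : - (`|x| + 2) < x by lra.
apply: dnear (H _ _ Mx) _; exists 1 => // y; rewrite ltr_norml => yx.
have yy := ler_norm (- y); rewrite normrN in yy.
have ? := normr_ge0 x; have ? := normr_ge0 y.
by apply: E; lra.
Qed.

End Primitive.

(** * The unit circle of the l^q norm *)

Section GenTrig.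
Context {R : realType}.
Variable q : R.

Definition nq (t : R) : R := `|cos t| `^ q + `|sin t| `^ q.

(** At polar angle t the unit circle has radius nq(t)^(-1/q), so the density is the squared radius
    and the primitive is twice the swept area. Choice with a default is used because the primitive
    is known to exist only when 1 < q; [theta], the inverse function, is treated in the same way. *)
Definition sector (t : R) : R :=
  xget (fun=> 0) [set F : R -> R | F 0 = 0 /\
    forall x : R, is_derive x 1 F (nq x `^ (- 2 / q))] t.

Definition theta (f : R) : R := xget 0 [set t | sector t = f].

Fact e_key : unit. Proof. exact: tt. Qed.
Definition eC : R -> R := locked_with e_key (fun f => cos (theta f) * nq (theta f) `^ (- q^-1)).
Definition eS : R -> R := locked_with e_key (fun f => sin (theta f) * nq (theta f) `^ (- q^-1)).
Definition Piq : R := locked_with e_key (sector pi).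

Let PiqE : Piq = sector pi. Proof. by rewrite /Piq unlock. Qed.
Let eCE : eC = fun f => cos (theta f) * nq (theta f) `^ (- q^-1).
Proof. by rewrite /eC unlock. Qed.
Let eSE : eS = fun f => sin (theta f) * nq (theta f) `^ (- q^-1).
Proof. by rewrite /eS unlock. Qed.

Hypothesis q1 : 1 < q.
Let q0 : 0 < q. Proof. exact: lt_trans ltr01 q1. Qed.

Lemma nq_gt0 t : 0 < nq t.
Proof.
rewrite /nq lt_neqAle addr_ge0 ?powR_ge0// andbT eq_sym paddr_eq0 ?powR_ge0//.
rewrite !powR_eq0 (gt_eqF q0) !normr_eq0 !andbT; apply/negP => /andP[/eqP c /eqP s].
by have := cos2Dsin2 t; rewrite c s; lra.
Qed.

Lemma nq_derive (t : R) : is_derive t 1 nq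
  (q * (sp (q - 1) (sin t) * cos t - sp (q - 1) (cos t) * sin t)).
Proof.
have h1 := dcomp (is_derive_abs_powR (cos t) q1) (is_derive_cos t).
have h2 := dcomp (is_derive_abs_powR (sin t) q1) (is_derive_sin t).
by apply: (dEq (dD h1 h2)); ring.
Qed.

Let cts_dens (t : R) : {for t, continuous (fun x => nq x `^ (- 2 / q))}.
Proof. exact: dcontinuous (dpowR _ (nq_gt0 t) (nq_derive t)). Qed.

Let sectorP : sector 0 = 0 /\ forall x : R, is_derive x 1 sector (nq x `^ (- 2 / q)).
Proof.
rewrite /sector; case: xgetP => [F _ //|H].
by have [F HF] := primitive_exists cts_dens; case: (H F HF).
Qed.

Lemma sector0 : sector 0 = 0. Proof. by case: sectorP. Qed.
Lemma sector_derive (x : R) : is_derive x 1 sector (nq x `^ (- 2 / q)).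
Proof. by case: sectorP. Qed.

Lemma nqDpihalf t : nq (t + pi / 2) = nq t.
Proof. by rewrite /nq cosDpihalf sinDpihalf normrN addrC. Qed.

Lemma nqN t : nq (- t) = nq t.
Proof. by rewrite /nq cosN sinN normrN. Qed.

Lemma sectorDpihalf t : sector (t + pi / 2) = sector t + sector (pi / 2).
Proof.
have H : forall x : R, is_derive x 1 (fun t => sector (t + pi / 2) - sector t) 0.
  move=> x; have h := @dcomp R sector (fun t => t + pi / 2) x _ _ (sector_derive (x + pi / 2)) (dD (did x) (dcst x (pi / 2))).
  by apply: (dEq (dB h (sector_derive x))); rewrite nqDpihalf; ring.
have /= := is_derive_const t 0 H; rewrite add0r sector0; lra.
Qed.

Lemma sectorN t : sector (- t) = - sector t.
Proof.
have H : forall x : R, is_derive x 1 (fun t => sector (- t) + sector t) 0.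
  move=> x; have h := @dcomp R sector (fun t => - t) x _ _ (sector_derive (- x)) (dN (did x)).
  by apply: (dEq (dD h (sector_derive x))); rewrite nqN; ring.
have /= := is_derive_const t 0 H; rewrite oppr0 sector0; lra.
Qed.

Lemma Piq_half : sector (pi / 2) = Piq / 2.
Proof.
have := sectorDpihalf (pi / 2); rewrite -[pi / 2 + pi / 2]splitr -PiqE; lra.
Qed.

(** [nq] is at most 2, so [sector] has slope at least [c0]. This growth makes it onto, which the
    definition of [theta] by choice relies on. *)
Let c0 : R := 2 `^ (- 2 / q).
Let c0_gt0 : 0 < c0. Proof. exact: powR_gt0. Qed.

Let dens_ge t : c0 <= nq t `^ (- 2 / q).
Proof.
have n2 : nq t <= 2.
  have le1 (x : R) : x ^+ 2 <= 1 -> `|x| `^ q <= 1.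
    move=> x1; have <- : (1 : R) `^ q = 1 by rewrite powR1.
    apply: ge0_ler_powR; rewrite ?nnegrE ?(ltW q0)//.
    by rewrite -[leRHS]normr1 ler_normr ler_norml; nra.
  have := cos2Dsin2 t; have := sqr_ge0 (cos t); have := sqr_ge0 (sin t) => a b c.
  have := le1 (cos t); have := le1 (sin t); rewrite /nq; lra.
rewrite /c0 (_ : - 2 / q = - (2 / q)); last by lra.
rewrite !powRN lef_pV2 ?posrE ?powR_gt0 ?nq_gt0//.
by apply: ge0_ler_powR; rewrite ?nnegrE ?divr_ge0 ?(ltW (nq_gt0 _)) ?(ltW q0)//.
Qed.

Let sector_exp x y : x <= y -> c0 * (y - x) <= sector y - sector x.
Proof.
rewrite le_eqVlt => /predU1P[->|xy]; first by rewrite !subrr mulr0.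
have [||c] := @mvt R sector (fun t => nq t `^ (- 2 / q)) x y xy.
- by move=> t _; exact: dcontinuous (sector_derive t).
- by move=> t _; exact: sector_derive.
- by move=> _ ->; rewrite ler_wpM2r// subr_ge0 ltW.
Qed.

Lemma sector_lt x y : x < y -> sector x < sector y.
Proof.
move=> xy; rewrite -subr_gt0; apply: lt_le_trans (sector_exp (ltW xy)).
by rewrite mulr_gt0// subr_gt0.
Qed.

Lemma thetaK f : sector (theta f) = f.
Proof.
rewrite /theta; case: xgetP => [t _ //|H]; exfalso.
pose M := `|f| / c0.
have M0 : 0 <= M by rewrite divr_ge0// ltW.
have cM : c0 * M = `|f| by rewrite /M mulrC divfK// gt_eqF.
have fM : f <= sector M.
  have := sector_exp M0; rewrite sector0 subr0 subr0 cM; exact: le_trans (ler_norm f).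
have fM' : sector (- M) <= f.
  by rewrite sectorN lerNl (le_trans (ler_norm _))// normrN -cM; have := sector_exp M0; rewrite sector0 subr0 subr0.
have [|||t _ tf] := @ivt R sector (- M) M f.
- by lra.
- by move=> x; exact: dcontinuous (sector_derive x).
- by rewrite fM'.
- exact: (H t).
Qed.

Lemma sectorK t : theta (sector t) = t.
Proof.
have := thetaK (sector t); have [/sector_lt|/sector_lt|//] := ltgtP (theta (sector t)) t; lra.
Qed.

Lemma theta_derive (f : R) : is_derive f 1 theta (nq (theta f) `^ (2 / q)).
Proof.
have H : is_derive (sector (theta f)) 1 theta (nq (theta f) `^ (- 2 / q))^-1.
  apply: is_derive_inverse.
  - by apply: (@filterE _ (nbhs (theta f)) _) => x; exact: sectorK.
  - by apply: (@filterE _ (nbhs (theta f)) _) => x; exact: dcontinuous (sector_derive x).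
  - exact: sector_derive.
  - by rewrite gt_eqF// powR_gt0// nq_gt0.
rewrite thetaK in H; apply: (dEq H).
by rewrite -powRN; congr (_ `^ _); field; rewrite gt_eqF.
Qed.

Let powRS1 (x k : R) : 0 < x -> x `^ k = x `^ (k - 1) * x.
Proof.
move=> x0; rewrite -{3}(powRr1 (ltW x0)) -powRD ?subrK//.
by apply/implyP => _; rewrite gt_eqF.
Qed.

Let cos_nq_derive (t : R) : is_derive t 1 (fun t => cos t * nq t `^ (- q^-1))
  (- nq t `^ (- q^-1 - 1) * sp (q - 1) (sin t)).
Proof.
have h := dM (is_derive_cos t) (dpowR (- q^-1) (nq_gt0 t) (nq_derive t)).
apply: (dEq h); rewrite (powRS1 (- q^-1) (nq_gt0 t)).
have nE : nq t = cos t * sp (q - 1) (cos t) + sin t * sp (q - 1) (sin t).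
  by rewrite !mul_sp.
have := cos2Dsin2 t; move: (cos t) (sin t) nE => c s nE cs.
set w := nq t `^ _; set a := sp _ c in nE *; set b := sp _ s in nE *.
have -> : c * (- q^-1 * w * (q * (b * c - a * s))) = - w * c * (b * c - a * s).
  by field; rewrite gt_eqF.
rewrite nE; transitivity (- w * b * (c ^+ 2 + s ^+ 2)); first by ring.
by rewrite cs; ring.
Qed.

Let sin_nq_derive (t : R) : is_derive t 1 (fun t => sin t * nq t `^ (- q^-1))
  (nq t `^ (- q^-1 - 1) * sp (q - 1) (cos t)).
Proof.
have h := dM (is_derive_sin t) (dpowR (- q^-1) (nq_gt0 t) (nq_derive t)).
apply: (dEq h); rewrite (powRS1 (- q^-1) (nq_gt0 t)).
have nE : nq t = cos t * sp (q - 1) (cos t) + sin t * sp (q - 1) (sin t).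
  by rewrite !mul_sp.
have := cos2Dsin2 t; move: (cos t) (sin t) nE => c s nE cs.
set w := nq t `^ _; set a := sp _ c in nE *; set b := sp _ s in nE *.
have -> : s * (- q^-1 * w * (q * (b * c - a * s))) = - w * s * (b * c - a * s).
  by field; rewrite gt_eqF.
rewrite nE; transitivity (w * a * (c ^+ 2 + s ^+ 2)); first by ring.
by rewrite cs; ring.
Qed.

Let nq_sp t (x : R) : nq t `^ (- q^-1 - 1) * sp (q - 1) x * nq t `^ (2 / q) =
  sp (q - 1) (x * nq t `^ (- q^-1)).
Proof.
rewrite spM (sp_gt0E _ (powR_gt0 _ (nq_gt0 _))) mulrAC -powRrM -powRD; last first.
  by apply/implyP => _; rewrite gt_eqF// nq_gt0.
by rewrite mulrC; congr (_ * _ `^ _); field; rewrite gt_eqF.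
Qed.

(** Parametrised by area, the circle is a Hamiltonian orbit: its velocity is the gradient of (|x|^q
    + |y|^q) / q turned by a right angle. *)
Lemma eC_derive (f : R) : is_derive f 1 eC (- sp (q - 1) (eS f)).
Proof.
rewrite eCE; apply: (dEq (dcomp (cos_nq_derive (theta f)) (theta_derive f))).
by rewrite eSE !mulNr nq_sp.
Qed.

Lemma eS_derive (f : R) : is_derive f 1 eS (sp (q - 1) (eC f)).
Proof.
rewrite eSE; apply: (dEq (dcomp (sin_nq_derive (theta f)) (theta_derive f))).
by rewrite eCE nq_sp.
Qed.

Lemma e_norm f : `|eC f| `^ q + `|eS f| `^ q = 1.
Proof.
rewrite eCE eSE !normrM (ger0_norm (powR_ge0 _ _)) !powRM ?powR_ge0//.
rewrite -mulrDl -/(nq _) -powRrM mulNr mulVf ?gt_eqF// powRN powRr1 ?divff ?gt_eqF ?nq_gt0//.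
exact/ltW/nq_gt0.
Qed.

Lemma thetaDhalf f : theta (f + Piq / 2) = theta f + pi / 2.
Proof. by rewrite -[LHS]/(theta _) -{1}(thetaK f) -Piq_half -sectorDpihalf sectorK. Qed.

Lemma thetaN f : theta (- f) = - theta f.
Proof. by rewrite -{1}(thetaK f) -sectorN sectorK. Qed.

Lemma thetaDPi f : theta (f + Piq) = theta f + pi.
Proof. by rewrite {1}(splitr Piq) addrA !thetaDhalf -addrA -splitr. Qed.

Lemma eCDhalf f : eC (f + Piq / 2) = - eS f.
Proof. by rewrite eCE eSE thetaDhalf cosDpihalf nqDpihalf mulNr. Qed.
Lemma eSDhalf f : eS (f + Piq / 2) = eC f.
Proof. by rewrite eCE eSE thetaDhalf sinDpihalf nqDpihalf. Qed.
Lemma eCDPi f : eC (f + Piq) = - eC f.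
Proof. by rewrite {1}(splitr Piq) addrA eCDhalf eSDhalf. Qed.
Lemma eSDPi f : eS (f + Piq) = - eS f.
Proof. by rewrite {1}(splitr Piq) addrA eSDhalf eCDhalf. Qed.
Lemma eCD2Pi f : eC (f + 2 * Piq) = eC f.
Proof. by rewrite mulrDl mul1r addrA !eCDPi opprK. Qed.
Lemma eSD2Pi f : eS (f + 2 * Piq) = eS f.
Proof. by rewrite mulrDl mul1r addrA !eSDPi opprK. Qed.
Lemma eCN f : eC (- f) = eC f.
Proof. by rewrite eCE thetaN cosN nqN. Qed.
Lemma eSN f : eS (- f) = - eS f.
Proof. by rewrite eSE thetaN sinN nqN mulNr. Qed.

Lemma theta0 : theta 0 = 0. Proof. by rewrite -{1}sector0 sectorK. Qed.
Lemma nq0 : nq 0 = 1.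
Proof. by rewrite /nq cos0 sin0 normr0 normr1 powR1 powR0 ?addr0// gt_eqF. Qed.
Lemma eC0 : eC 0 = 1. Proof. by rewrite eCE theta0 nq0 powR1 cos0 mulr1. Qed.
Lemma eS0 : eS 0 = 0. Proof. by rewrite eSE theta0 sin0 mul0r. Qed.

Lemma Piq_gt0 : 0 < Piq.
Proof. by rewrite PiqE -sector0 sector_lt// pi_gt0. Qed.

Lemma theta_lt f g : f < g -> theta f < theta g.
Proof.
move=> fg; rewrite ltNge; apply/negP; rewrite le_eqVlt => /predU1P[E|/sector_lt].
  by move: fg; rewrite -(thetaK f) -(thetaK g) E ltxx.
by rewrite !thetaK; lra.
Qed.

Lemma cross_gt0 f g : f < g < f + Piq -> 0 < eC f * eS g - eS f * eC g.
Proof.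
move=> /andP[fg gf].
have -> : eC f * eS g - eS f * eC g = sin (theta g - theta f) *
    (nq (theta f) `^ (- q^-1) * nq (theta g) `^ (- q^-1)).
  rewrite sinB eCE eSE.
  by move: (_ `^ _) (nq (theta g) `^ _) (cos _) (sin _) (cos _) (sin _) => *; ring.
rewrite !mulr_gt0 ?powR_gt0 ?nq_gt0// sin_gt0_pi// subr_gt0 theta_lt//=.
by rewrite ltrBlDl -thetaDPi theta_lt.
Qed.

Lemma eS_gt0 f : 0 < f < Piq -> 0 < eS f.
Proof.
move=> f0; have := @cross_gt0 0 f; rewrite add0r eC0 eS0 mul1r mul0r subr0; exact.
Qed.

(** The polar angle is plus or minus an arccosine according to the sign of [b], which keeps it in
    [-pi, pi] and hence the parameter in [-Piq, Piq]. *)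
Lemma e_surj a b : `|a| `^ q + `|b| `^ q = 1 ->
  exists f, [/\ - Piq <= f <= Piq, eC f = a & eS f = b].
Proof.
move=> ab; pose rho := Num.sqrt (a ^+ 2 + b ^+ 2).
have ab0 : 0 < a ^+ 2 + b ^+ 2.
  rewrite lt_neqAle addr_ge0 ?sqr_ge0// andbT eq_sym paddr_eq0 ?sqr_ge0//.
  apply/negP => /andP[]; rewrite !sqrf_eq0 => /eqP a0 /eqP b0.
  by move: ab; rewrite a0 b0 normr0 powR0 ?gt_eqF//; lra.
have rho0 : 0 < rho by rewrite sqrtr_gt0.
have rho2 : rho ^+ 2 = a ^+ 2 + b ^+ 2 by rewrite sqr_sqrtr// ltW.
have ar : -1 <= a / rho <= 1.
  rewrite lter_pdivlMr// lter_pdivrMr//; nra.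
pose t := (if 0 <= b then 1 else -1) * acos (a / rho).
have ct : cos t = a / rho.
  by rewrite /t; case: ifP => _; rewrite ?mul1r ?mulN1r ?cosN acosK.
have st : sin t = b / rho.
  have s : sin (acos (a / rho)) = `|b| / rho.
    rewrite sin_acos//.
    have -> : 1 - (a / rho) ^+ 2 = (b / rho) ^+ 2.
      have : a ^+ 2 = rho ^+ 2 - b ^+ 2 by rewrite rho2; ring.
      by rewrite !expr_div_n => ->; field; rewrite gt_eqF.
    by rewrite sqrtr_sqr normrM (gtr0_norm (_ : 0 < rho^-1)) ?invr_gt0.
  rewrite /t; case: ifPn => [b0|]; first by rewrite mul1r s ger0_norm.
  by rewrite -ltNge => b0; rewrite mulN1r sinN s ltr0_norm// mulNr opprK.
have nt : nq t = rho `^ (- q).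
  rewrite /nq ct st !normrM !powRM// (gtr0_norm (_ : 0 < rho^-1)) ?invr_gt0//.
  rewrite -mulrDl ab mul1r -powR_inv1; last exact: ltW.
  by rewrite -powRrM mulN1r.
have nr : nq t `^ (- q^-1) = rho.
  by rewrite nt -powRrM mulrNN divff ?gt_eqF// powRr1// ltW.
have tpi : - pi <= t <= pi.
  have := acos_ge0 ar; have := acos_lepi ar; rewrite /t; case: ifP => _; lra.
exists (sector t); rewrite eCE eSE sectorK ct st nr !divfK ?gt_eqF//; split=> //.
have sl x y : x <= y -> sector x <= sector y.
  by rewrite le_eqVlt => /predU1P[->//|/sector_lt/ltW].
by case/andP: tpi => /sl + /sl; rewrite sectorN PiqE => -> ->.
Qed.

End GenTrig.

(** * The Jacobian of the exponential map *)

Section Cross.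
Context {R : realType}.
Variable q : R.
Hypothesis q1 : 1 < q.
Let q0 : 0 < q. Proof. exact: lt_trans ltr01 q1. Qed.
Local Notation C := (eC q).
Local Notation S := (eS q).
Local Notation Pi := (Piq q).
Implicit Types f g h t x y : R.

(** Strict convexity of |t|^q / q: the graph lies above its tangent at [x] and touches it only
    there. The strictness yields the equality case of Hölder's inequality in [dual_eq]. *)
Lemma young_lt t x : t != x ->
  t * sp (q - 1) x < `|t| `^ q / q + (1 - q^-1) * `|x| `^ q.
Proof.
move=> tx; pose w t := `|t| `^ q / q - t * sp (q - 1) x.
have dw (s : R) : is_derive s 1 w (sp (q - 1) s - sp (q - 1) x).
  have h1 := dM (is_derive_abs_powR s q1) (dcst s q^-1).
  have h2 := dM (did s) (dcst s (sp (q - 1) x)).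
  by apply: (dEq (dB h1 h2)); field; rewrite gt_eqF.
have cw s : {for s, continuous w} by exact: dcontinuous (dw s).
have wx : w x = - ((1 - q^-1) * `|x| `^ q) by rewrite /w mul_sp//; ring.
suff : w x < w t by rewrite wx /w; lra.
have q10 : 0 < q - 1 by rewrite subr_gt0.
move: tx; rewrite neq_lt => /orP[tx|xt].
  have [s /andP[ts sx] E] := mvt tx (fun s _ => cw s) (fun s _ => dw s).
  have := sp_lt q10 sx; rewrite -subr_lt0 => k0.
  by rewrite -subr_lt0 E nmulr_rlt0 ?subr_gt0.
have [s /andP[ts sx] E] := mvt xt (fun s _ => cw s) (fun s _ => dw s).
have := sp_lt q10 ts; rewrite -subr_gt0 => k0.
by rewrite -subr_gt0 E mulr_gt0// subr_gt0.
Qed.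

Lemma young_le t x : t * sp (q - 1) x <= `|t| `^ q / q + (1 - q^-1) * `|x| `^ q.
Proof.
have [->|/young_lt/ltW//] := eqVneq t x.
by rewrite mul_sp//; lra.
Qed.

(* With e = (C, S) and e' its derivative: crs f g = e(f) x e(g),
   al f g = e(f) x e'(g) and ga f g = e'(f) x e'(g). *)
Definition crs f g := C f * S g - S f * C g.
Definition al f g := C f * sp (q - 1) (C g) + S f * sp (q - 1) (S g).
Definition ga f g := sp (q - 1) (C f) * sp (q - 1) (S g) - sp (q - 1) (S f) * sp (q - 1) (C g).
(** Sector minus triangle: [Wq f g] is twice the area between the arc from f to g and its chord, so
    F(f, g - f, r) has height r^2 / 2 times it. [Dq f g] is the Jacobian of F divided by r^3. *)
Definition Wq f g := (g - f) - crs f g.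
Definition Dq f g := (1 - al f g) * (1 - al g f) - Wq f g * ga f g.

Lemma al_ff f : al f f = 1.
Proof. by rewrite /al !mul_sp// e_norm. Qed.

Lemma dual_le x y f : `|x| `^ q + `|y| `^ q = 1 ->
  x * sp (q - 1) (C f) + y * sp (q - 1) (S f) <= 1.
Proof.
move=> xy; have := young_le x (C f); have := young_le y (S f); have := e_norm q1 f.
have q10 : 0 < 1 - q^-1 by rewrite subr_gt0 invf_lt1.
nra.
Qed.

Lemma dual_eq x y f : `|x| `^ q + `|y| `^ q = 1 ->
  x * sp (q - 1) (C f) + y * sp (q - 1) (S f) = 1 -> x = C f /\ y = S f.
Proof.
move=> xy E; have h1 := young_le x (C f); have h2 := young_le y (S f); have h3 := e_norm q1 f.
have h : `|x| `^ q / q + (1 - q^-1) * `|C f| `^ q + (`|y| `^ q / q + (1 - q^-1) * `|S f| `^ q) = 1.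
  transitivity ((`|x| `^ q + `|y| `^ q) / q + (1 - q^-1) * (`|C f| `^ q + `|S f| `^ q)).
    by ring.
  by rewrite xy h3; ring.
split.
  by have [//|/young_lt h4] := eqVneq x (C f); lra.
by have [//|/young_lt h4] := eqVneq y (S f); lra.
Qed.

Lemma gaC f g : ga g f = - ga f g. Proof. by rewrite /ga; ring. Qed.

Lemma crs_gt0 f g : f < g < f + Pi -> 0 < crs f g.
Proof. exact: cross_gt0. Qed.

Lemma crsDPi f g : crs f (g + Pi) = - crs f g.
Proof. by rewrite /crs eCDPi// eSDPi//; ring. Qed.

(** If e(f) = e(g) the cross product vanishes, whereas it has a strict sign on either side of the
    half-turn; at the half-turn itself e(g) = - e(f). *)
Lemma e_inj f g : f < g < f + 2 * Pi -> ~ (C f = C g /\ S f = S g).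
Proof.
move=> /andP[fg gf] [Cfg Sfg].
have crs0 : crs f g = 0 by rewrite /crs Cfg Sfg; ring.
have [g1|g1|g1] := ltgtP g (f + Pi).
- by have := @crs_gt0 f g; rewrite crs0 fg g1 ltxx => /(_ isT).
- have crs1 : crs f (g - Pi) = 0.
    by have := crsDPi f (g - Pi); rewrite subrK crs0 => /eqP; rewrite eq_sym oppr_eq0 => /eqP.
  have : 0 < crs f (g - Pi) by apply: crs_gt0; apply/andP; split; lra.
  by rewrite crs1 ltxx.
- move: Cfg Sfg (e_norm q1 f); rewrite g1 eCDPi// eSDPi// => h1 h2.
  have -> : C f = 0 by lra.
  have -> : S f = 0 by lra.
  by rewrite normr0 powR0 ?gt_eqF//; lra.
Qed.

Lemma al_le1 f g : al f g <= 1.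
Proof. by apply: dual_le; exact: e_norm. Qed.

Lemma al_lt1 f g : f < g < f + 2 * Pi -> al f g < 1.
Proof.
move=> fg; rewrite lt_neqAle al_le1 andbT; apply/eqP => E.
exact: e_inj fg (dual_eq (e_norm q1 f) E).
Qed.

Lemma al_lt1' f g : f < g < f + 2 * Pi -> al g f < 1.
Proof.
move=> fg; rewrite lt_neqAle al_le1 andbT; apply/eqP => E.
have [h1 h2] := dual_eq (e_norm q1 g) E; exact: (e_inj fg (conj (esym h1) (esym h2))).
Qed.

(** [sp (q - 1)] is multiplicative and increasing, so [ga] compares the images of the two products
    that [crs] compares. *)
Lemma ga_gt0E f g : (0 < ga f g) = (0 < crs f g).
Proof.
have q10 : 0 < q - 1 by rewrite subr_gt0.
rewrite /ga -!spM !subr_gt0; apply/idP/idP; last exact: sp_lt.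
by apply: contraTT; rewrite -!leNgt; exact: sp_le.
Qed.

Lemma ga_gt0 f g : f < g < f + Pi -> 0 < ga f g.
Proof. by rewrite ga_gt0E; exact: crs_gt0. Qed.

Lemma crs_derive f g : is_derive g 1 (crs f) (al f g).
Proof.
have h1 := dZ (C f) (eS_derive q1 g); have h2 := dZ (S f) (eC_derive q1 g).
by apply: (dEq (dB h1 h2)); rewrite /al; ring.
Qed.

Lemma crs_derivel f g : is_derive f 1 (crs^~ g) (- al g f).
Proof.
have h1 := dM (eC_derive q1 f) (dcst f (S g)); have h2 := dM (eS_derive q1 f) (dcst f (C g)).
by apply: (dEq (dB h1 h2)); rewrite /al; ring.
Qed.

Lemma al_derivel f g : is_derive f 1 (al^~ g) (ga f g).
Proof.
have h1 := dM (eC_derive q1 f) (dcst f (sp (q - 1) (C g))).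
have h2 := dM (eS_derive q1 f) (dcst f (sp (q - 1) (S g))).
by apply: (dEq (dD h1 h2)); rewrite /ga; ring.
Qed.

Lemma Wq_derive f g : is_derive g 1 (Wq f) (1 - al f g).
Proof. by apply: (dEq (dB (dB (did g) (dcst g f)) (crs_derive f g))); ring. Qed.

Lemma Wq_derivel f g : is_derive f 1 (Wq^~ g) (- (1 - al g f)).
Proof. by apply: (dEq (dB (dB (dcst f g) (did f)) (crs_derivel f g))); ring. Qed.

Lemma Wq_ff f : Wq f f = 0. Proof. by rewrite /Wq /crs; ring. Qed.

Lemma Wq_gt0 f g : f < g < f + 2 * Pi -> 0 < Wq f g.
Proof.
move=> /andP[fg gf]; rewrite -(Wq_ff f); apply: (@is_derive_incr R (Wq f) (fun g => 1 - al f g) f g fg).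
- by move=> x _; exact: dcontinuous (Wq_derive f x).
- by move=> x _; exact: Wq_derive.
- by move=> x /andP[? ?]; rewrite subr_gt0 al_lt1//; apply/andP; split=> //; lra.
Qed.

Lemma Piq2 : 0 < Pi. Proof. exact: Piq_gt0. Qed.

Lemma Dq_gt0 f g : f < g < f + 2 * Pi -> 0 < Dq f g.
Proof.
move=> /andP[fg gf]; have Pi0 := Piq2.
have fgf : f < g < f + 2 * Pi by rewrite fg.
have [gfP|gfP] := leP (f + Pi) g.
  have W0 : 0 < Wq f g by exact: Wq_gt0.
  have g0 : ga f g <= 0.
    rewrite leNgt ga_gt0E -leNgt -(subrK Pi g) crsDPi oppr_le0.
    move: gfP; rewrite le_eqVlt => /predU1P[<-|gfP]; first by rewrite addrK /crs; lra.
    by apply/ltW/crs_gt0; apply/andP; split; lra.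
  have h1 : 0 < 1 - al f g by rewrite subr_gt0 al_lt1.
  have h2 : 0 < 1 - al g f by rewrite subr_gt0 al_lt1'.
  rewrite /Dq; have := mulr_gt0 h1 h2; have := mulr_ge0_le0 (ltW W0) g0; lra.
(* [U] runs from [U f = 0] to [U g = Dq f g]. Once [al h h] and [al f f] are written for 1, a
   bilinear identity in e and e' at the three parameters reduces its derivative to
   [2 * ga h g * (1 - al h f)], which is positive as long as [g < f + Pi]. *)
pose U h := (al h g - al f g) * (1 - al h f) - Wq f h * ga f g.
have U0 : U f = 0 by rewrite /U Wq_ff; ring.
have UD : U g = Dq f g by rewrite /U /Dq al_ff.
rewrite -UD -U0.
have dU (h : R) : is_derive h 1 U (2 * ga h g * (1 - al h f)).
  have h1 := dB (al_derivel h g) (dcst h (al f g)).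
  have h2 := dB (dcst h 1) (al_derivel h f).
  have h3 := dM (Wq_derive f h) (dcst h (ga f g)).
  apply: (dEq (dB (dM h1 h2) h3)).
  have E1 := al_ff h; have E2 := al_ff f.
  transitivity (ga h g * (al f f - al h f) + (al h g - al f g) * - ga h f - (al h h - al f h) * ga f g).
    by rewrite E1 E2; ring.
  transitivity (2 * ga h g * (al f f - al h f)); last by rewrite E2.
  by rewrite /al /ga; ring.
apply: (is_derive_incr fg _ (fun h _ => dU h)) => h /andP[fh hg].
  exact: dcontinuous (dU h).
rewrite mulr_gt0//; first by rewrite mulr_gt0// ga_gt0//; apply/andP; split; lra.
by rewrite subr_gt0 al_lt1'//; apply/andP; split; lra.
Qed.

Definition kap g := (q - 1) * `|C g| `^ (q - 2) * `|S g| `^ (q - 2).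

Definition fq f g := crs f g - (g - f) * al g f.

Lemma sp_q1 x : sp (q - 1) x = `|x| `^ (q - 2) * x.
Proof.
have [->|x0] := eqVneq x 0; first by rewrite sp0 mulr0.
have -> : q - 2 = q - 1 - 1 by ring.
have -> : sp (q - 1) x = Num.sg x * (`|x| `^ (q - 1 - 1) * `|x|).
  rewrite spE mulrC -{3}(powRr1 (normr_ge0 x)) -powRD ?subrK 1?mulrC//.
  by rewrite normr_eq0 x0 implybT.
by rewrite mulrCA -numEsg.
Qed.

(** Where e' is differentiable: for q <= 2 the power [sp (q - 1)] is only handled away from 0, that
    is, off the coordinate axes. *)
Definition smooth_at g := (2 < q) || (C g != 0) && (S g != 0).

Lemma spC_derive g : smooth_at g ->
  is_derive g 1 (fun g => sp (q - 1) (C g)) (- (kap g * S g)).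
Proof.
move=> sg; have H : is_derive (C g) 1 (sp (q - 1)) ((q - 1) * `|C g| `^ (q - 1 - 1)).
  case/orP: sg => [q2|/andP[c _]]; last exact: is_derive_sp_neq0.
  by apply: is_derive_sp; lra.
apply: (dEq (dcomp H (eC_derive q1 g))); rewrite /kap [sp _ (S g)]sp_q1.
by rewrite (_ : q - 1 - 1 = q - 2); last (by ring); ring.
Qed.

Lemma spS_derive g : smooth_at g ->
  is_derive g 1 (fun g => sp (q - 1) (S g)) (kap g * C g).
Proof.
move=> sg; have H : is_derive (S g) 1 (sp (q - 1)) ((q - 1) * `|S g| `^ (q - 1 - 1)).
  case/orP: sg => [q2|/andP[_ c]]; last exact: is_derive_sp_neq0.
  by apply: is_derive_sp; lra.
apply: (dEq (dcomp H (eS_derive q1 g))); rewrite /kap [sp _ (C g)]sp_q1.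
by rewrite (_ : q - 1 - 1 = q - 2); last (by ring); ring.
Qed.

Lemma al_derive f g : smooth_at g -> is_derive g 1 (al f) (- (kap g * crs f g)).
Proof.
move=> sg; apply: (dEq (dD (dZ (C f) (spC_derive sg)) (dZ (S f) (spS_derive sg)))).
by rewrite /crs; ring.
Qed.

Lemma ga_derive f g : smooth_at g -> is_derive g 1 (ga f) (kap g * al g f).
Proof.
move=> sg; apply: (dEq (dB (dZ _ (spS_derive sg)) (dZ _ (spC_derive sg)))).
by rewrite /al; ring.
Qed.

Lemma Dq_derive f g : smooth_at g -> is_derive g 1 (Dq f) (kap g * fq f g).
Proof.
move=> sg; have h1 := dM (dB (dcst g 1) (al_derive f sg)) (dB (dcst g 1) (al_derivel g f)).
apply: (dEq (dB h1 (dM (Wq_derive f g) (ga_derive f sg)))).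
by rewrite /fq /Wq gaC; ring.
Qed.

Lemma Dq_ff f : Dq f f = 0.
Proof. by rewrite /Dq al_ff Wq_ff; ring. Qed.

Lemma continuous_spC g : {for g, continuous (fun g => sp (q - 1) (C g))}.
Proof.
apply: (@continuous_comp _ _ _ C (sp (q - 1))); first exact: dcontinuous (eC_derive q1 g).
by apply: continuous_sp; rewrite subr_gt0.
Qed.

Lemma continuous_spS g : {for g, continuous (fun g => sp (q - 1) (S g))}.
Proof.
apply: (@continuous_comp _ _ _ S (sp (q - 1))); first exact: dcontinuous (eS_derive q1 g).
by apply: continuous_sp; rewrite subr_gt0.
Qed.

Lemma continuous_al f g : {for g, continuous (al f)}.
Proof.
apply: continuousD; apply: continuousM; try exact: cst_continuous.
  exact: continuous_spC.
exact: continuous_spS.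
Qed.

Lemma continuous_ga f g : {for g, continuous (ga f)}.
Proof.
apply: continuousB; apply: continuousM; try exact: cst_continuous.
  exact: continuous_spS.
exact: continuous_spC.
Qed.

Lemma continuous_Dq f g : {for g, continuous (Dq f)}.
Proof.
apply: continuousB; apply: continuousM.
- by apply: continuousB; [exact: cst_continuous|exact: continuous_al].
- by apply: continuousB; [exact: cst_continuous|exact: dcontinuous (al_derivel g f)].
- exact: dcontinuous (Wq_derive f g).
- exact: continuous_ga.
Qed.

End Cross.

(** * Absolutely continuous functions *)

Section AbsCont.
Context {R : realType}.
Implicit Types (f P : R -> R) (a b x y : R).
Local Notation mu := (@lebesgue_measure R).

(** The supremum of the points reachable from [a] is itself reachable, and the local hypothesis
    there carries past it unless it equals [b]. This is Cousin's lemma; it takes the place of a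
    covering argument in [ac_le]. *)
Lemma cousin (Q : R -> R -> Prop) a b : a <= b ->
  (forall x y z, x <= y -> y <= z -> Q x y -> Q y z -> Q x z) ->
  (forall t, a <= t <= b -> exists2 d, 0 < d & forall x y,
     a <= x -> x <= t -> t <= y -> y <= b -> t - d < x -> y < t + d -> Q x y) ->
  Q a b.
Proof.
move=> ab Qtr Qloc; pose E := [set x | a <= x <= b /\ Q a x].
have Ea : E a.
  split; first by rewrite lexx.
  by have [|d d0] := Qloc a; [rewrite lexx|apply => //; lra].
have Eub : has_ubound E by exists b => x [/andP[]].
have Es : has_sup E by split; [exists a|].
pose c := sup E.
have ac : a <= c by exact: ub_le_sup.
have cb : c <= b by apply: ge_sup; [exists a|move=> x [/andP[]]].
have [|d d0 H] := Qloc c; first by rewrite ac.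
have [x Ex cx] := sup_adherent d0 Es; case: (Ex) => /andP[ax xb] Qax.
have xc : x <= c by exact: ub_le_sup.
pose y := Num.min b (c + d / 2).
have cy : c <= y by rewrite le_min cb/=; lra.
have yb : y <= b by rewrite ge_min lexx.
have Qay : Q a y.
  apply: (Qtr a x y) => //; first exact: le_trans cy.
  by apply: H => //; rewrite gt_min; apply/orP; right; lra.
have yc : y <= c by apply: ub_le_sup => //; split => //; rewrite yb (le_trans ac).
suff -> : b = y by [].
have [->//|E'] : y = b \/ y = c + d / 2 by rewrite /y; case: leP; [left|right].
by lra.
Qed.

(** Consecutive non-overlapping intervals in [x, y], the form in which the definition of absolute
    continuity accepts exceptional intervals. *)
Let chain := fix chain (x y : R) (s : seq (R * R)) : Prop :=
  if s is p :: s' then [/\ x <= p.1, p.1 <= p.2 & chain p.2 y s'] else x <= y.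

Let chain_cat x y z s t : chain x y s -> chain y z t -> chain x z (s ++ t).
Proof.
elim: s x => [|p s IH] x /=; last by move=> [? ? h] ?; split => //; exact: IH.
by case: t => [|p t] xy /=; [exact: le_trans|move=> [yp ? ?]; split=> //; exact: le_trans yp].
Qed.

Let chain_le x y s : chain x y s -> x <= y.
Proof. by elim: s x => [|p s IH] x //= [h1 h2 /IH]; lra. Qed.

Let chain_nth x y s i : chain x y s -> (i < size s)%N ->
  [/\ x <= (nth (0, 0) s i).1, (nth (0, 0) s i).1 <= (nth (0, 0) s i).2 &
   (nth (0, 0) s i).2 <= y].
Proof.
elim: s x i => [|p s IH] x [|i] //= [h1 h2 h3] hi; first by have := chain_le h3.
by have [? ? ?] := IH _ i h3 hi; split=> //; lra.
Qed.

Let chain_disj x y s i j : chain x y s -> (i < j)%N -> (j < size s)%N ->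
  (nth (0, 0) s i).2 <= (nth (0, 0) s j).1.
Proof.
elim: s x i j => [|p s IH] x [|i] [|j] //= [h1 h2 h3] ij hj.
  by have [] := chain_nth h3 hj.
exact: (IH p.2 i j h3).
Qed.

(** Monotonicity of [P] is enough: around the null set where the derivatives are not compared, the
    increments of [P] are nonnegative and those of [f] are absorbed by absolute continuity.
    Elsewhere the derivatives control the increments up to a small linear error. *)
Lemma ac_le f P a b : 0 <= a -> a <= b -> b <= 1 -> abs_continuous01 f ->
  (forall x y, a <= x -> x <= y -> y <= b -> P x <= P y) ->
  {ae mu, forall t, a <= t <= b -> exists u v,
     [/\ is_derive t 1 f u, is_derive t 1 P v & u <= v]} ->
  f b - f a <= P b - P a.
Proof.
move=> a0 ab b1 acf Pmon [A [mA A0 HA]].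
apply/ler_addgt0Pr => e e0.
(* Half of [e] pays for the exceptional intervals; the slope error [k] costs at most the other half
   over [a, b]. *)
pose e' := e / 2; pose k := e / (2 * (b - a + 1)).
have ba1 : 0 < 2 * (b - a + 1) by lra.
have k0 : 0 < k by rewrite divr_gt0.
have [delta delta0 Hd] := acf e' (divr_gt0 e0 (ltr0Sn _ _)).
have [|U [oU AU muU]] := lebesgue_regularity_outer mA _ delta0; first by rewrite [ltLHS]A0 ltry.
have mU : measurable U by exact: measurable_realfun.open_measurable.
have {}muU : (mu U < delta%:E)%E.
  suff -> : mu U = mu (U `\` A) by [].
  by rewrite -{1}(setDKU AU) measureU0//; exact: measurableD.
pose len (s : seq (R * R)) := \sum_(p <- s) (p.2 - p.1).
pose var (s : seq (R * R)) := \sum_(p <- s) `|f p.2 - f p.1|.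
(* The list collects the exceptional intervals. Their total length is bounded by the measure of [U]
   inside ]x, y], a bound that is additive in the interval, as [cousin] requires. *)
pose Q x y := exists s, [/\ chain x y s, ((len s)%:E <= mu (U `&` `]x, y]))%E &
  f y - f x <= P y - P x + k * (y - x) + var s].
have Qab : Q a b.
  apply: cousin => // [x y z xy yz [s [cs ls vs]] [t [ct lt vt]]|t tab].
    exists (s ++ t); split; first exact: chain_cat cs ct.
      have -> : `]x, z]%classic = `]x, y] `|` `]y, z].
        by rewrite -itv_bndbnd_setU// bnd_simp.
      rewrite setIUr measureU//.
      - by rewrite /len big_cat/= EFinD leeD.
      - by apply: measurableI.
      - by apply: measurableI.
      clear -vt; apply/seteqP; split => w //= [[_ +] [_]]; rewrite !in_itv/= => /andP[_ h1] /andP[h2 _]; lra.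
    by clear -vs vt; rewrite /var big_cat/= -!/(var _); lra.
  have [tA|tA] := pselect (A t).
    have /nbhs_ballP[d /= d0 dU] : nbhs t U by apply: open_nbhs_nbhs; split => //; exact: AU.
    exists d => // x y ax xt ty yb xd yd; exists [:: (x, y)]; split.
    - by clear -xt ty; split=> //=; lra.
    - rewrite /len big_seq1 /=.
      have -> : U `&` `]x, y] = `]x, y]%classic.
        apply/setIidr => w /=; rewrite in_itv/= => /andP[? ?]; apply: dU.
        by rewrite /ball/= ltr_norml; lra.
      rewrite lebesgue_measure_itv/= lte_fin; case: ltP => // yx.
      by rewrite lee_fin; lra.
    - rewrite /var big_seq1 /=; have := Pmon x y ax; have := ler_norm (f y - f x).
      have : 0 <= k * (y - x) by rewrite mulr_ge0//; [exact: ltW|lra].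
      by move=> ? ? /(_ _ yb) h; have := h ltac:(lra); lra.
  have [u [v [/is_derive_epsP fu /is_derive_epsP Pv uv]]] : exists u v,
     [/\ is_derive t 1 f u, is_derive t 1 P v & u <= v].
    have [//|h] := pselect (exists u v, [/\ is_derive t 1 f u, is_derive t 1 P v & u <= v]).
    by exfalso; apply: tA; apply: HA => /= /(_ tab).
  have k20 : 0 < k / 2 by lra.
  have [d1 d10 h1] := fu _ k20; have [d2 d20 h2] := Pv _ k20.
  exists (Num.min d1 d2); first by rewrite lt_min d10.
  move=> x y ax xt ty yb; rewrite ltrBlDl -ltrBlDr lt_min => /andP[xd1 xd2].
  rewrite -ltrBlDl lt_min => /andP[yd1 yd2].
  exists [::]; split => /=; first lra.
    by rewrite /len big_nil.
  rewrite /var big_nil addr0.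
  have := h1 (y - t); have := h1 (x - t); have := h2 (y - t); have := h2 (x - t).
  rewrite !subrKC (ger0_norm (_ : 0 <= y - t)) ?subr_ge0//.
  rewrite (ler0_norm (_ : x - t <= 0)) ?subr_le0//.
  rewrite !opprB => /(_ xd2) q1 /(_ yd2) q2 /(_ xd1) q3 /(_ yd1) q4.
  move: q1 q2 q3 q4; rewrite !ler_norml => /andP[a1 a2] /andP[a3 a4] /andP[a5 a6] /andP[a7 a8].
  have : 0 <= (v - u) * (y - x) by clear -uv xt ty; rewrite mulr_ge0//; lra.
  by clear -a1 a2 a3 a4 a5 a6 a7 a8 xt ty k20; lra.
case: Qab => s [cs ls vs].
have vse : var s < e'.
  rewrite /var (big_nth (0, 0)) big_mkord; apply: (Hd (size s) (fun i => (nth (0, 0) s i).1) (fun i => (nth (0, 0) s i).2)).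
  - by move=> i; have [? ? ?] := chain_nth cs (ltn_ord i); repeat split; lra.
  - move=> i j _ _ [w [/=]]; rewrite !in_itv/= => /andP[? ?] /andP[? ?].
    apply/eqP/negPn/negP => ij.
    have [ij'|ij'] : (i < j)%N \/ (j < i)%N.
      by case: (ltngtP i j) => [||/ord_inj E]; [left|right|move: ij; rewrite E eqxx].
    + by have := chain_disj cs ij' (ltn_ord _); lra.
    + by have := chain_disj cs ij' (ltn_ord _); lra.
  - have -> : \sum_(i < size s) ((nth (0, 0) s i).2 - (nth (0, 0) s i).1) = len s.
      by rewrite /len (big_nth (0, 0)) big_mkord.
    rewrite -lte_fin; apply: (le_lt_trans ls); apply: le_lt_trans muU.
    by apply: le_measure; rewrite ?inE//; exact: measurableI.
have : k * (b - a) <= e / 2.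
  rewrite /k mulrAC ler_pdivrMr//; nra.
move: vs vse; rewrite /e'; lra.
Qed.

End AbsCont.

(** * Change of variables *)

Section Density.
Local Open Scope ereal_scope.
Context {d} {T : measurableType d} {R : realType}.
Variables (mu : {measure set T -> \bar R}) (g : T -> R).
Hypotheses (g0 : forall x, (0 <= g x)%R) (mg : measurable_fun setT g).

Definition dens (A : set T) : \bar R := \int[mu]_(x in A) (g x)%:E.

Let dens0 : dens set0 = 0.
Proof. exact: integral_set0. Qed.
Let dens_ge0 A : 0 <= dens A.
Proof. by apply: integral_ge0 => x _; rewrite lee_fin. Qed.
Let dens_sigma_additive : semi_sigma_additive dens.
Proof.
move=> F mF tF mUF; rewrite /dens ge0_integral_bigcup//.
- apply: is_cvg_nneseries => n _ _; exact: dens_ge0.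
- by apply/measurable_EFinP; exact: measurable_funTS.
- by move=> x _; rewrite lee_fin.
Qed.
HB.instance Definition _ := isMeasure.Build _ _ _ dens dens0 dens_ge0 dens_sigma_additive.

Definition dens_measure : {measure set T -> \bar R} := dens.

Import HBNNSimple.

Lemma integral_dens (f : T -> \bar R) : (forall x, 0 <= f x) -> measurable_fun setT f ->
  \int[dens]_x f x = \int[mu]_x (f x * (g x)%:E).
Proof.
move=> f0 mf; pose h := nnsfun_approx measurableT mf.
have fE x : f x = lim ((EFin \o h n) x @[n --> \oo]).
  by apply/esym/cvg_lim => //; apply: cvg_nnsfun_approx.
have mgE : measurable_fun setT (EFin \o g) by exact/measurable_EFinP.
transitivity (limn (fun n => \int[dens]_x (h n x)%:E)).
  under eq_integral => x _ do rewrite fE.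
  rewrite monotone_convergence//.
  - by move=> n; exact/measurable_EFinP.
  - by move=> n x _; rewrite lee_fin.
  - by move=> x _ m n mn; rewrite lee_fin; exact/lefP/nd_nnsfun_approx.
have -> : (fun n => \int[dens]_x (h n x)%:E) =
    (fun n => \int[mu]_x ((h n x)%:E * (g x)%:E)).
  apply/funext => n.
  rewrite integralT_nnsfun sintegralE.
  under [RHS]eq_integral => x _.
    rewrite (fimfunE (h n)) -fsumEFin// ge0_mule_fsuml; last first.
      by move=> y; rewrite lee_fin; exact: nnfun_muleindic_ge0.
    over.
  rewrite ge0_integral_fsum//; last 2 first.
  - move=> y; apply: emeasurable_funM => //.
    by apply/measurable_EFinP; apply: measurable_funM.
  - by move=> y x _; rewrite mule_ge0// ?lee_fin//; exact: nnfun_muleindic_ge0.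
  apply: eq_fsbigr => y _.
  have [y0|y0] := leP 0%R y; last first.
    rewrite preimage_nnfun0// measure0 mule0 integral0_eq// => x _.
    by rewrite indicE in_set0 mulr0 mul0e.
  under eq_integral do rewrite EFinM -muleA.
  rewrite ge0_integralZl//; last 2 first.
  - by apply: emeasurable_funM => //; exact/measurable_EFinP.
  - by move=> x _; rewrite mule_ge0// lee_fin.
  congr (_ * _); rewrite /= /dens integral_mkcond; apply: eq_integral => x _.
  by rewrite patchE indicE; case: ifPn => _; rewrite ?mul1e ?mul0e.
rewrite -monotone_convergence//; last 3 first.
- by move=> n; apply: emeasurable_funM => //; exact/measurable_EFinP.
- by move=> n x _; rewrite mule_ge0// lee_fin.
- by move=> x _ m n mn; rewrite lee_wpmul2r// lee_fin//; exact/lefP/nd_nnsfun_approx.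
apply: eq_integral => x _; apply/cvg_lim => //.
have [gx0|gx0] := eqVneq (g x) 0%R.
  by rewrite gx0 mule0; under eq_fun do rewrite mule0; exact: cvg_cst.
apply: cvgeM; last exact: cvg_cst.
- have [ff|ff] := boolP (f x \is a fin_num); first by rewrite mule_def_fin.
  by rewrite mule_def_infty_neq0.
- by apply: cvg_nnsfun_approx.
Qed.

End Density.

Section Substitution.
Context {R : realType}.
Local Notation mu := (@lebesgue_measure R).
Implicit Types (a b : R) (G g : R -> R) (f : R -> \bar R) (I J : set R).

(** Half-lines suffice to identify the image of the measure g dx under [G], and on a half-line both
    sides are an increment of [G] by the fundamental theorem. *)
Let half_dist G g a b y : a < b ->
  (forall x, a <= x <= b -> is_derive x 1 G (g x)) ->
  (forall x, a <= x <= b -> {for x, continuous g}) ->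
  (forall x, a <= x <= b -> 0 < g x) ->
  (\int[mu]_(x in `[a, b] `&` G @^-1` `]-oo, y]) (g x)%:E =
   mu (`]-oo, y] `&` `[G a, G b]))%E.
Proof.
move=> ab dG cg g0.
have cG x : a <= x <= b -> {for x, continuous G} by move=> /dG; exact: dcontinuous.
have Gincr u v : a <= u -> u < v -> v <= b -> G u < G v.
  move=> au uv vb; apply: (@is_derive_incr _ G g u v uv) => x /andP[ux xv].
  - by apply: cG; lra.
  - by apply: dG; lra.
  - by apply: g0; lra.
have Gle u v : a <= u -> u <= v -> v <= b -> G u <= G v.
  by move=> au; rewrite le_eqVlt => /predU1P[->//|uv vb]; apply/ltW/Gincr.
have FTC c : a <= c <= b -> (\int[mu]_(x in `[a, c]) (g x)%:E = (G c - G a)%:E)%E.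
  move=> /andP[]; rewrite le_eqVlt => /predU1P[<- _|ac cb].
    by rewrite subrr set_itv1 integral_set1.
  rewrite (@continuous_FTC2 _ g G a c)//.
  - by apply: continuous_in_subspaceT => x; rewrite inE/= in_itv/= => ?; apply: cg; lra.
  - split.
    + by move=> x; rewrite in_itv/= => ?; have [] : is_derive x 1 G (g x) by apply: dG; lra.
    + by apply: cvg_at_right_filter; apply: cG; lra.
    + by apply: cvg_at_left_filter; apply: cG; lra.
  - by move=> x; rewrite in_itv/= derive1E => ?; have [_ ->] : is_derive x 1 G (g x) by apply: dG; lra.
have [yb|yb] := leP (G b) y.
  have -> : `[a, b]%classic `&` G @^-1` `]-oo, y] = `[a, b]%classic.
    apply/setIidl => x /=; rewrite !in_itv/= => /andP[ax xb].
    by apply: le_trans yb; exact: Gle.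
  have -> : `]-oo, y]%classic `&` `[G a, G b] = `[G a, G b]%classic.
    by apply/setIidr => x /=; rewrite !in_itv/= => /andP[_ /le_trans]; exact.
  rewrite FTC ?lexx ?ltW// lebesgue_measure_itv/= lte_fin Gincr//.
have [ya|ya] := ltP y (G a).
  have -> : `[a, b]%classic `&` G @^-1` `]-oo, y] = set0.
    apply/seteqP; split => x //= []; rewrite !in_itv/= => /andP[ax xb] Gx.
    by have := Gle a x (lexx _) ax xb; lra.
  have -> : `]-oo, y]%classic `&` `[G a, G b] = set0.
    by apply/seteqP; split => x //= []; rewrite !in_itv/=; lra.
  by rewrite integral_set0 measure0.
have [c acb Gc] : exists2 c, a <= c <= b & G c = y.
  have [||c ? ?] := @IVT _ G a b y (ltW ab); last by exists c.
  - by apply: continuous_in_subspaceT => x; rewrite inE/= in_itv/= => /cG.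
  - by rewrite ge_min ya/= le_max (ltW yb) orbT.
have /andP[ac cb] := acb.
have -> : `[a, b]%classic `&` G @^-1` `]-oo, y] = `[a, c]%classic.
  apply/seteqP; split => x /=; rewrite !in_itv/= -Gc.
    by move=> [/andP[ax xb] Gx]; rewrite ax/= leNgt; apply/negP => cx; have := Gincr c x ac cx xb; lra.
  by move=> /andP[ax xc]; split; [lra|apply: Gle].
have -> : `]-oo, y]%classic `&` `[G a, G b] = `[G a, G c]%classic.
  by apply/seteqP; split => x /=; rewrite !in_itv/= -Gc; have := Gle c b ac cb (lexx _); lra.
rewrite FTC// lebesgue_measure_itv/= lte_fin; case: ltP => // h.
by have := Gle a c (lexx _) ac cb; move=> ?; congr (_%:E); lra.
Qed.

Lemma subst_compact G g a b f : a < b ->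
  (forall x, a <= x <= b -> is_derive x 1 G (g x)) ->
  (forall x, a <= x <= b -> {for x, continuous g}) ->
  (forall x, a <= x <= b -> 0 < g x) ->
  (forall y, 0 <= f y)%E -> measurable_fun setT f ->
  (\int[mu]_(y in `[G a, G b]) f y = \int[mu]_(x in `[a, b]) (f (G x) * (g x)%:E))%E.
Proof.
move=> ab dG cg g0 f0 mf.
(* Extension by 0 outside [a, b], where nothing is known about [G] and [g]. *)
pose G' := G \_ `[a, b]; pose g' := g \_ `[a, b].
have mG : measurable_fun setT (G' : measurableTypeR R -> measurableTypeR R).
  apply/(measurable_restrictT G) => //; apply: subspace_continuous_measurable_fun => //.
  by apply: continuous_in_subspaceT => x; rewrite inE/= in_itv/= => /dG /dcontinuous.
have mg : measurable_fun setT g'.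
  apply/(measurable_restrictT g) => //; apply: subspace_continuous_measurable_fun => //.
  by apply: continuous_in_subspaceT => x; rewrite inE/= in_itv/= => /cg.
have g'0 x : 0 <= g' x.
  by rewrite /g' patchE; case: ifPn => //; rewrite inE/= in_itv/= => /g0/ltW.
pose J := `[G a, G b]%classic.
have mJ : measurable J by exact: measurable_itv.
have mJC : measurable (~` J) by exact: measurableC.
pose nu := pushforward (dens mu g') G' : set (measurableTypeR R) -> \bar R.
have nuE A : measurable A -> nu A = (\int[mu]_(x in `[a, b] `&` G @^-1` A) (g x)%:E)%E.
  move=> mA; rewrite /nu /pushforward /dens integral_mkcond [RHS]integral_mkcond.
  apply: eq_integral => x _; rewrite /g' !patchE /G'.
  have [xab|xab] := boolP (x \in `[a, b]%classic); last first.
    rewrite (_ : x \in `[a, b] `&` G @^-1` A = false); first by case: ifP.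
    by apply/negbTE; apply: contra xab; rewrite !inE => -[].
  have -> : (x \in G \_ `[a, b] @^-1` A) = (x \in `[a, b] `&` G @^-1` A) => //.
  by apply/idP/idP; rewrite !inE /preimage/= patchE xab; move: xab; rewrite inE/=; tauto.
pose num : {measure set (measurableTypeR R) -> \bar R} := @measure_function_pushforward__canonical__measure_function_Measure
  _ _ (measurableTypeR R) (measurableTypeR R) R (dens_measure mu g'0 mg) G' mG.
pose rJ : {measure set (measurableTypeR R) -> \bar R} := mrestr mu mJ.
(* The image of g dx lives on [J]. Adding Lebesgue measure on the complement of [J] produces a
   measure on the whole line, to which the uniqueness of Lebesgue measure applies. *)
pose tot : {measure set (measurableTypeR R) -> \bar R} := measure_add num (mrestr mu mJC).
have numE y : num `]-oo, y]%classic = rJ `]-oo, y]%classic.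
  by rewrite -[LHS]/(nu _) nuE ?half_dist.
have rJfin y : (rJ `]-oo, y]%classic < +oo)%E.
  apply: (@le_lt_trans _ _ (mu J)); first by apply: le_measure; rewrite ?inE//; exact: measurableI.
  by rewrite lebesgue_measure_itv/=; case: ifP => _; rewrite ?ltry// -EFinB ltry.
have numc c d : num `]c, d]%classic = rJ `]c, d]%classic.
  have [dc|cd] := ltP d c.
    have -> : `]c, d]%classic = set0.
      by apply/seteqP; split => x //=; rewrite in_itv/=; lra.
    by rewrite !measure0.
  have -> : `]c, d]%classic = `]-oo, d] `\` `]-oo, c].
    apply/seteqP; split => x /=; rewrite !in_itv/=.
      by move=> /andP[cx ->]; split=> //; apply/negP; rewrite -ltNge.
    by move=> [-> /negP]; rewrite -ltNge => ->.
  have I : `]-oo, d]%classic `&` `]-oo, c]%classic = `]-oo, c]%classic.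
    by apply/setIidr => x /=; rewrite !in_itv/= => /le_trans; exact.
  have nD : num (`]-oo, d] `\` `]-oo, c]) = (num `]-oo, d]%classic - num (`]-oo, d] `&` `]-oo, c]))%E.
    by apply: measureD => //; have := rJfin d; rewrite -numE.
  have rD : rJ (`]-oo, d] `\` `]-oo, c]) = (rJ `]-oo, d]%classic - rJ (`]-oo, d] `&` `]-oo, c]))%E.
    by apply: measureD => //; exact: rJfin.
  by rewrite nD rD I !numE.
have totD A : tot A = (num A + mu (A `&` ~` J))%E by exact: measure_addE.
have totE A : measurable A -> mu A = tot A.
  apply: lebesgue_measure_unique => _ [[c d] _ <-] /=.
  apply: etrans (esym (totD _)).
  rewrite numc -[X in (X + _)%E]/(mu (`]c, d] `&` J)) -measureU//; last 3 first.
  - by apply: measurableI.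
  - by apply: measurableI.
  - by apply/seteqP; split => x //= [[_ ?] [_ ?]].
  by rewrite -setIUr setUv setIT.
have GJ x : a <= x <= b -> J (G x).
  have Gincr u v : a <= u -> u < v -> v <= b -> G u < G v.
    move=> au uv vb; apply: (@is_derive_incr _ G g u v uv) => w /andP[ux xv].
    - by apply: dcontinuous; apply: dG; lra.
    - by apply: dG; lra.
    - by apply: g0; lra.
  move=> /andP[]; rewrite /J /= in_itv/= => ax xb; apply/andP; split.
    have [h|h] := ltP a x; first exact/ltW/Gincr.
    by have -> : x = a by lra.
  have [h|h] := ltP x b; first exact/ltW/Gincr.
  by have -> : x = b by lra.
transitivity (\int[num]_(y in J) f y)%E.
  apply: eq_measure_integral => A mA AJ; rewrite [LHS]totE// totD.
  have -> : A `&` ~` J = set0 by apply/seteqP; split => x //= [/AJ].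
  by rewrite measure0 adde0.
rewrite ge0_integral_pushforward//; last exact: measurable_funTS.
have mGJ : measurable (G' @^-1` J) by rewrite -[X in measurable X]setTI; exact (mG measurableT _ mJ).
pose h := (f \o G') \_ (G' @^-1` J).
have h0 x : (0 <= h x)%E by rewrite /h patchE; case: ifP => // _; exact: f0.
have mh : measurable_fun setT h.
  by apply/(measurable_restrictT _ mGJ); apply: measurable_funTS; exact: (measurableT_comp mf mG).
rewrite integral_mkcond -/h; apply: (etrans (integral_dens mu g'0 mg h0 mh)); rewrite /h.
rewrite [RHS]integral_mkcond; apply: eq_integral => x _; rewrite !patchE /g' patchE.
case: (boolP (x \in `[a, b]%classic)) => xab; last by rewrite mule0.
have GxJ : J (G x) by apply: GJ; move: xab; rewrite inE/= in_itv.
have G'x : G' x = G x by rewrite /G' patchE xab.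
by rewrite mem_set /preimage/= G'x.
Qed.

(** Monotone convergence along compact intervals exhausting [I]. This covers open and unbounded
    domains, where the density need not be bounded. *)
Lemma subst_incr G g (a_ b_ : nat -> R) f I J :
  (forall n, a_ n < b_ n) -> (forall n, a_ n.+1 <= a_ n) -> (forall n, b_ n <= b_ n.+1) ->
  I = \bigcup_n `[a_ n, b_ n]%classic -> J = G @` I ->
  {in I, forall x : R, is_derive x 1 G (g x)} ->
  {in I, forall x, {for x, continuous g}} ->
  {in I, forall x, 0 < g x} ->
  (forall y, 0 <= f y)%E -> measurable_fun setT f ->
  (\int[mu]_(y in J) f y = \int[mu]_(x in I) (f (G x) * (g x)%:E))%E.
Proof.
move=> ab a_n b_n IE JE dG cg g0 f0 mf.
have sI n x : a_ n <= x <= b_ n -> x \in I.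
  by move=> xn; rewrite inE IE; exists n.
have mI : measurable I by rewrite IE; apply: bigcup_measurable => n _; exact: measurable_itv.
have mGg : measurable_fun I (fun x => f (G x) * (g x)%:E)%E.
  rewrite IE; apply/measurable_fun_bigcup => [n|n]; first exact: measurable_itv.
  have cc (h : R -> R) : {in I, forall x, {for x, continuous h}} -> measurable_fun `[a_ n, b_ n] h.
    move=> ch; apply: subspace_continuous_measurable_fun => //.
    by apply: continuous_in_subspaceT => x; rewrite inE/= in_itv/= => /sI /ch.
  apply: emeasurable_funM.
    by apply: measurableT_comp => //; apply: cc => x /dG /dcontinuous.
  by apply/measurable_EFinP; exact: cc.
have Gincr n u v : a_ n <= u -> u < v -> v <= b_ n -> G u < G v.
  move=> au uv vb; apply: (@is_derive_incr _ G g u v uv) => x /andP[ux xv].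
  - by apply: dcontinuous; apply: dG; apply: (sI n); lra.
  - by apply: dG; apply: (sI n); lra.
  - by apply: g0; apply: (sI n); lra.
have Gle n u v : a_ n <= u -> u <= v -> v <= b_ n -> G u <= G v.
  by move=> au; rewrite le_eqVlt => /predU1P[->//|uv vb]; apply/ltW/(Gincr n).
have JU : J = \bigcup_n `[G (a_ n), G (b_ n)]%classic.
  rewrite JE IE; apply/seteqP; split => y /=.
    move=> [x [n _ /=]]; rewrite in_itv/= => /andP[ax xb] <-; exists n => //=.
    by rewrite in_itv/=; apply/andP; split; apply: (Gle n) => //; rewrite ltW.
  move=> [n _ /=]; rewrite in_itv/= => /andP[Ga Gb].
  have [||c] := @IVT _ G (a_ n) (b_ n) y (ltW (ab n)).
  - by apply: continuous_in_subspaceT => x; rewrite inE/= in_itv/= => /sI /dG /dcontinuous.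
  - by rewrite ge_min Ga/= le_max Gb orbT.
  - by move=> cn Gc; exists c => //; exists n.
have ndI : nondecreasing_seq (fun n => `[a_ n, b_ n]%classic).
  apply/nondecreasing_seqP => n; apply/subsetPset => x /=; rewrite !in_itv/=.
  by have := a_n n; have := b_n n; lra.
have ndJ : nondecreasing_seq (fun n => `[G (a_ n), G (b_ n)]%classic).
  apply/nondecreasing_seqP => n; apply/subsetPset => x /=; rewrite !in_itv/= => /andP[h1 h2].
  have := a_n n; have := b_n n; have := ab n => ? ? ?.
  apply/andP; split; [apply: le_trans h1|apply: (le_trans h2)]; apply: (Gle n.+1); lra.
have L : (\int[mu]_(y in `[G (a_ n), G (b_ n)]) f y @[n --> \oo] --> \int[mu]_(y in J) f y)%E.
  rewrite JU; apply: ge0_nondecreasing_set_cvg_integral => // n.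
  exact: measurable_funTS.
have Rr : (\int[mu]_(x in `[a_ n, b_ n]) (f (G x) * (g x)%:E) @[n --> \oo] -->
    \int[mu]_(x in I) (f (G x) * (g x)%:E))%E.
  rewrite IE; apply: ge0_nondecreasing_set_cvg_integral => //.
  - move=> n; apply: measurable_funS mGg => //.
    by move=> x /=; rewrite in_itv/= => /sI; rewrite inE.
  - by move=> n x /=; rewrite in_itv/= => /sI xI; rewrite mule_ge0// lee_fin ltW// g0.
have E : (fun n => \int[mu]_(y in `[G (a_ n), G (b_ n)]) f y)%E =
   (fun n => \int[mu]_(x in `[a_ n, b_ n]) (f (G x) * (g x)%:E))%E.
  apply/funext => n; apply: subst_compact => // x /sI xI; [exact: dG|exact: cg|exact: g0].
rewrite E in L; exact: (cvg_unique _ L Rr).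
Qed.

Lemma reflect_integral f I : measurable I -> measurable_fun I f ->
  (forall x, I x -> 0 <= f x)%E ->
  (\int[mu]_(x in I) f x = \int[mu]_(x in -%R @^-1` I) f (- x)%R)%E.
Proof.
move=> mI mf f0.
have mN : measurable_fun setT (-%R : measurableTypeR R -> measurableTypeR R) by exact: measurable_funN.
pose num : {measure set (measurableTypeR R) -> \bar R} := @measure_function_pushforward__canonical__measure_function_Measure
  _ _ (measurableTypeR R) (measurableTypeR R) R mu -%R mN.
have numE A : measurable A -> mu A = num A.
  apply: lebesgue_measure_unique => _ [[c d] _ <-] /=.
  rewrite /pushforward (_ : _ @^-1` _ = `[- d, - c[%classic).
    rewrite !lebesgue_measure_itv/= !lte_fin ltrN2; case: ifP => // _.
    by rewrite -!EFinB; congr (_%:E); ring.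
  by apply/seteqP; split => x /=; rewrite !in_itv/=; lra.
transitivity (\int[num]_(y in I) f y)%E.
  by apply: eq_measure_integral => A mA _; exact: numE.
by rewrite ge0_integral_pushforward// => y; rewrite inE; exact: f0.
Qed.

Lemma subst_decr G g (a_ b_ : nat -> R) f I J :
  (forall n, a_ n < b_ n) -> (forall n, a_ n.+1 <= a_ n) -> (forall n, b_ n <= b_ n.+1) ->
  I = \bigcup_n `[a_ n, b_ n]%classic -> J = G @` I ->
  {in I, forall x : R, is_derive x 1 G (- g x)} ->
  {in I, forall x, {for x, continuous g}} ->
  {in I, forall x, 0 < g x} ->
  (forall y, 0 <= f y)%E -> measurable_fun setT f ->
  (\int[mu]_(y in J) f y = \int[mu]_(x in I) (f (G x) * (g x)%:E))%E.
Proof.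
move=> ab a_n b_n IE JE dG cg g0 f0 mf.
have sI n x : a_ n <= x <= b_ n -> x \in I.
  by move=> xn; rewrite inE IE; exists n.
have mI : measurable I by rewrite IE; apply: bigcup_measurable => n _; exact: measurable_itv.
have mGg : measurable_fun I (fun x => f (G x) * (g x)%:E)%E.
  rewrite IE; apply/measurable_fun_bigcup => [n|n]; first exact: measurable_itv.
  have cc (h : R -> R) : {in I, forall x, {for x, continuous h}} -> measurable_fun `[a_ n, b_ n] h.
    move=> ch; apply: subspace_continuous_measurable_fun => //.
    by apply: continuous_in_subspaceT => x; rewrite inE/= in_itv/= => /sI /ch.
  apply: emeasurable_funM.
    by apply: measurableT_comp => //; apply: cc => x /dG /dcontinuous.
  by apply/measurable_EFinP; exact: cc.
rewrite [RHS]reflect_integral//; last first.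
  by move=> x Ix; rewrite mule_ge0// lee_fin ltW// g0// inE.
apply: (@subst_incr (fun x => G (- x)) (fun x => g (- x)) (fun n => - b_ n) (fun n => - a_ n)) => //.
- by move=> n; rewrite ltrN2.
- by move=> n; rewrite lerN2.
- by move=> n; rewrite lerN2.
- rewrite IE; apply/seteqP; split => x /= [n _ /=]; rewrite in_itv/= => xn; exists n => //=;
    by rewrite in_itv/=; lra.
- rewrite JE; apply/seteqP; split => y /= [x Ix <-].
    by exists (- x); rewrite /preimage /= ?opprK.
  by exists (- x).
- move=> x; rewrite inE /preimage/= => Ix.
  by apply: (dEq (@dcomp R G (fun t => - t) x _ _ (dG _ (mem_set Ix)) (dN (did x)))); ring.
- move=> x; rewrite inE /preimage/= => Ix.
  by apply: (@continuous_comp _ _ _ -%R g); [exact: continuousN|exact: cg (mem_set Ix)].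
- by move=> x; rewrite inE => Ix; exact: g0 (mem_set Ix).
Qed.

Lemma exhaust_oo (a b : R) : a < b -> exists a_ b_ : nat -> R,
  [/\ forall n, a_ n < b_ n, forall n, a_ n.+1 <= a_ n, forall n, b_ n <= b_ n.+1 &
   `]a, b[%classic = \bigcup_n `[a_ n, b_ n]%classic].
Proof.
move=> ab; pose e n := (b - a) / (n.+3)%:R.
have e0 n : 0 < e n by rewrite divr_gt0// subr_gt0.
have eS n : e n.+1 <= e n.
  by rewrite ler_pM2l ?subr_gt0// lef_pV2 ?posrE// ler_nat.
have e3 n : e n <= (b - a) / 3.
  by rewrite ler_pM2l ?subr_gt0// lef_pV2 ?posrE// ler_nat.
exists (fun n => a + e n), (fun n => b - e n); split.
- by move=> n; have := e3 n; lra.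
- by move=> n; have := eS n; lra.
- by move=> n; have := eS n; lra.
apply/seteqP; split => x /=; rewrite in_itv/=; last first.
  by move=> [n _ /=]; rewrite in_itv/=; have := e0 n; lra.
move=> /andP[ax xb].
pose m := Num.min (x - a) (b - x).
have m0 : 0 < m by rewrite lt_min !subr_gt0 ax.
have [n hn] : exists n, e n <= m.
  exists (Num.truncn ((b - a) / m)).
  rewrite /e ler_pdivrMr// mulrC -ler_pdivrMr//.
  apply/ltW/(lt_le_trans (truncnS_gt _)); rewrite ler_nat.
  by rewrite -[X in (X <= _)%N]addn0 -addn2 -addSnnS leq_add.
exists n => //=; rewrite in_itv/=; move: hn; rewrite le_min => /andP[]; lra.
Qed.

Lemma exhaust_T : exists a_ b_ : nat -> R,
  [/\ forall n, a_ n < b_ n, forall n, a_ n.+1 <= a_ n, forall n, b_ n <= b_ n.+1 &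
   setT = \bigcup_n `[a_ n, b_ n]%classic].
Proof.
exists (fun n => - (n.+1)%:R), (fun n => (n.+1)%:R); split.
- by move=> n; apply: (@lt_le_trans _ _ 0); rewrite ?oppr_lt0.
- by move=> n; rewrite lerN2 ler_nat.
- by move=> n; rewrite ler_nat.
apply/seteqP; split => x //= _; exists (Num.truncn `|x|) => //=.
by rewrite in_itv/= -ler_norml; exact/ltW/truncnS_gt.
Qed.

End Substitution.

(** * Horizontal curves *)

Section DerivePair.
Context {R : realType}.

Lemma is_deriveE (V : normedModType R) (f : R -> V) (t : R) (v : V) :
  is_derive t 1 f v <-> (h^-1 *: ((f \o shift t) (h *: 1) - f t) @[h --> (0 : R)^'] --> v).
Proof.
split=> [[df <-] //|H]; split; first by apply/cvg_ex; exists v.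
by apply/cvg_lim => //; exact: norm_hausdorff.
Qed.

Lemma is_derive_pairP (U V : normedModType R) (f : R -> U * V) (t : R) (v : U * V) :
  is_derive t 1 f v <->
  is_derive t 1 (fun s => (f s).1) v.1 /\ is_derive t 1 (fun s => (f s).2) v.2.
Proof.
rewrite !is_deriveE; split=> [H|[H1 H2]].
  split.
    by apply: (@cvg_comp _ _ _ _ (@fst U V) _ _ _ H); exact: cvg_fst.
  by apply: (@cvg_comp _ _ _ _ (@snd U V) _ _ _ H); exact: cvg_snd.
rewrite [v]surjective_pairing.
apply: cvg_trans (cvg_pair H1 H2).
apply: near_eq_cvg; near=> h; rewrite /=.
by rewrite [in RHS](surjective_pairing (f _)) [in RHS](surjective_pairing (f t)).
Unshelve. all: by end_near. Qed.

End DerivePair.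

Section AC.
Context {R : realType}.

Lemma ac_lip (U V : normedModType R) (f : R -> U) (g : R -> V) (K : R) :
  0 < K -> abs_continuous01 f ->
  (forall a b, 0 <= a <= 1 -> 0 <= b <= 1 -> `|g b - g a| <= K * `|f b - f a|) ->
  abs_continuous01 g.
Proof.
move=> K0 acf gf e e0; have [d d0 H] := acf (e / K) (divr_gt0 e0 K0).
exists d => // n a b ab tab sab; have := H n a b ab tab sab.
rewrite ltr_pdivlMr// => /(le_lt_trans _); apply; rewrite mulr_suml; apply: ler_sum => i _.
by have [? [? ?]] := ab i; rewrite mulrC; apply: gf; lra.
Qed.

Lemma ac_id : abs_continuous01 (id : R -> R).
Proof.
move=> e e0; exists e => // n a b ab _; apply: le_lt_trans; apply: ler_sum => i _.
by have [? [? ?]] := ab i; rewrite ger0_norm// subr_ge0.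
Qed.

Lemma acD (V : normedModType R) (f g : R -> V) : abs_continuous01 f -> abs_continuous01 g ->
  abs_continuous01 (fun t => f t + g t).
Proof.
move=> acf acg e e0; have e20 : 0 < e / 2 by rewrite divr_gt0.
have [d d0 H] := acf _ e20; have [d' d'0 H'] := acg _ e20.
exists (Num.min d d'); first by rewrite lt_min d0.
move=> n a b ab tab; rewrite lt_min => /andP[sd sd'].
have h1 := H n a b ab tab sd; have h2 := H' n a b ab tab sd'.
rewrite [e]splitr; apply: le_lt_trans (ltrD h1 h2); rewrite -big_split/=.
by apply: ler_sum => i _; rewrite opprD addrACA ler_normD.
Qed.

(** Meant for the clamped reparametrisations min(2 t, 1) and max(2 t - 1, 0) of a concatenation,
    which are constant on half of [0, 1]; hence the non-strict monotonicity and the factor 2. *)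
Lemma ac_comp (V : normedModType R) (f : R -> V) (c : R -> R) :
  abs_continuous01 f -> (forall x y, x <= y -> c x <= c y) ->
  (forall x, 0 <= x <= 1 -> 0 <= c x <= 1) ->
  (forall x y, x <= y -> c y - c x <= 2 * (y - x)) -> abs_continuous01 (fun t => f (c t)).
Proof.
move=> acf cm c01 c2 e e0; have [d d0 H] := acf _ e0.
exists (d / 2); first by rewrite divr_gt0.
move=> n a b ab tab sab; apply: (H n (c \o a) (c \o b)).
- move=> i /=; have [? [? ?]] := ab i; have := c01 (a i); have := c01 (b i) => h1 h2.
  have /andP[? ?] : 0 <= c (a i) <= 1 by apply: h2; lra.
  have /andP[? ?] : 0 <= c (b i) <= 1 by apply: h1; lra.
  by split=> //; split=> //; exact: cm.
- move=> i j _ _ [w [/=]]; rewrite !in_itv/= => /andP[h1 h2] /andP[h3 h4].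
  (* If the images of two intervals meet, the intervals overlap, and the midpoint of the overlap
     lies in both. *)
  apply: tab => //; exists ((Num.max (a i) (a j) + Num.min (b i) (b j)) / 2).
  have lt x y : c x < c y -> x < y.
    by move=> cxy; rewrite ltNge; apply/negP => /cm; lra.
  have H1 : Num.max (a i) (a j) < Num.min (b i) (b j).
    rewrite gt_max !lt_min; apply/andP; split; apply/andP; split; apply: lt => //; lra.
  have : a i <= Num.max (a i) (a j) by rewrite le_max lexx.
  have : a j <= Num.max (a i) (a j) by rewrite le_max lexx orbT.
  have : Num.min (b i) (b j) <= b i by rewrite ge_min lexx.
  have : Num.min (b i) (b j) <= b j by rewrite ge_min lexx orbT.
  by split; rewrite /= in_itv/=; lra.
- apply: (@le_lt_trans _ _ (2 * \sum_i (b i - a i))); last lra.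
  by rewrite mulr_sumr; apply: ler_sum => i _; apply: c2; have [? []] := ab i.
Qed.

Lemma ac_continuous (V : normedModType R) (f : R -> V) (t : R) e :
  abs_continuous01 f -> 0 < e -> exists2 d, 0 < d &
    forall a b, 0 <= a <= 1 -> 0 <= b <= 1 -> `|b - a| < d -> `|f b - f a| < e.
Proof.
move=> acf e0; have [d d0 H] := acf e e0; exists d => // a b.
wlog : a b / a <= b => [W a01 b01 ab|ab a01 b01 dab].
  have [|/ltW] := leP a b => h; first exact: W.
  by rewrite distrC; apply: W => //; rewrite distrC.
have := H 1%N (fun=> a) (fun=> b); rewrite !big_ord1; apply.
- by move=> i; lra.
- by move=> i j _ _ _; rewrite (ord1 i) (ord1 j).
- by apply: le_lt_trans dab; exact: ler_norm.
Qed.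

End AC.

Section NegligibleAffine.
Context {R : realType}.
Local Notation mu := (@lebesgue_measure R).

Lemma negligible_affine (a b : R) (N : set R) : 0 < a -> mu.-negligible N ->
  mu.-negligible [set t | N (a * t + b)].
Proof.
move=> a0 [A [mA A0 NA]].
have dG (x : R) : is_derive x 1 (fun t => a * t + b) a.
  by apply: (dEq (dD (dZ a (did x)) (dcst x b))); ring.
have mG : measurable_fun setT (fun t : R => a * t + b).
  apply: continuous_measurable_fun => x; exact: dcontinuous (dG x).
pose P := (fun t : R => a * t + b) @^-1` A.
have mP : measurable P by rewrite -[X in measurable X]setTI; apply: mG.
exists P; split => //; last by move=> t /= /NA.
have [a_ [b_ [h1 h2 h3 h4]]] := @exhaust_T R.
have := @subst_incr R (fun t => a * t + b) (fun=> a) a_ b_ (fun y => (\1_A y)%:E) setT setT h1 h2 h3 h4.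
have -> : (\int[mu]_y (\1_A y)%:E = 0)%E by rewrite integral_indic// setIT; exact: A0.
move=> H.
have {}H : (0 = \int[mu]_x ((\1_A (a * x + b)%R) %:E * a%:E))%E.
  apply: H => //.
  - apply/seteqP; split => y //= _; exists ((y - b) / a) => //.
    by rewrite mulrC divfK ?gt_eqF// subrK.
  - by move=> x _; exact: cst_continuous.
  - by apply/measurable_EFinP.
have E : (\int[mu]_x ((\1_A (a * x + b)%R)%:E * a%:E) = \int[mu]_x (a%:E * (\1_P x)%:E))%E.
  by apply: eq_integral => x _; rewrite muleC.
move: H; rewrite E {E}.
rewrite ge0_integralZl//; last 2 first.
- by apply/measurable_EFinP.
- by rewrite lee_fin ltW.
rewrite integral_indic// setIT => /esym/eqP; rewrite mule_eq0 eqe gt_eqF//=.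
by move=> /eqP.
Qed.

Lemma aeS (P Q : R -> Prop) : (forall t, P t -> Q t) ->
  {ae mu, forall t, P t} -> {ae mu, forall t, Q t}.
Proof. by move=> PQ; apply: negligibleS => t /= + /PQ; exact. Qed.

Lemma aeT (P : R -> Prop) : (forall t, P t) -> {ae mu, forall t, P t}.
Proof.
move=> HP; apply: (@negligibleS _ _ _ mu set0); last exact: negligible_set0.
by move=> t /=; apply; exact: HP.
Qed.

End NegligibleAffine.

Section HorizontalCurves.
Context {R : realType}.
Local Notation H := (R * R * R)%type.
Local Notation mu := (@lebesgue_measure R).
Variable p : R.
Hypothesis p0 : 0 < p.

Definition lpn (a b : R) : R := (`|a| `^ p + `|b| `^ p) `^ p^-1.

Lemma lpn_ge0 a b : 0 <= lpn a b. Proof. exact: powR_ge0. Qed.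

Lemma lpnM c a b : 0 <= c -> lpn (c * a) (c * b) = c * lpn a b.
Proof.
move=> c0; rewrite /lpn !normrM !powRM// -mulrDr powRM ?powR_ge0 ?addr_ge0 ?powR_ge0//.
suff -> : (`|c| `^ p) `^ p^-1 = c by [].
by rewrite -powRrM divff ?gt_eqF// powRr1 ?ger0_norm.
Qed.

Lemma lpn_eq0 a b : lpn a b = 0 -> a = 0 /\ b = 0.
Proof.
move/powR_eq0_eq0/eqP; rewrite paddr_eq0 ?powR_ge0// !powR_eq0 !normr_eq0.
by move=> /andP[/andP[/eqP -> _] /andP[/eqP -> _]].
Qed.

Lemma measurable_lpn (D : set R) (u1 u2 : R -> R) : measurable_fun D u1 -> measurable_fun D u2 ->
  measurable_fun D (fun t => lpn (u1 t) (u2 t)).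
Proof.
move=> m1 m2; apply: (measurableT_comp (measurable_powR p^-1)).
apply: measurable_funD.
  by apply: (measurableT_comp (measurable_powR p)); exact: measurableT_comp.
by apply: (measurableT_comp (measurable_powR p)); exact: measurableT_comp.
Qed.

Lemma field_derivP (gamma : R -> H) (t u1 u2 : R) :
  is_derive t 1 gamma (u1 *: Xfield (gamma t) + u2 *: Yfield (gamma t)) <->
  [/\ is_derive t 1 (fun s => (gamma s).1.1) u1, is_derive t 1 (fun s => (gamma s).1.2) u2 &
     is_derive t 1 (fun s => (gamma s).2)
       (2^-1 * ((gamma t).1.1 * u2 - u1 * (gamma t).1.2))].
Proof.
have -> : u1 *: Xfield (gamma t) + u2 *: Yfield (gamma t) =
    (u1, u2, 2^-1 * ((gamma t).1.1 * u2 - u1 * (gamma t).1.2)) :> H.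
  rewrite /Xfield /Yfield; case: (gamma t) => [[x y] z] /=.
  by congr (_, _, _) => /=; rewrite /GRing.scale/=; ring.
rewrite is_derive_pairP is_derive_pairP /=; split; first by move=> [[]].
by move=> [].
Qed.

Lemma normH (g : H) : `|g| = Num.max (Num.max `|g.1.1| `|g.1.2|) `|g.2|.
Proof. by []. Qed.

Lemma le_normH (g : H) (e : R) : (`|g| <= e) = [&& `|g.1.1| <= e, `|g.1.2| <= e & `|g.2| <= e].
Proof. by rewrite normH !ge_max andbA. Qed.

(** Extending the controls by 0 makes them measurable on the whole line, which rescaling in
    [horizontal_cat] and integration over half-lines in [speed_primitive] require. *)
Lemma horizontal_restrict (gamma : R -> H) u1 u2 : horizontal gamma u1 u2 ->
  exists v1 v2, [/\ horizontal gamma v1 v2, measurable_fun setT v1, measurable_fun setT v2 &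
    lp_length p u1 u2 = lp_length p v1 v2].
Proof.
move=> [ac m1 m2 d]; exists (u1 \_ `[0, 1]), (u2 \_ `[0, 1]).
have mI : measurable (`[0, 1]%classic : set R) by exact: measurable_itv.
have m1' : measurable_fun setT (u1 \_ `[0, 1]) by apply/(measurable_restrictT u1 mI).
have m2' : measurable_fun setT (u2 \_ `[0, 1]) by apply/(measurable_restrictT u2 mI).
split; [|exact: m1'|exact: m2'|].
  split; [exact: ac|exact: measurable_funTS|exact: measurable_funTS|].
  apply: aeS d => t dt t01; rewrite !patchE mem_set; first exact: dt.
  by rewrite /= in_itv.
by rewrite /lp_length; apply: eq_integral => t t01; rewrite !patchE t01.
Qed.

Definition lset (g0 g1 : H) := [set l | exists gamma u1 u2,
    [/\ horizontal gamma u1 u2, gamma 0 = g0, gamma 1 = g1 & l = lp_length p u1 u2]].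

Lemma heis_distE g0 g1 : heis_dist p g0 g1 = fine (ereal_inf (lset g0 g1)).
Proof. by []. Qed.

Lemma lp_lengthE u1 u2 : lp_length p u1 u2 = (\int[mu]_(t in `[0%R, 1%R]) (lpn (u1 t) (u2 t))%:E)%E.
Proof. by []. Qed.

Lemma smooth_horizontal (x y z u1 u2 : R -> R) :
  (forall t : R, is_derive t 1 x (u1 t)) -> (forall t : R, is_derive t 1 y (u2 t)) ->
  (forall t : R, is_derive t 1 z (2^-1 * (x t * u2 t - u1 t * y t))) ->
  (forall t, {for t, continuous u1}) -> (forall t, {for t, continuous u2}) ->
  horizontal (fun t => (x t, y t, z t)) u1 u2.
Proof.
move=> dx dy dz c1 c2.
pose w t := 2^-1 * (x t * u2 t - u1 t * y t).
have cw t : {for t, continuous w}.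
  apply: continuousM; first exact: cst_continuous.
  by apply: continuousB; apply: continuousM => //; [exact: dcontinuous (dx t)|exact: dcontinuous (dy t)].
have lip (f df : R -> R) : (forall t : R, is_derive t 1 f (df t)) -> (forall t, {for t, continuous df}) ->
    exists2 K, 0 < K & forall a b, 0 <= a <= 1 -> 0 <= b <= 1 -> `|f b - f a| <= K * `|b - a|.
  move=> dF cF.
  have [|c c01 Hc] := @EVT_max R (fun t => `|df t|) 0 1 ler01.
    apply: continuous_subspaceT => t; apply: continuous_comp; first exact: cF.
    exact: norm_continuous.
  exists (`|df c| + 1); first by rewrite ltr_wpDl.
  move=> a b; wlog ab : a b / a < b => [W a01 b01|a01 b01].
    have [h|h|->] := ltgtP a b; first exact: W.
      by rewrite distrC [X in _ <= _ * X]distrC; exact: W.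
    by rewrite !subrr normr0 mulr0.
  have [e /andP[ae eb] ->] := mvt ab (fun t _ => dcontinuous (dF t)) (fun t _ => dF t).
  rewrite normrM ler_wpM2r//; have := Hc e; rewrite in_itv/= => h.
  by apply: (le_trans (h _)); rewrite ?lerDl//; lra.
have [K1 K10 L1] := lip _ _ dx c1; have [K2 K20 L2] := lip _ _ dy c2.
have [K3 K30 L3] := lip _ _ dz cw.
split.
- apply: (@ac_lip _ _ _ id _ (K1 + K2 + K3)) => //; [lra|exact: ac_id|].
  move=> a b a01 b01; rewrite le_normH /=.
  have n0 : 0 <= `|b - a| by [].
  have := L1 a b a01 b01; have := L2 a b a01 b01; have := L3 a b a01 b01.
  by move=> h3 h2 h1; apply/and3P; split; nra.
- apply: subspace_continuous_measurable_fun => //; apply: continuous_subspaceT => t; exact: c1.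
- apply: subspace_continuous_measurable_fun => //; apply: continuous_subspaceT => t; exact: c2.
- by apply: aeT => t _; apply/field_derivP; split; [exact: dx|exact: dy|exact: dz].
Qed.

Lemma horizontal_lip (Psi : H -> H) (v1 v2 : R -> R -> R) (K : R) (gamma : R -> H) (u1 u2 : R -> R) : 0 < K ->
  (forall g h, `|Psi g - Psi h| <= K * `|g - h|) ->
  (forall (D : set R) (u1 u2 : R -> R), measurable_fun D u1 -> measurable_fun D u2 ->
     measurable_fun D (fun t => v1 (u1 t) (u2 t)) /\ measurable_fun D (fun t => v2 (u1 t) (u2 t))) ->
  (forall (gamma : R -> H) (t a b : R), is_derive t 1 gamma (a *: Xfield (gamma t) + b *: Yfield (gamma t)) ->
    is_derive t 1 (Psi \o gamma)
       (v1 a b *: Xfield (Psi (gamma t)) + v2 a b *: Yfield (Psi (gamma t)))) ->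
  horizontal gamma u1 u2 ->
  horizontal (Psi \o gamma) (fun t => v1 (u1 t) (u2 t)) (fun t => v2 (u1 t) (u2 t)).
Proof.
move=> K0 PK vm vd [ac m1 m2 d].
have [m1' m2'] := vm _ _ _ m1 m2.
split; [by apply: (ac_lip K0 ac) => a b _ _; exact: PK|exact: m1'|exact: m2'|].
by apply: aeS d => t dt t01; apply: vd; exact: dt.
Qed.

Lemma lset_lip (g0 g1 : H) (Psi : H -> H) (v1 v2 : R -> R -> R) :
  (forall gamma u1 u2, horizontal gamma u1 u2 ->
    horizontal (Psi \o gamma) (fun t => v1 (u1 t) (u2 t)) (fun t => v2 (u1 t) (u2 t))) ->
  (forall a b, lpn (v1 a b) (v2 a b) = lpn a b) ->
  lset g0 g1 `<=` lset (Psi g0) (Psi g1).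
Proof.
move=> hP vn l [gamma [u1 [u2 [hg E0 E1 ->]]]].
exists (Psi \o gamma), (fun t => v1 (u1 t) (u2 t)), (fun t => v2 (u1 t) (u2 t)); split.
- exact: hP.
- by rewrite /= E0.
- by rewrite /= E1.
- by rewrite !lp_lengthE; apply: eq_integral => t _; rewrite vn.
Qed.

Definition hinv (g : H) : H := let: (x, y, z) := g in (- x, - y, - z).

Lemma heis_mulA (f g h : H) : heis_mul f (heis_mul g h) = heis_mul (heis_mul f g) h.
Proof.
case: f g h => [[a b] c] [[a' b'] c'] [[a'' b''] c'']; rewrite /heis_mul.
by congr (_, _, _); ring.
Qed.
Lemma heis_mul0 (g : H) : heis_mul g (0, 0, 0) = g.
Proof. by case: g => [[a b] c]; rewrite /heis_mul; congr (_, _, _); ring. Qed.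
Lemma heis_0mul (g : H) : heis_mul (0, 0, 0) g = g.
Proof. by case: g => [[a b] c]; rewrite /heis_mul; congr (_, _, _); ring. Qed.
Lemma heis_mulV (g : H) : heis_mul g (hinv g) = (0, 0, 0).
Proof. by case: g => [[a b] c]; rewrite /heis_mul; congr (_, _, _); ring. Qed.
Lemma heis_Vmul (g : H) : heis_mul (hinv g) g = (0, 0, 0).
Proof. by case: g => [[a b] c]; rewrite /heis_mul; congr (_, _, _); ring. Qed.

Lemma horizontal_left (h : H) gamma u1 u2 : horizontal gamma u1 u2 ->
  horizontal (heis_mul h \o gamma) u1 u2.
Proof.
case: h => [[a b] c]; pose K := 1 + `|a| + `|b|.
have K0 : 0 < K by rewrite /K; have := normr_ge0 a; have := normr_ge0 b; lra.
apply: (@horizontal_lip (heis_mul (a, b, c)) (fun x _ => x) (fun _ y => y) K gamma u1 u2 K0).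
- move=> [[x y] z] [[x' y'] z'] /=; rewrite /heis_mul le_normH /=.
  have : `|((x, y, z) : H) - (x', y', z')| <= `|((x, y, z) : H) - (x', y', z')| by [].
  rewrite {1}le_normH/=; set n := `|((x, y, z) : H) - (x', y', z')| => /and3P[h1 h2 h3].
  have n0 : 0 <= n by exact: le_trans h1.
  have a0 := normr_ge0 a; have b0 := normr_ge0 b.
  apply/and3P; split.
  + by rewrite opprD addrACA subrr add0r; apply: (le_trans h1); rewrite /K; nra.
  + by rewrite opprD addrACA subrr add0r; apply: (le_trans h2); rewrite /K; nra.
  + have -> : c + z + 2^-1 * (a * y - x * b) - (c + z' + 2^-1 * (a * y' - x' * b)) =
        (z - z') + 2^-1 * (a * (y - y') - b * (x - x')) by ring.
    apply: (le_trans (ler_normD _ _)); rewrite normrM ger0_norm ?invr_ge0//.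
    have := ler_normB (a * (y - y')) (b * (x - x')); rewrite !normrM => h4.
    have : `|a| * `|y - y'| <= `|a| * n by rewrite ler_wpM2l.
    have : `|b| * `|x - x'| <= `|b| * n by rewrite ler_wpM2l.
    have : 0 <= `|a| * n by rewrite mulr_ge0.
    have : 0 <= `|b| * n by rewrite mulr_ge0.
    by rewrite /K; lra.
- by [].
- move=> {}gamma t u v /field_derivP[d1 d2 d3]; apply/field_derivP.
  have -> : heis_mul (a, b, c) \o gamma = fun s => (a + (gamma s).1.1, b + (gamma s).1.2,
      c + (gamma s).2 + 2^-1 * (a * (gamma s).1.2 - (gamma s).1.1 * b)) :> H.
    by apply/funext => s; rewrite /heis_mul/=; case: (gamma s) => [[]].
  split => /=.
  + by apply: (dEq (dD (dcst t a) d1)); ring.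
  + by apply: (dEq (dD (dcst t b) d2)); ring.
  + apply: (dEq (dD (dD (dcst t c) d3) (dZ _ (dB (dZ a d2) (dM d1 (dcst t b)))))).
    by ring.
Qed.

Lemma lset_left_sub (h g0 g1 : H) : lset g0 g1 `<=` lset (heis_mul h g0) (heis_mul h g1).
Proof.
apply: (@lset_lip g0 g1 (heis_mul h) (fun x _ => x) (fun _ y => y)) => //.
by move=> gamma u1 u2; exact: horizontal_left.
Qed.

Lemma dist_left (h g0 g1 : H) : heis_dist p (heis_mul h g0) (heis_mul h g1) = heis_dist p g0 g1.
Proof.
rewrite !heis_distE; congr (fine (ereal_inf _)); apply/seteqP; split; last exact: lset_left_sub.
have := @lset_left_sub (hinv h) (heis_mul h g0) (heis_mul h g1).
by rewrite !heis_mulA heis_Vmul !heis_0mul.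
Qed.

Definition hmir (g : H) : H := let: (x, y, z) := g in (x, - y, - z).
Definition hrot (g : H) : H := let: (x, y, z) := g in (- y, x, z).

Lemma horizontal_mir gamma u1 u2 : horizontal gamma u1 u2 ->
  horizontal (hmir \o gamma) u1 (fun t => - u2 t).
Proof.
apply: (@horizontal_lip hmir (fun x _ => x) (fun _ y => - y) 1 gamma u1 u2 ltr01).
- move=> [[x y] z] [[x' y'] z'] /=; rewrite mul1r !normH/=.
  by rewrite -!opprD !normrN.
- by move=> D a b m1 m2; split=> //; exact: measurableT_comp.
- move=> {}gamma t u v /field_derivP[d1 d2 d3]; apply/field_derivP.
  have -> : hmir \o gamma = fun s => ((gamma s).1.1, - (gamma s).1.2, - (gamma s).2) :> H.
    by apply/funext => s /=; case: (gamma s) => [[]].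
  split => /=; [exact: d1|exact: dN|].
  by apply: (dEq (dN d3)); ring.
Qed.

Lemma lset_mir_sub g0 g1 : lset g0 g1 `<=` lset (hmir g0) (hmir g1).
Proof.
apply: (@lset_lip g0 g1 hmir (fun x _ => x) (fun _ y => - y)).
  by move=> gamma u1 u2; exact: horizontal_mir.
by move=> a b; rewrite /lpn normrN.
Qed.

Lemma dist_mir g0 g1 : heis_dist p (hmir g0) (hmir g1) = heis_dist p g0 g1.
Proof.
rewrite !heis_distE; congr (fine (ereal_inf _)); apply/seteqP; split; last exact: lset_mir_sub.
have := @lset_mir_sub (hmir g0) (hmir g1).
by case: g0 g1 => [[a b] c] [[a' b'] c'] /=; rewrite !opprK.
Qed.

Lemma horizontal_rot gamma u1 u2 : horizontal gamma u1 u2 ->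
  horizontal (hrot \o gamma) (fun t => - u2 t) u1.
Proof.
apply: (@horizontal_lip hrot (fun _ y => - y) (fun x _ => x) 1 gamma u1 u2 ltr01).
- move=> [[x y] z] [[x' y'] z'] /=; rewrite mul1r !normH/=.
  by rewrite -!opprD !normrN [Num.max `|y - _| _]maxC.
- by move=> D a b m1 m2; split=> //; exact: measurableT_comp.
- move=> {}gamma t u v /field_derivP[d1 d2 d3]; apply/field_derivP.
  have -> : hrot \o gamma = fun s => (- (gamma s).1.2, (gamma s).1.1, (gamma s).2) :> H.
    by apply/funext => s /=; case: (gamma s) => [[]].
  split => /=; [exact: dN|exact: d1|].
  by apply: (dEq d3); ring.
Qed.

End HorizontalCurves.

(** * Concatenation of curves and finiteness of the distance *)

Section Concatenation.
Context {R : realType}.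
Local Notation H := (R * R * R)%type.
Local Notation mu := (@lebesgue_measure R).
Variable p : R.
Hypothesis p0 : 0 < p.

Let glue_derive (gamma gamma1 : R -> H) (t c b u1 u2 : R) (d : R) : 0 < d ->
  (forall s, `|s - t| < d -> gamma s = gamma1 (c * s + b)) ->
  is_derive (c * t + b) 1 gamma1
    (u1 *: Xfield (gamma1 (c * t + b)) + u2 *: Yfield (gamma1 (c * t + b))) ->
  is_derive t 1 gamma ((c * u1) *: Xfield (gamma t) + (c * u2) *: Yfield (gamma t)).
Proof.
move=> d0 E /field_derivP[d1 d2 d3].
have dG : is_derive t 1 (fun s => c * s + b) c.
  by apply: (dEq (dD (dZ c (did t)) (dcst t b))); ring.
have near (f : H -> R) a : is_derive (c * t + b) 1 (fun s => f (gamma1 s)) a ->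
    is_derive t 1 (fun s => f (gamma s)) (a * c).
  move=> h; have h' := @dcomp R (fun s => f (gamma1 s)) (fun s => c * s + b) t _ _ h dG.
  by apply: (dnear h'); exists d => // y yt; rewrite E.
apply/field_derivP; split.
- by apply: (dEq (near (fun g => g.1.1) _ d1)); ring.
- by apply: (dEq (near (fun g => g.1.2) _ d2)); ring.
- apply: (dEq (near (fun g => g.2) _ d3)); rewrite E ?subrr ?normr0//; ring.
Qed.

Let negligible_point (c : R) : mu.-negligible [set t : R | t = c].
Proof. by exists [set c]; split; [exact: measurable_set1|exact: lebesgue_measure_set1|]. Qed.

Let half_gt0 : (0 : R) < 2^-1. Proof. by rewrite invr_gt0. Qed.
Let half_le1 : 2^-1 <= (1 : R). Proof. by rewrite invf_le1// ler1n. Qed.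
Let half_lt1 : 2^-1 < (1 : R). Proof. by rewrite invf_lt1// ltr1n. Qed.
Let half_eq0 : 2 * (2^-1 - 0) = (1 : R). Proof. by rewrite subr0 divff. Qed.
Let half_eq1 : 2 * (1 - 2^-1) = (1 : R). Proof. by field. Qed.
Let split01 : `[0%R, 1%R]%classic = `[0%R, 2^-1[%classic `|` `[2^-1, 1%R]%classic :> set R.
Proof. by rewrite -itv_bndbnd_setU// bnd_simp. Qed.

Let scaled_measurable (a : R -> R) (c : R) : measurable_fun setT a ->
  measurable_fun setT (fun t : R => 2 * a (2 * t - c)).
Proof.
move=> ma.
have maff : measurable_fun setT (fun t : R => 2 * t - c).
  by apply: measurable_funB; [apply: measurable_funM; [exact: measurable_cst|exact: measurable_id]|exact: measurable_cst].
exact: (measurable_funM (@measurable_cst _ _ _ _ setT (2 : R)) (measurableT_comp ma maff)).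
Qed.

Let half_length (c b : R) (u1 u2 : R -> R) : measurable_fun setT u1 -> measurable_fun setT u2 ->
  c < b -> 2 * (b - c) = 1 ->
  (\int[mu]_(t in `[c, b]) (lpn p (2 * u1 (2 * t - 2 * c)) (2 * u2 (2 * t - 2 * c)))%:E =
   lp_length p u1 u2)%E.
Proof.
move=> m1 m2 cb bc; rewrite lp_lengthE.
have dG (x : R) : is_derive x 1 (fun t => 2 * t - 2 * c) 2.
  by apply: (dEq (dB (dZ 2 (did x)) (dcst x (2 * c)))); ring.
have := @subst_compact R (fun t => 2 * t - 2 * c) (fun=> 2) c b
  (fun t => (lpn p (u1 t) (u2 t))%:E) cb.
have -> : 2 * c - 2 * c = 0 by ring.
have -> : 2 * b - 2 * c = 1 by lra.
move=> -> //.
- by apply: eq_integral => t _; rewrite lpnM// EFinM muleC.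
- by move=> x _; exact: cst_continuous.
- by move=> y; rewrite lee_fin lpn_ge0.
- by apply/measurable_EFinP; exact: measurable_lpn.
Qed.

Lemma horizontal_cat (gam1 gam2 : R -> H) u1' u2' w1' w2' :
  horizontal gam1 u1' u2' -> horizontal gam2 w1' w2' -> gam1 1 = gam2 0 ->
  exists gam v1 v2, [/\ horizontal gam v1 v2,
    forall t, t < 2^-1 -> gam t = gam1 (2 * t), forall t, 2^-1 <= t -> gam t = gam2 (2 * t - 1) &
    lp_length p v1 v2 = (lp_length p u1' u2' + lp_length p w1' w2')%E].
Proof.
move=> /(horizontal_restrict p)[u1 [u2 [[ac1 _ _ d1] mu1 mu2 Lu]]].
move=> /(horizontal_restrict p)[w1 [w2 [[ac2 _ _ d2] mw1 mw2 Lw]]] E12.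
rewrite Lu Lw.
pose m1 t : R := Num.min (2 * t) 1; pose m2 t : R := Num.max (2 * t - 1) 0.
(* A sum of two clamped curves instead of a case distinction: absolute continuity is then inherited
   from the summands. *)
pose gam t := gam1 (m1 t) + gam2 (m2 t) - gam1 1.
(* The shifts [2 * 0] and [2 * 2^-1] are left unevaluated so that both halves are instances of
   [half_length]. *)
pose glue (a b : R -> R) (t : R) := if t < 2^-1 then 2 * a (2 * t - 2 * 0) else 2 * b (2 * t - 2 * 2^-1).
have mglue a b : measurable_fun setT a -> measurable_fun setT b -> measurable_fun setT (glue a b).
  move=> ma mb; apply: measurable_fun_ifT.
  - by apply: measurable_fun_ltr; [exact: measurable_id|exact: measurable_cst].
  - exact: scaled_measurable.
  - exact: scaled_measurable.
have gam_lt t : t < 2^-1 -> gam t = gam1 (2 * t + 0).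
  move=> t2; rewrite /gam /m1 /m2 min_l ?max_r; [|lra|lra].
  by rewrite -E12 addr0 addrK.
have gam_ge t : 2^-1 <= t -> gam t = gam2 (2 * t + -1).
  move=> t2; rewrite /gam /m1 /m2 min_r ?max_l; [|lra|lra].
  by rewrite addrAC subrr add0r.
exists gam, (glue u1 w1), (glue u2 w2); split.
- split.
  + have acm1 : abs_continuous01 (fun t => gam1 (m1 t)).
      apply: ac_comp ac1 _ _ _.
      * by move=> x y xy; rewrite /m1 le_min !ge_min lexx orbT andbT; apply/orP; left; lra.
      * by move=> x x01; rewrite /m1 le_min ge_min lexx orbT; lra.
      * by clear -mglue gam_ge; move=> x y xy; rewrite /m1; case: (leP (2 * x) 1); case: (leP (2 * y) 1); lra.
    have acm2 : abs_continuous01 (fun t => gam2 (m2 t)).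
      apply: ac_comp ac2 _ _ _.
      * by move=> x y xy; rewrite /m2 ge_max !le_max lexx orbT andbT; apply/orP; left; lra.
      * by move=> x x01; rewrite /m2 ge_max le_max lexx orbT; lra.
      * by clear -mglue gam_ge; move=> x y xy; rewrite /m2; case: (leP (2 * x - 1) 0); case: (leP (2 * y - 1) 0); lra.
    apply: (@ac_lip R H H _ gam 1 ltr01 (acD acm1 acm2)) => a b _ _.
    by rewrite mul1r /gam opprD opprK addrACA addNr addr0.
  + exact: (measurable_funTS (mglue _ _ mu1 mw1)).
  + exact: (measurable_funTS (mglue _ _ mu2 mw2)).
  (* The exceptional times are the junction and the rescaled exceptional times of the two curves. *)
  + have n1 := negligible_point 2^-1.
    have n2 := @negligible_affine R 2 0 _ ltac:(lra) d1.
    have n3 := @negligible_affine R 2 (-1) _ ltac:(lra) d2.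
    apply: negligibleS (negligibleU n1 (negligibleU n2 n3)) => t /= nt.
    have [|tn2] := eqVneq t 2^-1; [by left|right].
    apply: contrapT => /not_orP[/contrapT h1 /contrapT h2]; apply: nt => t01.
    have [t2|t2] := ltP t 2^-1.
      rewrite /glue t2 (_ : 2 * t - 2 * 0 = 2 * t + 0); last ring.
      apply: (@glue_derive gam gam1 t 2 0 _ _ (2^-1 - t)); first lra.
        by clear -gam_lt n2; move=> s; rewrite ltr_norml => st; apply: gam_lt; lra.
      by apply: h1; lra.
    have {}t2 : 2^-1 < t by rewrite lt_neqAle eq_sym tn2.
    rewrite /glue ltNge (ltW t2)/= (_ : 2 * t - 2 * 2^-1 = 2 * t + -1); last by field.
    apply: (@glue_derive gam gam2 t 2 (-1) _ _ (t - 2^-1)); first lra.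
      by clear -gam_ge n2; move=> s; rewrite ltr_norml => st; apply: gam_ge; lra.
    by apply: h2; lra.
- by move=> t ht; rewrite (gam_lt _ ht) addr0.
- by move=> t ht; rewrite (gam_ge _ ht).
- apply: esym; rewrite [RHS]lp_lengthE.
  have mL (D : set R) : measurable_fun D (fun t => (lpn p (glue u1 w1 t) (glue u2 w2 t))%:E).
    by apply: measurable_funTS; apply/measurable_EFinP; exact: (measurable_lpn _ (mglue _ _ mu1 mw1) (mglue _ _ mu2 mw2)).
  rewrite split01.
  have L0 t : (0 <= (lpn p (glue u1 w1 t) (glue u2 w2 t))%:E)%E by rewrite lee_fin lpn_ge0.
  rewrite (@ge0_integral_setU _ _ _ mu _ _ (measurable_itv _) (measurable_itv _) _ (mL _)); last 2 first.
  - by move=> x _; exact: L0.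
  - by apply/disj_setPS => x /= []; rewrite !in_itv/= => /andP[_ h1] /andP[h2 _]; move: h1; rewrite ltNge h2.
  have A1 : lp_length p u1 u2 = (\int[mu]_(x in `[0%R, 2^-1%R[) (lpn p (glue u1 w1 x) (glue u2 w2 x))%:E)%E.
    rewrite -(half_length mu1 mu2 half_gt0 (half_eq0)).
    have mR : measurable_fun (`[0, 2^-1[%classic : set R) (fun t : R => (lpn p (2 * u1 (2 * t - 2 * 0)) (2 * u2 (2 * t - 2 * 0)))%:E).
      by apply/measurable_EFinP; apply: measurable_funTS; exact: (measurable_lpn _ (scaled_measurable _ mu1) (scaled_measurable _ mu2)).
    apply: (etrans (esym (integral_itv_bndo_bndc mR))).
    by apply: eq_integral => t; rewrite inE/= in_itv/= /glue => /andP[_ ->].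
  have A2 : lp_length p w1 w2 = (\int[mu]_(x in `[2^-1%R, 1%R]) (lpn p (glue u1 w1 x) (glue u2 w2 x))%:E)%E.
    rewrite -(half_length mw1 mw2 half_lt1 half_eq1).
    by apply: eq_integral => t; rewrite inE/= in_itv/= /glue leNgt => /andP[/negbTE -> _].
  by rewrite A1 A2.
Qed.

Lemma lset_cat (g0 g1 g2 : H) l1 l2 : lset p g0 g1 l1 -> lset p g1 g2 l2 ->
  lset p g0 g2 (l1 + l2)%E.
Proof.
move=> [gam1 [u1 [u2 [h1 E0 E1 ->]]]] [gam2 [w1 [w2 [h2 F0 F1 ->]]]].
have [|gam [v1 [v2 [hg glt gge <-]]]] := horizontal_cat h1 h2; first by rewrite E1 F0.
exists gam, v1, v2; split => //.
- by rewrite (glt _ half_gt0) mulr0.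
- by rewrite (gge _ half_le1) mulr1 (_ : 2 - 1 = 1)//; ring.
Qed.

Lemma lp_length_cst (u1 u2 : R -> R) (c : R) : 0 <= c ->
  (forall t, 0 <= t <= 1 -> lpn p (u1 t) (u2 t) = c) -> lp_length p u1 u2 = c%:E.
Proof.
move=> c0 uc; rewrite lp_lengthE (eq_integral (fun=> c%:E)).
  transitivity (c%:E * mu `[0%R, 1%R]%classic)%E; first exact: integral_cst.
  by rewrite lebesgue_measure_itv/= lte_fin ltr01 -EFinB subr0 mule1.
by move=> t; rewrite inE/= in_itv/= => t01; rewrite uc.
Qed.

Let reach g := exists2 l, lset p (0, 0, 0) g l & (l < +oo)%E.

Let reach_line a b : reach (a, b, 0).
Proof.
exists (lpn p a b)%:E; last exact: ltry.
exists (fun t => (t * a, t * b, 0)), (fun=> a), (fun=> b); split.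
- apply: (@smooth_horizontal R (fun t => t * a) (fun t => t * b) (fun=> 0) (fun=> a) (fun=> b)).
  + by move=> t; apply: (dEq (dM (did t) (dcst t a))); ring.
  + by move=> t; apply: (dEq (dM (did t) (dcst t b))); ring.
  + by move=> t; apply: (dEq (dcst t 0)); ring.
  + by move=> t; exact: cst_continuous.
  + by move=> t; exact: cst_continuous.
- by rewrite !mul0r.
- by rewrite !mul1r.
- by rewrite (@lp_length_cst _ _ (lpn p a b))// lpn_ge0.
Qed.

Let reach_mul g h : reach g -> reach h -> reach (heis_mul g h).
Proof.
move=> [l lg loo] [l' lh l'oo]; exists (l + l')%E; last by rewrite lte_add_pinfty.
apply: (lset_cat lg); have := @lset_left_sub R p g _ _ _ lh; rewrite heis_mul0; exact.
Qed.

Let reach_all g : reach g.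
Proof.
case: g => [[x y] z].
(* The last four factors form the commutator of (z, 0, 0) and (0, 1, 0), which is (0, 0, z). *)
have -> : (x, y, z) = heis_mul (heis_mul (x, y, 0) (heis_mul (z, 0, 0) (0, 1, 0)))
    (heis_mul (- z, 0, 0) (0, -1, 0)).
  by rewrite /heis_mul; congr (_, _, _); field.
by do !apply: reach_mul => //; exact: reach_line.
Qed.

Lemma lset_ge0 g0 g1 l : lset p g0 g1 l -> (0 <= l)%E.
Proof.
move=> [? [u1 [u2 [_ _ _ ->]]]]; apply: integral_ge0 => t _; rewrite lee_fin; exact: powR_ge0.
Qed.

Lemma einf_fin g0 g1 : ereal_inf (lset p g0 g1) \is a fin_num.
Proof.
rewrite ge0_fin_numE; last by apply: le_ereal_inf_tmp => l /lset_ge0.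
have [l lg loo] := reach_all (heis_mul (hinv g0) g1).
apply: le_lt_trans loo; apply: ereal_inf_lbound.
have := @lset_left_sub R p g0 _ _ _ lg; rewrite heis_mulA heis_mulV heis_mul0 heis_0mul; exact.
Qed.

Lemma dist_ge0 g0 g1 : 0 <= heis_dist p g0 g1.
Proof. by rewrite heis_distE fine_ge0//; apply: le_ereal_inf_tmp => l /lset_ge0. Qed.

Lemma dist_le g0 g1 l : lset p g0 g1 l%:E -> heis_dist p g0 g1 <= l.
Proof.
move=> lg; rewrite heis_distE -lee_fin fineK ?einf_fin//; exact: ereal_inf_lbound.
Qed.

Lemma dist_ge g0 g1 c : (forall l, lset p g0 g1 l -> (c%:E <= l)%E) -> c <= heis_dist p g0 g1.
Proof.
move=> H; rewrite heis_distE -lee_fin fineK ?einf_fin//.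
by apply: le_ereal_inf_tmp => l /H.
Qed.

Lemma dist_triangle g0 g1 g2 : heis_dist p g0 g2 <= heis_dist p g0 g1 + heis_dist p g1 g2.
Proof.
apply/ler_addgt0Pr => e e0; have e20 : 0 < e / 2 by rewrite divr_gt0.
have [l1 lg1 h1] := lb_ereal_inf_adherent e20 (einf_fin g0 g1).
have [l2 lg2 h2] := lb_ereal_inf_adherent e20 (einf_fin g1 g2).
rewrite -lee_fin heis_distE fineK ?einf_fin//.
apply: (le_trans (ereal_inf_lbound (lset_cat lg1 lg2))).
apply: (le_trans (leeD (ltW h1) (ltW h2))).
rewrite !heis_distE -[X in (X + _)%E]fineK ?fin_numD ?einf_fin//.
rewrite -[X in (_ + X)%E]fineK ?fin_numD ?einf_fin//.
rewrite !fineD ?einf_fin//= -EFinD lee_fin; lra.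
Qed.

End Concatenation.

(** * The isoperimetric inequality *)

Section Isoperimetric.
Context {R : realType}.
Local Notation H := (R * R * R)%type.
Local Notation mu := (@lebesgue_measure R).
Variables (p q : R).
Hypotheses (p1 : 1 < p) (q1 : 1 < q) (pq : p^-1 + q^-1 = 1).
Local Notation C := (eC q).
Local Notation S := (eS q).
Local Notation Pi := (Piq q).
Let p0 : 0 < p. Proof. exact: lt_trans ltr01 p1. Qed.
Let q0 : 0 < q. Proof. exact: lt_trans ltr01 q1. Qed.
Let q10 : 0 < q - 1. Proof. by rewrite subr_gt0. Qed.

Lemma conj_mul : (q - 1) * p = q.
Proof.
have E : q + p = p * q.
  by rewrite -[RHS]mul1r -pq; field; rewrite !gt_eqF.
by rewrite mulrBl mul1r mulrC -E addrK.
Qed.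

Lemma conj_mul2 : (p - 1) * q = p.
Proof.
have E : q + p = p * q.
  by rewrite -[RHS]mul1r -pq; field; rewrite !gt_eqF.
by rewrite mulrBl mul1r -E addrAC subrr add0r.
Qed.

Lemma conj_mul3 : (p - 1) * (q - 1) = 1.
Proof. by rewrite mulrBr conj_mul2; ring. Qed.

Lemma lpn_unit f : lpn p (- sp (q - 1) (S f)) (sp (q - 1) (C f)) = 1.
Proof.
have qn : q - 1 != 0 by rewrite gt_eqF.
by rewrite /lpn normrN !abs_sp// -!powRrM conj_mul addrC e_norm// powR1.
Qed.

Lemma lpn_vel l f : 0 <= l -> lpn p (- (l * sp (q - 1) (S f))) (l * sp (q - 1) (C f)) = l.
Proof. by move=> l0; rewrite -mulrN lpnM// lpn_unit mulr1. Qed.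

(** Dividing (a, b) by its norm and applying [sp (p - 1)], the inverse of [sp (q - 1)], gives after
    a quarter turn a point of the l^q circle, which [e_surj] parametrises. *)
Lemma vel_exists (a b : R) : exists f, [/\ - Pi <= f <= Pi, a = - (lpn p a b * sp (q - 1) (S f)) &
  b = lpn p a b * sp (q - 1) (C f)].
Proof.
have [l0|l0] := eqVneq (lpn p a b) 0.
  by have [a0 b0] := lpn_eq0 l0; exists 0; rewrite l0 a0 b0 !mul0r oppr0; split => //; rewrite oppr_le0 (ltW (Piq_gt0 q1)).
have lgt : 0 < lpn p a b by rewrite lt_neqAle eq_sym l0 lpn_ge0.
set l := lpn p a b in l0 lgt *.
have p10 : p - 1 != 0 by rewrite gt_eqF// subr_gt0.
have lE : `|a / l| `^ p + `|b / l| `^ p = 1.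
  rewrite !normrM (gtr0_norm (_ : 0 < l^-1)) ?invr_gt0// !powRM ?invr_ge0 ?(ltW lgt)//.
  rewrite -mulrDl -(powR_inv1 (ltW lgt)) -powRrM mulN1r powRN /l /lpn -powRrM mulVf ?gt_eqF//.
  by rewrite powRr1 ?addr_ge0 ?powR_ge0// divff//; apply: contra_neq l0 => e; rewrite /l /lpn e powR0// invr_neq0// gt_eqF.
have [|f [fPi Cf Sf]] := @e_surj R q q1 (sp (p - 1) (b / l)) (sp (p - 1) (- (a / l))).
  by rewrite !abs_sp// -!powRrM conj_mul2 normrN addrC.
exists f; rewrite Cf Sf !sp_sp// conj_mul3 !sp1 mulrN opprK.
by split => //; rewrite mulrC divfK.
Qed.

Lemma hoelder_lpn X Y a b : `|X| `^ q + `|Y| `^ q = 1 -> X * b - Y * a <= lpn p a b.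
Proof.
move=> XY; have [f [_ Ea Eb]] := vel_exists a b; set l := lpn p a b in Ea Eb *.
have l0 : 0 <= l by exact: lpn_ge0.
rewrite Ea Eb; have := dual_le q1 f XY; rewrite -subr_ge0 => /(mulr_ge0 l0); lra.
Qed.

(* The half unit circle as a graph over the x-axis, extended by 0 outside [-1, 1]. *)
Definition arcY (x : R) : R := (Num.max 0 (1 - `|x| `^ q)) `^ q^-1.

Lemma arcY_ge0 x : 0 <= arcY x. Proof. exact: powR_ge0. Qed.

Lemma arcY_norm x : `|x| <= 1 -> `|x| `^ q + `|arcY x| `^ q = 1.
Proof.
move=> x1; have xq : `|x| `^ q <= 1.
  rewrite -[leRHS](_ : 1 `^ q = 1); last by rewrite powR1.
  by apply: ge0_ler_powR; rewrite ?nnegrE ?(ltW q0).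
rewrite (ger0_norm (arcY_ge0 x)) /arcY -powRrM mulVf ?gt_eqF// powRr1 ?le_max ?lexx//.
by rewrite max_r ?subrKC// subr_ge0.
Qed.

Lemma arcY_S f : 0 < f < Pi -> arcY (C f) = S f.
Proof.
move=> f0; have S0 : 0 < S f by exact: eS_gt0.
rewrite /arcY -(e_norm q1 f) addrAC subrr add0r max_r ?powR_ge0// -powRrM divff ?gt_eqF//.
by rewrite powRr1// gtr0_norm.
Qed.

Lemma continuous_arcY x : {for x, continuous arcY}.
Proof.
have c1 : {for x, continuous (fun x => Num.max 0 (1 - `|x| `^ q))}.
  apply: (@continuous_max _ _ (fun=> 0) (fun x => 1 - `|x| `^ q)); first exact: cst_continuous.
  by apply: continuousB; [exact: cst_continuous|exact: continuous_abs_powR].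
have E : arcY = (fun y => `|y| `^ q^-1) \o (fun x => Num.max 0 (1 - `|x| `^ q)).
  by apply/funext => y; rewrite /= ger0_norm// le_max lexx.
rewrite E; apply: continuous_comp; first exact: c1.
by apply: continuous_abs_powR; rewrite invr_gt0.
Qed.

Definition arcG : R -> R :=
  xget (fun=> 0) [set F : R -> R | forall x : R, is_derive x 1 F (arcY x)].

Lemma arcG_derive (x : R) : is_derive x 1 arcG (arcY x).
Proof.
rewrite /arcG; case: xgetP => [F _ HF //|H].
by have [F [_ HF]] := primitive_exists continuous_arcY; case: (H F HF).
Qed.

(** The area of the half disc under the graph [arcY], expressed by [Pi]. *)
Lemma arcG_half : arcG 1 - arcG (-1) = Pi / 2.
Proof.
(* Area to the left of the vertical line through e(f), up to a constant, plus the sector and minus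
   the triangle at the origin; the sum is constant on the upper half circle. *)
pose h f := arcG (C f) + (f - C f * S f) / 2.
have dh (f : R) : 0 < f < Pi -> is_derive f 1 h 0.
  move=> f0; have d1 := @dcomp R arcG C f _ _ (arcG_derive (C f)) (eC_derive q1 f).
  have d2 := dM (dB (did f) (dM (eC_derive q1 f) (eS_derive q1 f))) (dcst f 2^-1).
  apply: (dEq (dD d1 d2)); rewrite arcY_S//.
  have := e_norm q1 f; rewrite -!mul_sp// => E.
  transitivity (2^-1 * (1 - (C f * sp (q - 1) (C f) + S f * sp (q - 1) (S f)))); first by field.
  by rewrite E subrr mulr0.
have ch f : {for f, continuous h}.
  apply: continuousD.
    apply: continuous_comp; first exact: dcontinuous (eC_derive q1 f).
    exact: dcontinuous (arcG_derive _).
  apply: dcontinuous (dM (dB (did f) (dM (eC_derive q1 f) (eS_derive q1 f))) (dcst f 2^-1)).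
have [c _] := mvt (Piq_gt0 q1) (fun f _ => ch f) dh.
rewrite mul0r /h; have := eCDPi q1 0; have := eSDPi q1 0.
rewrite add0r eC0// eS0// oppr0 => -> ->; lra.
Qed.

(** The primitive of the speed extended by 0. It is monotone, and Lebesgue's differentiation theorem
    gives its derivative almost everywhere; this is all that [ac_le] asks of it. *)
Lemma speed_primitive (gam : R -> H) u1 u2 L : horizontal gam u1 u2 ->
  lp_length p u1 u2 = L%:E -> exists P : R -> R,
  [/\ forall x y, x <= y -> P x <= P y, P 1 - P 0 <= L &
   {ae mu, forall t : R, 0 <= t <= 1 -> exists a b,
     is_derive t 1 gam (a *: Xfield (gam t) + b *: Yfield (gam t)) /\
     is_derive t 1 P (lpn p a b)}].
Proof.
move=> hg hL; have [v1 [v2 [[_ _ _ hv] mv1 mv2 lv]]] := horizontal_restrict p hg.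
rewrite hL lp_lengthE in lv.
pose w := (fun t => lpn p (v1 t) (v2 t)) \_ `[0, 1].
have w0 t : 0 <= w t by rewrite /w patchE; case: ifP => // _; exact: lpn_ge0.
have mw : measurable_fun setT w.
  apply/(measurable_restrictT _ (measurable_itv _)).
  by apply: measurable_funS (measurable_lpn p mv1 mv2).
have Iw : (\int[mu]_t (w t)%:E = L%:E)%E.
  rewrite lv [RHS]integral_mkcond; apply: eq_integral => t _.
  by rewrite restrict_EFin.
have iw : mu.-integrable setT (EFin \o w).
  apply/integrableP; split; first exact/measurable_EFinP.
  under eq_integral do rewrite /= ger0_norm//.
  by rewrite Iw ltry.
have iwy y : mu.-integrable `]-oo, y] (EFin \o w) by exact: integrableS iw.
have li : locally_integrable setT w by apply: open_integrable_locally => //; exact: openT.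
pose P x := (\int[mu]_(t in `]-oo, x]) w t)%R; exists P; split.
- move=> x y xy; rewrite /P /Rintegral; apply: fine_le.
  + exact: integrable_fin_num.
  + exact: integrable_fin_num.
  + apply: ge0_subset_integral => //; last by move=> t /=; rewrite !in_itv/= => /le_trans; apply.
    by apply: measurable_funTS; exact/measurable_EFinP.
  by move=> t _; rewrite lee_fin.
- have P0 : 0 <= P 0 by apply: Rintegral_ge0.
  suff : P 1 <= L by lra.
  rewrite -lee_fin /P /Rintegral fineK; last exact: integrable_fin_num.
  rewrite -Iw; apply: ge0_subset_integral => //; first exact/measurable_EFinP.
  by move=> t _; rewrite lee_fin.
- have := FTC1Ny iwy li; move: hv; apply: (@filterS2 _ _ (ae_filter_ringOfSetsType mu)) => t h1 h2 t01.
  exists (v1 t), (v2 t); split; first exact: h1.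
  have [dP dPE] := h2; apply: DeriveDef => //; rewrite -derive1E dPE /w patchE mem_set//.
Qed.

Lemma ac_extrema (f : R -> R) : abs_continuous01 f ->
  exists t0 t1, [/\ 0 <= t0 <= 1, 0 <= t1 <= 1 &
    forall t, 0 <= t <= 1 -> f t0 <= f t <= f t1].
Proof.
(* Nothing is known outside [0, 1], so the extreme value theorem is applied after clamping the
   argument to [0, 1]. *)
move=> acf; pose c (t : R) := Num.max 0 (Num.min 1 t).
have c01 t : 0 <= c t <= 1 by rewrite /c le_max lexx ge_max ler01 ge_min lexx.
have cE t : 0 <= t <= 1 -> c t = t by move=> /andP[t0 t1]; rewrite /c min_r// max_r.
have cd s t : `|c s - c t| <= `|s - t|.
  have := ler_norm (s - t); have := ler_norm (- (s - t)); rewrite normrN.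
  by rewrite /c; have [?|?] := leP 1 s; have [?|?] := leP 1 t; rewrite ?(max_r (@ler01 R));
    try (have [?|?] := leP 0 s); try (have [?|?] := leP 0 t); rewrite ler_norml => ? ?;
    apply/andP; lra.
have cf : continuous (f \o c).
  move=> x; apply/cts_epsP => e e0.
  have [d d0 H1] := ac_continuous x acf e0; exists d => // y yx; apply: ltW; apply: H1 => //.
  exact: le_lt_trans (cd _ _) yx.
have ws := @continuous_subspaceT R R `[0, 1] (f \o c) cf.
have [t1 t1I H1] := EVT_max ler01 ws; have [t0 t0I H0] := EVT_min ler01 ws.
rewrite in_itv/= in t1I; rewrite in_itv/= in t0I.
exists t0, t1; split => // t tI; have := H1 t; have := H0 t.
by rewrite /= in_itv/= tI !cE// => -> // ->.
Qed.

Definition speed_bound (gam : R -> H) (P : R -> R) :=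
  [/\ abs_continuous01 gam, forall x y, x <= y -> P x <= P y &
   {ae mu, forall t : R, 0 <= t <= 1 -> exists a b,
     is_derive t 1 gam (a *: Xfield (gam t) + b *: Yfield (gam t)) /\
     is_derive t 1 P (lpn p a b)}].

(** Schmidt's comparison function. Along a horizontal curve the differential of z + x y / 2 is x dy,
    so that of [calib] is (x - m) dy - e Y dx, where (x - m, e Y) lies on the l^q circle of radius
    r; the sign [e] selects the upper or the lower half. *)
Definition calib (m r e : R) (g : H) : R :=
  g.2 + g.1.1 * g.1.2 / 2 - m * g.1.2 - e * (r ^+ 2 * arcG ((g.1.1 - m) / r)).

Lemma arcG_lip x y : `|arcG x - arcG y| <= `|x - y|.
Proof.
wlog xy : x y / y < x => [H0|].
  have [|/H0//|->] := ltgtP x y; last by rewrite !subrr.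
  by move=> /H0; rewrite distrC [leRHS]distrC.
have [c _ ->] := mvt xy (fun x _ => dcontinuous (arcG_derive x)) (fun x _ => arcG_derive x).
rewrite normrM ler_piMl// ger0_norm ?arcY_ge0//.
have E1 : 1 `^ q^-1 = 1 :> R by rewrite powR1.
rewrite /arcY -[leRHS]E1; apply: ge0_ler_powR; rewrite ?nnegrE ?invr_ge0 ?(ltW q0) ?le_max ?lexx//.
Qed.

Lemma calib_ac (gam : R -> H) (m r e : R) : 0 < r -> abs_continuous01 gam -> abs_continuous01 (calib m r e \o gam).
Proof.
move=> r0 acg.
have acn : abs_continuous01 (fun t => `|gam t|).
  by apply: (ac_lip ltr01 acg) => a b _ _; rewrite mul1r ler_dist_dist.
have [t0 [t1 [_ _ bd]]] := ac_extrema acn; set M := `|gam t1| in bd.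
have M0 : 0 <= M by exact: normr_ge0.
have K0 : 0 < 1 + M + `|m| + `|e| * r by rewrite -addrA -addrA ltr_pwDl// !addr_ge0// mulr_ge0// ltW.
apply: (ac_lip K0 acg) => a b /bd/andP[_ ba] /bd/andP[_ bb].
rewrite /calib /=; set d := `|gam b - gam a|.
have := lexx d; rewrite {1}/d le_normH => /and3P[/= dx dy dz].
move: ba bb; rewrite !le_normH => /and3P[xa ya _] /and3P[xb yb _].
have Gd := arcG_lip (((gam b).1.1 - m) / r) (((gam a).1.1 - m) / r).
set G1 := arcG _ in Gd *; set G2 := arcG _ in Gd *.
have Gd' : `|r ^+ 2 * (G1 - G2)| <= r * d.
  rewrite normrM (ger0_norm (sqr_ge0 r)) expr2 -mulrA ler_pM2l//.
  apply: le_trans (ler_wpM2l (ltW r0) Gd) _.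
  rewrite -{1}(ger0_norm (ltW r0)) -normrM.
  by rewrite (_ : r * _ = (gam b).1.1 - (gam a).1.1)//; field; rewrite gt_eqF.
have exy : `|(gam b).1.1 * (gam b).1.2 - (gam a).1.1 * (gam a).1.2| <= 2 * M * d.
  rewrite (_ : _ - _ = (gam b).1.1 * ((gam b).1.2 - (gam a).1.2) +
    ((gam b).1.1 - (gam a).1.1) * (gam a).1.2); last by ring.
  apply: le_trans (ler_normD _ _) _; rewrite !normrM.
  have e1 := ler_pM (normr_ge0 _) (normr_ge0 _) xb dy.
  have e2 := ler_pM (normr_ge0 _) (normr_ge0 _) dx ya.
  by clear -Gd' e1 e2; move: e1 e2; lra.
have em : `|m * ((gam b).1.2 - (gam a).1.2)| <= `|m| * d by rewrite normrM ler_wpM2l.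
have ee : `|e * (r ^+ 2 * (G1 - G2))| <= `|e| * (r * d) by rewrite normrM ler_wpM2l.
rewrite (_ : _ - _ = ((gam b).2 - (gam a).2) +
   ((gam b).1.1 * (gam b).1.2 - (gam a).1.1 * (gam a).1.2) / 2
   - m * ((gam b).1.2 - (gam a).1.2) - e * (r ^+ 2 * (G1 - G2))); last by ring.
have n4 (x y z t : R) : `|x + y - z - t| <= `|x| + `|y| + `|z| + `|t|.
  by clear -ee; have := ler_normB (x + y - z) t; have := ler_normB (x + y) z; have := ler_normD x y; lra.
apply: le_trans (n4 _ _ _ _) _.
clear -dz exy em ee; move: dz exy em ee; rewrite (normrM _ 2^-1) (@ger0_norm _ 2^-1)//; lra.
Qed.

Lemma calib_derive (gam : R -> H) (t a b m r e : R) : 0 < r ->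
  is_derive t 1 gam (a *: Xfield (gam t) + b *: Yfield (gam t)) ->
  is_derive t 1 (calib m r e \o gam)
    (((gam t).1.1 - m) * b - e * r * arcY (((gam t).1.1 - m) / r) * a).
Proof.
move=> r0 /field_derivP[dx dy dz].
have dG := @dcomp R arcG (fun s => ((gam s).1.1 - m) / r) t _ _ (arcG_derive _)
  (dM (dB dx (dcst t m)) (dcst t r^-1)).
have d1 := dB (dB (dD dz (dM (dM dx dy) (dcst t 2^-1))) (dM (dcst t m) dy))
  (dM (dcst t e) (dM (dcst t (r ^+ 2)) dG)).
apply: (dEq d1); set Y := arcY _; move: (Y) => {}Y; field; rewrite ?gt_eqF//.
Qed.

(** Hölder's inequality against the point of the unit l^q circle with first coordinate (x - m) / r
    and second coordinate of sign [e]. *)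
Lemma calib_speed_le (x a b m r e : R) : 0 < r -> (e = 1 \/ e = -1) -> `|x - m| <= r ->
  (x - m) * b - e * r * arcY ((x - m) / r) * a <= r * lpn p a b.
Proof.
move=> r0 e1 xm.
have xr : `|(x - m) / r| <= 1.
  by rewrite normrM (gtr0_norm (_ : 0 < r^-1)) ?invr_gt0// ler_pdivrMr// mul1r.
have := arcY_norm xr; set Y := arcY _ => XY.
have h := @hoelder_lpn ((x - m) / r) (e * Y) a b.
have := ler_wpM2l (ltW r0) (h _); rewrite (normrM e).
have -> : `|e| = 1 by case: e1 => ->; rewrite ?normrN normr1.
rewrite mul1r => /(_ XY) /(le_trans _); apply.
by rewrite le_eqVlt; apply/orP; left; apply/eqP; field; rewrite gt_eqF.
Qed.

Lemma calib_le (gam : R -> H) (P : R -> R) (m r e a b : R) : speed_bound gam P -> 0 < r -> (e = 1 \/ e = -1) ->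
  0 <= a -> a <= b -> b <= 1 -> (forall t, a <= t <= b -> `|(gam t).1.1 - m| <= r) ->
  calib m r e (gam b) - calib m r e (gam a) <= r * (P b - P a).
Proof.
move=> [acg Pm ae] r0 e1 a0 ab b1 bd; rewrite mulrBr.
apply: (@ac_le R (calib m r e \o gam) (fun t => r * P t) a b a0 ab b1 (calib_ac m e r0 acg)).
  by move=> x y _ xy _; rewrite ler_pM2l//; exact: Pm.
move: ae; apply: aeS => t ht tab.
have [|u1 [u2 [hu hP]]] := ht; first by move/andP: tab => [? ?]; apply/andP; split; lra.
eexists; eexists; split; [exact: calib_derive hu|exact: dZ hP|].
by apply: calib_speed_le => //; exact: bd.
Qed.

(** The inequality [calib_le] holds on every piece, so equality on [a, b] forbids a deficit on any
    subinterval. *)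
Lemma calib_sub (gam : R -> H) (P : R -> R) (m r e a b x y : R) : speed_bound gam P -> 0 < r ->
  (e = 1 \/ e = -1) -> 0 <= a -> b <= 1 -> (forall t, 0 <= t <= 1 -> `|(gam t).1.1 - m| <= r) ->
  calib m r e (gam b) - calib m r e (gam a) = r * (P b - P a) ->
  a <= x -> x <= y -> y <= b -> r * (P y - P x) <= calib m r e (gam y) - calib m r e (gam x).
Proof.
move=> sb r0 e1 a0 b1 xm E ax xy yb.
have pc s t : 0 <= s -> s <= t -> t <= 1 ->
    calib m r e (gam t) - calib m r e (gam s) <= r * (P t - P s).
  move=> s0 st t1; apply: calib_le => // c /andP[c0 c1]; apply: xm.
  by rewrite (le_trans s0 c0) (le_trans c1 t1).
have h1 := pc a x a0 ax (le_trans xy (le_trans yb b1)).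
have h2 := pc y b (le_trans a0 (le_trans ax xy)) yb b1.
move: E h1 h2; clear; move: (calib _ _ _ _) (calib _ _ _ _) (calib _ _ _ _) (calib _ _ _ _).
by move=> c1 c2 c3 c4; lra.
Qed.

Let calib_end m r e s (g : H) : 0 < r -> (s = 1 \/ s = -1) -> g.1.1 = m + s * r ->
  calib m r e g = g.2 + g.1.1 * g.1.2 / 2 - m * g.1.2 - e * (r ^+ 2 * arcG s).
Proof.
move=> r0 s1 gx; rewrite /calib gx; congr (_ - _ * (_ * arcG _)).
by field; rewrite gt_eqF.
Qed.

(** The x-coordinate fills [m - r, m + r]. One sign of the calibration is used between the two
    extremal times and the opposite sign outside; changing the sign at the extremes contributes
    [Pi * r ^+ 2]. Equality in total forces equality on each piece, hence on intervals that do not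
    straddle an extremal time. *)
Lemma isoperimetric (gam : R -> H) (P : R -> R) (x0 y0 z0 z1 : R) : speed_bound gam P ->
  gam 0 = (x0, y0, z0) -> gam 1 = (x0, y0, z1) -> exists m r, 0 <= r /\
  [/\ z1 - z0 + Pi * r ^+ 2 <= r * (P 1 - P 0), r = 0 -> z1 <= z0 &
   0 < r -> z1 - z0 + Pi * r ^+ 2 = r * (P 1 - P 0) -> exists s0 s1,
     (forall t, 0 <= t <= 1 -> `|(gam t).1.1 - m| <= r) /\
     forall a b, 0 <= a -> a <= b -> b <= 1 ->
     ~ a < s0 < b -> ~ a < s1 < b -> exists2 e, e = 1 \/ e = -1 &
     calib m r e (gam b) - calib m r e (gam a) = r * (P b - P a)].
Proof.
move=> sb g0 g1; have [acg Pm ae] := sb.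
have acx : abs_continuous01 (fun t => (gam t).1.1).
  apply: (ac_lip ltr01 acg) => a b _ _; rewrite mul1r.
  by have := lexx `|gam b - gam a|; rewrite {1}le_normH => /and3P[].
have [t0 [t1 [t0I t1I ext]]] := ac_extrema acx.
pose m := ((gam t0).1.1 + (gam t1).1.1) / 2; pose r := ((gam t1).1.1 - (gam t0).1.1) / 2.
have r0 : 0 <= r by have /andP[] := ext 0 ltac:(by rewrite lexx ler01); rewrite /r; lra.
have xm t : 0 <= t <= 1 -> `|(gam t).1.1 - m| <= r.
  by clear -ext; move=> /ext/andP[? ?]; rewrite ler_norml /m /r; apply/andP; split; lra.
exists m, r; split => //.
have [r00|rn0] := eqVneq r 0.
  (* When the x-coordinate is constant, the calibration of every width [e > 0] is available, and [e]
     may tend to 0. *)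
  have h (e : R) : 0 < e -> z1 - z0 <= e * (P 1 - P 0).
    move=> e0; have := @calib_le gam P m e 1 0 1 sb e0 (or_introl erefl) (lexx 0) ler01 (lexx 1) _.
    rewrite /calib g0 g1 /=.
    have H1 t : 0 <= t <= 1 -> `|(gam t).1.1 - m| <= e by move=> /xm; rewrite r00; lra.
    by move=> /(_ H1); lra.
  have hz : z1 <= z0.
    have P01 := Pm 0 1 ler01; rewrite leNgt; apply/negP => zz.
    have k0 : 0 < 2 * (P 1 - P 0 + 1) by lra.
    have := h ((z1 - z0) / (2 * (P 1 - P 0 + 1))) ltac:(clear -r00 P01 zz; by apply: divr_gt0; lra).
    rewrite mulrAC ler_pdivlMr// -subr_ge0.
    rewrite (_ : _ - _ = - (z1 - z0) * (P 1 - P 0 + 2)); last by ring.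
    by clear -r00 P01 zz; rewrite mulNr oppr_ge0 leNgt => /negP; apply; apply: mulr_gt0; lra.
  by split => //; rewrite r00 ?ltxx// expr0n/= mulr0 mul0r; lra.
have rgt : 0 < r by rewrite lt_neqAle eq_sym rn0.
(* [s0 <= s1] are the extremal times in order of occurrence; [e = 1] when the minimum comes first
   and [e = -1] when the maximum does. *)
suff key s0 s1 e : 0 <= s0 -> s0 <= s1 -> s1 <= 1 -> (e = 1 \/ e = -1) ->
    (gam s0).1.1 = m + (- e) * r -> (gam s1).1.1 = m + e * r ->
  [/\ z1 - z0 + Pi * r ^+ 2 <= r * (P 1 - P 0), r = 0 -> z1 <= z0 &
   0 < r -> z1 - z0 + Pi * r ^+ 2 = r * (P 1 - P 0) -> exists s0 s1,
     (forall t, 0 <= t <= 1 -> `|(gam t).1.1 - m| <= r) /\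
     forall a b, 0 <= a -> a <= b -> b <= 1 ->
     ~ a < s0 < b -> ~ a < s1 < b -> exists2 e, e = 1 \/ e = -1 &
     calib m r e (gam b) - calib m r e (gam a) = r * (P b - P a)].
  move/andP: t0I => [? ?]; move/andP: t1I => [? ?].
  have [t01|t10] := leP t0 t1.
    apply: (key t0 t1 1); rewrite ?mul1r ?mulN1r//; [by left|rewrite /m /r; lra|rewrite /m /r; lra].
  apply: (key t1 t0 (-1)); rewrite ?opprK ?mul1r ?mulN1r//; [exact: ltW|by right|rewrite /m /r; lra|rewrite /m /r; lra].
move=> s00 s01 s11 e1 x0E x1E.
have e1' : - e = 1 \/ - e = -1 by case: e1 => ->; rewrite ?opprK; [right|left].
have pc := fun a b e' (e1 : e' = 1 \/ e' = -1) h1 h2 h3 =>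
  @calib_le gam P m r e' a b sb rgt e1 h1 h2 h3
   (fun t ht => xm t ltac:(by case/andP: ht => ? ?; apply/andP; split; lra)).
pose B (g : H) := g.2 + g.1.1 * g.1.2 / 2 - m * g.1.2.
have E0 e' := @calib_end m r e' (- e) (gam s0) rgt e1' x0E.
have E1 e' := @calib_end m r e' e (gam s1) rgt e1 x1E.
have Eg e' : calib m r e' (gam 0) = z0 + x0 * y0 / 2 - m * y0 - e' * (r ^+ 2 * arcG ((x0 - m) / r)).
  by rewrite /calib g0.
have Eg' e' : calib m r e' (gam 1) = z1 + x0 * y0 / 2 - m * y0 - e' * (r ^+ 2 * arcG ((x0 - m) / r)).
  by rewrite /calib g1.
have G1 : r ^+ 2 * arcG 1 - r ^+ 2 * arcG (-1) = Pi * r ^+ 2 / 2.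
  by rewrite -mulrBr arcG_half; ring.
(* The values of [arcG] at the endpoints of the curve cancel, those at the extremal times add up to
   twice the area of the half disc, and the rest telescopes because the curve closes up in x and
   y. *)
have tot : calib m r e (gam s0) - calib m r e (gam 0)
    + (calib m r (- e) (gam s1) - calib m r (- e) (gam s0))
    + (calib m r e (gam 1) - calib m r e (gam s1)) = z1 - z0 + Pi * r ^+ 2.
  rewrite !E0 !E1 Eg Eg'; move: (arcG ((x0 - m) / r)) => g.
  by clear -e1 G1; case: e1 => ->; rewrite ?opprK; move: G1; lra.
have i1 := pc 0 s0 e e1 (lexx 0) s00 ltac:(clear -s01 s11 x1E; lra).
have i2 := pc s0 s1 (- e) e1' s00 s01 s11.
have i3 := pc s1 1 e e1 ltac:(clear -rgt s00 s01; lra) s11 (lexx 1).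
split; [rewrite -tot; lra|by move=> /eqP; rewrite (negbTE rn0)|move=> _ Eq; exists s0, s1; split => // a b a0 ab b1 n0 n1].
rewrite -tot in Eq.
have [q1' q2' q3'] : [/\ calib m r e (gam s0) - calib m r e (gam 0) = r * (P s0 - P 0),
    calib m r (- e) (gam s1) - calib m r (- e) (gam s0) = r * (P s1 - P s0) &
    calib m r e (gam 1) - calib m r e (gam s1) = r * (P 1 - P s1)].
  move: Eq i1 i2 i3; clear; move: (calib _ _ _ _) (calib _ _ _ _) (calib _ _ _ _) (calib _ _ _ _).
  move: (calib _ _ _ _) (calib _ _ _ _) => c1 c2 c3 c4 c5 c6 *; split; lra.
have sub e' u v : e' = 1 \/ e' = -1 -> 0 <= u -> v <= 1 ->
    calib m r e' (gam v) - calib m r e' (gam u) = r * (P v - P u) -> u <= a -> b <= v ->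
    calib m r e' (gam b) - calib m r e' (gam a) = r * (P b - P a).
  move=> he u0 v1 E ua bv; apply/eqP; rewrite eq_le pc//=.
  by apply: (calib_sub sb rgt he u0 v1 xm E).
have [bs0|bs0] := leP b s0; first by exists e => //; apply: (sub e 0 s0 e1 (lexx 0) (le_trans s01 s11) q1').
have s0a : s0 <= a by rewrite leNgt; apply/negP => ?; apply: n0; apply/andP.
have [bs1|bs1] := leP b s1; first by exists (- e) => //; apply: (sub (- e) s0 s1 e1' s00 s11 q2').
have s1a : s1 <= a by rewrite leNgt; apply/negP => ?; apply: n1; apply/andP.
by exists e => //; apply: (sub e s1 1 e1 (le_trans s00 s01) (lexx 1) q3').
Qed.

(** Velocity l e'(f + w t), prescribed only inside an interval so that the pieces of a concatenation
    qualify. *)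
Definition arc_on (gam : R -> H) (l f w a b : R) := forall t : R, a < t < b ->
  is_derive t 1 gam (- (l * sp (q - 1) (S (f + w * t))) *: Xfield (gam t) +
    (l * sp (q - 1) (C (f + w * t))) *: Yfield (gam t)).

(** Of three points just after [t], at least one differs from both [s0] and [s1]. *)
Lemma dense2 (a b s0 s1 t d : R) : a < t < b -> 0 < d ->
  exists s, [/\ a < s < b, `|s - t| < d, s != s0 & s != s1].
Proof.
move=> /andP[at_ tb] d0; pose e := Num.min (b - t) d / 4.
have h : 0 < Num.min (b - t) d by rewrite lt_min d0 subr_gt0 tb.
have h1 : Num.min (b - t) d <= b - t by rewrite ge_min lexx.
have h2 : Num.min (b - t) d <= d by rewrite ge_min lexx orbT.
have e0 : 0 < e by rewrite /e; lra.
have eb : 4 * e <= b - t by rewrite /e; lra.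
have ed : 4 * e <= d by rewrite /e; lra.
have k (n : R) : 0 < n < 4 -> a < t + n * e < b /\ `|t + n * e - t| < d.
  move=> /andP[n0 n4]; have p1' := mulr_gt0 n0 e0.
  have p2' : n * e < 4 * e by rewrite ltr_pM2r.
  by clear -at_ eb ed p1' p2'; rewrite addrAC subrr add0r gtr0_norm//; split; [apply/andP; split|]; lra.
have [k1 k1'] := k 1 ltac:(clear -h2 e0 eb ed; lra); have [k2 k2'] := k 2 ltac:(clear -h2 e0 eb ed; lra).
have [k3 k3'] := k 3 ltac:(lra).
have ne (n n' : R) : n != n' -> t + n * e != t + n' * e.
  by move=> nn; rewrite (inj_eq (addrI _)) (inj_eq (mulIf _))// gt_eqF.
have [n1 n2 n3] : [/\ t + 1 * e != t + 2 * e, t + 1 * e != t + 3 * e & t + 2 * e != t + 3 * e].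
  by clear -k2' k3 k3' ne; split; apply: ne; rewrite lt_eqF//; lra.
have [E0|E0] := eqVneq (t + 1 * e) s0; last first.
  have [E1|E1] := eqVneq (t + 1 * e) s1; last by exists (t + 1 * e).
  have [E2|E2] := eqVneq (t + 2 * e) s0; last by exists (t + 2 * e); split => //; rewrite -E1 eq_sym.
  by exists (t + 3 * e); split => //; rewrite -?E1 -?E2 eq_sym.
have [E1|E1] := eqVneq (t + 2 * e) s1; last by exists (t + 2 * e); split => //; rewrite -E0 eq_sym.
by exists (t + 3 * e); split => //; rewrite -?E1 -?E0 eq_sym.
Qed.

Lemma derive_ge (f : R -> R) (t c c' d : R) : 0 < d -> is_derive t 1 f c ->
  (forall h, 0 < h < d -> c' * h <= f (t + h) - f t) -> c' <= c.
Proof.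
move=> d0 /is_derive_epsP df H; rewrite leNgt; apply/negP => cc.
have [e e0 He] := df ((c' - c) / 2) ltac:(lra).
pose h := Num.min d e / 2; have h0 : 0 < Num.min d e by rewrite lt_min d0.
have h1 : Num.min d e <= d by rewrite ge_min lexx.
have h2 : Num.min d e <= e by rewrite ge_min lexx orbT.
have hp : 0 < h by rewrite /h; lra.
have := H h ltac:(clear -He h0 h1 h2 hp; rewrite hp/= /h; lra); have := He h ltac:(clear -He h0 h1 h2 hp; rewrite gtr0_norm// /h; lra).
rewrite (gtr0_norm hp) => /(le_trans (ler_norm _)) i1 i2.
by have := mulr_gt0 (_ : 0 < c' - c) hp; rewrite subr_gt0 => /(_ cc); lra.
Qed.

(** The derivative of a curve determines its controls, so on an arc of speed [l] the derivative of
    [P] is [l] almost everywhere. *)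
Lemma speed_ge gam P l f w a b x y : speed_bound gam P -> 0 <= a -> b <= 1 -> 0 <= l ->
  arc_on gam l f w a b -> a < x -> x <= y -> y < b -> l * (y - x) <= P y - P x.
Proof.
move=> [acg Pm ae] a0 b1 l0 arc ax xy yb.
rewrite mulrBr; apply: (@ac_le R (fun t => l * t) P x y _ xy).
- lra.
- lra.
- have K0 : 0 < 1 + l by lra.
  apply: (ac_lip K0 (@ac_id R)) => s t _ _; rewrite -mulrBr normrM (ger0_norm l0).
  by apply: ler_wpM2r; [exact: normr_ge0|rewrite lerDr].
- by move=> s t _ st _; exact: Pm.
move: ae; apply: aeS => t ht tI.
have [|u1 [u2 [hu hP]]] := ht; first by move/andP: tI => [? ?]; apply/andP; split; lra.
exists l, (lpn p u1 u2); split => //; first by apply: (dEq (dZ l (did t))); rewrite mulr1.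
have /arc/field_derivP[dx dy _] : a < t < b by clear -ax yb tI; move/andP: tI => [? ?]; apply/andP; split; lra.
have /field_derivP[dx' dy' _] := hu.
by rewrite -(dunique dx dx') -(dunique dy dy') lpn_vel.
Qed.

(** The hypotheses turn the isoperimetric inequality into Pi (r - R0)^2 <= 0, so it is an equality
    with r = R0. Along a piece known to be an arc, equality in Hölder's inequality then identifies
    the position on the circle, with one centre [m] for all pieces. *)
Lemma iso_rigid (gam : R -> H) (P : R -> R) x0 y0 z0 z1 R0 : speed_bound gam P ->
  gam 0 = (x0, y0, z0) -> gam 1 = (x0, y0, z1) -> 0 < R0 ->
  z1 - z0 = Pi * R0 ^+ 2 -> P 1 - P 0 <= 2 * Pi * R0 ->
  exists m, forall l f w a b, 0 <= a -> b <= 1 -> 0 < l -> arc_on gam l f w a b ->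
    forall t, a < t < b -> (gam t).1.1 = m + R0 * C (f + w * t).
Proof.
move=> sb g0 g1 R00 hz hP; have [m [r [r0 [ineq r00 eqc]]]] := isoperimetric sb g0 g1.
have PR : 0 < Pi * R0 ^+ 2 by rewrite mulr_gt0 ?exprn_gt0// Piq_gt0.
have rgt : 0 < r by rewrite lt_neqAle r0 andbT eq_sym; apply/eqP => /r00; lra.
have rP : r * (P 1 - P 0) <= r * (2 * Pi * R0) by rewrite ler_pM2l.
have rR : r = R0.
  apply/eqP; rewrite -subr_eq0 -sqrf_eq0 eq_le sqr_ge0 andbT.
  rewrite -(pmulr_rle0 _ (Piq_gt0 q1)); rewrite hz in ineq; move: (le_trans ineq rP); lra.
subst r; have [|s0 [s1 [xm eqs]]] := eqc R00.
  by apply/eqP; rewrite eq_le ineq/= (le_trans rP)// hz; lra.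
exists m => l f w a b a0 b1 l0 arc.
(* Away from the switching times the calibration grows at the maximal rate [R0 * l], so [dual_eq]
   applies. *)
have gen t : a < t < b -> t != s0 -> t != s1 -> (gam t).1.1 = m + R0 * C (f + w * t).
  move=> tI t0 t1.
  have [d [d0 da db ds0 ds1]] : exists d, [/\ 0 < d, a < t - d, t + d < b,
      ~ t - d < s0 < t + d & ~ t - d < s1 < t + d].
    pose M := Num.min (Num.min (t - a) (b - t)) (Num.min `|t - s0| `|t - s1|).
    have M0 : 0 < M by rewrite !lt_min !subr_gt0 !normr_gt0 !subr_eq0 t0 t1 !andbT.
    exists (M / 2).
    have M1 : M <= t - a by rewrite /M !ge_min lexx.
    have M2 : M <= b - t by rewrite /M !ge_min lexx !orbT.
    have M3 : M <= `|t - s0| by rewrite /M !ge_min lexx !orbT.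
    have M4 : M <= `|t - s1| by rewrite /M !ge_min lexx !orbT.
    move: M0 M1 M2 M3 M4; clear; move: M => M M0 M1 M2 M3 M4.
    by split; [lra|lra|lra|apply/negP|apply/negP]; rewrite -ltr_distlC; lra.
  have [tda tdb tdd] : [/\ 0 <= t - d, t - d <= t + d & t + d <= 1].
    by move: a0 b1 da db d0; clear; split; lra.
  have [e e1 ee] := eqs (t - d) (t + d) tda tdb tdd ds0 ds1.
  have dV := calib_derive m e R00 (arc t tI).
  have xmt : `|(gam t).1.1 - m| <= R0 by clear -xm tI tda tdb tdd; apply: xm; move/andP: tI => [? ?]; apply/andP; split; lra.
  have vle := calib_speed_le (- (l * sp (q - 1) (S (f + w * t))))
    (l * sp (q - 1) (C (f + w * t))) R00 e1 xmt.
  have vge : R0 * l <= (((gam t).1.1 - m) * (l * sp (q - 1) (C (f + w * t)))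
     - e * R0 * arcY (((gam t).1.1 - m) / R0) * - (l * sp (q - 1) (S (f + w * t)))).
    apply: (derive_ge d0 dV) => h /andP[h0 hd] /=.
    have [td0 td1 td2 td3] : [/\ 0 <= t - d, t + d <= 1, t - d <= t & t + h <= t + d].
      by move: a0 b1 da db d0 hd; clear; split; lra.
    have th : t <= t + h by rewrite lerDl ltW.
    apply: le_trans (calib_sub sb R00 e1 td0 td1 xm ee td2 th td3).
    rewrite -mulrA; apply: ler_wpM2l; first exact: ltW.
    have := speed_ge sb a0 b1 (ltW l0) arc (_ : a < t) (_ : t <= t + h) (_ : t + h < b).
    rewrite addrAC subrr add0r; apply => //; first by case/andP: tI.
    by apply: lt_trans db; rewrite ltrD2l.
  rewrite lpn_vel ?(ltW l0)// in vle.
  have xr : `|((gam t).1.1 - m) / R0| <= 1.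
    by rewrite normrM (gtr0_norm (_ : 0 < R0^-1)) ?invr_gt0// ler_pdivrMr// mul1r.
  have := arcY_norm xr; set Y := arcY _ in vge vle * => XY.
  have XY' : `|((gam t).1.1 - m) / R0| `^ q + `|e * Y| `^ q = 1.
    by rewrite (normrM e) (_ : `|e| = 1) ?mul1r//; case: e1 => ->; rewrite ?normrN normr1.
  have [] := dual_eq q1 (f := f + w * t) XY'; last by move=> <- _; field; rewrite gt_eqF.
  have Rl : R0 * l != 0 by rewrite mulf_neq0// gt_eqF.
  apply: (mulfI Rl); rewrite mulr1; apply/eqP; rewrite eq_le; apply/andP; split.
    apply: le_trans vle; rewrite le_eqVlt; apply/orP; left; apply/eqP.
    by field; rewrite gt_eqF.
  apply: le_trans vge _; rewrite le_eqVlt; apply/orP; left; apply/eqP.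
  by field; rewrite gt_eqF.
(* At the two switching times the formula follows by continuity from nearby times. *)
move=> t tI; apply/eqP; rewrite -subr_eq0 -normr_le0 leNgt; apply/negP.
set D := _ - _ => D0.
have /field_derivP[dx _ _] := arc t tI.
have dC := @dcomp R C (fun s => f + w * s) t _ _ (eC_derive q1 _) (dD (dcst t f) (dZ w (did t))).
have /cts_epsP/(_ (`|D| / 2)) := dcontinuous (dB dx (dD (dcst t m) (dZ R0 dC))); case; first lra.
move=> d d0 Hd; have [s [sI sd n0 n1]] := dense2 s0 s1 tI d0.
clear -gen D0 Hd sI sd n0 n1; have := Hd s sd; rewrite (gen s sI n0 n1) subrr sub0r normrN -/D; lra.
Qed.

End Isoperimetric.

(** * Geodesics *)

Section Geodesics.
Context {R : realType}.
Local Notation H := (R * R * R)%type.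
Local Notation mu := (@lebesgue_measure R).
Variables (p q : R).
Hypotheses (p1 : 1 < p) (q1 : 1 < q) (pq : p^-1 + q^-1 = 1).
Local Notation C := (eC q).
Local Notation S := (eS q).
Local Notation Pi := (Piq q).
Local Notation d := (heis_dist p).
Local Notation crs := (crs q).
Local Notation al := (al q).
Local Notation Wq := (Wq q).
Local Notation arc_on := (arc_on q).
Let p0 : 0 < p. Proof. exact: lt_trans ltr01 p1. Qed.
Let Pi0 : 0 < Pi. Proof. exact: Piq_gt0. Qed.

Lemma eD2Pin n f : C (f + n%:R * (2 * Pi)) = C f /\ S (f + n%:R * (2 * Pi)) = S f.
Proof.
elim: n => [|n [IC IS]]; first by rewrite mul0r addr0.
by rewrite -natr1 mulrDl mul1r addrA eCD2Pi// eSD2Pi.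
Qed.

Lemma e_eqP f f' : C f = C f' -> S f = S f' -> exists n : nat,
  f' = f + n%:R * (2 * Pi) \/ f = f' + n%:R * (2 * Pi).
Proof.
wlog ff : f f' / f <= f' => [H0|].
  have [/H0//|/ltW/H0 H1 C1 S1] := leP f f'.
  by have [n hn] := H1 (esym C1) (esym S1); exists n; case: hn; [right|left].
have D0 : 0 <= (f' - f) / (2 * Pi) by rewrite divr_ge0 ?subr_ge0 ?mulr_ge0 ?(ltW Pi0).
move=> Cf Sf; exists (Num.truncn ((f' - f) / (2 * Pi))); left; set n := Num.truncn _.
have /andP[n1 n2] := truncn_itv D0; rewrite -/n in n1 n2.
have P20 : 0 < 2 * Pi by rewrite mulr_gt0.
rewrite ler_pdivlMr// in n1; rewrite ltr_pdivrMr// in n2.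
have [Cn Sn] := eD2Pin n f.
apply/eqP; rewrite eq_le; apply/andP; split; last by rewrite -lerBrDl.
rewrite leNgt; apply/negP => lt1; case: (@e_inj R q q1 (f + n%:R * (2 * Pi)) f').
  by rewrite lt1/= -addrA -ltrBlDl (lt_le_trans n2)// -natr1 mulrDl mul1r.
by rewrite Cn Sn.
Qed.

Lemma e_eqD f f' s : C f = C f' -> S f = S f' -> C (f + s) = C (f' + s) /\ S (f + s) = S (f' + s).
Proof.
move=> Cf Sf; have [n [->|->]] := e_eqP Cf Sf; rewrite addrAC.
  by have [-> ->] := eD2Pin n (f + s).
by have [-> ->] := eD2Pin n (f' + s).
Qed.

Definition expF (f s r : R) : H :=
  (r * (C (f + s) - C f), r * (S (f + s) - S f), r ^+ 2 / 2 * Wq f (f + s)).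

Lemma expF_cat f s s' r : heis_mul (expF f s r) (expF (f + s) s' r) = expF f (s + s') r.
Proof.
rewrite /expF /heis_mul /Wq /crs -!addrA.
by congr (_, _, _); field.
Qed.

Lemma expF_full f r : expF f (2 * Pi) r = (0, 0, Pi * r ^+ 2).
Proof.
by rewrite /expF /Wq /crs eCD2Pi// eSD2Pi// !subrr !mulr0; congr (_, _, _); field.
Qed.

Lemma expF0 f r : expF f 0 r = (0, 0, 0).
Proof. by rewrite /expF addr0 !subrr Wq_ff// !mulr0. Qed.

Lemma expF_per f f' s r : C f = C f' -> S f = S f' -> expF f s r = expF f' s r.
Proof.
move=> Cf Sf; have [C1 S1] := e_eqD s Cf Sf.
by rewrite /expF /Wq /crs Cf Sf C1 S1; congr (_, _, _); ring.
Qed.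

(** An arc run backwards and reflected in the x-axis is again positively oriented; this converts
    distances to the origin into distances from it. *)
Lemma hmir_inv_expF f s r : hmir (hinv (expF f s r)) = expF (- (f + s)) s r.
Proof.
rewrite /expF /hinv /hmir /= /Wq /crs.
rewrite (_ : - (f + s) + s = - f); last by ring.
rewrite !eCN// !eSN//.
by congr (_, _, _); ring.
Qed.

(* Speed l, initial direction e'(f), turning rate w: a straight line when w = 0. *)
Definition harc (l f w t : R) : H :=
  if w == 0 then (- (l * sp (q - 1) (S f)) * t, l * sp (q - 1) (C f) * t, 0)
  else expF f (w * t) (l / w).

Lemma harc0 l f w : harc l f w 0 = (0, 0, 0).
Proof. by rewrite /harc; case: ifP => _; rewrite !mulr0// expF0. Qed.

Let harc_derive3 l f w (t : R) :
  [/\ is_derive t 1 (fun t => (harc l f w t).1.1) (- (l * sp (q - 1) (S (f + w * t)))),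
      is_derive t 1 (fun t => (harc l f w t).1.2) (l * sp (q - 1) (C (f + w * t))) &
      is_derive t 1 (fun t => (harc l f w t).2) (2^-1 *
        ((harc l f w t).1.1 * (l * sp (q - 1) (C (f + w * t))) -
          - (l * sp (q - 1) (S (f + w * t))) * (harc l f w t).1.2))].
Proof.
rewrite /harc; have [->|w0] := eqVneq w 0; rewrite /= ?mul0r ?addr0.
  split; [exact: (dEq (dZ _ (did t)) (mulr1 _))|exact: (dEq (dZ _ (did t)) (mulr1 _))|].
  by apply: (dEq (dcst t 0)); ring.
have da := dD (dcst t f) (dZ w (did t)).
have dC := @dcomp R C (fun s => f + w * s) t _ _ (eC_derive q1 _) da.
have dS := @dcomp R S (fun s => f + w * s) t _ _ (eS_derive q1 _) da.
have dW := @dcomp R (Wq f) (fun s => f + w * s) t _ _ (Wq_derive q1 f _) da.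
split.
- by apply: (dEq (dZ (l / w) (dB dC (dcst t (C f))))); field.
- by apply: (dEq (dZ (l / w) (dB dS (dcst t (S f))))); field.
apply: (dEq (dZ ((l / w) ^+ 2 / 2) dW)).
have := al_ff q1 (f + w * t); rewrite /al => E.
rewrite -[X in X - (C f * _ + _)]E; move: (sp _ _) (sp _ _) => a b; field => //.
Qed.

Lemma harc_arc l f w a b : arc_on (harc l f w) l f w a b.
Proof. by move=> t _; apply/field_derivP; exact: harc_derive3. Qed.

Lemma harc_horizontal l f w : exists2 u, horizontal (harc l f w) u.1 u.2 &
  0 <= l -> lp_length p u.1 u.2 = l%:E.
Proof.
exists (fun t => - (l * sp (q - 1) (S (f + w * t))), fun t => l * sp (q - 1) (C (f + w * t))).
  have -> : harc l f w = fun t => ((harc l f w t).1.1, (harc l f w t).1.2, (harc l f w t).2).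
    by apply/funext => t; case: (harc l f w t) => [[]].
  have cw (t : R) : {for t, continuous (fun t => f + w * t)}.
    exact: (dcontinuous (dD (dcst t f) (dZ w (did t)))).
  have cSP (t : R) : {for t, continuous ((fun g => sp (q - 1) (S g)) \o (fun t => f + w * t))}.
    by apply: continuous_comp; [exact: cw|exact: continuous_spS].
  have cCP (t : R) : {for t, continuous ((fun g => sp (q - 1) (C g)) \o (fun t => f + w * t))}.
    by apply: continuous_comp; [exact: cw|exact: continuous_spC].
  have h3 := harc_derive3 l f w.
  apply: (smooth_horizontal (fun t => let: And3 a _ _ := h3 t in a)
    (fun t => let: And3 _ a _ := h3 t in a) (fun t => let: And3 _ _ a := h3 t in a)) => t.
    apply: continuousN; apply: continuousM; first exact: cst_continuous.
    exact: cSP.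
  apply: continuousM; first exact: cst_continuous.
  exact: cCP.
by move=> l0; apply: lp_length_cst => // t _ /=; rewrite lpn_vel.
Qed.

Lemma harc_lset g l f w : 0 <= l -> lset p g (heis_mul g (harc l f w 1)) l%:E.
Proof.
move=> l0; have [u hu /(_ l0) lu] := harc_horizontal l f w.
exists (heis_mul g \o harc l f w), u.1, u.2; split => //; first exact: horizontal_left.
by rewrite /= harc0 heis_mul0.
Qed.

Lemma expF_harc f s r : 0 < s -> expF f s r = harc (r * s) f s 1.
Proof. by move=> s0; rewrite /harc gt_eqF// mulr1 mulfK// gt_eqF. Qed.

Lemma dist00 : d (0, 0, 0) (0, 0, 0) = 0.
Proof.
apply/eqP; rewrite eq_le dist_ge0// andbT; apply: dist_le => //.
have := harc_lset (0, 0, 0) 0 0 (lexx 0); rewrite heis_0mul /harc eqxx.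
by rewrite !mul0r oppr0 !mul0r.
Qed.

Let dist_expF_le f s r : 0 <= s -> 0 < r -> d (0, 0, 0) (expF f s r) <= r * s.
Proof.
rewrite le_eqVlt => /predU1P[<-|s0] r0; first by rewrite expF0 mulr0 dist00.
apply: dist_le => //; rewrite expF_harc//.
have := harc_lset (0, 0, 0) f s (_ : 0 <= r * s); rewrite heis_0mul; apply.
by rewrite mulr_ge0// ltW.
Qed.

(** For a loop of length L and half-width [k] the isoperimetric inequality reads Pi r^2 + Pi k^2 <=
    k L, and the left side is at least 2 Pi r k. The positive height excludes [k = 0]. *)
Lemma closed_dist_ge r : 0 < r -> 2 * Pi * r <= d (0, 0, 0) (0, 0, Pi * r ^+ 2).
Proof.
move=> r0; apply: dist_ge => // l [gam [u1 [u2 [hg g0 g1 ->]]]].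
have := @lset_ge0 R p (0, 0, 0) (0, 0, Pi * r ^+ 2) (lp_length p u1 u2).
move=> /(_ (ex_intro _ gam (ex_intro _ u1 (ex_intro _ u2 (And4 hg g0 g1 erefl))))).
case E : (lp_length p u1 u2) => [L| |] //; first last.
  by move=> _; exact: leey.
rewrite !lee_fin => L0.
have [P [Pm P1 ae]] := speed_primitive hg E.
have sb : speed_bound p gam P by split => //; case: hg.
have [m [k [k0 [i1 i2 _]]]] := isoperimetric p1 q1 pq sb g0 g1.
have Pr : 0 < Pi * r ^+ 2 by rewrite mulr_gt0 ?exprn_gt0.
have kgt : 0 < k by rewrite lt_neqAle k0 andbT eq_sym; apply/eqP => /i2; lra.
rewrite subr0 in i1.
have i3 : Pi * r ^+ 2 + Pi * k ^+ 2 <= k * L by apply: le_trans i1 _; rewrite ler_pM2l.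
rewrite -(ler_pM2l kgt); apply: le_trans i3; rewrite -subr_ge0.
by rewrite (_ : _ - _ = Pi * (r - k) ^+ 2); [rewrite mulr_ge0 ?sqr_ge0// ltW|ring].
Qed.

(** The arc and its complement make up a full turn, whose length is minimal by [closed_dist_ge]; by
    the triangle inequality neither part can be shortened. *)
Lemma dist_expF f s r : 0 <= s <= 2 * Pi -> 0 < r -> d (0, 0, 0) (expF f s r) = r * s.
Proof.
move=> /andP[s0 s2] r0; apply/eqP; rewrite eq_le dist_expF_le//=.
have := dist_triangle p0 (0, 0, 0) (expF f s r) (expF f (2 * Pi) r).
have E : expF f (2 * Pi) r = heis_mul (expF f s r) (expF (f + s) (2 * Pi - s) r).
  by rewrite expF_cat addrC subrK.
rewrite [X in d (expF f s r) X]E -{2}(heis_mul0 (expF f s r)) dist_left//.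
rewrite expF_full; have := closed_dist_ge r0; have := dist_expF_le (f + s) (_ : 0 <= 2 * Pi - s) r0.
by rewrite subr_ge0 => /(_ s2); lra.
Qed.

Lemma dist_inv_expF f s r : 0 <= s <= 2 * Pi -> 0 < r ->
  d (0, 0, 0) (hinv (expF f s r)) = r * s.
Proof.
move=> s02 r0; rewrite -(dist_mir p (0,0,0)) hmir_inv_expF.
by rewrite /hmir oppr0 dist_expF.
Qed.

Lemma dist_to0 (h : H) : d h (0, 0, 0) = d (0, 0, 0) (hinv h).
Proof. by rewrite -(dist_left p (hinv h) h) heis_Vmul heis_mul0. Qed.

Lemma expF_geodesic (g : H) f s r : 0 <= s <= 2 * Pi -> 0 < r ->
  min_geodesic d (fun t => heis_mul g (expF f (s * t) r)).
Proof.
move=> s02 r0 a b a01 b01; rewrite !dist_left// mulr0 mulr1 expF0 dist_expF//.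
have key a' b' : 0 <= a' <= 1 -> 0 <= b' <= 1 -> a' <= b' ->
    expF f (s * b') r = heis_mul (expF f (s * a') r) (expF (f + s * a') (s * (b' - a')) r) /\
    0 <= s * (b' - a') <= 2 * Pi.
  move=> /andP[a0 a1] /andP[b0 b1] ab; split; first by rewrite expF_cat; congr (expF _ _ _); ring.
  move/andP: s02 => [s0 s2]; rewrite mulr_ge0 ?subr_ge0//= (le_trans _ s2)//.
  by rewrite ler_piMr//; lra.
have [ab|/ltW ab] := leP a b.
  have [E I] := key a b a01 b01 ab.
  rewrite E -{1}(heis_mul0 (expF f (s * a) r)) dist_left// dist_expF// distrC ger0_norm ?subr_ge0//; ring.
have [E I] := key b a b01 a01 ab; rewrite E.
rewrite -{2}(heis_mul0 (expF f (s * b) r)) dist_left// dist_to0 dist_inv_expF//.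
by rewrite ger0_norm ?subr_ge0//; ring.
Qed.

Lemma arc_on_rot (gam : R -> H) l f w a b : arc_on gam l f w a b ->
  arc_on (fun t => hrot (gam t)) l (f + Pi / 2) w a b.
Proof.
move=> arc t tI; have /field_derivP[dx dy dz] := arc t tI; rewrite addrAC eSDhalf// eCDhalf// spN mulrN.
have E s : hrot (gam s) = (- (gam s).1.2, (gam s).1.1, (gam s).2) by case: (gam s) => [[]].
apply/field_derivP; split; rewrite ?E /=.
- under eq_fun do rewrite E /=.
  exact: dN dy.
- by under eq_fun do rewrite E /=; exact: dx.
under eq_fun do rewrite E /=.
by apply: (dEq dz); ring.
Qed.

Lemma arc_on_left (g : H) (gam : R -> H) l f w a b : arc_on gam l f w a b ->
  arc_on (fun t => heis_mul g (gam t)) l f w a b.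
Proof.
move=> arc t tI; have /field_derivP[dx dy dz] := arc t tI.
have E s : heis_mul g (gam s) = (g.1.1 + (gam s).1.1, g.1.2 + (gam s).1.2,
   g.2 + (gam s).2 + 2^-1 * (g.1.1 * (gam s).1.2 - (gam s).1.1 * g.1.2)).
  by case: g (gam s) => [[x y] z] [[x' y'] z'].
apply/field_derivP; split; rewrite ?E /=; under eq_fun do rewrite E /=.
- by apply: (dEq (dD (dcst t _) dx)); rewrite add0r.
- by apply: (dEq (dD (dcst t _) dy)); rewrite add0r.
apply: (dEq (dD (dD (dcst t _) dz) (dZ 2^-1 (dB (dZ g.1.1 dy) (dM dx (dcst t g.1.2)))))).
ring.
Qed.

Lemma arc_on_affine (gam gam1 : R -> H) l f w a b c e :
  (forall t : R, a < t < b -> gam t = gam1 (c * t + e)) ->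
  (forall t : R, a < t < b -> 0 < c * t + e < 1) ->
  arc_on gam1 l f w 0 1 -> arc_on gam (c * l) (f + w * e) (c * w) a b.
Proof.
move=> E I arc t tI; have /field_derivP[dx dy dz] := arc _ (I t tI).
have nr (h : H -> R) v : is_derive (c * t + e) 1 (fun s => h (gam1 s)) v ->
    is_derive t 1 (fun s => h (gam s)) (c * v).
  move=> dh; have da := dD (dZ c (did t)) (dcst t e).
  have d1 := @dcomp R (fun s => h (gam1 s)) (fun t => c * t + e) t _ _ dh da.
  apply: (dnear (dEq d1 _)); first by ring.
  exists (Num.min (t - a) (b - t)); first by case/andP: tI => ? ?; rewrite lt_min !subr_gt0; apply/andP.
  move=> y; rewrite lt_min !ltr_norml => /andP[/andP[y1 y2] /andP[y3 y4]].
  by rewrite E//; apply/andP; split; lra.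
have -> : f + w * e + c * w * t = f + w * (c * t + e) by ring.
apply/field_derivP; split; rewrite ?E//.
- by apply: (dEq (nr (fun g => g.1.1) _ dx)); ring.
- by apply: (dEq (nr (fun g => g.1.2) _ dy)); ring.
by apply: (dEq (nr (fun g => g.2) _ dz)); ring.
Qed.

(** [iso_rigid] controls the x-coordinate; applied to the curve turned by a right angle, it controls
    y as well. *)
Lemma rigid_xy (gam : R -> H) u1 u2 r : 0 < r -> horizontal gam u1 u2 ->
  lp_length p u1 u2 = (2 * Pi * r)%:E -> gam 0 = (0, 0, 0) -> gam 1 = (0, 0, Pi * r ^+ 2) ->
  exists m n, forall l f w a b, 0 <= a -> b <= 1 -> 0 < l -> arc_on gam l f w a b ->
    forall t, a < t < b -> (gam t).1.1 = m + r * C (f + w * t) /\ (gam t).1.2 = n + r * S (f + w * t).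
Proof.
move=> r0 hg hl g0 g1; have hr := horizontal_rot hg.
have hlr : lp_length p (fun t => - u2 t) u1 = (2 * Pi * r)%:E.
  by rewrite -hl /lp_length; apply: eq_integral => t _; rewrite normrN addrC.
have [P [Pm P1 ae]] := speed_primitive hg hl.
have [P' [Pm' P1' ae']] := speed_primitive hr hlr.
have sb : speed_bound p gam P by split => //; case: hg.
have sb' : speed_bound p (hrot \o gam) P' by split => //; case: hr.
have g0' : (hrot \o gam) 0 = (0, 0, 0) by rewrite /= g0 /= oppr0.
have g1' : (hrot \o gam) 1 = (0, 0, Pi * r ^+ 2) by rewrite /= g1 /= oppr0.
have [m hm] := iso_rigid p1 q1 pq sb g0 g1 r0 (subr0 _) P1.
have [n hn] := iso_rigid p1 q1 pq sb' g0' g1' r0 (subr0 _) P1'.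
exists m, (- n) => l f w a b a0 b1 l0 arc t tI; split; first exact: hm arc _ tI.
have := hn l (f + Pi / 2) w a b a0 b1 l0 (arc_on_rot arc) t tI.
rewrite addrAC eCDhalf// => /=; case: (gam t) => [[x y] z] /= E.
by rewrite -[LHS]opprK E; ring.
Qed.

(* A minimizing concatenation from 0 to g to y, followed by the known arc that closes
   up at (0, 0, Pi r^2), is an equality case of the isoperimetric inequality. *)
Lemma closing_rigid (y g : H) f s r l' f' w' l'' f'' w'' :
  y = expF f s r -> 0 < s < 2 * Pi -> 0 < r ->
  g = harc l' f' w' 1 -> y = heis_mul g (harc l'' f'' w'' 1) -> 0 < l' -> 0 <= l'' ->
  l' + l'' = r * s -> [/\ C f' = C f, S f' = S f & l' = r * w'].
Proof.
move=> yE /andP[s0 s2] r0 gE yg l'0 l''0 ll.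
have [u hu lu] := harc_horizontal l' f' w'.
have [v hv lv] := harc_horizontal l'' f'' w''.
have s2' : 0 < 2 * Pi - s by rewrite subr_gt0.
have rs2 : 0 < r * (2 * Pi - s) by rewrite mulr_gt0.
have [k hk lk] := harc_horizontal (r * (2 * Pi - s)) (f + s) (2 * Pi - s).
have hv' := horizontal_left g hv; have hk' := horizontal_left y hk.
have e1 : (heis_mul g \o harc l'' f'' w'') 1 = (heis_mul y \o harc (r * (2 * Pi - s)) (f + s) (2 * Pi - s)) 0.
  by rewrite /= harc0 heis_mul0.
(* The loop [gb] below follows the first arc on [0, 1/2], the second on [1/2, 3/4] and the closing
   arc on [3/4, 1]; hence the factors 2 and 4. *)
have [ga [v1 [v2 [hga ga1 ga2 lga]]]] := horizontal_cat p0 hv' hk' e1.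
have e2 : harc l' f' w' 1 = ga 0 by rewrite ga1// mulr0 /= harc0 heis_mul0.
have [gb [w1 [w2 [hgb gb1 gb2 lgb]]]] := horizontal_cat p0 hu hga e2.
have h2 : (0 : R) < 2^-1 by rewrite invr_gt0.
have b0 : gb 0 = (0, 0, 0) by rewrite gb1// mulr0 harc0.
have h21 : 2^-1 <= (1 : R) by rewrite invf_le1// ler1n.
have b1 : gb 1 = (0, 0, Pi * r ^+ 2).
  rewrite gb2// (_ : 2 * 1 - 1 = 1); last by ring.
  rewrite ga2// (_ : 2 * 1 - 1 = 1); last by ring.
  rewrite /= -expF_harc// yE expF_cat addrC subrK expF_full//.
have lb : lp_length p w1 w2 = (2 * Pi * r)%:E.
  rewrite lgb lga lu ?(ltW l'0)// lv// lk ?(ltW rs2)// -!EFinD addrA ll; congr (_ %:E); ring.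
have [m [n H]] := rigid_xy r0 hgb lb b0 b1.
have a1 : arc_on gb (2 * l') (f' + w' * 0) (2 * w') 0 2^-1.
  apply: (@arc_on_affine gb (harc l' f' w')); last exact: harc_arc.
    by move=> t /andP[_ t2]; rewrite addr0 gb1.
  by move=> t /andP[t0 t2]; rewrite addr0 mulr_gt0//= -ltr_pdivlMl// mulr1.
pose l3 := r * (2 * Pi - s); pose w3 := 2 * Pi - s.
have gb3 (t : R) : 3 / 4 < t < 1 -> gb t = heis_mul y (harc l3 (f + s) w3 (4 * t + (-3))).
  move=> /andP[t0 t1]; rewrite gb2 ?ga2; [|lra|lra].
  by rewrite /=; congr (heis_mul y (harc _ _ _ _)); ring.
have a3 : arc_on gb (4 * l3) (f + s + w3 * (-3)) (4 * w3) (3 / 4) 1.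
  apply: (@arc_on_affine gb (fun t => heis_mul y (harc l3 (f + s) w3 t)) l3 (f + s) w3 _ _ 4 (-3) gb3).
    by clear -gb3; move=> t /andP[t0 t1]; apply/andP; split; lra.
  by apply: arc_on_left; exact: harc_arc.
(* The closing arc is explicit, so the position at 7/8, the middle of its time interval, gives the
   centre. *)
have [mE nE] : m = - (r * C f) /\ n = - (r * S f).
  have [] := H _ _ _ (3 / 4) 1 _ (lexx 1) _ a3 (7 / 8); [by lra|by rewrite mulr_gt0|by apply/andP; split; lra|].
  rewrite gb3; last by apply/andP; split; lra.
  have -> : f + s + w3 * (-3) + 4 * w3 * (7 / 8) = f + s + w3 * 2^-1 by field.
  have -> : 4 * (7 / 8) + (-3) = 2^-1 :> R by field.
  rewrite /harc gt_eqF// yE /= /l3 mulfK ?gt_eqF// => Em En.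
  clear -Em En; split; [move: Em|move: En]; lra.
(* Near time 1/4 the first arc is known both from its definition and from the rigidity formula. The
   two velocities are multiples of the same vector e', and pairing with e compares the factors. *)
have lw : l' = r * w'.
  have [t tE] : exists t : R, t = 4^-1 by exists 4^-1.
  have tI : 0 < t < 2^-1 by rewrite tE; apply/andP; split; lra.
  have /field_derivP[dx dy _] := a1 t tI.
  set th := f' + w' * 0 + 2 * w' * t in dx dy.
  have da := dD (dcst t (f' + w' * 0)) (dZ (2 * w') (did t)).
  have dC := @dcomp R C (fun t => f' + w' * 0 + 2 * w' * t) t _ _ (eC_derive q1 _) da.
  have dS := @dcomp R S (fun t => f' + w' * 0 + 2 * w' * t) t _ _ (eS_derive q1 _) da.
  have l20 : 0 < 2 * l' by rewrite mulr_gt0.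
  have Ht := H _ _ _ 0 2^-1 (lexx 0) h21 l20 a1.
  have nb : exists2 d, 0 < d & forall y : R, `|y - t| < d -> 0 < y < 2^-1.
    exists 4^-1 => // y' /ltr_normlP[y1 y2]; rewrite tE in y1 y2.
    by apply/andP; split; lra.
  have [d0 d00 dn] := nb.
  have dx' := dnear (dD (dcst t m) (dZ r dC)) (ex_intro2 _ _ d0 d00 (fun y' h => esym (proj1 (Ht y' (dn y' h))))).
  have dy' := dnear (dD (dcst t n) (dZ r dS)) (ex_intro2 _ _ d0 d00 (fun y' h => esym (proj2 (Ht y' (dn y' h))))).
  have Ex := dunique dx dx'; have Ey := dunique dy dy'.
  have := al_ff q1 th; rewrite /al -/th in Ex Ey * => E1.
  have Ex2 : l' * sp (q - 1) (S th) = r * w' * sp (q - 1) (S th) by move: Ex; lra.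
  have Ey2 : l' * sp (q - 1) (C th) = r * w' * sp (q - 1) (C th) by move: Ey; lra.
  rewrite -[LHS]mulr1 -[RHS]mulr1 -E1 !mulrDr !(mulrCA _ (C th)) !(mulrCA _ (S th)).
  by rewrite Ex2 Ey2.
have w'0 : w' != 0 by apply/eqP => w0; move: lw l'0; rewrite w0 mulr0 => ->; rewrite ltxx.
(* The position at 1/4 shows that the circle of the first arc has the same centre, so its initial
   phase agrees with that of the known arc. *)
have [] := H _ _ _ 0 2^-1 (lexx 0) h21 _ a1 4^-1; [by rewrite mulr_gt0|by apply/andP; split; lra|].
rewrite gb1; last by lra.
have -> : f' + w' * 0 + 2 * w' * 4^-1 = f' + w' * 2^-1 by field.
have -> : 2 * 4^-1 = 2^-1 :> R by field.
rewrite /harc (negbTE w'0) /= lw mulfK// mE nE => Em En.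
have rn : r != 0 by rewrite gt_eqF.
split => //; apply: (mulfI rn); lra.
Qed.

End Geodesics.

(** * A chart of the half-space *)

Section Chart.
Context {R : realType}.
Variable q : R.
Hypothesis q1 : 1 < q.
Local Notation C := (eC q).
Local Notation S := (eS q).
Local Notation Pi := (Piq q).
Local Notation crs := (crs q).
Local Notation al := (al q).
Local Notation ga := (ga q).
Local Notation Wq := (Wq q).
Local Notation Dq := (Dq q).
Let q0 : 0 < q. Proof. exact: lt_trans ltr01 q1. Qed.
Let Pi0 : 0 < Pi. Proof. exact: Piq_gt0. Qed.
Implicit Types m f g : R.

(* [psi m] is the parameter at which the unit [l^q] circle has tangent direction [(1, m)]. *)
Definition psiP m f := - Pi < f < 0 /\
  exists2 l : R, 0 < l & - (l * sp (q - 1) (S f)) = 1 /\ l * sp (q - 1) (C f) = m.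

Lemma psi_exists m : exists f, psiP m f.
Proof.
have q10 : q - 1 != 0 by rewrite gt_eqF// subr_gt0.
pose a := sp (q - 1)^-1 m; pose n := (`|a| `^ q + 1) `^ q^-1.
have aq : 0 < `|a| `^ q + 1 by rewrite ltr_wpDl ?powR_ge0.
have n0 : 0 < n by exact: powR_gt0.
have nq : n `^ q = `|a| `^ q + 1 by rewrite /n -powRrM mulVf ?gt_eqF// powRr1// ltW.
have qi : (q - 1)^-1 != 0 by rewrite invr_eq0.
have [|f [fI Cf Sf]] := @e_surj R q q1 (a / n) (- n^-1).
  rewrite normrN !normrM (gtr0_norm (_ : 0 < n^-1)) ?invr_gt0//.
  rewrite powRM ?invr_ge0 ?(ltW n0)// -[X in _ + X]mul1r -mulrDl -nq -powRM ?invr_ge0 ?(ltW n0)//.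
  by rewrite divff ?gt_eqF// powR1.
have Sf0 : S f < 0 by rewrite Sf oppr_lt0 invr_gt0.
exists f; split.
  case/andP: fI => f1 f2; rewrite !lt_neqAle f1 /=; apply/andP; split.
    rewrite andbT; apply/eqP => E; move: Sf0; rewrite -E eSN// -(add0r Pi) eSDPi// eS0// !oppr0 ltxx//.
  apply/andP; split.
  - by apply/eqP => E; move: Sf0; rewrite E eS0// ltxx.
  rewrite leNgt; apply/negP => f0; move: f2; rewrite le_eqVlt => /predU1P[E|f2].
    by move: Sf0; rewrite E -(add0r Pi) eSDPi// eS0// oppr0 ltxx.
  by have := @eS_gt0 R q q1 f; rewrite f0 f2 => /(_ isT); lra.
exists (n `^ (q - 1)); first exact: powR_gt0.
have E x : n `^ (q - 1) * sp (q - 1) (x / n) = sp (q - 1) x.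
  rewrite spM (sp_gt0E _ (_ : 0 < n^-1)) ?invr_gt0// mulrC -mulrA.
  rewrite -powRM ?invr_ge0 ?(ltW n0)// mulVf ?gt_eqF// powR1 mulr1 //.
rewrite Cf Sf -mulrN -spN opprK; split.
  by rewrite -[n^-1]mul1r E sp_gt0E// powR1.
by rewrite E /a sp_sp// mulVf// sp1.
Qed.

Definition psi m : R := xget 0 [set f | psiP m f].

Lemma psi_spec m : psiP m (psi m).
Proof. by have [f Hf] := psi_exists m; rewrite /psi; case: xgetP => [? _ //|/(_ f)]. Qed.

(** The intercept of the line of slope [m] through e(f): two points with distinct first coordinates
    span a chord of slope [m] exactly when their values agree. *)
Definition lev m f := S f - m * C f.

Lemma lev_derive m f : is_derive f 1 (lev m) (sp (q - 1) (C f) + m * sp (q - 1) (S f)).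
Proof. by apply: (dEq (dB (eS_derive q1 f) (dZ m (eC_derive q1 f)))); ring. Qed.

Lemma psi_dir m : exists2 l : R, 0 < l &
  (forall f, sp (q - 1) (C f) + m * sp (q - 1) (S f) = l * ga (psi m) f) /\
  (forall a b, C (psi m) * (m * a + b) - S (psi m) * a = l * a + C (psi m) * b).
Proof.
have [_ [l l0 [E1 E2]]] := psi_spec m; move: (psi m) E1 E2 => s E1 E2.
exists l => //; split.
  by move=> f; have := congr1 (fun x => x * sp (q - 1) (C f)) E1; rewrite -E2 /ga; lra.
move=> a b; have := al_ff q1 s; rewrite /al => /(congr1 (fun x => l * a * x)).
by have := congr1 (fun x => x * (S s * a)) E1; rewrite -E2; lra.
Qed.

Lemma ga_psi_lt0 f g : f - Pi < g < f -> ga f g < 0.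
Proof. by move=> /andP[h1 h2]; rewrite gaC oppr_lt0; apply: ga_gt0 => //; rewrite h2/= -ltrBlDr. Qed.

(** By [psi_dir] the derivative of [lev m] is a positive multiple of [ga (psi m)]. So [lev m] falls
    before [psi m] and rises after it, and every intermediate level is taken once on each branch. *)
Lemma lev_incr m f g : psi m <= f -> f < g -> g <= psi m + Pi -> lev m f < lev m g.
Proof.
move=> h1 h2 h3; have [l l0 [Hl _]] := psi_dir m.
apply: (is_derive_incr h2 (fun x _ => dcontinuous (lev_derive m x)) (fun x _ => lev_derive m x)).
by move=> x /andP[x1 x2]; rewrite Hl mulr_gt0// ga_gt0//; apply/andP; split; lra.
Qed.

Lemma lev_decr m f g : psi m - Pi <= f -> f < g -> g <= psi m -> lev m g < lev m f.
Proof.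
move=> h1 h2 h3; have [l l0 [Hl _]] := psi_dir m; rewrite -ltrN2.
apply: (is_derive_incr h2 (fun x _ => dcontinuous (dN (lev_derive m x))) (fun x _ => dN (lev_derive m x))).
move=> x /andP[x1 x2]; rewrite Hl -mulrN mulr_gt0// oppr_gt0 ga_psi_lt0//; apply/andP; split; lra.
Qed.

Lemma levDPi m f : lev m (f + Pi) = - lev m f.
Proof. by rewrite /lev eSDPi// eCDPi//; ring. Qed.

(* The second endpoint of the chord of slope m of the unit circle that starts at e(f). *)
Definition opp m f : R := xget 0 [set g | psi m < g < psi m + Pi /\ lev m g = lev m f].

Lemma opp_spec m f : psi m - Pi < f < psi m -> psi m < opp m f < psi m + Pi /\ lev m (opp m f) = lev m f.
Proof.
move=> /andP[f1 f2].
have L1 : lev m (psi m) < lev m f by apply: lev_decr => //; exact: ltW.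
have L2 : lev m f < lev m (psi m + Pi).
  have -> : lev m (psi m + Pi) = lev m (psi m - Pi).
    by rewrite levDPi -[X in lev m X](subrK Pi) levDPi opprK.
  by apply: lev_decr => //; exact: ltW.
have [g /andP[g1 g2] gE] := @ivt R (lev m) (psi m) (psi m + Pi) (lev m f) ltac:(lra)
  (fun x => dcontinuous (lev_derive m x)) ltac:(by rewrite !ltW).
have P1 : psi m < g < psi m + Pi.
  rewrite !lt_neqAle g1 g2 !andbT; apply/andP; split; apply/eqP => E.
    by move: L1; rewrite -gE E ltxx.
  by move: L2; rewrite -gE E ltxx.
by rewrite /opp; case: xgetP => [? _ //|/(_ g)]; case.
Qed.

Lemma opp_uniq m f g : psi m - Pi < f < psi m -> psi m < g < psi m + Pi -> lev m g = lev m f ->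
  opp m f = g.
Proof.
move=> fI /andP[g1 g2] gE; have [/andP[u1 u2] oE] := opp_spec fI.
have [lt1|lt1|//] := ltgtP (opp m f) g.
  have := lev_incr (ltW u1) lt1 (ltW g2); lra.
have := lev_incr (ltW g1) lt1 (ltW u2); lra.
Qed.

(** [opp m] is [lev m] on the falling branch followed by the inverse of [lev m] on the rising
    one. *)
Lemma opp_derive m (f : R) : psi m - Pi < f < psi m ->
  is_derive f 1 (opp m) (ga (psi m) f / ga (psi m) (opp m f)).
Proof.
move=> fI; have [oI oE] := opp_spec fI; have /andP[u1 u2] := oI; have /andP[f1 f2] := fI.
have [l l0 [Hl _]] := psi_dir m.
have g0 : 0 < ga (psi m) (opp m f) by exact: ga_gt0.
pose G v := xget 0 [set g | psi m < g < psi m + Pi /\ lev m g = v].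
have GE g : psi m < g < psi m + Pi -> G (lev m g) = g.
  move=> gI; rewrite /G; case: xgetP => [g' _ [g'I g'E]|/(_ g)]; last by case.
  have /andP[h1 h2] := gI; have /andP[h1' h2'] := g'I.
  have [lt1|lt1|//] := ltgtP g' g.
    have := lev_incr (ltW h1') lt1 (ltW h2); lra.
  have := lev_incr (ltW h1) lt1 (ltW h2'); lra.
have dG : is_derive (lev m (opp m f)) 1 G (sp (q - 1) (C (opp m f)) + m * sp (q - 1) (S (opp m f)))^-1.
  apply: is_derive_inverse.
  - near=> g; apply: GE; apply/andP; split; near: g; [exact: lt_nbhsr|exact: lt_nbhsl].
  - by apply: (@filterE _ (nbhs (opp m f)) _) => x; exact: dcontinuous (lev_derive m x).
  - exact: lev_derive.
  - by rewrite Hl mulf_neq0// gt_eqF.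
rewrite oE in dG.
apply: (dnear (dEq (@dcomp R G (lev m) f _ _ dG (lev_derive m f)) _)).
  by rewrite !Hl; field; rewrite !gt_eqF.
exists (Num.min (f - (psi m - Pi)) (psi m - f)); first by rewrite lt_min !subr_gt0 f1 f2.
move=> y; rewrite lt_min !ltr_norml => /andP[/andP[y1 y2] /andP[y3 y4]].
have yI : psi m - Pi < y < psi m by apply/andP; split; lra.
by have [oy Ey] := opp_spec yI; rewrite -Ey GE.
Unshelve. all: by end_near. Qed.

Lemma chord m f : psi m - Pi < f < psi m -> let g := opp m f in
  [/\ f < g < f + 2 * Pi, 0 < C g - C f & S g - S f = m * (C g - C f)].
Proof.
move=> fI g; have [oI oE] := opp_spec fI; have /andP[u1 u2] := oI; have /andP[f1 f2] := fI.
have SE : S g - S f = m * (C g - C f) by move: oE; rewrite /lev -/g; lra.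
split => //; first by rewrite /g; apply/andP; split; lra.
have [l l0 [_ Hl]] := psi_dir m; rewrite -(pmulr_rgt0 _ l0).
have := Hl (C g - C f) 0; rewrite addr0 -SE mulr0 addr0 => <-.
have c1 : 0 < crs (psi m) g by exact: crs_gt0.
have c2 : 0 < crs f (psi m) by apply: crs_gt0 => //; apply/andP; split; lra.
move: c1 c2; rewrite /crs; lra.
Qed.

(* The value of z / x^2 at the points F(f, s, r) for which y / x = m; with
   m = y / x it makes f a coordinate in place of z. *)
Definition zet m f := Wq f (opp m f) / (2 * (C (opp m f) - C f) ^+ 2).

Definition zetD m f := Dq f (opp m f) / ((C (opp m f) - C f) ^+ 2 * (1 - al f (opp m f))).

Lemma zet_derive m (f : R) : psi m - Pi < f < psi m -> is_derive f 1 (zet m) (- zetD m f).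
Proof.
move=> fI; have [oI oE] := opp_spec fI; have [gI k0 kE] := chord fI.
have dopp := opp_derive fI; set g := opp m f in oI oE gI k0 kE dopp *.
have [l l0 [Hl _]] := psi_dir m.
have P1 : 0 < l * ga (psi m) g by rewrite mulr_gt0// ga_gt0.
have oP : ga (psi m) f / ga (psi m) g =
    (sp (q - 1) (C f) + m * sp (q - 1) (S f)) / (sp (q - 1) (C g) + m * sp (q - 1) (S g)).
  by rewrite !Hl; field; rewrite !gt_eqF// -(pmulr_rgt0 _ l0).
rewrite oP in dopp; rewrite -Hl in P1.
(* Because the chord has slope [m], both [1 - al f g] and [1 - al g f] contain its width as a
   factor. *)
have alE : 1 - al f g = (C g - C f) * (sp (q - 1) (C g) + m * sp (q - 1) (S g)).
  have := al_ff q1 g; have := congr1 (fun x => x * sp (q - 1) (S g)) kE; rewrite /al; lra.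
have beE : 1 - al g f = - ((C g - C f) * (sp (q - 1) (C f) + m * sp (q - 1) (S f))).
  have := al_ff q1 f; have := congr1 (fun x => x * sp (q - 1) (S f)) kE; rewrite /al; lra.
have dC := @dcomp R C (opp m) f _ _ (eC_derive q1 _) dopp.
have dS := @dcomp R S (opp m) f _ _ (eS_derive q1 _) dopp.
have dk := dB dC (eC_derive q1 f).
have dW := dB (dB dopp (did f)) (dB (dM (eC_derive q1 f) dS) (dM (eS_derive q1 f) dC)).
have dW' := @dEq R (fun f => Wq f (opp m f)) _ _ (- 2 * (1 - al g f)) dW _.
have k2 : 2 * ((C g - C f) * (C g - C f)) != 0 by rewrite !mulf_neq0// gt_eqF.
have dV2 := @dV R (fun f => 2 * ((C (opp m f) - C f) * (C (opp m f) - C f))) f _ k2 (dZ 2 (dM dk dk)).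
apply: (dEq (dM (dW' _) dV2)).
  transitivity ((1 - al f g) * ((sp (q - 1) (C f) + m * sp (q - 1) (S f)) /
     (sp (q - 1) (C g) + m * sp (q - 1) (S g))) - (1 - al g f)).
    by rewrite /al; ring.
  by rewrite alE beE; field; rewrite gt_eqF.
rewrite /zetD -/g /Dq alE beE /ga; move: k0 P1; move: (Wq f g) (C g - C f).
move: (sp _ (C f)) (sp _ (S f)) (sp _ (C g)) (sp _ (S g)) => a b a1 b1 W k k0 P1.
by field; rewrite !gt_eqF.
Qed.

Lemma zet_gt0 m f : psi m - Pi < f < psi m -> 0 < zet m f.
Proof.
move=> fI; have [gI k0 _] := chord fI; rewrite /zet divr_gt0 ?Wq_gt0//.
by rewrite mulr_gt0// exprn_gt0.
Qed.

Lemma zetD_gt0 m f : psi m - Pi < f < psi m -> 0 < zetD m f.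
Proof.
move=> fI; have [gI k0 _] := chord fI; rewrite /zetD divr_gt0 ?Dq_gt0//.
by rewrite mulr_gt0 ?exprn_gt0// subr_gt0 al_lt1.
Qed.

Lemma zetD_continuous m f : psi m - Pi < f < psi m -> {for f, continuous (zetD m)}.
Proof.
move=> fI; have [gI k0 _] := chord fI.
have co := dcontinuous (opp_derive fI).
have cC : {for f, continuous (C \o opp m)}.
  by apply: continuous_comp => //; exact: dcontinuous (eC_derive q1 _).
have cS : {for f, continuous (S \o opp m)}.
  by apply: continuous_comp => //; exact: dcontinuous (eS_derive q1 _).
have cC0 : {for f, continuous C} by exact: dcontinuous (eC_derive q1 _).
have cS0 : {for f, continuous S} by exact: dcontinuous (eS_derive q1 _).
have csC : {for f, continuous ((fun g => sp (q - 1) (C g)) \o opp m)}.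
  by apply: continuous_comp => //; exact: continuous_spC.
have csS : {for f, continuous ((fun g => sp (q - 1) (S g)) \o opp m)}.
  by apply: continuous_comp => //; exact: continuous_spS.
have csC0 := @continuous_spC R q q1 f; have csS0 := @continuous_spS R q q1 f.
have c1 : {for f, continuous (fun f => al f (opp m f))}.
  by apply: continuousD; apply: continuousM.
have c2 : {for f, continuous (fun f => al (opp m f) f)}.
  by apply: continuousD; apply: continuousM.
have c3 : {for f, continuous (fun f => ga f (opp m f))}.
  by apply: continuousB; apply: continuousM.
have c4 : {for f, continuous (fun f => crs f (opp m f))}.
  by apply: continuousB; apply: continuousM.
have cid : {for f, continuous (fun f : R => f)} by [].
have cw : {for f, continuous (fun f => Wq f (opp m f))}.
  by apply: continuousB => //; apply: continuousB.
have cc : {for f, continuous (fun=> 1 : R)} by exact: cst_continuous.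
have ck : {for f, continuous (fun f => C (opp m f) - C f)} by apply: continuousB.
apply: continuousM.
  by apply: continuousB; apply: continuousM => //; apply: continuousB.
apply: continuousV.
  by rewrite mulf_neq0 ?expf_neq0 ?gt_eqF// subr_gt0 al_lt1.
apply: continuousM; last by apply: continuousB.
exact: continuousM.
Qed.

Definition slope f g := (S g - S f) / (C g - C f).

Lemma slope_derive f (g : R) : C g - C f != 0 ->
  is_derive g 1 (slope f) ((1 - al f g) / (C g - C f) ^+ 2).
Proof.
move=> k0; have d1 := dB (eS_derive q1 g) (dcst g (S f)).
have d2 := @dV R (fun g => C g - C f) g _ k0 (dB (eC_derive q1 g) (dcst g (C f))).
apply: (dEq (dM d1 d2)); have := al_ff q1 g; rewrite /al.
set A := sp _ (C g); set B := sp _ (S g); move: A B => A B E.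
by rewrite -[X in _ = (X - _) / _]E; field.
Qed.

Lemma eC_decr f g : 0 <= f -> f < g -> g <= Pi -> C g < C f.
Proof.
move=> f0 fg gP; rewrite -ltrN2.
apply: (is_derive_incr fg (fun x _ => dcontinuous (dN (eC_derive q1 x))) (fun x _ => dN (eC_derive q1 x))).
by move=> x /andP[x1 x2]; rewrite opprK sp_gt0// eS_gt0//; apply/andP; split; lra.
Qed.

(* C f < C g iff `|g| < rad f: the endpoints g for which F(f, g - f, r) has x > 0. *)
Definition rad f := Num.min (- f) (2 * Pi + f).

Lemma rad_gt0 f : -(2 * Pi) < f < 0 -> 0 < rad f.
Proof. by move=> /andP[h1 h2]; rewrite /rad lt_min oppr_gt0 h2/=; lra. Qed.

(** [C] is even, has period [2 * Pi] and decreases on [0, Pi]; [rad f] represents [f] in that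
    interval. *)
Lemma eC_rad f g : -(2 * Pi) < f < 0 -> f < g < f + 2 * Pi -> (C f < C g) = (`|g| < rad f).
Proof.
move=> /andP[f1 f2] /andP[g1 g2].
have [rP rC rf] : [/\ rad f <= Pi, C (rad f) = C f & - rad f <= f \/ rad f = 2 * Pi + f].
  rewrite /rad; have [h|h] := leP (- f) (2 * Pi + f); split; try lra.
  - by rewrite eCN.
  - by rewrite addrC eCD2Pi.
have r0 : 0 < rad f by apply: rad_gt0; apply/andP.
have rf1 : rad f <= - f by rewrite /rad ge_min lexx.
have rf2 : rad f <= 2 * Pi + f by rewrite /rad ge_min lexx orbT.
have gC : C g = C `|g| by case: (ger0P g) => // _; rewrite eCN.
have [gr|gr] := ltP `|g| (rad f); first by rewrite -rC gC eC_decr.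
apply/negbTE; rewrite -leNgt -rC.
have gB : `|g| <= 2 * Pi - rad f.
  by case: (ger0P g) => gs; [case: rf => ?; lra|lra].
rewrite gC; have [gP|gP] := leP `|g| Pi.
  move: gr; rewrite le_eqVlt => /predU1P[->//|gr].
  by apply/ltW/eC_decr => //; exact: ltW.
have -> : C `|g| = C (2 * Pi - `|g|).
  by rewrite -(eCN q1 (2 * Pi - `|g|)) opprB -(eCD2Pi q1 (`|g| - 2 * Pi)) subrK.
move: gB; rewrite le_eqVlt => /predU1P[->|gB]; first by rewrite opprB addrC subrK.
by apply/ltW/eC_decr; lra.
Qed.

(** Together with [chart_bwd], a bijection between the pairs (m, f) with [f] on the falling branch
    of [lev m] and the pairs (f, g) with [-(2 * Pi) < f < 0] and [|g| < rad f]. It exchanges the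
    slope for the second endpoint in the area formula. *)
Lemma chart_fwd m f : psi m - Pi < f < psi m ->
  [/\ -(2 * Pi) < f < 0, `|opp m f| < rad f & slope f (opp m f) = m].
Proof.
move=> fI; have [gI k0 kE] := chord fI; have [/andP[s1 s2] _] := psi_spec m.
have /andP[f1 f2] := fI.
have fJ : -(2 * Pi) < f < 0 by apply/andP; split; lra.
split => //; first by rewrite -eC_rad// -subr_gt0.
by rewrite /slope kE mulfK// gt_eqF.
Qed.

Lemma crs_ge0 f g : f <= g <= f + Pi -> 0 <= crs f g.
Proof.
move=> /andP[]; rewrite le_eqVlt => /predU1P[->|fg]; first by rewrite /crs mulrC subrr.
rewrite le_eqVlt => /predU1P[->|gf]; first by rewrite crsDPi// /crs mulrC subrr oppr0.
by apply/ltW/crs_gt0 => //; rewrite fg.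
Qed.

Lemma lev2Pi m f : lev m (f + 2 * Pi) = lev m f.
Proof. by rewrite (_ : f + 2 * Pi = f + Pi + Pi) ?levDPi ?opprK//; ring. Qed.

Lemma chart_bwd f g : -(2 * Pi) < f < 0 -> `|g| < rad f ->
  psi (slope f g) - Pi < f < psi (slope f g) /\ opp (slope f g) f = g.
Proof.
move=> fI gr; have /andP[f1 f2] := fI.
have [rf1 rf2] : rad f <= - f /\ rad f <= 2 * Pi + f by rewrite /rad !ge_min !lexx orbT.
have gI : f < g < f + 2 * Pi by move: gr; rewrite ltr_norml => /andP[? ?]; apply/andP; split; lra.
have k0 : C f < C g by rewrite eC_rad.
set m := slope f g.
have kE : S g - S f = m * (C g - C f) by rewrite /m /slope divfK// subr_eq0 gt_eqF.
have levE : lev m g = lev m f by move: kE; rewrite /lev; lra.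
have [l l0 [_ Hl]] := psi_dir m; have [/andP[s1 s2] _] := psi_spec m.
(* The chord points in the direction of e' at [psi m], so the cross product with e at [psi m]
   increases from [f] to [g]. Comparing its signs excludes the wrong branches. *)
have kap : crs (psi m) f < crs (psi m) g.
  have := Hl (C g - C f) 0; rewrite addr0 -kE mulr0 addr0 /crs => E.
  rewrite -subr_gt0 (_ : _ - _ = C (psi m) * (S g - S f) - S (psi m) * (C g - C f)); last by ring.
  by rewrite E mulr_gt0// subr_gt0.
have inc x y : psi m <= x -> x < y -> y <= psi m + Pi -> lev m x = lev m y -> False.
  by move=> h1 h2 h3 E; have := lev_incr h1 h2 h3; rewrite E ltxx.
have dec x y : psi m - Pi <= x -> x < y -> y <= psi m -> lev m x = lev m y -> False.
  by move=> h1 h2 h3 E; have := lev_decr h1 h2 h3; rewrite E ltxx.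
have crs2 x : crs (psi m) (x + 2 * Pi) = crs (psi m) x by rewrite /crs eCD2Pi// eSD2Pi.
have cpos x : psi m <= x <= psi m + Pi -> 0 <= crs (psi m) x by exact: crs_ge0.
have cneg x : psi m - Pi <= x <= psi m -> crs (psi m) x <= 0.
  by clear -q1 cpos; move=> /andP[? ?]; rewrite -oppr_ge0 -crsDPi// cpos//; apply/andP; split; lra.
have levE' : lev m (g - 2 * Pi) = lev m f by rewrite -levE -(lev2Pi m (g - 2 * Pi)) subrK.
have /andP[g1 g2] := gI.
have fpsi : f < psi m.
  rewrite ltNge; apply/negP => fs.
  have c0 := cpos f ltac:(clear -f2 s1 fs; apply/andP; split; lra).
  have [h|h] := leP g (psi m + Pi); first exact: (inc f g).
  have [h'|h'] := leP g (psi m + 2 * Pi).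
    have := cneg (g - 2 * Pi) ltac:(clear -h h'; apply/andP; split; lra).
    by clear -kap crs2 c0; rewrite -crs2 subrK; lra.
  by apply: (inc (g - 2 * Pi) f) => //; clear -h' f2 s1 fs g2; lra.
have psif : psi m - Pi < f.
  rewrite ltNge; apply/negP => fs.
  have c0 := cpos (f + 2 * Pi) ltac:(clear -f1 s2 fs; apply/andP; split; lra); rewrite crs2 in c0.
  have [h|h] := leP g (psi m - Pi).
    by apply: (inc (f + 2 * Pi) (g + 2 * Pi)); rewrite ?lev2Pi//; lra.
  have [h'|h'] := leP g (psi m).
    have := cneg g ltac:(clear -h h'; apply/andP; split; lra); clear -kap c0; lra.
  by apply: (inc g (f + 2 * Pi)); rewrite ?lev2Pi//; lra.
have fJ : psi m - Pi < f < psi m by rewrite psif.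
split => //; apply: opp_uniq => //; apply/andP; split; rewrite ltNge; apply/negP => h.
  by apply: (dec f g) => //; exact: ltW.
by apply: (dec (g - 2 * Pi) f) => //; lra.
Qed.

Lemma opp_surj m g : psi m < g < psi m + Pi -> exists2 f, psi m - Pi < f < psi m & opp m f = g.
Proof.
move=> gI; have /andP[g1 g2] := gI.
have L1 : lev m (psi m) < lev m g by apply: lev_incr => //; exact: ltW.
have L2 : lev m g < lev m (psi m - Pi).
  by rewrite -(lev2Pi m (psi m - Pi)) (_ : _ + 2 * Pi = psi m + Pi); [apply: lev_incr => //; exact: ltW|ring].
have [f /andP[f1 f2] fE] := @ivt R (fun x => - lev m x) (psi m - Pi) (psi m) (- lev m g) ltac:(lra)
  (fun x => dcontinuous (dN (lev_derive m x))) ltac:(by rewrite !lerN2 !ltW).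
have {}fE : lev m f = lev m g by rewrite -[LHS]opprK fE opprK.
have fI : psi m - Pi < f < psi m.
  rewrite !lt_neqAle f1 f2 !andbT; apply/andP; split; apply/eqP => E.
    by move: L2; rewrite -fE E ltxx.
  by move: L1; rewrite -fE E ltxx.
by exists f => //; apply: opp_uniq.
Qed.

Lemma opp_decr m f f' : psi m - Pi < f -> f < f' -> f' < psi m -> opp m f' < opp m f.
Proof.
move=> h1 h2 h3.
have [|/andP[a1 a2] aE] := @opp_spec m f; first by apply/andP; split; lra.
have [|/andP[b1 b2] bE] := @opp_spec m f'; first by apply/andP; split; lra.
have lt1 := lev_decr (ltW h1) h2 (ltW h3); rewrite ltNge; apply/negP => le1.
move: lt1; rewrite -aE -bE ltNge => /negP; apply; move: le1.
by rewrite le_eqVlt => /predU1P[->//|lt2]; exact/ltW/lev_incr/ltW/b2/lt2/ltW.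
Qed.

(** [opp m] is decreasing and onto, so moving [f] to the left moves both ends of the chord apart and
    a single [f] meets both bounds. [near_pick] is the opposite motion. *)
Lemma far_pick m f1 g1 : psi m - Pi < f1 < psi m -> psi m < g1 < psi m + Pi ->
  exists f, [/\ psi m - Pi < f <= f1 & g1 <= opp m f].
Proof.
move=> fI gI; have [f' f'I f'E] := opp_surj gI; have /andP[? ?] := fI; have /andP[? ?] := f'I.
have [h|h] := leP f1 f'; last by exists f'; rewrite f'E; split => //; apply/andP; split; lra.
exists f1; split; first by apply/andP; split; lra.
rewrite -f'E; move: h; rewrite le_eqVlt => /predU1P[->//|h]; exact/ltW/opp_decr.
Qed.

Lemma near_pick m f1 g1 : psi m - Pi < f1 < psi m -> psi m < g1 < psi m + Pi ->
  exists f, [/\ f1 <= f < psi m & opp m f <= g1].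
Proof.
move=> fI gI; have [f' f'I f'E] := opp_surj gI; have /andP[? ?] := fI; have /andP[? ?] := f'I.
have [h|h] := leP f' f1; last by exists f'; rewrite f'E; split => //; apply/andP; split; lra.
exists f1; split; first by apply/andP; split; lra.
rewrite -f'E; move: h; rewrite le_eqVlt => /predU1P[->//|h]; exact/ltW/opp_decr.
Qed.

(** Expresses the width of the chord through cross products with the fixed point e(psi m), which are
    continuous up to the ends of the branches. *)
Lemma wid m f : psi m - Pi < f < psi m -> exists2 l : R, 0 < l &
  (forall f, psi m - Pi < f < psi m ->
    l * (C (opp m f) - C f) = crs (psi m) (opp m f) + crs f (psi m)).
Proof.
move=> _; have [l l0 [_ Hl]] := psi_dir m; exists l => // f' fI.
have [_ _ kE] := chord fI; have := Hl (C (opp m f') - C f') 0.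
by rewrite addr0 -kE mulr0 addr0 => <-; rewrite /crs; ring.
Qed.

(** As [f] and [opp m f] approach [psi m - Pi] and [psi m + Pi], the width of the chord tends to 0,
    while the segment it cuts off keeps the area of a fixed smaller one. *)
Lemma zet_large m M : exists2 f, psi m - Pi < f < psi m & M <= zet m f.
Proof.
have Pi0' : 0 < Pi by [].
have mid : psi m - Pi < psi m - Pi / 2 < psi m by apply/andP; split; lra.
have [l l0 Hl] := wid mid.
pose w := Wq (psi m - Pi / 2) (psi m).
have w0 : 0 < w by apply: Wq_gt0 => //; apply/andP; split; lra.
pose K := `|M| + 1; have K0 : 0 < K by rewrite /K ltr_wpDl.
have [e e0 eE] : exists2 e : R, 0 < e & 2 * (2 * e / l) ^+ 2 * K <= w.
  exists (Num.min 1 (w * l ^+ 2 / (8 * K))).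
    by rewrite lt_min ltr01 divr_gt0 ?mulr_gt0 ?exprn_gt0.
  set e := Num.min _ _; have e1 : e <= 1 by rewrite ge_min lexx.
  have e2 : e <= w * l ^+ 2 / (8 * K) by rewrite ge_min lexx orbT.
  have ep : 0 < e by rewrite lt_min ltr01 divr_gt0 ?mulr_gt0 ?exprn_gt0.
  rewrite ler_pdivlMr ?mulr_gt0// in e2.
  rewrite expr_div_n mulrA mulrAC ler_pdivrMr ?exprn_gt0//; apply: le_trans e2.
  rewrite (_ : 2 * (2 * e) ^+ 2 * K = (e * (8 * K)) * e); last by ring.
  by rewrite ler_piMr// !mulr_ge0// ltW.
have cont1 : {for psi m - Pi, continuous (fun f => crs f (psi m))}.
  exact: dcontinuous (crs_derivel q1 (psi m - Pi) (psi m)).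
have cont2 : {for psi m + Pi, continuous (crs (psi m))}.
  exact: dcontinuous (crs_derive q1 (psi m) (psi m + Pi)).
have E1 : crs (psi m - Pi) (psi m) = 0.
  by rewrite -[X in crs _ X](subrK Pi) crsDPi// /crs mulrC subrr oppr0.
have E2 : crs (psi m) (psi m + Pi) = 0 by rewrite crsDPi// /crs mulrC subrr oppr0.
have /cts_epsP/(_ e e0)[d1 d10 H1] := cont1; have /cts_epsP/(_ e e0)[d2 d20 H2] := cont2.
pose f1 := psi m - Pi + Num.min (Pi / 2) (d1 / 2).
pose g1 := psi m + Pi - Num.min (Pi / 2) (d2 / 2).
have m1 : 0 < Num.min (Pi / 2) (d1 / 2) by rewrite lt_min !divr_gt0.
have m2 : 0 < Num.min (Pi / 2) (d2 / 2) by rewrite lt_min !divr_gt0.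
have m11 : Num.min (Pi / 2) (d1 / 2) <= Pi / 2 by rewrite ge_min lexx.
have m12 : Num.min (Pi / 2) (d1 / 2) <= d1 / 2 by rewrite ge_min lexx orbT.
have m21 : Num.min (Pi / 2) (d2 / 2) <= Pi / 2 by rewrite ge_min lexx.
have m22 : Num.min (Pi / 2) (d2 / 2) <= d2 / 2 by rewrite ge_min lexx orbT.
have [f [/andP[f0 ff] gg]] := @far_pick m f1 g1 ltac:(clear -m1 m11 Pi0'; apply/andP; rewrite /f1; split; lra)
   ltac:(clear -m2 m21 Pi0'; apply/andP; rewrite /g1; split; lra).
have fI : psi m - Pi < f < psi m by clear -f0 ff m11 Pi0'; apply/andP; split => //; rewrite /f1 in ff; lra.
exists f => //; have [gI k0 _] := chord fI; have [/andP[u1 u2] _] := opp_spec fI.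
have c1 : crs f (psi m) <= e.
  have := H1 f ltac:(clear -f0 ff m12 d10; rewrite ltr_norml; apply/andP; rewrite /f1 in ff; split; lra).
  by rewrite E1 subr0 => /(le_trans (ler_norm _)).
have c2 : crs (psi m) (opp m f) <= e.
  have := H2 (opp m f) ltac:(clear -gg u2 m22 d20; rewrite ltr_norml; apply/andP; rewrite /g1 in gg; split; lra).
  by rewrite E2 subr0 => /(le_trans (ler_norm _)).
have kl : C (opp m f) - C f <= 2 * e / l by rewrite ler_pdivlMr// mulrC Hl//; clear -c1 c2; lra.
have Wle : w <= Wq f (opp m f).
  apply: (@le_trans _ _ (Wq f (psi m))).
    rewrite -lerN2; apply: (is_derive_nondecr _ (fun x _ => dcontinuous (dN (Wq_derivel q1 x (psi m)))) (fun x _ => dN (Wq_derivel q1 x (psi m)))).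
      clear -ff m11; rewrite /f1 in ff; lra.
    by move=> x _; rewrite opprK subr_ge0 al_le1.
  apply: (is_derive_nondecr _ (fun x _ => dcontinuous (Wq_derive q1 f x)) (fun x _ => Wq_derive q1 f x)).
    exact: ltW.
  by move=> x _; rewrite subr_ge0 al_le1.
rewrite /zet ler_pdivlMr ?mulr_gt0 ?exprn_gt0//; apply: le_trans Wle; apply: le_trans eE.
apply: (@le_trans _ _ (K * (2 * (C (opp m f) - C f) ^+ 2))).
  by apply: ler_wpM2r; [rewrite mulr_ge0 ?sqr_ge0|rewrite /K; have := ler_norm M; clear -K0; lra].
rewrite mulrC; apply: ler_wpM2r; first exact: ltW.
rewrite ler_pM2l// ler_sqr ?nnegrE//; [exact: ltW|by rewrite divr_ge0// ?mulr_ge0// ltW].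
Qed.

(** The derivative of [al] in its first argument is [ga], which is continuous and vanishes on the
    diagonal; the mean value theorem gives a bound uniform near [s]. *)
Lemma one_sub_al_small s e : 0 < e -> exists2 d, 0 < d & forall x y,
  `|x - s| < d -> `|y - s| < d -> 1 - al x y <= e * `|y - x|.
Proof.
move=> e0; set a := sp (q - 1) (C s); set b := sp (q - 1) (S s).
pose M := `|a| + `|b| + 1; have M0 : 0 < M by rewrite /M ltr_wpDl// addr_ge0.
pose n := Num.min 1 (e / (2 * M)); have n0 : 0 < n by rewrite lt_min ltr01 divr_gt0// mulr_gt0.
have n1 : n <= 1 by rewrite ge_min lexx.
have n2 : n * (2 * M) <= e by rewrite -ler_pdivlMr ?mulr_gt0// ge_min lexx orbT.
have /cts_epsP/(_ n n0)[d1 d10 H1] := @continuous_spC R q q1 s.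
have /cts_epsP/(_ n n0)[d2 d20 H2] := @continuous_spS R q q1 s.
have ga_le x y : `|x - s| < Num.min d1 d2 -> `|y - s| < Num.min d1 d2 -> `|ga x y| <= e.
  rewrite !lt_min => /andP[x1 x2] /andP[y1 y2]; rewrite /ga.
  have := H1 x x1; have := H1 y y1; have := H2 x x2; have := H2 y y2.
  rewrite -/a -/b; move: (sp _ (C x)) (sp _ (S x)) (sp _ (C y)) (sp _ (S y)) => a1 b1 a2 b2.
  move=> h4 h3 h2 h1; apply: le_trans n2.
  have -> : a1 * b2 - b1 * a2 = (a1 - a) * b + a * (b2 - b) + (a1 - a) * (b2 - b)
     - ((b1 - b) * a + b * (a2 - a) + (b1 - b) * (a2 - a)) by ring.
  apply: le_trans (ler_normB _ _) _.
  have k (u v c d : R) : `|u| <= n -> `|v| <= n -> `|u * c + d * v + u * v| <= n * (`|c| + `|d| + 1).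
    move=> hu hv; apply: le_trans (ler_normD _ _) _.
    have i1 := ler_normD (u * c) (d * v); rewrite !normrM in i1 *.
    have j1 := ler_wpM2r (normr_ge0 c) hu; have j2 := ler_wpM2l (normr_ge0 d) hv.
    have j3 : `|u| * `|v| <= n * 1.
      by apply: ler_pM => //; exact: le_trans hv n1.
    lra.
  have := k _ _ b a h1 h4; have := k _ _ a b h3 h2; rewrite /M.
  by move=> *; lra.
exists (Num.min d1 d2); first by rewrite lt_min d10.
move=> x y xd yd; have [<-|] := eqVneq x y; first by rewrite al_ff// !subrr normr0 mulr0.
have der := fun t (_ : True) => al_derivel q1 t y.
have btw c : (x < c < y) || (y < c < x) -> `|c - s| < Num.min d1 d2.
  by move: xd yd; rewrite !ltr_norml => /andP[? ?] /andP[? ?] /orP[|] /andP[? ?];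
    apply/andP; split; lra.
rewrite -(al_ff q1 y) neq_lt => /orP[xy|yx].
  have [c cI ->] := mvt xy (fun t _ => dcontinuous (al_derivel q1 t y)) (fun t _ => al_derivel q1 t y).
  rewrite (gtr0_norm (_ : 0 < y - x)) ?subr_gt0// ler_pM2r ?subr_gt0//.
  by apply: le_trans (ler_norm _) _; apply: ga_le => //; apply: btw; rewrite cI.
have [c cI E] := mvt yx (fun t _ => dcontinuous (al_derivel q1 t y)) (fun t _ => al_derivel q1 t y).
rewrite -opprB E -mulNr distrC (gtr0_norm (_ : 0 < x - y)) ?subr_gt0// ler_pM2r ?subr_gt0//.
apply: le_trans (ler_norm _) _; rewrite normrN; apply: ga_le => //; apply: btw; rewrite cI orbT //.
Qed.

(** Near the tangent point the area of the segment is small compared with the square of the width of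
    the chord. *)
Lemma zet_small m e : 0 < e -> exists2 f, psi m - Pi < f < psi m & zet m f <= e.
Proof.
move=> e0; have Pi0' : 0 < Pi by [].
have mid : psi m - Pi < psi m - Pi / 2 < psi m by apply/andP; split; lra.
have [l l0 Hl] := wid mid; set s := psi m in mid Hl *.
(* The estimates below give a [Wq] of at most n (8 l^2 + 2 l) k^2 for a chord of width [k], hence
   [zet] is at most n (4 l^2 + l) = e. *)
pose n := e / (4 * l ^+ 2 + l); have n0 : 0 < n by rewrite divr_gt0// addr_gt0// mulr_gt0// exprn_gt0.
have nE : n * (4 * l ^+ 2 + l) = e by rewrite /n divfK// gt_eqF// addr_gt0// mulr_gt0// exprn_gt0.
have [d1 d10 H1] := one_sub_al_small s n0.
have h2 : (0 : R) < 2^-1 by rewrite invr_gt0.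
have /is_derive_epsP/(_ _ h2)[d2 d20 H2] := crs_derive q1 s s.
have /is_derive_epsP/(_ _ h2)[d3 d30 H3] := crs_derivel q1 s s.
have /is_derive_epsP/(_ _ n0)[d4 d40 H4] := lev_derive m s.
have ls : sp (q - 1) (C s) + m * sp (q - 1) (S s) = 0.
  have [l' _ [-> _]] := psi_dir m; rewrite -/s /ga; ring.
have [d [d0 dP D1 D2 [D3 D4]]] : exists d, [/\ 0 < d, d < Pi, d < d1, d < d2 & d < d3 /\ d < d4].
  pose M := Num.min (Num.min Pi d1) (Num.min d2 (Num.min d3 d4)).
  have M0 : 0 < M by rewrite !lt_min Pi0 d10 d20 d30.
  have K x : M <= x -> M / 2 < x by move=> ?; lra.
  exists (M / 2); split; last split; try (by apply: K; rewrite /M !ge_min lexx ?orbT).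
  by rewrite divr_gt0.
have [f [/andP[f1 f2] gg]] := @near_pick m (s - d) (s + d) ltac:(clear -d0 dP; apply/andP; rewrite -/s; split; lra)
   ltac:(clear -d0 dP; apply/andP; rewrite -/s; split; lra).
have fI : psi m - Pi < f < psi m.
  by rewrite -/s in f2 *; clear -f1 f2 dP; apply/andP; split; lra.
exists f => //; have [gI k0 kE] := chord fI; have [/andP[u1 u2] oE] := opp_spec fI.
rewrite -/s in f2 u1 u2; set g := opp m f in gg gI k0 kE u1 u2 oE *.
have r0 : 0 < g - s by rewrite subr_gt0.
have r1 : 0 < s - f by rewrite subr_gt0.
have kg : (g - s) / 2 <= crs s g.
  have := H2 (g - s) ltac:(rewrite gtr0_norm//; clear -gg D2; lra).
  rewrite (addrC s) subrK al_ff// mul1r (gtr0_norm r0) {2}/crs (mulrC (C s)) subrr subr0.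
  by rewrite ler_norml; clear -r0; move=> /andP[? ?]; lra.
have kf : (s - f) / 2 <= crs f s.
  have := H3 (f - s) ltac:(rewrite distrC gtr0_norm//; clear -f1 D3; lra).
  rewrite (addrC s) subrK al_ff// (distrC f) (gtr0_norm r1) {2}/crs (mulrC (C s)) subrr subr0.
  by rewrite ler_norml; clear -r0; move=> /andP[? ?]; lra.
have kl := Hl f fI; rewrite -/g in kl.
have lv : lev m f - lev m s <= n * (g - s).
  have := H4 (g - s) ltac:(rewrite gtr0_norm//; clear -gg D4; lra).
  by rewrite (addrC s) subrK ls mul0r subr0 (gtr0_norm r0) oE => /(le_trans (ler_norm _)).
have W1 : Wq s g <= n * (g - s) ^+ 2.
  have [c /andP[c1 c2]] := mvt u1 (fun x _ => dcontinuous (Wq_derive q1 s x)) (fun x _ => Wq_derive q1 s x).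
  rewrite Wq_ff subr0 => ->; rewrite expr2 mulrA ler_pM2r//.
  have c0 : 0 < c - s by rewrite subr_gt0.
  apply: le_trans (H1 s c _ _) _; [by rewrite subrr normr0|rewrite gtr0_norm//|].
    by clear -c2 gg D1; lra.
  by rewrite ler_pM2l// gtr0_norm//; clear -c2; lra.
have W2 : Wq f s <= n * (s - f) ^+ 2.
  have [c /andP[c1 c2]] := mvt f2 (fun x _ => dcontinuous (Wq_derivel q1 x s)) (fun x _ => Wq_derivel q1 x s).
  rewrite Wq_ff sub0r => /eqP; rewrite mulNr eqr_opp => /eqP ->; rewrite expr2 mulrA ler_pM2r//.
  have c0 : 0 < s - c by rewrite subr_gt0.
  apply: le_trans (H1 s c _ _) _; [by rewrite subrr normr0|rewrite distrC gtr0_norm//|].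
    by clear -c1 f1 D1; lra.
  by rewrite ler_pM2l// distrC gtr0_norm//; clear -c1; lra.
(* The segment consists of the two smaller segments that meet at the tangent point and of a
   triangle. *)
have WE : Wq f g = Wq f s + Wq s g + (C g - C f) * (lev m f - lev m s).
  rewrite (_ : (C g - C f) * (lev m f - lev m s) =
    (C g - C f) * (S f - S s) - m * (C g - C f) * (C f - C s)); last by rewrite /lev; ring.
  by rewrite -kE /Wq /crs; ring.
rewrite /zet -/g ler_pdivrMr ?mulr_gt0 ?exprn_gt0// WE.
set k := C g - C f in k0 kl *.
have r2 : g - s <= 2 * (l * k) by rewrite kl; clear -kg kf r1; lra.
have r3 : s - f <= 2 * (l * k) by rewrite kl; clear -kg kf r0; lra.
have sq1 : n * (g - s) ^+ 2 <= n * (2 * (l * k)) ^+ 2.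
  by rewrite ler_pM2l// ler_sqr// nnegrE ?(ltW r0)// (le_trans _ r2)// ltW.
have sq2 : n * (s - f) ^+ 2 <= n * (2 * (l * k)) ^+ 2.
  by rewrite ler_pM2l// ler_sqr// nnegrE ?(ltW r1)// (le_trans _ r3)// ltW.
have t1 : k * (lev m f - lev m s) <= k * (n * (2 * (l * k))).
  by rewrite ler_pM2l//; apply: le_trans lv _; rewrite ler_pM2l.
have := congr1 (fun x => x * (2 * k ^+ 2)) nE; clear -W1 W2 sq1 sq2 t1; lra.
Qed.

Lemma zet_onto m z : 0 < z -> exists2 f, psi m - Pi < f < psi m & zet m f = z.
Proof.
move=> z0; have [f1 f1I h1] := zet_large m z; have [f2 f2I h2] := zet_small m z0.
have Iv x y t : psi m - Pi < x < psi m -> psi m - Pi < y < psi m -> x <= t <= y -> psi m - Pi < t < psi m.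
  by move=> /andP[? ?] /andP[? ?] /andP[? ?]; apply/andP; split; lra.
have [ff|ff] := ltP f2 f1.
  have : - zet m f2 <= - zet m f1.
    apply: (is_derive_nondecr (ltW ff) (fun x hx => dcontinuous (dN (zet_derive (Iv _ _ x f2I f1I hx))))
      (fun x hx => dN (zet_derive (Iv _ _ x f2I f1I _)))).
      by move=> x /andP[? ?]; rewrite !ltW.
    move=> x hx; rewrite opprK; apply/ltW/zetD_gt0/(Iv _ _ x f2I f1I).
    by move: hx => /andP[? ?]; rewrite !ltW.
  rewrite lerN2 => h; exists f1 => //; apply/eqP; rewrite eq_le h1 andbT; lra.
pose c x := Num.max f1 (Num.min f2 x).
have cE x : f1 <= x <= f2 -> c x = x by move=> /andP[? ?]; rewrite /c min_r// max_r.
have cI x : f1 <= c x <= f2 by rewrite /c le_max lexx ge_max ff ge_min lexx.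
have cc x : {for x, continuous (zet m \o c)}.
  apply: continuous_comp; last exact: dcontinuous (zet_derive (Iv _ _ _ f1I f2I (cI x))).
  apply: (@continuous_max _ _ (fun=> f1) (fun x => Num.min f2 x)); first exact: cst_continuous.
  by apply: (@continuous_min _ _ (fun=> f2) (fun x => x)); first exact: cst_continuous.
have [x xI xE] := @ivt R (fun x => - (zet m \o c) x) f1 f2 (- z) ff (fun x => continuousN (cc x))
  ltac:(by rewrite /= !cE ?lexx ?ff// !lerN2 h1 h2).
exists x; first exact: (Iv f1 f2).
by move: xE; rewrite /= cE// => /oppr_inj.
Qed.

End Chart.

(** * Every point is the end of an explicit minimiser *)

Section Reach.
Context {R : realType}.
Local Notation H := (R * R * R)%type.
Local Notation mu := (@lebesgue_measure R).
Variables (p q : R).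
Hypotheses (p1 : 1 < p) (q1 : 1 < q) (pq : p^-1 + q^-1 = 1).
Local Notation C := (eC q).
Local Notation S := (eS q).
Local Notation Pi := (Piq q).
Local Notation d := (heis_dist p).
Local Notation expF := (expF q).
Local Notation harc := (harc q).
Let p0 : 0 < p. Proof. exact: lt_trans ltr01 p1. Qed.
Let Pi0 : 0 < Pi. Proof. exact: Piq_gt0. Qed.

Lemma hrot_expF f s r : hrot (expF f s r) = expF (f + Pi / 2) s r.
Proof.
rewrite /expF /= addrAC !eCDhalf// !eSDhalf// /Wq /crs !eCDhalf// !eSDhalf//.
by congr (_, _, _); ring.
Qed.

Lemma reach_pos x y z : 0 < x -> 0 < z -> exists f s r,
  [/\ -(2 * Pi) < f < 0, 0 < s < 2 * Pi, 0 < r & (x, y, z) = expF f s r].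
Proof.
move=> x0 z0; set m := y / x.
have [f fI fz] := zet_onto q1 m (divr_gt0 z0 (exprn_gt0 2 x0)).
have [gI k0 kE] := chord q1 fI; have [fJ _ _] := chart_fwd q1 fI.
exists f, (opp q m f - f), (x / (C (opp q m f) - C f)); split => //.
- by case/andP: gI => ? ?; apply/andP; split; lra.
- by rewrite divr_gt0.
have kn : C (opp q m f) - C f != 0 by rewrite gt_eqF.
have xn : x != 0 by rewrite gt_eqF.
rewrite /expF (addrC f) subrK kE; congr (_, _, _).
- by field.
- by rewrite /m; field; rewrite xn.
have -> : z = z / x ^+ 2 * x ^+ 2 by rewrite divfK// expf_neq0.
by rewrite -fz /zet; move: (Wq _ _ _) => W; field.
Qed.

(** Quarter turns bring a point off the vertical axis to x > 0, where the chart applies; points on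
    the axis are ends of full turns. *)
Lemma reach_up x y z : 0 < z -> exists f s r,
  [/\ 0 < s <= 2 * Pi, 0 < r & (x, y, z) = expF f s r].
Proof.
move=> z0.
have pos x' y' : 0 < x' -> exists f s r, [/\ 0 < s <= 2 * Pi, 0 < r & (x', y', z) = expF f s r].
  move=> x0; have [f [s [r [_ /andP[s0 s1] r0 E]]]] := reach_pos y' x0 z0.
  by exists f, s, r; rewrite s0 ltW.
have rot x' y' : (exists f s r, [/\ 0 < s <= 2 * Pi, 0 < r & (y', - x', z) = expF f s r]) ->
    exists f s r, [/\ 0 < s <= 2 * Pi, 0 < r & (x', y', z) = expF f s r].
  move=> [f [s [r [sI r0 E]]]]; exists (f + Pi / 2), s, r; rewrite -hrot_expF -E.
  by rewrite /hrot opprK.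
have [x0|x0|<-] := ltgtP 0 x; first exact: pos.
  by apply: (rot x y); apply: (rot y (- x)); apply: pos; rewrite oppr_gt0.
have [y0|y0|<-] := ltgtP 0 y; first by apply: (rot 0 y); apply: pos.
  by apply: (rot 0 y); apply: (rot y (- 0)); apply: (rot (- 0) (- y)); apply: pos; rewrite oppr_gt0.
exists 0, (2 * Pi), (Num.sqrt (z / Pi)); split.
- by rewrite lexx andbT mulr_gt0.
- by rewrite sqrtr_gt0 divr_gt0.
by rewrite expF_full// sqr_sqrtr ?divr_ge0 ?(ltW z0) ?(ltW Pi0)// mulrC divfK// gt_eqF.
Qed.

(** The linear function e(f) x (x, y) calibrates the segment of velocity l e'(f): Hölder's
    inequality bounds its rate by the speed, and it grows by [l] between the endpoints. *)
Lemma line_dist a b : d (0, 0, 0) (a, b, 0) = lpn p a b.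
Proof.
have [f [_ Ea Eb]] := vel_exists p1 q1 pq a b; set l := lpn p a b in Ea Eb *.
have l0 : 0 <= l by exact: lpn_ge0.
apply/eqP; rewrite eq_le; apply/andP; split.
  apply: dist_le => //; have := harc_lset p1 q1 pq (0, 0, 0) f 0 l0.
  by rewrite heis_0mul /harc eqxx !mulr1 -Ea -Eb.
apply: dist_ge => // _ [gam [u1 [u2 [hg g0 g1 ->]]]].
have := @lset_ge0 R p (0, 0, 0) (a, b, 0) (lp_length p u1 u2).
move=> /(_ (ex_intro _ gam (ex_intro _ u1 (ex_intro _ u2 (And4 hg g0 g1 erefl))))).
case E : (lp_length p u1 u2) => [L| |] //; last by move=> _; exact: leey.
move=> _; rewrite lee_fin.
have [P [Pm P1 ae]] := speed_primitive hg E; apply: le_trans P1.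
have acg : abs_continuous01 gam by case: hg.
have K0 : 0 < `|C f| + `|S f| + 1 by rewrite ltr_wpDl// addr_ge0.
pose F := fun t => C f * (gam t).1.2 - S f * (gam t).1.1.
have acF : abs_continuous01 F.
  apply: (ac_lip K0 acg) => s t _ _; rewrite /F.
  have := lexx `|gam t - gam s|; rewrite {1}le_normH => /and3P[/= dx dy _].
  rewrite (_ : _ - _ = C f * ((gam t).1.2 - (gam s).1.2) - S f * ((gam t).1.1 - (gam s).1.1)); last by ring.
  apply: le_trans (ler_normB _ _) _; rewrite !normrM.
  have h1 := ler_wpM2l (normr_ge0 (C f)) dy; have h2 := ler_wpM2l (normr_ge0 (S f)) dx.
  have := normr_ge0 (gam t - gam s); lra.
have <- : F 1 - F 0 = l.
  rewrite /F g0 g1 /= Ea Eb; have := congr1 (fun x => l * x) (al_ff q1 f); rewrite /al; lra.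
apply: (ac_le (lexx 0) ler01 (lexx 1) acF) => [x y _ xy _|]; first exact: Pm.
move: ae; apply: aeS => t ht tI; have [v1 [v2 [/field_derivP[dx dy _] hP]]] := ht tI.
exists (C f * v2 - S f * v1), (lpn p v1 v2); split; [exact: (dB (dZ (C f) dy) (dZ (S f) dx))|exact: hP|].
exact: (hoelder_lpn p1 q1 pq _ _ (e_norm q1 f)).
Qed.

Lemma hmir_harc l f w : hmir (harc l f w 1) = harc l (Pi - f) (- w) 1.
Proof.
have cP x : C (Pi - x) = - C x by rewrite addrC eCDPi// eCN.
have sP x : S (Pi - x) = S x by rewrite addrC eSDPi// eSN// opprK.
rewrite /harc oppr_eq0; case: eqVneq => [_|w0]; rewrite !mulr1.
  by rewrite /= cP sP spN; congr (_, _, _); ring.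
rewrite /hmir /expF /Wq /crs.
have -> : Pi - f - w = Pi - (f + w) by ring.
by rewrite !cP !sP; congr (_, _, _); field.
Qed.

Lemma reach_all v : exists l f w, [/\ 0 <= l, d (0, 0, 0) v = l & v = harc l f w 1].
Proof.
have up x y z : 0 < z -> exists l f w, [/\ 0 <= l, d (0, 0, 0) (x, y, z) = l & (x, y, z) = harc l f w 1].
  move=> z0; have [f [s [r [/andP[s0 s2] r0 E]]]] := reach_up x y z0.
  exists (r * s), f, s; split; first by rewrite mulr_ge0// ltW.
    by rewrite E dist_expF// s2 ltW.
  by rewrite E expF_harc.
case: v => [[x y] z]; have [z0|z0|<-] := ltgtP 0 z; first exact: up.
  have [l [f [w [l0 dl E]]]] := up x (- y) (- z) ltac:(by rewrite oppr_gt0).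
  exists l, (Pi - f), (- w); split => //.
    by rewrite -dl -(dist_mir p (0, 0, 0)) /= oppr0.
  by rewrite -hmir_harc -E /= !opprK.
have [f [_ Ea Eb]] := vel_exists p1 q1 pq x y.
exists (lpn p x y), f, 0; split; [exact: lpn_ge0|exact: line_dist|].
by rewrite /harc eqxx !mulr1 -Ea -Eb.
Qed.

(** Both legs through [g] are replaced by the minimisers of [reach_all]. Their lengths add up to the
    full distance, so [closing_rigid] places the first leg on the given circle with the given
    initial phase. *)
Lemma geodesic_pt (g : H) f s r t : 0 < s < 2 * Pi -> 0 < r -> 0 < t < 1 ->
  d (0, 0, 0) g = t * (r * s) -> d g (expF f s r) = (1 - t) * (r * s) -> g = expF f (t * s) r.
Proof.
move=> sI r0 /andP[t0 t1] dg dgy; have /andP[s0 s2] := sI.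
have rs0 : 0 < r * s by rewrite mulr_gt0.
have [l' [f' [w' [l'0 dl' E']]]] := reach_all g.
have [l'' [f'' [w'' [l''0 dl'' E'']]]] := reach_all (heis_mul (hinv g) (expF f s r)).
have dl2 : l'' = (1 - t) * (r * s).
  by rewrite -dl'' -dgy -(dist_left p (hinv g) g) heis_Vmul.
have yE : expF f s r = heis_mul g (harc l'' f'' w'' 1).
  by rewrite -E'' heis_mulA heis_mulV heis_0mul.
have l'gt : 0 < l' by rewrite -dl' dg mulr_gt0.
have ll : l' + l'' = r * s by rewrite -dl' dg dl2; ring.
have [C1 S1 lw] := closing_rigid p1 q1 pq erefl sI r0 E' yE l'gt l''0 ll.
have wE : w' = t * s.
  by apply: (mulfI (lt0r_neq0 r0)); rewrite -lw -dl' dg; ring.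
have w0 : 0 < w' by rewrite wE mulr_gt0.
rewrite E' /harc gt_eqF// mulr1 (expF_per q1 _ _ C1 S1) lw mulfK ?gt_eqF//.
by rewrite wE.
Qed.

Lemma expF_inj f s r f' s' r' : -(2 * Pi) < f < 0 -> -(2 * Pi) < f' < 0 ->
  0 < s < 2 * Pi -> 0 < s' < 2 * Pi -> 0 < r -> 0 < r' ->
  expF f s r = expF f' s' r' -> [/\ f = f', s = s' & r = r'].
Proof.
move=> fI f'I sI s'I r0 r'0 E; have /andP[s0 s2] := sI; have /andP[s'0 s'2] := s'I.
have dE : r * s = r' * s'.
  have <- := dist_expF p1 q1 pq f (_ : 0 <= s <= 2 * Pi) r0; last by rewrite !ltW.
  by rewrite E dist_expF// !ltW.
have sh : 0 < s' / 2 by rewrite divr_gt0.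
(* Cut at its midpoint, the second arc becomes a broken minimiser with the same end, to which
   [closing_rigid] applies. *)
have y2 : expF f s r = heis_mul (harc (r' * (s' / 2)) f' (s' / 2) 1) (harc (r' * (s' / 2)) (f' + s' / 2) (s' / 2) 1).
  by rewrite -!expF_harc// expF_cat -splitr.
have l0 : 0 < r' * (s' / 2) by rewrite mulr_gt0.
have [C1 S1 lw] := closing_rigid p1 q1 pq erefl sI r0 erefl y2 l0 (ltW l0)
  ltac:(by rewrite dE; field).
have rr : r = r' by apply: (mulIf (lt0r_neq0 sh)); rewrite lw.
have ss : s = s' by apply: (mulfI (lt0r_neq0 r0)); rewrite dE rr.
split => //; have /andP[? ?] := fI; have /andP[? ?] := f'I.
have [lt1|lt1|//] := ltgtP f f'.
  by case: (@e_inj R q q1 f f'); [apply/andP; split; lra|rewrite C1 S1].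
by case: (@e_inj R q q1 f' f); [apply/andP; split; lra|rewrite C1 S1].
Qed.

End Reach.

(** * The area formula *)

Section Lebesgue.
Context {R : realType}.
Local Notation M := (measurableTypeR R).
Local Notation mu := (@lebesgue_measure R).
Local Open Scope ereal_scope.

Lemma int_indic (D : set M) (f : M -> \bar R) : measurable D ->
  \int[mu]_(x in D) f x = \int[mu]_x (f x * (\1_D x)%:E).
Proof.
move=> mD; rewrite [LHS]integral_mkcond; apply: eq_integral => x _.
by rewrite patchE indicE; case: ifP => _; rewrite ?mule1 ?mule0.
Qed.

Lemma int_scale (c : R) (f : M -> \bar R) : (0 < c)%R -> (forall x, 0 <= f x) ->
  measurable_fun setT f -> \int[mu]_x f x = \int[mu]_x (f (c * x)%R * c%:E).
Proof.
move=> c0 f0 mf; have [a_ [b_ [ab aS bS E]]] := @exhaust_T R.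
rewrite -[RHS](@subst_incr R (fun x => c * x)%R (fun=> c) a_ b_ f setT setT) => //.
- apply/seteqP; split => // y _; exists (y / c)%R => //.
  by rewrite mulrC divfK// gt_eqF.
- by move=> x _; apply: (dEq (dZ c (did x))); rewrite mulr1.
- by move=> x _; exact: cst_continuous.
Qed.

Lemma int_shift (c : R) (f : M -> \bar R) : (forall x, 0 <= f x) ->
  measurable_fun setT f -> \int[mu]_x f x = \int[mu]_x f (x + c)%R.
Proof.
move=> f0 mf; have [a_ [b_ [ab aS bS E]]] := @exhaust_T R.
transitivity (\int[mu]_x (f (x + c)%R * 1%:E)); last by apply: eq_integral => x _; rewrite mule1.
rewrite -[RHS](@subst_incr R (fun x => x + c)%R (fun=> 1%R) a_ b_ f setT setT) => //.
- by apply/seteqP; split => // y _; exists (y - c)%R => //; rewrite subrK.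
- by move=> x _; apply: (dEq (dD (did x) (dcst x c))); rewrite addr0.
- by move=> x _; exact: cst_continuous.
Qed.

Lemma int_opp (f : M -> \bar R) : (forall x, 0 <= f x) ->
  measurable_fun setT f -> \int[mu]_x f x = \int[mu]_x f (- x)%R.
Proof. by move=> f0 mf; rewrite (@reflect_integral R f setT). Qed.

Lemma measurable_int (d : measure_display) (T : measurableType d) (f : T -> M -> \bar R) :
  (forall x y, 0 <= f x y) -> measurable_fun setT (fun z : T * M => f z.1 z.2) ->
  measurable_fun setT (fun x => \int[mu]_y f x y).
Proof.
move=> f0 mf; exact: (@measurable_fun_fubini_tonelli_F _ _ T M R mu (fun z : T * M => f z.1 z.2) mf (fun z => f0 z.1 z.2)).
Qed.

Lemma int_swap (f : M -> M -> \bar R) :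
  (forall x y, 0 <= f x y) -> measurable_fun setT (fun z : M * M => f z.1 z.2) ->
  \int[mu]_x \int[mu]_y f x y = \int[mu]_y \int[mu]_x f x y.
Proof.
move=> f0 mf; exact: (@fubini_tonelli _ _ M M R mu mu (fun z : M * M => f z.1 z.2) mf (fun z => f0 z.1 z.2)).
Qed.

Lemma integral_indic_T (A : set M) : measurable A -> \int[mu]_x (\1_A x)%:E = mu A.
Proof. by move=> mA; rewrite integral_indic// setIT. Qed.

Lemma lebesgue3E (O : set (M * M * M)) : measurable O ->
  lebesgue3 O = \int[mu]_x \int[mu]_y \int[mu]_z (\1_O (x, y, z))%:E.
Proof.
move=> mO; have E : lebesgue3 O = \int[mu \x mu]_w mu (xsection O w) by [].
have mf : measurable_fun setT (fun w : M * M => mu (xsection O w)).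
  exact: (@measurable_fun_xsection _ _ (M * M)%type M R mu O mO).
have f0 (w : M * M) : 0 <= mu (xsection O w) by exact: measure_ge0.
have F := @fubini_tonelli1 _ _ M M R mu mu _ mf f0.
rewrite E.
apply: (etrans F).
apply: eq_integral => x _; apply: eq_integral => y _.
rewrite -integral_indic_T; last exact: measurable_xsection.
by apply: eq_integral => z _; rewrite !indicE mem_xsection.
Qed.

Lemma int_mulr (f : M -> \bar R) (k : R) : (0 <= k)%R -> (forall x, 0 <= f x) ->
  measurable_fun setT f -> \int[mu]_x (f x * k%:E) = (\int[mu]_x f x) * k%:E.
Proof. by move=> k0 f0 mf; rewrite ge0_integralZr ?lee_fin. Qed.

Definition meas3 (u : M -> M -> M -> R) :=
  measurable_fun setT (fun w : M * M * M => u w.1.1 w.1.2 w.2).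

Lemma meas3_comp (u : M -> M -> M -> R) (d : measure_display) (T : measurableType d)
    (a b c : T -> M) : meas3 u ->
  measurable_fun setT a -> measurable_fun setT b -> measurable_fun setT c ->
  measurable_fun setT (fun t => u (a t) (b t) (c t)).
Proof.
move=> mu3 ma mb mc.
exact: (measurableT_comp mu3 (measurable_fun_pair (measurable_fun_pair ma mb) mc)).
Qed.

Lemma mcst (d : measure_display) (T : measurableType d) (a : M) : measurable_fun setT (fun _ : T => a).
Proof. exact: measurable_cst. Qed.

Lemma mid : measurable_fun setT (fun x : M => x).
Proof. exact: measurable_id. Qed.

(** For fixed x > 0 the substitutions y = x m and z = x^2 z' are scalings, with factors x and x^2
    contributing x^3. *)
Lemma int_chart (u : M -> M -> M -> R) : (forall x y z, 0 <= u x y z)%R -> meas3 u ->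
  (forall x y z, (x <= 0)%R -> u x y z = 0%R) ->
  \int[mu]_x \int[mu]_y \int[mu]_z (u x y z)%:E =
  \int[mu]_m \int[mu]_z \int[mu]_x (u x (x * m)%R (x ^+ 2 * z)%R * x ^+ 3)%:E.
Proof.
move=> u0 m3 ux.
have mw1 : measurable_fun setT (fun w : M * M * M => w.1.1).
  exact: (measurableT_comp measurable_fst measurable_fst).
have mw2 : measurable_fun setT (fun w : M * M * M => w.1.2).
  exact: (measurableT_comp measurable_snd measurable_fst).
have mw3 : measurable_fun setT (fun w : M * M * M => w.2) by exact: measurable_snd.
pose v x m z := (u x (x * m) (x ^+ 2 * z) * x ^+ 3)%R.
have v0 x m z : (0 <= v x m z)%R.
  rewrite /v; have [x0|x0] := leP x 0%R; first by rewrite ux// mul0r.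
  by rewrite mulr_ge0// exprn_ge0// ltW.
have mv : meas3 v.
  apply: measurable_funM; last exact: measurable_funX.
  apply: meas3_comp => //; first exact: measurable_funM.
  by apply: measurable_funM => //; exact: measurable_funX.
transitivity (\int[mu]_x \int[mu]_m \int[mu]_z (v x m z)%:E).
  apply: eq_integral => x _; have [x0|x0] := leP x 0%R.
    transitivity (\int[mu]_(_ in [set: M]) (0 : \bar R)).
      by apply: eq_integral => y _; apply: integral0_eq => z _; rewrite ux.
    by apply: eq_integral => y _; apply/esym/integral0_eq => z _; rewrite /v ux// mul0r.
  have m2 : measurable_fun setT (fun y : M => \int[mu]_z (u x y z)%:E).
    apply: measurable_int; first by move=> *; rewrite lee_fin.
    apply/measurable_EFinP; apply: meas3_comp => //; exact: mcst.
  rewrite (int_scale x0)//; last by move=> y; apply: integral_ge0 => z _; rewrite lee_fin.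
  apply: eq_integral => m _.
  have m1 : measurable_fun setT (fun z : M => (u x (x * m)%R z)%:E).
    by apply/measurable_EFinP; apply: meas3_comp => //; exact: mcst.
  rewrite -int_mulr ?(ltW x0)//; last by move=> z; rewrite lee_fin.
  rewrite (@int_scale (x ^+ 2))//.
  - by apply: eq_integral => z _; rewrite -!EFinM; congr (_ %:E); rewrite /v; ring.
  - by rewrite exprn_gt0.
  - by move=> z; rewrite mule_ge0 ?lee_fin// ltW.
  - by apply: emeasurable_funM => //; exact: measurable_cst.
rewrite int_swap.
- apply: eq_integral => m _; rewrite int_swap//; first by move=> *; rewrite lee_fin.
  by apply/measurable_EFinP; apply: (meas3_comp (T := (M * M)%type)) => //; exact: mcst.
- by move=> x y; apply: integral_ge0 => z _; rewrite lee_fin.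
by apply: measurable_int => [w z|]; [rewrite lee_fin|apply/measurable_EFinP; apply: meas3_comp].
Qed.

End Lebesgue.

Section AreaFormula.
Context {R : realType}.
Local Notation M := (measurableTypeR R).
Local Notation mu := (@lebesgue_measure R).
Variable q : R.
Hypothesis q1 : 1 < q.
Local Notation C := (eC q).
Local Notation S := (eS q).
Local Notation Pi := (Piq q).
Local Notation Wq := (Wq q).
Local Notation Dq := (Dq q).
Local Notation al := (al q).
Local Notation psi := (psi q).
Local Notation opp := (opp q).
Local Notation slope := (slope q).
Local Notation rad := (rad q).
Let Pi0 : 0 < Pi. Proof. exact: Piq_gt0. Qed.

Lemma slope_lt f g g' : -(2 * Pi) < f < 0 -> `|g| < rad f -> `|g'| < rad f ->
  (slope f g < slope f g') = (g < g').
Proof.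
move=> fI; have key g1 g2 : `|g1| < rad f -> `|g2| < rad f -> g1 < g2 -> slope f g1 < slope f g2.
  move=> h1 h2 lt12.
  have gI x : g1 <= x <= g2 -> f < x < f + 2 * Pi /\ C f < C x.
    move: h1 h2; rewrite !ltr_norml => /andP[a1 a2] /andP[a3 a4] /andP[b1 b2].
    have r1 : rad f <= - f by rewrite /rad ge_min lexx.
    have r2 : rad f <= 2 * Pi + f by rewrite /rad ge_min lexx orbT.
    have xI : f < x < f + 2 * Pi by apply/andP; split; lra.
    by rewrite eC_rad// ltr_norml; split => //; apply/andP; split; lra.
  have dS x : g1 <= x <= g2 -> is_derive x 1 (slope f) ((1 - al f x) / (C x - C f) ^+ 2).
    by move=> /gI[_ k]; apply: slope_derive => //; rewrite gt_eqF// subr_gt0.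
  apply: (is_derive_incr lt12 (fun x hx => dcontinuous (dS x hx))).
    by move=> x /andP[? ?]; apply: dS; rewrite !ltW.
  move=> x /andP[? ?]; have [xI kx] := gI x ltac:(by rewrite !ltW).
  by rewrite divr_gt0 ?exprn_gt0 ?subr_gt0// al_lt1.
move=> h1 h2; apply/idP/idP => [|lt12]; last exact: key.
apply: contraTT; rewrite -!leNgt le_eqVlt => /predU1P[->//|lt12]; exact/ltW/key.
Qed.

Definition inV (w : M * M) : bool := psi w.1 - Pi < w.2 < psi w.1.

(** Says that the slopes of the chords from e(f) to e(a) and e(b) enclose [m], so that [opp m f]
    lies between [a] and [b]. These are inequalities between continuous functions; letting [a] and
    [b] be rational shows that [opp] is measurable. *)
Definition boxV (a b : R) : set (M * M) := [set w | [/\ -(2 * Pi) < w.2 < 0, `|a| < rad w.2, `|b| < rad w.2,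
   S a - S w.2 < w.1 * (C a - C w.2) & w.1 * (C b - C w.2) < S b - S w.2]].

Lemma boxV_opp a b w : boxV a b w -> inV w /\ opp w.1 w.2 < b.
Proof.
case: w => m f [/= fI ar br h1 h2].
have /andP[f1 f2] := fI.
have gI x : `|x| < rad f -> f < x < f + 2 * Pi /\ 0 < C x - C f.
  rewrite ltr_norml => /andP[a1 a2].
  have r1 : rad f <= - f by rewrite /rad ge_min lexx.
  have r2 : rad f <= 2 * Pi + f by rewrite /rad ge_min lexx orbT.
  have xI : f < x < f + 2 * Pi by apply/andP; split; lra.
  by rewrite subr_gt0 eC_rad// ltr_norml; split => //; apply/andP; split; lra.
have [_ ka] := gI a ar; have [_ kb] := gI b br.
have sa : slope f a < m by rewrite /slope ltr_pdivrMr.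
have sb : m < slope f b by rewrite /slope ltr_pdivlMr.
have ab : a < b by rewrite -(slope_lt fI ar br); exact: lt_trans sb.
pose c x := Num.max a (Num.min b x).
have cE x : a <= x <= b -> c x = x by move=> /andP[? ?]; rewrite /c min_r// max_r.
have cI x : a <= c x <= b by rewrite /c le_max lexx ge_max (ltW ab) ge_min lexx.
have cr x : `|c x| < rad f.
  by move: ar br (cI x); rewrite !ltr_norml => /andP[? ?] /andP[? ?] /andP[? ?]; apply/andP; split; lra.
have cc x : {for x, continuous (slope f \o c)}.
  apply: continuous_comp; last first.
    have [_ k] := gI _ (cr x); apply: dcontinuous (slope_derive q1 _).
    by rewrite gt_eqF.
  apply: (@continuous_max _ _ (fun=> a) (fun x => Num.min b x)); first exact: cst_continuous.
  by apply: (@continuous_min _ _ (fun=> b) (fun x => x)); first exact: cst_continuous.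
have [g gab gm] := @ivt R (slope f \o c) a b m (ltW ab) cc
  ltac:(by rewrite /= !cE ?lexx ?ltW// !ltW).
rewrite /= cE// in gm.
have gr : `|g| < rad f by rewrite -(cE g gab).
have [] := chart_bwd q1 fI gr; rewrite gm => mI oE; split => //=.
by rewrite oE -(slope_lt fI gr br) gm.
Qed.

Lemma inV_boxV w c : inV w -> opp w.1 w.2 < c -> exists a b : rat,
  boxV (ratr a) (ratr b) w /\ (ratr b : R) < c.
Proof.
case: w => m f /= fV oc; have [/= fI gr sE] := chart_fwd q1 fV.
set g := opp m f in oc gr sE.
have [|a aI] := @rat_in_itvoo R (- rad f) g.
  by move: gr; rewrite ltr_norml => /andP[].
have [|b bI] := @rat_in_itvoo R g (Num.min c (rad f)).
  by rewrite lt_min oc; move: gr; rewrite ltr_norml => /andP[].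
move: aI bI; rewrite !in_itv /= lt_min => /andP[a1 a2] /and3P[b1 b2 b3].
have ar : `|ratr a : R| < rad f by move: gr; rewrite !ltr_norml => /andP[? ?]; apply/andP; split; lra.
have br : `|ratr b : R| < rad f by move: gr; rewrite !ltr_norml => /andP[? ?]; apply/andP; split; lra.
exists a, b; split => //; split => //=.
  have k : 0 < C (ratr a) - C f.
    rewrite subr_gt0 eC_rad//; move: ar; rewrite ltr_norml => /andP[? ?].
    have r1 : rad f <= - f by rewrite /rad ge_min lexx.
    have r2 : rad f <= 2 * Pi + f by rewrite /rad ge_min lexx orbT.
    by apply/andP; split; lra.
  by rewrite -ltr_pdivrMr// -sE -/(slope f _) slope_lt.
have k : 0 < C (ratr b) - C f.
  rewrite subr_gt0 eC_rad//; move: br; rewrite ltr_norml => /andP[? ?].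
  have r1 : rad f <= - f by rewrite /rad ge_min lexx.
  have r2 : rad f <= 2 * Pi + f by rewrite /rad ge_min lexx orbT.
  by apply/andP; split; lra.
by rewrite -ltr_pdivlMr// -sE -/(slope f _) slope_lt.
Qed.

Lemma mC : measurable_fun setT (C : M -> M).
Proof. by apply: continuous_measurable_fun => x; exact: dcontinuous (eC_derive q1 x). Qed.

Lemma mS : measurable_fun setT (S : M -> M).
Proof. by apply: continuous_measurable_fun => x; exact: dcontinuous (eS_derive q1 x). Qed.

Lemma mspC : measurable_fun setT ((fun x => sp (q - 1) (C x)) : M -> M).
Proof. by apply: continuous_measurable_fun => x; exact: continuous_spC. Qed.

Lemma mspS : measurable_fun setT ((fun x => sp (q - 1) (S x)) : M -> M).
Proof. by apply: continuous_measurable_fun => x; exact: continuous_spS. Qed.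

Lemma mltset (d : measure_display) (T : measurableType d) (u v : T -> M) :
  measurable_fun setT u -> measurable_fun setT v -> measurable [set w | u w < v w].
Proof.
move=> mu1 mv1; have := measurable_fun_ltr mu1 mv1 measurableT (I : measurable [set true]).
by rewrite setTI; congr measurable; apply/seteqP; split => w /=.
Qed.

Lemma measurable_boxV a b : measurable (boxV a b).
Proof.
have m1 : measurable_fun setT (fun w : M * M => w.1) by exact: measurable_fst.
have m2 : measurable_fun setT (fun w : M * M => w.2) by exact: measurable_snd.
have mk (c : R) : measurable_fun setT (fun _ : M * M => (c : M)) by exact: mcst.
have mN : measurable_fun setT (fun w : M * M => - w.2 : M) by exact: measurableT_comp.
have mP : measurable_fun setT (fun w : M * M => 2 * Pi + w.2 : M) by exact: measurable_funD.
have mC2 c : measurable_fun setT (fun w : M * M => C c - C w.2 : M).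
  by apply: measurable_funB => //; exact: (measurableT_comp mC m2).
have mS2 c : measurable_fun setT (fun w : M * M => S c - S w.2 : M).
  by apply: measurable_funB => //; exact: (measurableT_comp mS m2).
have -> : boxV a b = [set w | - (2 * Pi) < w.2] `&` [set w | w.2 < 0] `&`
   ([set w | `|a| < - w.2] `&` [set w | `|a| < 2 * Pi + w.2]) `&`
   ([set w | `|b| < - w.2] `&` [set w | `|b| < 2 * Pi + w.2]) `&`
   [set w | S a - S w.2 < w.1 * (C a - C w.2)] `&` [set w | w.1 * (C b - C w.2) < S b - S w.2].
  apply/seteqP; split => w; rewrite /boxV /rad /= !lt_min.
    by move=> [/andP[? ?] /andP[? ?] /andP[? ?] ? ?].
  by move=> [[[[[-> ->] [-> ->]] [-> ->]] ->] ->].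
by do ?apply: measurableI; apply: mltset; first [exact: mk|exact: m2|exact: mN|exact: mP|
  exact: mC2|exact: mS2|by apply: measurable_funM; [exact: m1|exact: mC2]].
Qed.

Lemma measurable_opp_lt (c : R) : measurable [set w : M * M | inV w /\ opp w.1 w.2 < c].
Proof.
have -> : [set w : M * M | inV w /\ opp w.1 w.2 < c] =
    \bigcup_(a : rat) \bigcup_(b : rat) (if (ratr b : R) < c then boxV (ratr a) (ratr b) else set0).
  apply/seteqP; split => w /=.
    move=> [wV wc]; have [a [b [ab bc]]] := inV_boxV wV wc.
    by exists a => //; exists b => //; rewrite bc.
  move=> [a _ [b _]]; case: ifP => // bc /boxV_opp[wV wb]; split => //; exact: lt_trans bc.
apply: bigcupT_measurable_rat => a; apply: bigcupT_measurable_rat => b.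
by case: ifP => // _; exact: measurable_boxV.
Qed.

Lemma measurable_inV : measurable_fun setT inV.
Proof.
apply: (measurable_fun_bool true); rewrite setTI.
have -> : inV @^-1` [set true] = [set w : M * M | inV w /\ opp w.1 w.2 < Pi].
  apply/seteqP; split => w /=; last by case.
  move=> wV; split => //; have [/andP[_ o2] _] := opp_spec q1 wV.
  by have [/andP[_ s2] _] := psi_spec q1 w.1; lra.
exact: measurable_opp_lt.
Qed.

Definition oppV (w : M * M) : M := if inV w then opp w.1 w.2 else 0.

Lemma measurable_oppV : measurable_fun setT oppV.
Proof.
apply: (measurability (RGenInftyO.G (R := R))); first exact: RGenInftyO.measurableE.
move=> _ [_ [c ->] <-]; rewrite setTI.
have -> : oppV @^-1` `]-oo, c[ = [set w | inV w /\ opp w.1 w.2 < c] `|`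
    ((inV @^-1` [set false]) `&` (if 0 < c then setT else set0)).
  apply/seteqP; split => w; rewrite /oppV /= in_itv /=.
    by case: ifP => wV h; [left|right; rewrite h].
  by case: ifP => wV [[]//|[]//]; case: ifP => //.
apply: measurableU; first exact: measurable_opp_lt.
apply: measurableI; last by case: ifP.
by have := measurable_inV measurableT (I : measurable [set false]); rewrite setTI.
Qed.

Lemma oppVE w : inV w -> oppV w = opp w.1 w.2. Proof. by rewrite /oppV => ->. Qed.

Lemma measurable_pairfun (d : measure_display) (T : measurableType d) (f g : T -> M) :
  measurable_fun setT f -> measurable_fun setT g ->
  [/\ measurable_fun setT (fun t => al (f t) (g t) : M),
    measurable_fun setT (fun t => Wq (f t) (g t) : M) &
    measurable_fun setT (fun t => Dq (f t) (g t) : M)].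
Proof.
move=> mf mg.
have mCf := measurableT_comp mC mf; have mSf := measurableT_comp mS mf.
have mCg := measurableT_comp mC mg; have mSg := measurableT_comp mS mg.
have msCf := measurableT_comp mspC mf; have msSf := measurableT_comp mspS mf.
have msCg := measurableT_comp mspC mg; have msSg := measurableT_comp mspS mg.
have mal : measurable_fun setT (fun t => al (f t) (g t) : M).
  by apply: measurable_funD; apply: measurable_funM.
have mal' : measurable_fun setT (fun t => al (g t) (f t) : M).
  by apply: measurable_funD; apply: measurable_funM.
have mga : measurable_fun setT (fun t => ga q (f t) (g t) : M).
  by apply: measurable_funB; apply: measurable_funM.
have mW : measurable_fun setT (fun t => Wq (f t) (g t) : M).
  apply: measurable_funB; first exact: measurable_funB.
  by apply: measurable_funB; apply: measurable_funM.
split => //; apply: measurable_funB; last exact: measurable_funM.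
by apply: measurable_funM; apply: measurable_funB => //; exact: measurable_cst.
Qed.

(** Denominators of [zet] and [zetD]. They are inverted as powers with exponent -1, for which
    measurability is at hand. *)
Let den2 (w : M * M) : R := 2 * (C (oppV w) - C w.2) ^+ 2.
Let den4 (w : M * M) : R := (C (oppV w) - C w.2) ^+ 2 * (1 - al w.2 (oppV w)).

Lemma measurable_zetV :
  measurable_fun setT (fun w : M * M => Wq w.2 (oppV w) * den2 w `^ (- 1) : M) /\
  measurable_fun setT (fun w : M * M => Dq w.2 (oppV w) * den4 w `^ (- 1) : M).
Proof.
have m2 : measurable_fun setT (fun w : M * M => w.2) by exact: measurable_snd.
have [ma mW mD] := measurable_pairfun m2 measurable_oppV.
have mk : measurable_fun setT (fun w : M * M => (C (oppV w) - C w.2) ^+ 2 : M).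
  apply: measurable_funX; apply: measurable_funB; first exact: (measurableT_comp mC measurable_oppV).
  exact: (measurableT_comp mC m2).
split; apply: measurable_funM => //; apply: (measurableT_comp (measurable_powR _)).
  by apply: measurable_funM => //; exact: measurable_cst.
by apply: measurable_funM => //; apply: measurable_funB => //; exact: measurable_cst.
Qed.

Lemma zetVE w : inV w -> [/\ Wq w.2 (oppV w) * den2 w `^ (- 1) = zet q w.1 w.2,
  Dq w.2 (oppV w) * den4 w `^ (- 1) = zetD q w.1 w.2 & 0 <= zetD q w.1 w.2].
Proof.
move=> wV; have [gI k0 kE] := chord q1 wV.
have a1 : 0 < 1 - al w.2 (opp w.1 w.2) by rewrite subr_gt0 al_lt1.
have z0 : 0 <= zetD q w.1 w.2 := ltW (zetD_gt0 q1 wV).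
split; last exact: z0.
  by rewrite /den2 oppVE// powR_inv1// mulr_ge0// exprn_ge0// ltW.
by rewrite /den4 oppVE// powR_inv1// mulr_ge0 ?exprn_ge0// ltW.
Qed.

Local Open Scope ereal_scope.

Definition Theta (Phi : M -> M -> \bar R) (m f : M) : \bar R :=
  if inV (m, f) then Phi m (zet q m f) * (zetD q m f)%:E else 0.

Lemma measurable_Theta Phi : measurable_fun setT (fun w : M * M => Phi w.1 w.2) ->
  measurable_fun setT (fun w : M * M => Theta Phi w.1 w.2).
Proof.
move=> mP; have [mZ mD] := measurable_zetV.
pose T' (w : M * M) := if inV w then
  Phi w.1 (Wq w.2 (oppV w) * den2 w `^ (- 1))%R * (Dq w.2 (oppV w) * den4 w `^ (- 1))%:E else 0.
rewrite (_ : (fun w => _) = T'); last first.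
  apply/funext => w; rewrite /Theta /T' -surjective_pairing; case: ifP => // wV.
  by have [-> -> _] := zetVE wV.
apply: measurable_fun_ifT; [exact: measurable_inV| |exact: measurable_cst].
apply: emeasurable_funM; last exact/measurable_EFinP.
exact: (measurableT_comp mP (measurable_fun_pair measurable_fst mZ)).
Qed.

Lemma Theta_ge0 Phi m f : (forall m z, 0 <= Phi m z) -> 0 <= Theta Phi m f.
Proof.
move=> P0; rewrite /Theta; case: ifP => // wV; rewrite mule_ge0// lee_fin.
by have [_ _] := zetVE wV.
Qed.

Lemma int_zet (Phi : M -> M -> \bar R) (m : M) : (forall m z, 0 <= Phi m z) ->
  measurable_fun setT (fun w : M * M => Phi w.1 w.2) -> (forall z, (z <= 0)%R -> Phi m z = 0) ->
  \int[mu]_z Phi m z = \int[mu]_f Theta Phi m f.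
Proof.
move=> P0 mP Pz.
have mPm : measurable_fun setT (Phi m).
  exact: (measurableT_comp mP (measurable_fun_pair (mcst m) (@mid R))).
have [a_ [b_ [ab aS bS E]]] := @exhaust_oo R (psi m - Pi)%R (psi m) ltac:(have : (0 < Pi)%R by []; lra).
transitivity (\int[mu]_(z in `]0%R, +oo[) Phi m z).
  rewrite [RHS]int_indic//; apply: eq_integral => z _; rewrite indicE mem_setE in_itv/= andbT.
  by case: ltP => z0; rewrite ?mule1// Pz ?mul0e.
rewrite (@subst_decr R (zet q m) (zetD q m) a_ b_ (Phi m) `](psi m - Pi)%R, psi m[%classic) //.
- rewrite [LHS]int_indic//; apply: eq_integral => f _; rewrite indicE mem_setE in_itv/= /Theta /inV /=.
  by case: ifP => _; rewrite ?mule1 ?mule0.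
- apply/seteqP; split => z /=; rewrite in_itv/=.
    by rewrite andbT => z0; have [f fI <-] := zet_onto q1 m z0; exists f; rewrite ?in_itv.
  by move=> [f]; rewrite in_itv/= => fI <-; rewrite andbT zet_gt0.
- by move=> f /set_mem; rewrite /= in_itv => fI; exact: zet_derive.
- by move=> f /set_mem; rewrite /= in_itv => fI; exact: zetD_continuous.
- by move=> f /set_mem; rewrite /= in_itv => fI; exact: zetD_gt0.
Qed.

(** For fixed [f] the slope increases with the endpoint [g]. Its derivative has the factor
    [1 - al f g], which cancels the one in the denominator of [zetD]. *)
Lemma int_slope (Phi : M -> M -> \bar R) (f : M) : (forall m z, 0 <= Phi m z) ->
  measurable_fun setT (fun w : M * M => Phi w.1 w.2) -> (-(2 * Pi) < f < 0)%R ->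
  \int[mu]_m Theta Phi m f = \int[mu]_(g in `](- rad f)%R, rad f[)
    (Phi (slope f g) (Wq f g / (2 * (C g - C f) ^+ 2))%R * (Dq f g / (C g - C f) ^+ 4)%:E).
Proof.
move=> P0 mP fI.
have gB g : (- rad f < g < rad f)%R -> (f < g < f + 2 * Pi)%R /\ (0 < C g - C f)%R.
  move=> /andP[g1 g2].
  have r1 : (rad f <= - f)%R by rewrite /rad ge_min lexx.
  have r2 : (rad f <= 2 * Pi + f)%R by rewrite /rad ge_min lexx orbT.
  have xI : (f < g < f + 2 * Pi)%R by apply/andP; split; lra.
  by rewrite subr_gt0 eC_rad// ltr_norml g1 g2.
have r0 := rad_gt0 fI.
have mTf : measurable_fun setT (Theta Phi ^~ f).
  exact: (measurableT_comp (measurable_Theta mP) (measurable_fun_pair (@mid R) (mcst f))).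
pose I := `](- rad f)%R, rad f[%classic : set M.
have [a_ [b_ [ab aS bS E]]] := @exhaust_oo R (- rad f)%R (rad f) ltac:(lra).
pose J := slope f @` I.
transitivity (\int[mu]_(m in J) Theta Phi m f).
  rewrite [RHS]integral_mkcond; apply: eq_integral => m _; rewrite patchE.
  case: ifPn => // /negP mJ; rewrite /Theta; case: ifP => // mV; case: mJ.
  rewrite inE; have [_ gr sE] := chart_fwd q1 mV; exists (opp m f) => //.
  by rewrite /I /= in_itv/= -ltr_norml.
rewrite (@subst_incr R (slope f) (fun g => (1 - al f g) / (C g - C f) ^+ 2)%R a_ b_ (Theta Phi ^~ f) I J) //.
- apply: eq_integral => g /set_mem; rewrite /I /= in_itv/= => gI; have [gf k0] := gB g gI.
  have [mV oE] : inV (slope f g, f) /\ opp (slope f g) f = g.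
    by apply: chart_bwd => //; rewrite ltr_norml.
  rewrite /Theta mV -muleA -EFinM /zet /zetD /= oE; congr (_ * _%:E).
  have a1 : (1 - al f g != 0)%R by rewrite gt_eqF// subr_gt0 al_lt1.
  have k1 : (C g - C f != 0)%R by rewrite gt_eqF.
  by move: (Dq f g) (1 - al f g)%R a1 (C g - C f)%R k1 => D a a1 k k1; field; rewrite a1 k1.
- move=> g /set_mem; rewrite /I /= in_itv/= => gI; have [gf k0] := gB g gI.
  by apply: slope_derive => //; rewrite gt_eqF.
- move=> g /set_mem; rewrite /I /= in_itv/= => gI; have [gf k0] := gB g gI.
  apply: continuousM.
    by apply: continuousB; [exact: cst_continuous|exact: continuous_al].
  apply: continuousV; first by rewrite expf_neq0// gt_eqF.
  have ck : {for g, continuous (fun g => C g - C f)%R}.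
    by apply: continuousB; [exact: dcontinuous (eC_derive q1 g)|exact: cst_continuous].
  exact: (continuousM ck ck).
- move=> g /set_mem; rewrite /I /= in_itv/= => gI; have [gf k0] := gB g gI.
  by rewrite divr_gt0 ?exprn_gt0// subr_gt0 al_lt1.
- by move=> m; exact: Theta_ge0.
Qed.

(** The Jacobian of F, set to 0 outside the parameter range so that [s] and [r] can be integrated
    over the whole line. *)
Definition wgt (f s r : R) : R := (if (0 < r) && (0 < s < 2 * Pi) then r ^+ 3 * Dq f (f + s) else 0)%R.

Definition uexp (u : M -> M -> M -> R) (f s r : R) : R :=
  u (r * (C (f + s) - C f))%R (r * (S (f + s) - S f))%R (r ^+ 2 / 2 * Wq f (f + s))%R.

Lemma wgt_ge0 f s r : (0 <= wgt f s r)%R.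
Proof.
rewrite /wgt; case: ifP => // /andP[r0 /andP[s0 s2]].
by rewrite mulr_ge0 ?exprn_ge0 ?(ltW r0)//; apply/ltW/Dq_gt0 => //; apply/andP; split; lra.
Qed.

Lemma meas_wgt : meas3 wgt.
Proof.
have mw1 : measurable_fun setT (fun w : M * M * M => w.1.1).
  exact: (measurableT_comp measurable_fst measurable_fst).
have mw2 : measurable_fun setT (fun w : M * M * M => w.1.2).
  exact: (measurableT_comp measurable_snd measurable_fst).
have mw3 : measurable_fun setT (fun w : M * M * M => w.2) by exact: measurable_snd.
have [_ _ mD] := measurable_pairfun mw1 (measurable_funD mw1 mw2).
apply: measurable_fun_ifT; last exact: mcst.
  apply: measurable_and; first exact: (measurable_fun_ltr (mcst 0%R) mw3).
  apply: measurable_and; first exact: (measurable_fun_ltr (mcst 0%R) mw2).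
  exact: (measurable_fun_ltr mw2 (mcst (2 * Pi)%R)).
by apply: measurable_funM => //; exact: measurable_funX.
Qed.

Lemma meas_uexp u : meas3 u -> meas3 (uexp u).
Proof.
move=> m3.
have mw1 : measurable_fun setT (fun w : M * M * M => w.1.1).
  exact: (measurableT_comp measurable_fst measurable_fst).
have mw2 : measurable_fun setT (fun w : M * M * M => w.1.2).
  exact: (measurableT_comp measurable_snd measurable_fst).
have mw3 : measurable_fun setT (fun w : M * M * M => w.2) by exact: measurable_snd.
have mfs : measurable_fun setT (fun w : M * M * M => w.1.1 + w.1.2 : M)%R by exact: measurable_funD.
have [_ mW _] := measurable_pairfun mw1 mfs.
apply: (@meas3_comp R u _ (M * M * M)%type (fun w => w.2 * (C (w.1.1 + w.1.2) - C w.1.1))%R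
  (fun w => w.2 * (S (w.1.1 + w.1.2) - S w.1.1))%R (fun w => w.2 ^+ 2 / 2 * Wq w.1.1 (w.1.1 + w.1.2))%R m3);
  apply: measurable_funM => //.
- by apply: measurable_funB; [exact: (measurableT_comp mC mfs)|exact: (measurableT_comp mC mw1)].
- by apply: measurable_funB; [exact: (measurableT_comp mS mfs)|exact: (measurableT_comp mS mw1)].
by apply: measurable_funM; [exact: measurable_funX|exact: mcst].
Qed.

(** After the exchanges of z / x^2 for [f] and of the slope for [g], the last substitution is x = r
    (C g - C f). The fourth power of the width in x^3 dx cancels the denominator left by
    [int_slope], and r^3 Dq remains. *)
Lemma area_pos (u : M -> M -> M -> R) : (forall x y z, 0 <= u x y z)%R -> meas3 u ->
  (forall x y z, (x <= 0)%R -> u x y z = 0%R) -> (forall x y z, (z <= 0)%R -> u x y z = 0%R) ->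
  \int[mu]_x \int[mu]_y \int[mu]_z (u x y z)%:E =
  \int[mu]_(f in `](-(2 * Pi))%R, 0%R[) \int[mu]_s \int[mu]_r (uexp u f s r * wgt f s r)%:E.
Proof.
move=> u0 m3 ux uz; rewrite (int_chart u0 m3 ux).
have mw1 : measurable_fun setT (fun w : M * M * M => w.1.1).
  exact: (measurableT_comp measurable_fst measurable_fst).
have mw2 : measurable_fun setT (fun w : M * M * M => w.1.2).
  exact: (measurableT_comp measurable_snd measurable_fst).
have mw3 : measurable_fun setT (fun w : M * M * M => w.2) by exact: measurable_snd.
pose Phi m z := \int[mu]_x (u x (x * m)%R (x ^+ 2 * z)%R * x ^+ 3)%:E.
have v0 x m z : (0 <= u x (x * m) (x ^+ 2 * z) * x ^+ 3)%R.
  have [x0|x0] := leP x 0%R; first by rewrite ux// mul0r.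
  by rewrite mulr_ge0// exprn_ge0// ltW.
have P0 m z : 0 <= Phi m z by apply: integral_ge0 => x _; rewrite lee_fin.
have mP : measurable_fun setT (fun w : M * M => Phi w.1 w.2).
  apply: (measurable_int (T := (M * M)%type)) => [w x|]; first by rewrite lee_fin.
  apply/measurable_EFinP; apply: measurable_funM; last exact: measurable_funX.
  apply: (meas3_comp (T := (M * M * M)%type)) => //; first exact: measurable_funM.
  by apply: measurable_funM => //; exact: measurable_funX.
have Pz m z : (z <= 0)%R -> Phi m z = 0.
  move=> z0; apply: integral0_eq => x _; rewrite uz ?mul0r//.
  by rewrite mulr_ge0_le0 ?sqr_ge0.
transitivity (\int[mu]_m \int[mu]_f Theta Phi m f).
  by apply: eq_integral => m _; exact: (int_zet P0 mP (Pz m)).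
rewrite int_swap; [|by move=> m f; exact: Theta_ge0|exact: measurable_Theta].
rewrite [RHS]integral_mkcond; apply: eq_integral => f _; rewrite patchE.
case: ifPn => fI; last first.
  apply: integral0_eq => m _; rewrite /Theta; case: ifP => // mV.
  by have [fJ _ _] := chart_fwd q1 mV; move: fI; rewrite notin_setE /= in_itv/=; case.
move: fI; rewrite mem_setE in_itv/= => fI.
have mub : measurable_fun setT (fun w : M * M => (uexp u f w.1 w.2 * wgt f w.1 w.2)%:E).
  apply/measurable_EFinP; apply: measurable_funM.
    exact: (meas3_comp (T := (M * M)%type) (meas_uexp m3) (mcst f) measurable_fst measurable_snd).
  exact: (meas3_comp (T := (M * M)%type) meas_wgt (mcst f) measurable_fst measurable_snd).
have ub0 s r : 0 <= (uexp u f s r * wgt f s r)%:E.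
  by rewrite lee_fin mulr_ge0 ?wgt_ge0 /uexp.
pose Psi s := \int[mu]_r (uexp u f s r * wgt f s r)%:E.
have Psi0 s : 0 <= Psi s by apply: integral_ge0.
have mPsi : measurable_fun setT Psi by exact: (measurable_int (T := M)).
have r1 : (rad f <= - f)%R by rewrite /rad ge_min lexx.
have r2 : (rad f <= 2 * Pi + f)%R by rewrite /rad ge_min lexx orbT.
rewrite int_slope//.
transitivity (\int[mu]_(g in `](- rad f)%R, rad f[) Psi (g - f)%R).
  apply: eq_integral => g; rewrite mem_setE in_itv/= => /andP[g1 g2].
  have xI : (f < g < f + 2 * Pi)%R by apply/andP; split; lra.
  have k0 : (0 < C g - C f)%R by rewrite subr_gt0 eC_rad// ltr_norml g1 g2.
  have sI : (0 < g - f < 2 * Pi)%R by apply/andP; case/andP: xI => ? ?; split; lra.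
  have D0 : (0 <= Dq f g / (C g - C f) ^+ 4)%R.
    by rewrite divr_ge0 ?exprn_ge0 ?(ltW k0)//; apply/ltW/Dq_gt0.
  have mux : measurable_fun setT (fun x : M => (u x (x * slope f g)
       (x ^+ 2 * (Wq f g / (2 * (C g - C f) ^+ 2))) * x ^+ 3)%:E).
    apply/measurable_EFinP; apply: measurable_funM; last exact: measurable_funX.
    apply: (meas3_comp (T := M)) => //; first by apply: measurable_funM => //; exact: mcst.
    by apply: measurable_funM; [exact: measurable_funX|exact: mcst].
  rewrite /Phi (int_scale k0)//; last by move=> x; rewrite lee_fin.
  rewrite -int_mulr//; first last.
  - apply: emeasurable_funM; last exact: measurable_cst.
    by apply: (measurableT_comp mux); apply: measurable_funM => //; exact: mcst.
  - by move=> x; rewrite mule_ge0 ?lee_fin// ltW.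
  apply: eq_integral => r _; rewrite -!EFinM; congr (_%:E).
  rewrite /uexp /wgt sI andbT (addrC f) subrK.
  have kn : (C g - C f != 0)%R by rewrite gt_eqF.
  case: ltP => r0; last by rewrite ux ?mul0r ?mulr0// mulr_ge0_le0// ltW.
  have -> : ((C g - C f) * r * slope f g = r * (S g - S f))%R by rewrite /slope; field.
  have -> : (((C g - C f) * r) ^+ 2 * (Wq f g / (2 * (C g - C f) ^+ 2)) = r ^+ 2 / 2 * Wq f g)%R.
    by move: (Wq f g) (C g - C f)%R kn => W k kn; field.
  rewrite (mulrC (C g - C f)%R r); move: (u _ _ _) => U; move: (Dq f g) => D.
  move: (C g - C f)%R kn => k kn.
  by field.
rewrite [LHS]int_indic//.
rewrite [LHS](int_shift f); first last.
- apply: emeasurable_funM; last by apply/measurable_EFinP; exact: measurable_indic.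
  apply: (measurableT_comp mPsi); apply: measurable_funB => //; exact: mcst.
- by move=> x; rewrite mule_ge0// lee_fin.
apply: eq_integral => s _; rewrite addrK indicE mem_setE in_itv/=.
(* Outside this range the chord does not advance in x, so [u] is evaluated at a point with x <=
   0. *)
have [sI|sI] := boolP (- rad f < s + f < rad f)%R; first by rewrite mule1.
rewrite mule0; apply/esym/integral0_eq => r _; rewrite /uexp /wgt.
case: ifP => [/andP[r0 s2]|]; last by rewrite mulr0.
rewrite ux ?mul0r//; apply: mulr_ge0_le0; first exact: ltW.
rewrite subr_le0 leNgt eC_rad//; last by apply/andP; case/andP: s2 => ? ?; split; lra.
by move: sI; rewrite -ltr_norml addrC.
Qed.

End AreaFormula.

(** * The area formula on the whole upper half-space *)

Section FullArea.
Context {R : realType}.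
Local Notation M := (measurableTypeR R).
Local Notation mu := (@lebesgue_measure R).
Variable q : R.
Hypothesis q1 : 1 < q.
Local Notation C := (eC q).
Local Notation S := (eS q).
Local Notation Pi := (Piq q).
Local Notation Wq := (Wq q).
Local Notation Dq := (Dq q).
Local Notation al := (al q).
Local Notation wgt := (wgt q).
Local Notation uexp := (uexp q).
Let Pi0 : 0 < Pi. Proof. exact: Piq_gt0. Qed.
Local Open Scope ereal_scope.

Lemma int_ae_eq (s : seq R) (f g : M -> \bar R) : measurable_fun setT f -> measurable_fun setT g ->
  (forall x, 0 <= f x) -> (forall x, 0 <= g x) -> (forall x, x \notin s -> f x = g x) ->
  \int[mu]_x f x = \int[mu]_x g x.
Proof.
move=> mf mg f0 g0 fg; apply: ge0_ae_eq_integral => //.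
have cs : countable ([set` s] : set R) by apply: finite_set_countable; exact: finite_seq.
exists [set` s]; split.
- exact: countable_measurable.
- exact: countable_lebesgue_measure0.
by move=> x /= /not_implyP[_ ne]; apply/negPn/negP => /fg.
Qed.

(** Leaves only finitely many endpoints for which the chord from e(f) is vertical, the set neglected
    in [area_up]. *)
Lemma eC_eq_rad f g : (-(2 * Pi) < f < 0)%R -> (f < g < f + 2 * Pi)%R -> C g = C f ->
  `|g|%R = rad q f \/ `|g|%R = (2 * Pi - rad q f)%R.
Proof.
move=> fI gI CE; have /andP[f1 f2] := fI; have /andP[g1 g2] := gI.
have [rP rC r0] : [/\ (rad q f <= Pi)%R, C (rad q f) = C f & (0 < rad q f)%R].
  split; last exact: rad_gt0.
    by rewrite /rad; have [h|h] := leP (- f)%R (2 * Pi + f)%R; lra.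
  by rewrite /rad; have [h|h] := leP (- f)%R (2 * Pi + f)%R; rewrite ?eCN// addrC eCD2Pi.
have gC : C g = C `|g|%R by case: (ger0P g) => // _; rewrite eCN.
have inj x y : (0 <= x <= Pi)%R -> (0 <= y <= Pi)%R -> C x = C y -> x = y.
  move=> /andP[? ?] /andP[? ?] E; have [lt1|lt1|//] := ltgtP x y.
    by have := @eC_decr R q q1 x y ltac:(lra) lt1 ltac:(lra); rewrite E ltxx.
  by have := @eC_decr R q q1 y x ltac:(lra) lt1 ltac:(lra); rewrite E ltxx.
have gn := normr_ge0 g.
have g2P : (`|g| <= 2 * Pi)%R by rewrite ler_norml; apply/andP; split; lra.
have [gP|gP] := leP `|g|%R Pi.
  by left; apply: inj; rewrite ?gn ?gP ?rP ?(ltW r0)// -gC CE rC.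
right; have : (2 * Pi - `|g|)%R = rad q f.
  apply: inj; rewrite ?rP ?(ltW r0)//; first by apply/andP; split; lra.
  by rewrite -(eCN q1 (2 * Pi - `|g|)%R) opprB -(eCD2Pi q1 (`|g| - 2 * Pi)%R) subrK -gC CE rC.
by move=> <-; ring.
Qed.

Lemma wgtDPi f s r : wgt (f + Pi)%R s r = wgt f s r.
Proof.
rewrite /wgt /Dq /Wq /crs /al /ga (addrAC f Pi s).
rewrite !(eCDPi q1) !(eSDPi q1) !spN.
by congr (if _ then _ * _ else _)%R; ring.
Qed.

Definition layer (u : M -> M -> M -> R) (f : M) : \bar R :=
  \int[mu]_s \int[mu]_r (uexp u f s r * wgt f s r)%:E.

Lemma layer_meas u : (forall x y z, 0 <= u x y z)%R -> meas3 u ->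
  [/\ forall f, 0 <= layer u f, measurable_fun setT (layer u),
    forall f s, 0 <= \int[mu]_r (uexp u f s r * wgt f s r)%:E &
    forall f, measurable_fun setT (fun s => \int[mu]_r (uexp u f s r * wgt f s r)%:E)].
Proof.
move=> u0 m3; have k0 f s r : 0 <= (uexp u f s r * wgt f s r)%:E.
  by rewrite lee_fin mulr_ge0 ?wgt_ge0 // /uexp.
have mk : measurable_fun setT (fun w : M * M * M => (uexp u w.1.1 w.1.2 w.2 * wgt w.1.1 w.1.2 w.2)%:E).
  by apply/measurable_EFinP; apply: measurable_funM; [exact: meas_uexp|exact: meas_wgt].
have mk2 : measurable_fun setT (fun w : M * M => \int[mu]_r (uexp u w.1 w.2 r * wgt w.1 w.2 r)%:E).
  exact: (@measurable_int R _ (M * M)%type (fun w r => (uexp u w.1 w.2 r * wgt w.1 w.2 r)%:E)).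
split.
- by move=> f; apply: integral_ge0 => s _; apply: integral_ge0.
- by apply: (@measurable_int R _ M) => [f s|//]; apply: integral_ge0.
- by move=> f s; apply: integral_ge0.
- move=> f; exact: (measurableT_comp mk2 (measurable_fun_pair (mcst f) (@mid R))).
Qed.

Lemma layer_periodic u f : layer u (f + 2 * Pi)%R = layer u f.
Proof.
apply: eq_integral => s _; apply: eq_integral => r _; congr (_%:E).
have -> : (f + 2 * Pi = f + Pi + Pi)%R by ring.
rewrite !wgtDPi; congr (_ * _)%R; rewrite /uexp /Wq /crs.
rewrite !(addrAC _ Pi s) !(eCDPi q1) !(eSDPi q1) !opprK.
by congr (u _ _ _); ring.
Qed.

Let I0 := `](-(2 * Pi))%R, 0%R[%classic : set M.

(** After the shift the integral runs over ]-Pi, Pi[; cutting it at 0 and moving the right half by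
    one period restores the original interval up to a point. *)
Lemma periodic_shift (h : M -> \bar R) : (forall f, 0 <= h f) -> measurable_fun setT h ->
  (forall f, h (f + 2 * Pi)%R = h f) -> \int[mu]_(f in I0) h (f + Pi)%R = \int[mu]_(f in I0) h f.
Proof.
move=> h0 mh hp; have mI : measurable I0 by exact: measurable_itv.
rewrite (int_indic (fun f => h (f + Pi)%R) mI) (int_indic h mI).
have mi (a b : R) : measurable_fun setT (fun f : M => (\1_(`]a, b[ : set M) f)%:E : \bar R).
  by apply/measurable_EFinP; exact: measurable_indic.
have mhi (a b : R) : measurable_fun setT (fun f : M => h f * (\1_(`]a, b[ : set M) f)%:E).
  exact: emeasurable_funM.
have hi0 (a b : R) f : 0 <= h f * (\1_(`]a, b[ : set M) f)%:E by rewrite mule_ge0 ?lee_fin.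
have mhp : measurable_fun setT (fun f : M => h (f + Pi)%R).
  by apply: (measurableT_comp mh); apply: measurable_funD => //; exact: mcst.
pose i (a b : R) (x : M) : R := \1_(`]a, b[ : set M) x.
have iE a b x : i a b x = (a < x < b)%R%:R by rewrite /i indicE mem_setE in_itv.
transitivity (\int[mu]_f (h f * (i (- Pi) Pi f)%:E)).
  rewrite [LHS](int_shift (- Pi)%R).
  - apply: eq_integral => f _; rewrite subrK -!/(i _ _ _) !iE; congr (_ * (nat_of_bool _)%:R%:E).
    by rewrite ltrBlDr add0r; congr andb; apply/idP/idP; lra.
  - by move=> f; rewrite mule_ge0 ?lee_fin.
  - exact: (emeasurable_funM mhp (mi _ _)).
transitivity (\int[mu]_f (h f * (i (- Pi) 0 f)%:E + h f * (i 0 Pi f)%:E)).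
  apply: (@int_ae_eq [:: 0%R]).
  - exact: mhi.
  - by apply: emeasurable_funD; exact: mhi.
  - by move=> f; exact: hi0.
  - by move=> f; rewrite adde_ge0//; exact: hi0.
  move=> f; rewrite inE => f0; rewrite !iE.
  have [fn|fp|/eqP] := ltgtP f 0%R; last by rewrite (negbTE f0).
    by rewrite andbT /= mule0 adde0 (lt_trans fn Pi0) andbT.
  by rewrite andbF mule0 add0e (lt_trans _ fp)// oppr_lt0.
rewrite (ge0_integralD mu measurableT (fun f _ => hi0 (- Pi)%R 0%R f) (mhi (- Pi)%R 0%R)
  (fun f _ => hi0 0%R Pi f) (mhi 0%R Pi)).
rewrite [X in _ + X](int_shift (2 * Pi)%R (hi0 0%R Pi) (mhi 0%R Pi)) -/(i _ _).
have -> : \int[mu]_f (h (f + 2 * Pi)%R * (i 0 Pi (f + 2 * Pi)%R)%:E) =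
    \int[mu]_f (h f * (i (-(2 * Pi)) (- Pi) f)%:E).
  apply: eq_integral => f _; rewrite hp !iE; congr (_ * (nat_of_bool _)%:R%:E).
  by congr andb; apply/idP/idP; lra.
rewrite -(ge0_integralD mu measurableT (fun f _ => hi0 (- Pi)%R 0%R f) (mhi (- Pi)%R 0%R)
  (fun f _ => hi0 (-(2 * Pi))%R (- Pi)%R f) (mhi (-(2 * Pi))%R (- Pi)%R)).
apply: (@int_ae_eq [:: (- Pi)%R]).
- by apply: emeasurable_funD; exact: mhi.
- exact: mhi.
- by move=> f; rewrite adde_ge0//; exact: hi0.
- by move=> f; exact: hi0.
move=> f; rewrite inE => f0; rewrite -!/(i _ _ _) !iE.
have [fn|fp|/eqP] := ltgtP f (- Pi)%R; last by rewrite (negbTE f0).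
  by rewrite /= mule0 add0e (lt_trans fn) ?oppr_lt0.
rewrite andbF mule0 adde0 (lt_trans _ fp)// ltrN2.
by have : (0 < Pi)%R by []; lra.
Qed.

Lemma meas3_mulb (u : M -> M -> M -> R) (b : M -> bool) : meas3 u -> measurable_fun setT b ->
  meas3 (fun x y z => if b x then u x y z else 0%R).
Proof.
move=> m3 mb; have mb' : measurable_fun setT (fun w : M * M * M => b w.1.1).
  by apply: (measurableT_comp mb); exact: (measurableT_comp measurable_fst measurable_fst).
exact: (measurable_fun_ifT mb' m3 (@measurable_cst _ _ _ _ setT (0%R : M))).
Qed.

Lemma inner_meas u : (forall x y z, 0 <= u x y z)%R -> meas3 u ->
  [/\ forall x, 0 <= \int[mu]_y \int[mu]_z (u x y z)%:E,
    measurable_fun setT (fun x => \int[mu]_y \int[mu]_z (u x y z)%:E),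
    forall x y, 0 <= \int[mu]_z (u x y z)%:E &
    forall x, measurable_fun setT (fun y => \int[mu]_z (u x y z)%:E)].
Proof.
move=> u0 m3; have k0 x y z : 0 <= (u x y z)%:E by rewrite lee_fin.
have mk : measurable_fun setT (fun w : M * M * M => (u w.1.1 w.1.2 w.2)%:E) by exact/measurable_EFinP.
have mk2 : measurable_fun setT (fun w : M * M => \int[mu]_z (u w.1 w.2 z)%:E).
  exact: (@measurable_int R _ (M * M)%type (fun w z => (u w.1 w.2 z)%:E)).
split.
- by move=> x; apply: integral_ge0 => y _; apply: integral_ge0.
- by apply: (@measurable_int R _ M) => [x y|//]; apply: integral_ge0.
- by move=> x y; apply: integral_ge0.
- move=> x; exact: (measurableT_comp mk2 (measurable_fun_pair (mcst x) (@mid R))).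
Qed.

(** The half-turn of the plane adds [Pi] to [f] and preserves the height and the Jacobian;
    periodicity restores the range of [f]. *)
Lemma area_neg (u : M -> M -> M -> R) : (forall x y z, 0 <= u x y z)%R -> meas3 u ->
  (forall x y z, (0 <= x)%R -> u x y z = 0%R) -> (forall x y z, (z <= 0)%R -> u x y z = 0%R) ->
  \int[mu]_x \int[mu]_y \int[mu]_z (u x y z)%:E = \int[mu]_(f in I0) layer u f.
Proof.
move=> u0 m3 ux uz; have [i0 mi i20 mi2] := inner_meas u0 m3.
have [l0 ml _ _] := layer_meas u0 m3.
rewrite (int_opp i0 mi).
transitivity (\int[mu]_x \int[mu]_y \int[mu]_z (u (- x)%R (- y)%R z)%:E).
  by apply: eq_integral => x _; rewrite (int_opp (i20 _) (mi2 _)).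
rewrite (@area_pos R q q1 (fun x y z => u (- x)%R (- y)%R z)).
- rewrite -(periodic_shift l0 ml (layer_periodic u)); apply: eq_integral => f _.
  apply: eq_integral => s _; apply: eq_integral => r _; rewrite wgtDPi; congr (_ * _)%:E.
  rewrite /uexp /Wq /crs (addrAC f Pi s) !(eCDPi q1) !(eSDPi q1).
  by congr (u _ _ _); ring.
- by move=> x y z; exact: u0.
- apply: (@meas3_comp R u _ (M * M * M)%type (fun w => - w.1.1)%R (fun w => - w.1.2)%R (fun w => w.2) m3).
  + by apply: measurableT_comp => //; exact: (measurableT_comp measurable_fst measurable_fst).
  + by apply: measurableT_comp => //; exact: (measurableT_comp measurable_snd measurable_fst).
  + exact: measurable_snd.
- by move=> x y z x0; rewrite ux// oppr_ge0.
- by move=> x y z z0; rewrite uz.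
Qed.

Lemma area_up (u : M -> M -> M -> R) : (forall x y z, 0 <= u x y z)%R -> meas3 u ->
  (forall x y z, (z <= 0)%R -> u x y z = 0%R) ->
  \int[mu]_x \int[mu]_y \int[mu]_z (u x y z)%:E = \int[mu]_(f in I0) layer u f.
Proof.
move=> u0 m3 uz.
pose up x y z := (if 0 < x then u x y z else 0)%R.
pose un x y z := (if x < 0 then u x y z else 0)%R.
have up0 x y z : (0 <= up x y z)%R by rewrite /up; case: ifP.
have un0 x y z : (0 <= un x y z)%R by rewrite /un; case: ifP.
have mup : meas3 up by apply: meas3_mulb => //; exact: (measurable_fun_ltr (mcst 0%R) (@mid R)).
have mun : meas3 un by apply: meas3_mulb => //; exact: (measurable_fun_ltr (@mid R) (mcst 0%R)).
have [i0 mi _ _] := inner_meas u0 m3.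
have [ip0 mip _ _] := inner_meas up0 mup; have [in0 min_ _ _] := inner_meas un0 mun.
have [l0 ml k0 mk] := layer_meas u0 m3.
have [lp0 mlp kp0 mkp] := layer_meas up0 mup; have [ln0 mln kn0 mkn] := layer_meas un0 mun.
transitivity (\int[mu]_x (\int[mu]_y \int[mu]_z (up x y z)%:E + \int[mu]_y \int[mu]_z (un x y z)%:E)).
  apply: (@int_ae_eq [:: 0%R]).
  - exact: mi.
  - exact: (emeasurable_funD mip min_).
  - exact: i0.
  - by move=> x; rewrite adde_ge0.
  move=> x; rewrite inE => x0.
  have [xn|xp|/eqP] := ltgtP x 0%R; last by rewrite (negbTE x0).
    rewrite [X in _ = X + _](_ : _ = 0) ?add0e.
      by apply: eq_integral => y _; apply: eq_integral => z _; rewrite /un xn.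
    by apply: integral0_eq => y _; apply: integral0_eq => z _; rewrite /up ltNge (ltW xn).
  rewrite [X in _ = _ + X](_ : _ = 0) ?adde0.
    by apply: eq_integral => y _; apply: eq_integral => z _; rewrite /up xp.
  by apply: integral0_eq => y _; apply: integral0_eq => z _; rewrite /un ltNge (ltW xp).
rewrite (ge0_integralD mu measurableT (fun x _ => ip0 x) mip (fun x _ => in0 x) min_).
have upx x y z : (x <= 0)%R -> up x y z = 0%R by move=> x0; rewrite /up ltNge x0.
have unx x y z : (0 <= x)%R -> un x y z = 0%R by move=> x0; rewrite /un ltNge x0.
have upz x y z : (z <= 0)%R -> up x y z = 0%R by move=> z0; rewrite /up uz// if_same.
have unz x y z : (z <= 0)%R -> un x y z = 0%R by move=> z0; rewrite /un uz// if_same.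
rewrite (area_pos q1 up0 mup upx upz) (area_neg un0 mun unx unz).
have mI : measurable I0 by exact: measurable_itv.
rewrite -(ge0_integralD mu mI (fun f _ => lp0 f) (measurable_funTS mlp) (fun f _ => ln0 f) (measurable_funTS mln)).
apply: eq_integral => f; rewrite mem_setE in_itv/= => fI.
rewrite -(ge0_integralD mu measurableT (fun s _ => kp0 f s) (mkp f) (fun s _ => kn0 f s) (mkn f)).
pose ra := rad q f.
(* The four values of [s] for which the chord can be vertical. For the other parameters in range
   exactly one of [up] and [un] agrees with [u] and the other vanishes. *)
apply: (@int_ae_eq [:: ra - f; - ra - f; 2 * Pi - ra - f; - (2 * Pi - ra) - f]%R).
- exact: (emeasurable_funD (mkp f) (mkn f)).
- exact: mk.
- by move=> s; rewrite adde_ge0.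
- exact: k0.
move=> s; rewrite !inE !negb_or => /and4P[n1 n2 n3 n4].
have [sI|sI] := boolP (0 < s < 2 * Pi)%R; last first.
  have w0 r : wgt f s r = 0%R by rewrite /wgt (negbTE sI) andbF.
  rewrite !integral0_eq ?adde0//; by move=> r _; rewrite w0 mulr0.
have Cne : C (f + s)%R != C f.
  apply/eqP => CE; have gI : (f < f + s < f + 2 * Pi)%R by rewrite ltrDl ltrD2l.
  have := eC_eq_rad fI gI CE; rewrite -/ra.
  have K (a : R) : `|f + s|%R = a -> s = (a - f)%R \/ s = (- a - f)%R.
    by case: (ger0P (f + s)%R) => _ <-; [left|right]; ring.
  by move=> [] /K [] E; move: n1 n2 n3 n4; rewrite -E eqxx.
have [Cl|Cg|/eqP] := ltgtP (C (f + s)%R) (C f); last by rewrite (negbTE Cne).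
  rewrite [X in X + _](_ : _ = 0) ?add0e.
    apply: eq_integral => r _; rewrite /wgt sI andbT; case: ltP => r0; rewrite ?mulr0//.
    by rewrite /uexp /un nmulr_llt0 ?r0// subr_lt0.
  apply: integral0_eq => r _; rewrite /wgt sI andbT; case: ltP => r0; rewrite ?mulr0//.
  rewrite /uexp /up ltNge (_ : _ <= _)%R ?mul0r//.
  by rewrite mulr_ge0_le0 ?(ltW r0)// subr_le0 ltW.
rewrite [X in _ + X](_ : _ = 0) ?adde0.
  apply: eq_integral => r _; rewrite /wgt sI andbT; case: ltP => r0; rewrite ?mulr0//.
  by rewrite /uexp /up mulr_gt0// subr_gt0.
apply: integral0_eq => r _; rewrite /wgt sI andbT; case: ltP => r0; rewrite ?mulr0//.
rewrite /uexp /un ltNge (_ : _ <= _)%R ?mul0r//.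
by rewrite mulr_ge0 ?(ltW r0)// subr_ge0 ltW.
Qed.

End FullArea.

(** * Contraction of sets *)

Section Contraction.
Context {R : realType}.
Local Notation M := (measurableTypeR R).
Local Notation H := (M * M * M)%type.
Local Notation mu := (@lebesgue_measure R).
Local Notation lebesgue3 := (@lebesgue3 R).
Variables (p q : R).
Hypotheses (p1 : 1 < p) (q1 : 1 < q) (pq : p^-1 + q^-1 = 1).
Local Notation C := (eC q).
Local Notation S := (eS q).
Local Notation Pi := (Piq q).
Local Notation Dq := (Dq q).
Local Notation expF := (expF q).
Local Notation d := (heis_dist p).
Let p0 : 0 < p. Proof. exact: lt_trans ltr01 p1. Qed.
Let Pi0 : 0 < Pi. Proof. exact: Piq_gt0. Qed.
Let I0 := `](-(2 * Pi))%R, 0%R[%classic : set M.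

Let mw1 : measurable_fun setT (fun w : H => w.1.1).
Proof. exact: (measurableT_comp measurable_fst measurable_fst). Qed.
Let mw2 : measurable_fun setT (fun w : H => w.1.2).
Proof. exact: (measurableT_comp measurable_snd measurable_fst). Qed.
Let mw3 : measurable_fun setT (fun w : H => w.2).
Proof. exact: measurable_snd. Qed.

Lemma measurable_triple (a b c : H -> M) : measurable_fun setT a -> measurable_fun setT b ->
  measurable_fun setT c -> measurable_fun setT (fun w => (a w, b w, c w) : H).
Proof. by move=> ma mb mc; apply: measurable_fun_pair => //; exact: measurable_fun_pair. Qed.

Lemma measurable_hmir : measurable_fun setT (hmir : H -> H).
Proof.
rewrite (_ : hmir = fun w : H => (w.1.1, - w.1.2, - w.2) : H); last by apply/funext => -[[]].
by apply: measurable_triple => //; apply: measurableT_comp.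
Qed.

Lemma measurable_left (g : H) : measurable_fun setT (heis_mul g : H -> H).
Proof.
rewrite (_ : heis_mul g = fun w : H => (g.1.1 + w.1.1, g.1.2 + w.1.2,
   g.2 + w.2 + 2^-1 * (g.1.1 * w.1.2 - w.1.1 * g.1.2)) : H); last first.
  by case: g => [[a b] c]; apply/funext => -[[]].
apply: measurable_triple; first by apply: measurable_funD => //; exact: mcst.
  by apply: measurable_funD => //; exact: mcst.
apply: measurable_funD; first by apply: measurable_funD => //; exact: mcst.
apply: measurable_funM; first exact: mcst.
by apply: measurable_funB; apply: measurable_funM => //; exact: mcst.
Qed.

Lemma preimage_measurable (F : H -> H) (O : set H) : measurable_fun setT F -> measurable O ->
  measurable (F @^-1` O).
Proof. by move=> mF mO; rewrite -[X in measurable X]setTI; exact: mF. Qed.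

Lemma meas3_indic (O : set H) : measurable O -> meas3 (fun x y z => \1_O (x, y, z) : R).
Proof.
move=> mO; have : measurable_fun setT (\1_O : H -> R) by exact: measurable_indic.
by congr measurable_fun; apply/funext => -[[]].
Qed.

Local Open Scope ereal_scope.

Lemma lebesgue3_mir (O : set H) : measurable O -> lebesgue3 (hmir @^-1` O) = lebesgue3 O.
Proof.
move=> mO; have mO' := preimage_measurable measurable_hmir mO.
rewrite (lebesgue3E mO') (lebesgue3E mO).
have u0 x y z : (0 <= \1_O (x, y, z) :> R)%R by rewrite indicE ler0n.
have [i0 mi i20 mi2] := inner_meas u0 (meas3_indic mO).
apply: eq_integral => x _; rewrite [RHS](int_opp (i20 x) (mi2 x)); apply: eq_integral => y _.
rewrite [RHS]int_opp//.
by apply/measurable_EFinP; apply: (meas3_comp (T := M) (meas3_indic mO)); [exact: mcst|exact: mcst|exact: mid].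
Qed.

(** With x and y fixed, the group law translates z, so three one-dimensional shifts suffice. *)
Lemma lebesgue3_left (g : H) (O : set H) : measurable O ->
  lebesgue3 (heis_mul g @^-1` O) = lebesgue3 O.
Proof.
move=> mO; have mO' := preimage_measurable (measurable_left g) mO.
case: g mO' => [[a b] c] mO'.
rewrite (lebesgue3E mO') (lebesgue3E mO).
have u0 x y z : (0 <= \1_O (x, y, z) :> R)%R by rewrite indicE ler0n.
have [i0 mi i20 mi2] := inner_meas u0 (meas3_indic mO).
rewrite [RHS](int_shift a i0 mi); apply: eq_integral => x _.
rewrite [RHS](int_shift b (i20 _) (mi2 _)); apply: eq_integral => y _.
rewrite [RHS](int_shift (c + 2^-1 * (a * y - x * b))%R)//; last first.
  by apply/measurable_EFinP; apply: (meas3_comp (T := M) (meas3_indic mO)); [exact: mcst|exact: mcst|exact: mid].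
apply: eq_integral => z _; rewrite (addrC x a) (addrC y b); congr (_%:E).
rewrite (_ : (z + (c + 2^-1 * (a * y - x * b)))%R = (c + z + 2^-1 * (a * y - x * b))%R); last by ring.
by rewrite !indicE.
Qed.

Definition upind (O : set H) (x y z : M) : R := (if 0 < z then \1_O (x, y, z) else 0)%R.

Lemma upind_props (O : set H) : measurable O -> [/\ forall x y z, (0 <= upind O x y z)%R,
  meas3 (upind O) & forall x y z, (z <= 0)%R -> upind O x y z = 0%R].
Proof.
move=> mO; split.
- by move=> x y z; rewrite /upind; case: ifP.
- apply: measurable_fun_ifT; [exact: (measurable_fun_ltr (mcst 0%R) mw3)|exact: meas3_indic|exact: (mcst (0%R : M))].
- by move=> x y z z0; rewrite /upind ltNge z0.
Qed.

Lemma measurable_up : measurable [set w : H | (0 < w.2)%R].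
Proof. exact: (mltset (mcst (0%R : M)) mw3). Qed.

Lemma area3 (O : set H) : measurable O ->
  lebesgue3 (O `&` [set w | (0 < w.2)%R]) = \int[mu]_(f in I0) layer q (upind O) f.
Proof.
move=> mO; have [u0 m3 uz] := upind_props mO.
rewrite -(area_up q1 u0 m3 uz) lebesgue3E; last by apply: measurableI => //; exact: measurable_up.
apply: eq_integral => x _; apply: eq_integral => y _; apply: eq_integral => z _.
have E : ((x, y, z) \in [set w : H | (0 < w.2)%R]) = (0 < z)%R by apply/idP/idP; rewrite inE.
by rewrite /upind !indicE in_setI E; case: ifP => _; rewrite ?andbT ?andbF.
Qed.

(** The plane z = 0 is null, and the reflection carries the lower half-space to the upper one. *)
Lemma area_split (O : set H) : measurable O -> lebesgue3 O =
  lebesgue3 (O `&` [set w | (0 < w.2)%R]) + lebesgue3 ((hmir @^-1` O) `&` [set w | (0 < w.2)%R]).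
Proof.
move=> mO; have mOm := preimage_measurable measurable_hmir mO.
pose Od := O `&` [set w : H | (w.2 < 0)%R]; pose Oz := O `&` [set w : H | w.2 = 0%R].
have mu_ : measurable (O `&` [set w : H | (0 < w.2)%R]) by apply: measurableI => //; exact: measurable_up.
have md : measurable [set w : H | (w.2 < 0)%R] by exact: (mltset mw3 (mcst (0%R : M))).
have mOd : measurable Od by exact: measurableI.
have mz : measurable [set w : H | w.2 = 0%R].
  rewrite (_ : [set w : H | w.2 = 0%R] = ~` ([set w : H | (0 < w.2)%R] `|` [set w : H | (w.2 < 0)%R])).
    by apply: measurableC; apply: measurableU => //; exact: measurable_up.
  apply/seteqP; split => w /=; first by move=> ->; rewrite ltxx => -[].
  by move=> /not_orP[/negP h1 /negP h2]; apply/eqP; rewrite eq_le !leNgt h1 h2.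
have z0 : lebesgue3 [set w : H | w.2 = 0%R] = 0.
  rewrite lebesgue3E//; apply: integral0_eq => x _; apply: integral0_eq => y _.
  transitivity (\int[mu]_(_ in [set: M]) (0 : \bar R)); last exact: integral0.
  apply: (@int_ae_eq R [:: 0%R]) => //.
  - apply/measurable_EFinP; apply: (meas3_comp (T := M) (meas3_indic mz)); [exact: mcst|exact: mcst|exact: mid].
  - by move=> z; rewrite inE => zn; rewrite indicE memNset//= => /eqP; rewrite (negbTE zn).
have Oz0 : lebesgue3 Oz = 0.
  apply/eqP; rewrite eq_le measure_ge0 andbT -z0; apply: le_measure; rewrite ?inE//.
    exact: measurableI.
  by move=> w [].
have -> : (hmir @^-1` O) `&` [set w : H | (0 < w.2)%R] = hmir @^-1` Od.
  by apply/seteqP; split => -[[x y] z]; rewrite /Od /= oppr_lt0.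
rewrite lebesgue3_mir//.
have OE : O = (O `&` [set w : H | (0 < w.2)%R]) `|` (Od `|` Oz).
  apply/seteqP; split => w; last by case=> [[]//|[[]//|[]//]].
  move=> Ow; have [h|h|h] := ltgtP 0%R w.2; [by left|by right; left|by right; right].
have mOz : measurable Oz by exact: measurableI.
have d0 : Od `&` Oz = set0.
  apply/seteqP; split => w //= [[_ /= h1] [_ /= h2]].
  by have := h1; rewrite lt_neqAle => /andP[/eqP ne _]; exact: (ne h2).
have d1 : O `&` [set w : H | (0 < w.2)%R] `&` (Od `|` Oz) = set0.
  apply/seteqP; split => w //= [[_ /= h1] [[_ /= h2]|[_ /= h2]]].
    by move: (lt_trans h1 h2); rewrite ltxx.
  by have := h1; rewrite lt_neqAle => /andP[/eqP ne _]; exact: (ne (esym h2)).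
have E1 := measureU lebesgue3 mu_ (measurableU _ _ mOd mOz) d1; rewrite -OE in E1.
have E2 := measureU lebesgue3 mOd mOz d0.
have E3 := etrans E2 (etrans (f_equal (fun x => lebesgue3 Od + x) Oz0) (adde0 _)).
exact: (etrans E1 (f_equal (fun x => lebesgue3 (O `&` [set w : H | (0 < w.2)%R]) + x) E3)).
Qed.

Definition jacobian_decay (N : R) := forall f s t : R, (-(2 * Pi) < f < 0)%R -> (0 < s < 2 * Pi)%R ->
  (0 < t < 1)%R -> (t `^ (N - 1) * Dq f (f + s) <= Dq f (f + t * s))%R.

Lemma int_le (D : set M) (f g : M -> \bar R) : measurable D -> (forall x, 0 <= f x) ->
  (forall x, 0 <= g x) -> measurable_fun setT f -> measurable_fun setT g ->
  (forall x, D x -> f x <= g x) -> \int[mu]_(x in D) f x <= \int[mu]_(x in D) g x.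
Proof.
move=> mD f0 g0 mf mg fg; apply: ge0_le_integral.
- exact: mD.
- by move=> x _; exact: f0.
- exact: measurable_funTS mf.
- exact: measurable_funTS mg.
- exact: fg.
Qed.

Lemma contract_up (N t : R) (Om O : set H) : jacobian_decay N -> (0 < t <= 1)%R ->
  measurable Om -> measurable O ->
  (forall f s r, (0 < s < 2 * Pi)%R -> (0 < r)%R -> Om (expF f s r) -> O (expF f (t * s) r)) ->
  (t `^ N)%:E * lebesgue3 (Om `&` [set w | (0 < w.2)%R]) <= lebesgue3 (O `&` [set w | (0 < w.2)%R]).
Proof.
move=> J /andP[t0 t1] mOm mO sub; rewrite !area3//.
have [uo0 mo uoz] := upind_props mOm; have [u0 m3 uz] := upind_props mO.
have [l0 ml k0 mk] := layer_meas q1 u0 m3; have [lo0 mlo ko0 mko] := layer_meas q1 uo0 mo.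
have mI : measurable I0 by exact: measurable_itv.
have tN0 : (0 <= t `^ N)%R by exact: powR_ge0.
have tN0' : 0 <= (t `^ N)%:E by rewrite lee_fin.
rewrite -(ge0_integralZl mu mI (measurable_funTS mlo) (fun f _ => lo0 f) tN0').
apply: int_le; [exact: mI|by move=> f; rewrite mule_ge0|exact: l0| |exact: ml|].
  by apply: emeasurable_funM => //; exact: measurable_cst.
move=> f; rewrite /I0 /= in_itv/= => fI; rewrite muleC /layer -(int_mulr tN0 (ko0 f) (mko f)).
(* Replacing [s] by [t * s] supplies one factor [t]; this is why the Jacobian has to decay with
   exponent N - 1 and not N. *)
rewrite [leRHS](int_scale t0 (k0 f) (mk f)).
have mkt : measurable_fun setT (fun s : M => \int[mu]_r (uexp q (upind O) f (t * s)%R r * wgt q f (t * s)%R r)%:E).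
  by apply: (measurableT_comp (mk f)); apply: measurable_funM => //; exact: mcst.
have tE0 : 0 <= t%:E by rewrite lee_fin ltW.
apply: int_le; [exact: measurableT|by move=> s; rewrite mule_ge0|by move=> s; rewrite mule_ge0| | |].
- exact: (emeasurable_funM (mko f) (@measurable_cst _ _ _ _ setT (t `^ N)%:E)).
- exact: (emeasurable_funM mkt (@measurable_cst _ _ _ _ setT t%:E)).
move=> s _.
have mr (v : M -> M -> M -> R) s' : meas3 v ->
    measurable_fun setT (fun r : M => (uexp q v f s' r * wgt q f s' r)%:E).
  move=> m3v; apply/measurable_EFinP; apply: measurable_funM.
    exact: (meas3_comp (T := M) (meas_uexp q1 m3v) (mcst f) (mcst s') (@mid R)).
  exact: (meas3_comp (T := M) (meas_wgt q1) (mcst f) (mcst s') (@mid R)).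
have r0 (v : M -> M -> M -> R) s' r : (forall x y z, 0 <= v x y z)%R ->
    0 <= (uexp q v f s' r * wgt q f s' r)%:E.
  by move=> v0; rewrite lee_fin mulr_ge0 ?wgt_ge0// /uexp.
rewrite -(int_mulr tN0 (fun r => r0 _ _ r uo0) (mr _ _ mo)) -(int_mulr (ltW t0) (fun r => r0 _ _ r u0) (mr _ _ m3)).
apply: int_le; [exact: measurableT|by move=> r; rewrite mule_ge0// r0|by move=> r; rewrite mule_ge0// r0| | |].
- by apply: emeasurable_funM; [exact: mr|exact: measurable_cst].
- by apply: emeasurable_funM; [exact: mr|exact: measurable_cst].
move=> r _; rewrite -!EFinM lee_fin.
rewrite [in leLHS]/wgt; case: ifPn => [/andP[rp sI]|_]; last first.
  by rewrite mulr0 mul0r !mulr_ge0 ?(ltW t0) ?wgt_ge0// /uexp.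
have /andP[s0 s2] := sI.
have tsI : (0 < t * s < 2 * Pi)%R.
  by rewrite mulr_gt0//= (le_lt_trans _ s2)// ler_piMl// ltW.
have W0 s' : (0 < s' < 2 * Pi)%R -> (0 < r ^+ 2 / 2 * Wq q f (f + s'))%R.
  move=> /andP[? ?]; rewrite mulr_gt0 ?divr_gt0 ?exprn_gt0//; apply: Wq_gt0 => //.
  by apply/andP; split; lra.
have DO : (t `^ N * Dq f (f + s) <= Dq f (f + t * s) * t)%R.
  have tE : (t `^ N = t `^ (N - 1) * t)%R.
    by rewrite -{3}(powRr1 (ltW t0)) -powRD ?subrK// (gt_eqF t0) implybT.
  rewrite tE mulrAC ler_pM2r//; move: t1; rewrite le_eqVlt => /predU1P[->|t1].
    by rewrite powR1 !mul1r.
  by apply: J => //; rewrite t0.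
rewrite /wgt rp tsI /= /uexp /upind !W0//.
have sub' := sub f s r sI rp; rewrite !indicE.
case: (boolP (_ \in Om)) => [/set_mem/sub' OO|_].
  rewrite mem_set// !mul1r; have := ler_wpM2l (exprn_ge0 3 (ltW rp)) DO.
  by rewrite mulrA (mulrC (r ^+ 3)%R (t `^ N)%R) -mulrA (mulrC (t `^ N)%R) mulrA.
rewrite !mul0r !mulr_ge0 ?exprn_ge0 ?(ltW rp) ?(ltW t0)//.
by apply/ltW/Dq_gt0 => //; apply/andP; case/andP: tsI => ? ?; split; lra.
Qed.

(** The union of a countable measurable cover is a single measurable superset, so such supersets
    suffice. Whether an intermediate set is measurable need not be decided. *)
Lemma mu_ext_ge (A : set H) (c : \bar R) :
  (forall O : set H, measurable O -> A `<=` O -> c <= lebesgue3 O) -> c <= mu_ext lebesgue3 A.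
Proof.
move=> Hc; apply: le_ereal_inf_tmp => _ [F [mF AF] <-].
have mU : measurable (\bigcup_k F k) by exact: bigcup_measurable.
apply: le_trans (Hc _ mU AF) _.
exact: (generalized_Boole_inequality lebesgue3 mF mU).
Qed.

Lemma mu_ext_le (A O : set H) : measurable O -> A `<=` O -> mu_ext lebesgue3 A <= lebesgue3 O.
Proof. by move=> mO AO; rewrite -(measurable_mu_extE lebesgue3 mO); exact: le_mu_ext. Qed.

Lemma expF_intermediate (Om : set H) f s r t : (0 <= t <= 1)%R -> (0 < s < 2 * Pi)%R -> (0 < r)%R ->
  Om (expF f s r) -> intermediate_set (d : H -> H -> R) (0, 0, 0)%R Om t (expF f (t * s) r).
Proof.
move=> t01 /andP[s0 s2] r0 Oms; exists (fun u => expF f (s * u) r); split.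
- have := @expF_geodesic R p q p1 q1 pq (0, 0, 0)%R f s r _ r0; rewrite !ltW// => /(_ isT).
  by congr min_geodesic; apply/funext => u; rewrite heis_0mul.
- by rewrite mulr0 expF0.
- by rewrite mulr1.
- by rewrite mulrC.
Qed.

Lemma intermediate_mir (Om : set H) t y : intermediate_set (d : H -> H -> R) (0, 0, 0)%R (hmir @^-1` Om) t y ->
  intermediate_set (d : H -> H -> R) (0, 0, 0)%R Om t (hmir y).
Proof.
move=> [gam [hg g0 g1 gt]]; exists (hmir \o gam); split => //=.
- by move=> a b a01 b01 /=; rewrite !dist_mir; exact: hg.
- by rewrite g0 /= oppr0.
- by rewrite gt.
Qed.

Lemma intermediate_left (g : H) (Om : set H) t y : intermediate_set (d : H -> H -> R) g Om t y <->
  intermediate_set (d : H -> H -> R) (0, 0, 0)%R (heis_mul g @^-1` Om) t (heis_mul (hinv g) y).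
Proof.
split=> [[gam [hg g0 g1 gt]]|[gam [hg g0 g1 gt]]].
  exists (fun u => heis_mul (hinv g) (gam u)); split.
  - by move=> a b a01 b01 /=; rewrite !dist_left; exact: hg.
  - by rewrite g0 heis_Vmul.
  - by rewrite /= heis_mulA heis_mulV heis_0mul.
  - by rewrite gt.
exists (fun u => heis_mul g (gam u)); split.
- by move=> a b a01 b01 /=; rewrite !dist_left; exact: hg.
- by rewrite g0 heis_mul0.
- exact: g1.
- by rewrite gt heis_mulA heis_mulV heis_0mul.
Qed.

Lemma contract0 (N t : R) (Om O : set H) : jacobian_decay N -> (0 < t <= 1)%R ->
  measurable Om -> measurable O -> intermediate_set (d : H -> H -> R) (0, 0, 0)%R Om t `<=` O ->
  (t `^ N)%:E * lebesgue3 Om <= lebesgue3 O.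
Proof.
move=> J tI mOm mO sub; have t01 : (0 <= t <= 1)%R by case/andP: tI => /ltW -> ->.
rewrite (area_split mOm) (area_split mO) ge0_muleDr ?measure_ge0//; apply: leeD.
  apply: contract_up => // f s r sI r0 Of; apply: sub; exact: expF_intermediate.
apply: contract_up => //; try exact: (preimage_measurable measurable_hmir).
move=> f s r sI r0 Of; apply: sub; apply: intermediate_mir; exact: expF_intermediate.
Qed.

Lemma contract (N t : R) (g : H) (Om : set H) : jacobian_decay N -> (0 <= t <= 1)%R -> (0 < N)%R ->
  measurable Om -> (t `^ N)%:E * lebesgue3 Om <= mu_ext lebesgue3 (intermediate_set (d : H -> H -> R) g Om t).
Proof.
move=> J /andP[]; rewrite le_eqVlt => /predU1P[<-|t0] t1 N0 mOm.
  by rewrite powR0 ?gt_eqF// mul0e mu_ext_ge0// => A; exact: measure_ge0.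
apply: mu_ext_ge => O mO sub.
rewrite -(lebesgue3_left g mOm) -(lebesgue3_left g mO).
apply: contract0 => //; [by rewrite t0|exact: preimage_measurable (measurable_left g) mOm|exact: preimage_measurable (measurable_left g) mO|].
move=> y hy; apply: sub; apply/intermediate_left.
by rewrite heis_mulA heis_Vmul heis_0mul.
Qed.

End Contraction.

(** * Decay of the Jacobian *)

Section Decay.
Context {R : realType}.
Variable q : R.
Hypothesis q1 : 1 < q.
Let q0 : 0 < q. Proof. exact: lt_trans ltr01 q1. Qed.
Local Notation C := (eC q).
Local Notation S := (eS q).
Local Notation Pi := (Piq q).
Local Notation al := (al q).
Local Notation ga := (ga q).
Local Notation crs := (crs q).
Local Notation Dq := (Dq q).
Local Notation kap := (kap q).
Local Notation fq := (fq q).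
Implicit Types f g h t x y : R.
Let Pi0 : 0 < Pi. Proof. exact: Piq_gt0. Qed.

Lemma continuous_le0 (F : R -> R) (x d : R) : {for x, continuous F} -> 0 < d ->
  (forall y, x < y < x + d -> F y <= 0) -> F x <= 0.
Proof.
move=> /cts_epsP cF d0 H; rewrite leNgt; apply/negP => F0.
have [e e0 He] := cF (F x / 2) (divr_gt0 F0 (ltr0Sn _ _)).
pose h := Num.min (d / 2) (e / 2).
have h0 : 0 < h by rewrite /h lt_min !divr_gt0.
have hd : h <= d / 2 by rewrite /h ge_min lexx.
have he : h <= e / 2 by rewrite /h ge_min lexx orbT.
have : `|F (x + h) - F x| <= F x / 2 by apply: He; rewrite addrC addKr gtr0_norm//; lra.
have : F (x + h) <= 0 by apply: H; apply/andP; split; lra.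
rewrite ler_norml => h1 /andP[h2 _]; lra.
Qed.

Lemma derive_le0_left (F : R -> R) (l x d : R) : is_derive x 1 F l -> F x = 0 -> 0 < d ->
  (forall y, x - d < y < x -> 0 <= F y) -> l <= 0.
Proof.
move=> /is_derive_epsP dF Fx d0 H; rewrite leNgt; apply/negP => l0.
have [e e0 He] := dF (l / 2) (divr_gt0 l0 (ltr0Sn _ _)).
pose h := Num.min (d / 2) (e / 2).
have h0 : 0 < h by rewrite /h lt_min !divr_gt0.
have hd : h <= d / 2 by rewrite /h ge_min lexx.
have he : h <= e / 2 by rewrite /h ge_min lexx orbT.
have : `|F (x + - h) - F x - l * - h| <= l / 2 * `|- h|.
  by apply: He; rewrite normrN gtr0_norm//; lra.
have : 0 <= F (x + - h) by apply: H; apply/andP; split; lra.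
have lh := mulr_gt0 l0 h0.
rewrite Fx normrN (gtr0_norm h0) ler_norml => h1 /andP[_ h2]; lra.
Qed.

Lemma abs_e_le1 g : `|C g| <= 1 /\ `|S g| <= 1.
Proof.
have E := e_norm q1 g; have c0 := powR_ge0 `|C g| q; have s0 := powR_ge0 `|S g| q.
by split; rewrite leNgt; apply/negP => h;
  have := gt0_ltr_powR q0 ler01 (normr_ge0 _) h; rewrite powR1; lra.
Qed.

(** At t = 1 the decay inequality is an equality, so its derivative from the left has a sign
    there. *)
Lemma decay_derive N f s : jacobian_decay q N -> -(2 * Pi) < f < 0 -> 0 < s < 2 * Pi ->
  smooth_at q (f + s) -> s * (kap (f + s) * fq f (f + s)) <= (N - 1) * Dq f (f + s).
Proof.
move=> J fI sI sm; rewrite -subr_le0.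
pose H t := Dq f (f + t * s) - t `^ (N - 1) * Dq f (f + s).
have d1 : is_derive (1 : R) 1 (fun t => f + t * s) s.
  by apply: (dEq (dD (dcst 1 f) (dM (did 1) (dcst 1 s)))); ring.
have d2 : is_derive (f + 1 * s) 1 (Dq f) (kap (f + s) * fq f (f + s)).
  by rewrite mul1r; exact: Dq_derive.
have d3 := @dpowR R (N - 1) (fun t => t) 1 _ ltr01 (did 1).
have dH := dB (@dcomp R _ (fun t => f + t * s) 1 _ _ d2 d1) (dM d3 (dcst 1 (Dq f (f + s)))).
apply: (@derive_le0_left H _ 1 1 _ _ ltr01).
- by apply: (dEq dH); rewrite powR1; ring.
- by rewrite /H mul1r powR1 mul1r subrr.
- move=> t /andP[t0 t1]; rewrite /H subr_ge0; apply: J => //.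
  by apply/andP; split; lra.
Qed.

(** On arcs from - Pi / 2 to a point just before 0, [fq] is close to 1 and [Dq] is bounded, while
    the negative power of [S] makes [kap] as large as desired; this violates [decay_derive]. *)
Lemma no_decay_lt2 N : q < 2 -> 1 <= N -> ~ jacobian_decay q N.
Proof.
move=> q2 N1 J; have Pi0' : 0 < Pi by [].
have q1' : 1 < q by [].
pose f : R := - (Pi / 2).
have CPi : C (Pi / 2) = 0 by rewrite -[Pi / 2]add0r eCDhalf// eS0 // oppr0.
have SPi : S (Pi / 2) = 1 by rewrite -[Pi / 2]add0r eSDhalf// eC0 //.
have Cf : C f = 0 by rewrite /f eCN.
have Sf : S f = -1 by rewrite /f eSN// SPi.
have F0 : fq f 0 = 1 by rewrite /fq /crs /al Cf Sf eC0 // eS0 // sp0; ring.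
have cF : {for 0, continuous (fq f)}.
  apply: (@dcontinuous R _ 0 _ (dB (crs_derive q1 f 0) (dM (dB (did 0) (dcst 0 f)) (al_derivel q1 0 f)))).
have cD := @continuous_Dq R q q1 f 0.
have cS := dcontinuous (eS_derive q1 0).
have [d1 d10 H1] := (cts_epsP _ _).1 cF (1/2) ltac:(lra).
have [d2 d20 H2] := (cts_epsP _ _).1 cD 1 ltr01.
pose B := Dq f 0 + 1.
have D0 : 0 < Dq f 0.
  by apply: Dq_gt0 => //; rewrite /f; move: Pi0'; clear; move: Pi => P P0; apply/andP; split; lra.
(* With [kap] at least [(q - 1) * X], a parameter length of at least [Pi / 4] and [fq] at least 1 /
   2, the left side of [decay_derive] reaches [(N - 1) * B + 1]. *)
pose X := 8 * ((N - 1) * B + 1) / ((q - 1) * Pi).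
have X0 : 0 < X.
  rewrite /X divr_gt0 ?mulr_gt0//; last by lra.
  by apply: ltr_pwDr => //; rewrite mulr_ge0// ?subr_ge0// /B addr_ge0// ltW.
have [e e0 He] := powR_small (a := 2 - q) (e := X^-1) ltac:(lra) ltac:(by rewrite invr_gt0).
have [d3 d30 H3] := (cts_epsP _ _).1 cS (e / 2) ltac:(clear -X0 e0; lra).
pose h := Num.min (Num.min (d1 / 2) (d2 / 2)) (Num.min (d3 / 2) (Pi / 4)).
have h0 : 0 < h by rewrite /h !lt_min !divr_gt0.
have h1 : h <= d1 / 2 by rewrite /h !ge_min lexx.
have h2 : h <= d2 / 2 by rewrite /h !ge_min lexx orbT.
have h3 : h <= d3 / 2 by rewrite /h !ge_min lexx !orbT.
have h4 : h <= Pi / 4 by rewrite /h !ge_min lexx !orbT.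
have nh : `|- h - 0| = h by rewrite subr0 normrN gtr0_norm.
have := H1 (- h); have := H2 (- h); have := H3 (- h); rewrite nh F0 eS0 // subr0.
move=> /(_ ltac:(clear -h0 h2 h3; lra)) S1 /(_ ltac:(clear -h0 h2 h3; lra)); rewrite ler_norml => /andP[_ D1].
move=> /(_ ltac:(clear -h0 h1; lra)); rewrite ler_norml => /andP[F1 _].
have Sh : 0 < S h by clear -q1' h0 h4; apply: eS_gt0 => //; apply/andP; split; lra.
have Ch : 0 < C h.
  have : 0 < crs h (Pi / 2) by clear -q1' h0 h4; apply: crs_gt0 => //; apply/andP; split; lra.
  by rewrite /crs CPi SPi mulr0 subr0 mulr1.
have sm : smooth_at q (- h).
  by rewrite /smooth_at eCN // eSN // oppr_eq0 !gt_eqF// orbT.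
have := @decay_derive N f (Pi / 2 - h) J.
rewrite (_ : f + _ = - h); last by rewrite /f; ring.
move=> /(_ ltac:(clear -h0 h4; rewrite /f; lra) ltac:(clear -h0 h4; lra) sm).
have kX : (q - 1) * X <= kap (- h).
  rewrite /kap eCN // eSN // normrN !gtr0_norm//.
  have k1 : 1 <= C h `^ (q - 2).
    rewrite -opprB powRN -[leLHS]invr1 lef_pV2 ?posrE ?powR_gt0//.
    have [+ _] := abs_e_le1 h; rewrite gtr0_norm// => c1.
    rewrite -[leRHS](powRr0 (C h)) ger_powR//; last lra.
    by rewrite Ch.
  have k2 : X <= S h `^ (q - 2).
    rewrite -opprB powRN -[leLHS]invrK lef_pV2 ?posrE ?invr_gt0 ?powR_gt0//.
    have := He (S h); rewrite gtr0_norm//; apply.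
    by clear -q1' S1 Sh; move: S1; rewrite eSN // normrN gtr0_norm//; lra.
  rewrite -mulrA ler_pM2l; last by rewrite subr_gt0.
  by clear -X0 k1 k2; rewrite -[leLHS]mul1r ler_pM//; lra.
have E : (q - 1) * X * Pi = 8 * ((N - 1) * B + 1).
  by clear -Pi0' q1'; rewrite /X; field; rewrite !gt_eqF//; lra.
have F2 : 1 / 2 <= fq f (- h) by clear -F1; lra.
set k := kap (- h) in kX *; set F := fq f (- h) in F2 *.
have B1 : (N - 1) * Dq f (- h) <= (N - 1) * B by rewrite ler_wpM2l//; rewrite /B; clear -N1 D1; lra.
have X10 : 0 <= (q - 1) * X by apply: mulr_ge0; [rewrite subr_ge0|]; exact: ltW.
have kF : (q - 1) * X / 2 <= k * F.
  by rewrite -[2^-1]div1r; apply: (ler_pM X10 _ kX F2); exact: divr_ge0.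
have : (Pi / 4) * ((q - 1) * X / 2) <= (Pi / 2 - h) * (k * F).
  apply: (ler_pM _ _ _ kF); [exact: divr_ge0 (ltW Pi0') _|exact: divr_ge0|by clear -h4; lra].
have -> : (Pi / 4) * ((q - 1) * X / 2) = (N - 1) * B + 1.
  by clear -E; transitivity ((q - 1) * X * Pi / 8); [field|rewrite E; field].
by clear -B1; lra.
Qed.

Lemma quarter_values : [/\ C (Pi / 2) = 0, S (Pi / 2) = 1, C 0 = 1 & S 0 = 0].
Proof.
have C0 : C 0 = 1 by exact: eC0.
have S0 : S 0 = 0 by exact: eS0.
by split => //; rewrite -[Pi / 2]add0r ?eCDhalf// ?eSDhalf// ?S0 ?oppr0.
Qed.

Lemma quarter_pos g : 0 < g < Pi / 2 -> 0 < S g /\ 0 < C g.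
Proof.
have [C1 S1 _ _] := quarter_values; have Pi0' : 0 < Pi by [].
move=> /andP[g0 g1]; split; first by apply: eS_gt0 => //; apply/andP; split; lra.
have : 0 < crs g (Pi / 2) by apply: crs_gt0 => //; apply/andP; split; lra.
by rewrite /crs C1 S1 mulr0 subr0 mulr1.
Qed.

(** On a quarter turn C^q = 1 - y, so [E] is the power (1 - y)^k. The bounds involving [k] are
    Bernoulli's inequality for this power and its reciprocal, read off from Young's inequality; they
    serve as a Taylor expansion with explicit error. *)
Lemma quarter_bounds g (y := `|S g| `^ q) (E := sp (q - 1) (C g)) (k := 1 - q^-1) : 0 < g < Pi / 2 ->
  [/\ 0 < y < 1, 0 < E, E <= 1 - k * y, 1 - y <= E & 1 - E <= k * y / (1 - y)].
Proof.
move=> gI; have [S0 C0] := quarter_pos gI.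
have iq : 0 < q^-1 < 1 by rewrite invr_gt0 q0 invf_lt1.
have N : `|C g| `^ q = 1 - y by rewrite -(e_norm q1 g) -/y addrK.
have y0 : 0 < y by rewrite powR_gt0// normr_gt0 gt_eqF.
have c0 : 0 < `|C g| `^ q by rewrite powR_gt0// normr_gt0 gt_eqF.
have E0 : 0 < E by exact: sp_gt0.
have [cl _] := abs_e_le1 g; rewrite gtr0_norm// in cl.
have E2 : C g * E = 1 - y by rewrite /E mul_sp.
have H1 : E <= 1 - k * y.
  have := @young_le R q q1 1 (C g); rewrite normr1 powR1 N -/E /k; lra.
have H2 : 1 - y <= E.
  by rewrite -E2 ler_piMl// ltW.
split => //; first by apply/andP; split=> //; lra.
have y1 : 0 < 1 - y by lra.
(* Young's inequality at the reciprocal of [C g] bounds 1 / E by 1 + k y / (1 - y). *)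
have := @young_le R q q1 1 (C g)^-1.
rewrite normr1 powR1 mul1r div1r normfV -(powR_inv1 (normr_ge0 (C g))) powRAC powR_inv1 ?powR_ge0// N.
have -> : sp (q - 1) (C g)^-1 = E^-1.
  apply: (mulfI (lt0r_neq0 E0)); rewrite mulfV ?gt_eqF// /E -spM mulfV ?gt_eqF//.
  by rewrite sp_gt0E// powR1.
move=> H; have h2 : E^-1 <= 1 + k * y / (1 - y).
  by apply: le_trans H _; rewrite le_eqVlt; apply/orP; left; apply/eqP; rewrite /k; field; rewrite !gt_eqF.
have w0 : 0 <= k * y / (1 - y) by rewrite divr_ge0 ?mulr_ge0// /k; lra.
move: (k * y / (1 - y)) w0 h2 => w w0 h2.
have h3 : 1 <= E * (1 + w) by rewrite -ler_pdivrMl// mulr1.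
have ky0 : 0 <= k * y by apply: mulr_ge0; rewrite /k; lra.
have : 0 <= (1 - E) * w by apply: mulr_ge0 => //; lra.
lra.
Qed.

Lemma eS_le_quarter u g : 0 <= u -> u <= g -> g <= Pi / 2 -> S u <= S g.
Proof.
move=> u0 ug gP; have Pi0' : 0 < Pi by [].
apply: (@is_derive_nondecr R S (fun g => sp (q - 1) (C g)) u g ug).
- by move=> x _; exact: dcontinuous (eS_derive q1 x).
- by move=> x _; exact: eS_derive.
- move=> x /andP[ux xg]; apply: sp_ge0; apply: ltW.
  by have [|//] := @quarter_pos x; apply/andP; split; lra.
Qed.

(** [g - S g] is the integral of 1 - E, which is about k S^q, while S^(q + 1) / (q + 1) has
    derivative S^q E. Both bounds follow by comparing derivatives from 0. *)
Lemma sub_eS_bounds g (y := `|S g| `^ q) (c := (1 - q^-1) / (q + 1)) : 0 < g < Pi / 2 ->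
  c * (S g * y) <= g - S g <= c * (1 - y) ^- 2 * (S g * y).
Proof.
move=> gI; have q1' : 1 < q by [].
have [S0 C0] := quarter_pos gI; have [/andP[y0 y1] _ _ _ _] := quarter_bounds gI.
have EY (x : R) : 0 <= S x -> S x * `|S x| `^ q = `|S x| `^ (q + 1).
  move=> x0; rewrite -[RHS]mulr_powRB1 ?normr_ge0 ?addrK ?ger0_norm//; lra.
pose u (m x : R) := m * c * `|S x| `^ (q + 1) - (x - S x).
have c0 : 0 <= c by rewrite /c divr_ge0//; [rewrite subr_ge0 invf_le1//; lra|lra].
have du m (x : R) : is_derive x 1 (u m) (m * (1 - q^-1) * sp q (S x) * sp (q - 1) (C x) - (1 - sp (q - 1) (C x))).
  have q11 : 1 < q + 1 by lra.
  have h1 := dcomp (is_derive_abs_powR (S x) q11) (eS_derive q1 x).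
  apply: (dEq (dB (dZ (m * c) h1) (dB (did x) (eS_derive q1 x)))).
  rewrite addrK /c; field; rewrite !gt_eqF//; lra.
have u0 m : u m 0 = 0.
  by have [_ _ _ S00] := quarter_values; rewrite /u S00 normr0 powR0; [ring|rewrite gt_eqF//; lra].
have g0 : 0 <= g by case/andP: gI => /ltW.
have bnd x : 0 < x < g -> [/\ 0 < x < Pi / 2, sp q (S x) = `|S x| `^ q, `|S x| `^ q <= y & 0 < S x].
  move=> /andP[x0 xg]; have xI : 0 < x < Pi / 2.
    by rewrite x0/=; case/andP: gI => _; exact: lt_trans.
  have [Sx _] := quarter_pos xI; split => //; first by rewrite sp_gt0E// gtr0_norm.
  rewrite /y !gtr0_norm//; apply: ge0_ler_powR; rewrite ?nnegrE; [exact: ltW..|].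
  by apply: eS_le_quarter; [exact: ltW..|case/andP: gI => _ /ltW].
apply/andP; split.
- have : - u 1 0 <= - u 1 g.
    apply: (@is_derive_nondecr R (fun x => - u 1 x) _ 0 g g0 _ (fun x _ => dN (du 1 x))).
      by move=> x _; exact: dcontinuous (dN (du 1 x)).
    move=> x xI; have [xP spS yx Sx] := bnd _ xI.
    have [/andP[Y0 Y1] E0 E1 E2 E3] := quarter_bounds xP.
    rewrite mul1r spS oppr_ge0 subr_le0.
    set k := 1 - q^-1 in E1 E2 E3 *; set Y := `|S x| `^ q in Y0 Y1 E1 E2 E3 *.
    have kY : 0 <= k * Y by rewrite mulr_ge0 ?ltW// /k subr_gt0 invf_lt1.
    set E := sp _ _ in E0 E1 E2 E3 *.
    have : k * Y * E <= k * Y by rewrite ler_piMr//; lra.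
    lra.
  by rewrite u0 /u /y (EY _ (ltW S0)); lra.
(* One factor 1 / (1 - y) comes from the bound on 1 - E and the other from E >= 1 - y. *)
- have : u ((1 - y) ^- 2) 0 <= u ((1 - y) ^- 2) g.
    apply: (@is_derive_nondecr R (u ((1 - y) ^- 2)) _ 0 g g0 _ (fun x _ => du _ x)).
      by move=> x _; exact: dcontinuous (du _ x).
    move=> x xI; have [xP spS yx Sx] := bnd _ xI.
    have [/andP[Y0 Y1] E0 E1 E2 E3] := quarter_bounds xP.
    rewrite spS subr_ge0; apply: le_trans E3 _.
    set k := 1 - q^-1 in E1 E2 *; set Y := `|S x| `^ q in Y0 Y1 E1 E2 yx *.
    have kY : 0 <= k * Y by rewrite mulr_ge0 ?ltW// /k subr_gt0 invf_lt1.
    set E := sp _ _ in E0 E1 E2 *.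
    have y1' : y < 1 by [].
    rewrite (_ : _ * E = k * Y * (E / (1 - y) ^+ 2)); last by ring.
    apply: ler_wpM2l => //.
    have y10 : 0 < 1 - y by lra.
    have Y10 : 0 < 1 - Y by lra.
    rewrite ler_pdivlMr ?exprn_gt0// mulrC ler_pdivrMr// expr2.
    by rewrite [leRHS]mulrC; apply: ler_pM; lra.
  by rewrite u0 /u /y (EY _ (ltW S0)); lra.
Qed.

(** The symmetric arc gives 4 y^2 - 4 (g - C S) T E with T = S^(q - 1), and g - C S is at least 2 S
    y / (q + 1). Since [y] is S^q, this is the leading term of order g^(2 q) with an explicit
    error. *)
Lemma Dq_symm_le g (y := `|S g| `^ q) : 0 < g < Pi / 2 ->
  Dq (- g) g <= 4 * (y * y) * (1 - 2 * (1 - y) / (q + 1)).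
Proof.
move=> gI; have q1' : 1 < q by [].
have [S0 C0] := quarter_pos gI; have [/andP[y0 y1] E0 _ E2 _] := quarter_bounds gI.
have /andP[B1 _] := sub_eS_bounds gI.
rewrite /Dq /al /ga /Wq /crs !eCN // !eSN // !spN.
have CE : C g * sp (q - 1) (C g) = 1 - y by rewrite mul_sp// -(e_norm q1 g) -/y addrK.
have ST : S g * sp (q - 1) (S g) = y by rewrite mul_sp// /y.
have T0 : 0 < sp (q - 1) (S g) by exact: sp_gt0.
have C1 : C g <= 1 - y / q.
  have := @young_le R q q1 (C g) 1; rewrite normr1 powR1 sp_gt0E// powR1 mulr1 -(mul_sp (C g) q0) CE; lra.
set E := sp _ (C g) in E0 E2 CE *; set T := sp _ (S g) in ST T0 *; fold y in E2, B1.
have h : 2 / (q + 1) * (S g * y) <= g - C g * S g.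
  have -> : 2 / (q + 1) * (S g * y) = (1 - q^-1) / (q + 1) * (S g * y) + S g * (y / q).
    by field; rewrite !gt_eqF//; lra.
  have : S g * (y / q) <= S g * (1 - C g) by rewrite ler_pM2l//; lra.
  lra.
have h2 : 2 / (q + 1) * (y * y) <= (g - C g * S g) * T.
  rewrite (_ : _ * (y * y) = 2 / (q + 1) * (S g * y) * T) ?ler_pM2r//.
  by rewrite -(_ : S g * T * y = y * y); [ring|rewrite ST].
have h3 : 2 / (q + 1) * (y * y) * (1 - y) <= (g - C g * S g) * T * E.
  have y0' : 0 < y by []. have y1' : y < 1 by [].
  apply: ler_pM => //; last by lra.
  by apply: mulr_ge0; [apply: divr_ge0; lra|apply: mulr_ge0; lra].
rewrite (_ : _ - _ = 4 * (y * y) - 4 * ((g - C g * S g) * T * E)); last first.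
  transitivity ((1 - C g * E + S g * T) ^+ 2 - (2 * g - 2 * C g * S g) * (2 * E * T)); first by ring.
  by rewrite CE ST; ring.
rewrite (_ : 4 * (y * y) * _ = 4 * (y * y) - 4 * (2 / (q + 1) * (y * y) * (1 - y))); first by lra.
by field; rewrite gt_eqF//; lra.
Qed.

(** Divided by y^2, the lower bound tends to k / (q (q + 1)) with k = 1 - 1 / q as [y] tends to
    0. *)
Lemma Dq0_ge g (y := `|S g| `^ q) : 0 < g < Pi / 2 ->
  (1 - q^-1) * (y * y) * (q^-1 - (1 - y) ^- 2 / (q + 1)) <= Dq 0 g.
Proof.
move=> gI; have q1' : 1 < q by [].
have [S0 C0] := quarter_pos gI; have [/andP[y0 y1] E0 E1 E2 _] := quarter_bounds gI.
have /andP[_ B1] := sub_eS_bounds gI.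
have [_ _ C00 S00] := quarter_values.
rewrite /Dq /al /ga /Wq /crs C00 S00 sp0 !mulr0 !mul0r !addr0 mul1r !subr0 [sp _ 1]sp_gt0E// powR1.
rewrite !mul1r mulr1.
have CE : C g * sp (q - 1) (C g) = 1 - y by rewrite mul_sp// -(e_norm q1 g) -/y addrK.
have ST : S g * sp (q - 1) (S g) = y by rewrite mul_sp// /y.
have T0 : 0 < sp (q - 1) (S g) by exact: sp_gt0.
have C1 : C g <= 1 - y / q.
  have := @young_le R q q1 (C g) 1; rewrite normr1 powR1 [sp _ 1]sp_gt0E// powR1 mulr1 -(mul_sp (C g) q0) CE; lra.
set E := sp _ (C g) in E0 E1 E2 CE *; set T := sp _ (S g) in ST T0 *; fold y in E1, E2, B1.
set m := (1 - y) ^- 2 in B1 *; set k := 1 - q^-1 in E1 B1 *.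
have k0 : 0 < k by rewrite subr_gt0 invf_lt1.
have h1 : (k * y) * (y / q) <= (1 - E) * (1 - C g).
  by apply: ler_pM; [rewrite mulr_ge0// ltW|rewrite divr_ge0// ltW//; lra|lra|lra].
have h2 : (g - S g) * T <= k / (q + 1) * m * (y * y).
  rewrite (_ : _ * (y * y) = k / (q + 1) * m * (S g * y) * T) ?ler_pM2r//.
  by rewrite -(_ : S g * T * y = y * y); [ring|rewrite ST].
have -> : k * (y * y) * (q^-1 - m / (q + 1)) = (k * y) * (y / q) - k / (q + 1) * m * (y * y) by ring.
lra.
Qed.

Lemma continuous_Dql f g : {for f, continuous (Dq^~ g)}.
Proof.
apply: continuousB; apply: continuousM.
- by apply: continuousB; [exact: cst_continuous|exact: dcontinuous (al_derivel q1 f g)].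
- by apply: continuousB; [exact: cst_continuous|exact: continuous_al].
- exact: dcontinuous (Wq_derivel q1 f g).
- rewrite (_ : ga^~ g = fun f => - ga g f); last by apply/funext => h; exact: gaC.
  by apply: continuousN; exact: (@continuous_ga R q q1 g f).
Qed.

(** The decay inequality on the arc from - h to g with intermediate point h, so that t = 2 h / (g +
    h), divided by h^(2 q); then h tends to 0. *)
Lemma Dq0_le g : jacobian_decay q (2 * q + 1) -> 0 < g < Pi / 2 ->
  (2 / g) `^ (2 * q) * Dq 0 g <= 4 * (1 - 2 / (q + 1)).
Proof.
move=> J /andP[g0 gP]; have q1' : 1 < q by []. have Pi0' : 0 < Pi by [].
pose F h := (2 / (g + h)) `^ (2 * q) * Dq (- h) g - 4 * (1 - 2 * (1 - `|S h| `^ q) / (q + 1)).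
have [_ _ _ S00] := quarter_values.
suff : F 0 <= 0.
  by rewrite /F S00 normr0 powR0 ?gt_eqF// subr0 oppr0 addr0 mulr1 subr_le0.
have g00 : g + 0 != 0 by rewrite addr0 gt_eqF.
have d1 : is_derive (0 : R) 1 (fun h => 2 / (g + h)) (2 * (- (0 + 1) / (g + 0) ^+ 2)).
  exact: dZ (@dV R (fun h => g + h) 0 _ g00 (dD (dcst 0 g) (did 0))).
have g20 : 0 < 2 / (g + 0) by rewrite addr0 divr_gt0.
have c1 := dcontinuous (@dpowR R (2 * q) (fun h => 2 / (g + h)) 0 _ g20 d1).
have c2 : {for 0, continuous (fun h => Dq (- h) g)}.
  apply: (@continuous_comp _ _ _ (fun h : R => - h) (Dq^~ g)).
    exact: dcontinuous (dN (did 0)).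
  exact: continuous_Dql.
have d3 := dcomp (is_derive_abs_powR (S 0) q1) (eS_derive q1 0).
have d4 := dZ 4 (dB (dcst 0 1) (dM (dZ 2 (dB (dcst 0 1) d3)) (dcst 0 (q + 1)^-1))).
have cF : {for 0, continuous F} by apply: continuousB (dcontinuous d4); exact: continuousM.
apply: (continuous_le0 cF g0) => h; rewrite add0r => /andP[h0 hg].
have hI : 0 < h < Pi / 2 by rewrite h0; lra.
rewrite /F subr_le0; have := Dq_symm_le hI; set Z := 1 - _.
have /andP[Sh0 Shh] : 0 <= S h <= h.
  have [/ltW S0 _] := quarter_pos hI.
  have /andP[B _] := sub_eS_bounds hI; rewrite S0 -subr_ge0; apply: le_trans B.
  by rewrite mulr_ge0 ?divr_ge0 ?mulr_ge0 ?powR_ge0// ?subr_ge0 ?invf_le1//; lra.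
have Z0 : 0 <= Z.
  rewrite /Z subr_ge0 ler_pdivrMr; last lra.
  by have := powR_ge0 `|S h| q; lra.
have yh : `|S h| `^ q * `|S h| `^ q <= h `^ (2 * q).
  rewrite mulrDl mul1r powRD; last by rewrite (gt_eqF h0) implybT.
  by rewrite ger0_norm//; apply: ler_pM; rewrite ?powR_ge0//; apply: ge0_ler_powR; rewrite ?nnegrE ?(ltW q0) ?(ltW h0).
move=> DZ; have hq : 0 < h `^ (2 * q) by exact: powR_gt0.
rewrite -(ler_pM2l hq); have := J (- h) (g + h) (2 * h / (g + h)).
move=> /(_ ltac:(clear -h0 hg gP Pi0'; lra) ltac:(clear -g0 h0 hg gP Pi0'; lra)).
have gh : 0 < g + h by exact: addr_gt0.
have h20 : 0 < 2 * h by exact: mulr_gt0.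
rewrite divr_gt0// ltr_pdivrMr// mul1r => /(_ ltac:(clear -hg; lra)).
rewrite (_ : 2 * q + 1 - 1 = 2 * q) ?addrK// (_ : - h + (g + h) = g); last by ring.
rewrite (_ : - h + 2 * h / (g + h) * (g + h) = h); last by field; lra.
move=> H; rewrite mulrA -powRM; [|lra|by rewrite divr_ge0//; lra].
rewrite (_ : h * (2 / (g + h)) = 2 * h / (g + h)); last by ring.
apply: le_trans H _; apply: le_trans DZ _.
by rewrite [leRHS]mulrCA -mulrA; apply: ler_wpM2l => //; apply: ler_wpM2r.
Qed.

Lemma quarter_onto y : 0 < y < 1 -> exists2 g, 0 < g < Pi / 2 & `|S g| `^ q = y.
Proof.
move=> /andP[y0 y1]; have [_ S1 _ S0] := quarter_values; have Pi0' : 0 < Pi by [].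
have v0 : 0 < y `^ q^-1 by exact: powR_gt0.
have v1 : y `^ q^-1 < 1.
  have iq : 0 < q^-1 by rewrite invr_gt0.
  by have := gt0_ltr_powR iq (ltW y0) ler01 y1; rewrite powR1.
have P2 : 0 <= Pi / 2 by lra.
have [||g /andP[g0 g1] E] := @ivt R S 0 (Pi / 2) (y `^ q^-1) P2.
- by move=> x; exact: dcontinuous (eS_derive q1 x).
- by rewrite S0 S1 !ltW.
exists g; last by rewrite E gtr0_norm// -powRrM mulVf ?gt_eqF// powRr1// ltW.
apply/andP; split; rewrite lt_neqAle ?g0 ?g1 andbT; apply/eqP => h.
  by move: v0; rewrite -E -h S0 ltxx.
by move: v1; rewrite -E h S1 ltxx.
Qed.

Lemma no_decay_gt2 : 2 < q -> ~ jacobian_decay q (2 * q + 1).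
Proof.
move=> q2 J; have q1' : 1 < q by [].
pose c := (1 - q^-1) / (q + 1); pose k := 1 - q^-1.
have k0 : 0 < k by rewrite subr_gt0 invf_lt1.
have c0 : 0 <= c by rewrite /c divr_ge0// ?ltW//; lra.
pose B := 4 * (1 - 2 / (q + 1)).
(* [F y <= 0] combines the two bounds on [Dq 0 g] for y = S(g)^q, after division by S(g)^(2 q) and
   with [g] estimated by [sub_eS_bounds]. At y = 0 it would give 4^(q - 1) <= q^2. *)
pose F y := 2 `^ (2 * q) * (k * (q^-1 - (1 - y) ^- 2 / (q + 1))) - (1 + c * (1 - y) ^- 2 * y) `^ (2 * q) * B.
have F0 : F 0 <= 0.
  have n0 : (1 - 0 : R) != 0 by rewrite subr0 oner_eq0.
  have d0 := @dV R (fun y => 1 - y) 0 _ n0 (dB (dcst 0 1) (did 0)).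
  have [l d2] : exists l : R, is_derive (0 : R) 1 (fun y : R => (1 - y) ^- 2) l.
    eexists; rewrite (_ : (fun y => _) = fun y : R => (1 - y)^-1 * (1 - y)^-1).
      exact: (dM d0 d0).
    by apply/funext => y; rewrite expr2 invfM.
  have dA := dZ (2 `^ (2 * q)) (dZ k (dB (dcst 0 q^-1) (dM d2 (dcst 0 (q + 1)^-1)))).
  have dB1 := dD (dcst 0 1) (dM (dZ c d2) (did 0)).
  have p10 : 0 < 1 + c * (1 - 0) ^- 2 * 0 :> R by rewrite mulr0 addr0.
  have dB2 := dM (@dpowR R (2 * q) (fun y => 1 + c * (1 - y) ^- 2 * y) 0 _ p10 dB1) (dcst 0 B).
  have cF := dcontinuous (dB dA dB2).
  apply: (continuous_le0 cF ltr01) => y; rewrite add0r => yI.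
  have [g gI Eg] := quarter_onto yI.
  have [S0 C0] := quarter_pos gI.
  have g0 : 0 < g by case/andP: gI.
  have := Dq0_ge gI; have /andP[_] := sub_eS_bounds gI; have := Dq0_le J gI.
  rewrite Eg -/c -/k -/B => H1 H2 H3; rewrite subr_le0.
  have gq : 0 < g `^ (2 * q) by exact: powR_gt0.
  have H4 : 2 `^ (2 * q) * Dq 0 g <= g `^ (2 * q) * B.
    move: H1; rewrite -(ler_pM2l gq) mulrA -powRM; [|by rewrite ltW|by rewrite divr_ge0// ltW].
    by rewrite (_ : g * (2 / g) = 2)//; field; rewrite gt_eqF.
  have B0 : 0 <= B.
    by rewrite /B mulr_ge0// subr_ge0 ler_pdivrMr//; lra.
  have y2 : y * y = S g `^ (2 * q).
    rewrite -Eg gtr0_norm// -powRD; last by rewrite (gt_eqF S0) implybT.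
    by rewrite mulrDl mul1r.
  have Sq : 0 < S g `^ (2 * q) by exact: powR_gt0.
  rewrite -(ler_pM2l Sq).
  apply: (@le_trans _ _ (2 `^ (2 * q) * Dq 0 g)).
    rewrite mulrCA ler_wpM2l ?powR_ge0//; apply: le_trans H3; rewrite -y2.
    by rewrite le_eqVlt; apply/orP; left; apply/eqP; ring.
  apply: le_trans H4 _; rewrite [leRHS]mulrA ler_wpM2r// -powRM; last first.
  - have y0 : 0 <= y by case/andP: yI => /ltW.
    have y1 : 0 <= 1 - y by case/andP: yI => _ /ltW; rewrite subr_ge0.
    by apply: addr_ge0 => //; apply: mulr_ge0 => //; apply: mulr_ge0 => //; rewrite invr_ge0 exprn_ge0.
  - exact: ltW.
  have gS : g <= S g * (1 + c * (1 - y) ^- 2 * y).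
    rewrite (_ : S g * _ = S g + c * (1 - y) ^- 2 * (S g * y)); first lra.
    by ring.
  apply: ge0_ler_powR => //; rewrite ?nnegrE ?ltW//; first by lra.
  exact: lt_le_trans g0 gS.
move: F0; rewrite /F /B subr0 expr1n invr1 mulr0 addr0 powR1 !mul1r.
(* Young's inequality for the exponent q - 1 > 1 at the points 2 and 1; it amounts to q < 2^(q -
   1). *)
have : 2 < (2 `^ (q - 1) / (q - 1) + (1 - (q - 1)^-1)).
  have q11 : 1 < q - 1 by lra.
  have n21 : (2 : R) != 1 by rewrite gt_eqF//; lra.
  have := @young_lt R (q - 1) q11 2 1 n21.
  by rewrite sp_gt0E// normr1 !powR1 !mulr1 ger0_norm.
have -> : 2 `^ (2 * q) = 4 * (2 `^ (q - 1) * 2 `^ (q - 1)) :> R.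
  rewrite -powRD; last by rewrite pnatr_eq0 implybT.
  rewrite (_ : 4 = 2 `^ 2); last by rewrite powR_mulrn// -natrX.
  rewrite -powRD; last by rewrite pnatr_eq0 implybT.
  by congr (_ `^ _); ring.
move: (2 `^ (q - 1)) => T; set L := _ / _ + _ => TL.
have Tq : q < T.
  have h : 0 < q - 1 by lra.
  by have := TL; rewrite -(ltr_pM2r h) (_ : L * (q - 1) = T + (q - 1) - 1) /L; [lra|field; lra].
have -> : 4 * (T * T) * (k * (q^-1 - (q + 1)^-1)) - 4 * (1 - 2 / (q + 1)) =
    4 * (k * (q^-1 / (q + 1))) * (T * T - q * q).
  by rewrite /k; field; rewrite !gt_eqF//; lra.
rewrite leNgt; apply/negP; rewrite negbK mulr_gt0//.
  rewrite mulr_gt0// mulr_gt0// divr_gt0 ?invr_gt0//; lra.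
by rewrite subr_gt0; apply: ltr_pM; lra.
Qed.

End Decay.

(** * Existence of an exponent for q > 2 *)

Section Doubling.
Context {R : realType}.
Variable q : R.
Hypothesis q1 : 1 < q.
Let q0 : 0 < q. Proof. exact: lt_trans ltr01 q1. Qed.
Local Notation C := (eC q).
Local Notation S := (eS q).
Local Notation Pi := (Piq q).
Local Notation al := (al q).
Local Notation ga := (ga q).
Local Notation crs := (crs q).
Local Notation Dq := (Dq q).
Local Notation kap := (kap q).
Local Notation fq := (fq q).
Implicit Types f g h t x y : R.
Let Pi0 : 0 < Pi. Proof. exact: Piq_gt0. Qed.

Lemma derive_slope_ge (F dF : R -> R) (a b m : R) : a <= b ->
  (forall x, is_derive x 1 F (dF x)) -> (forall x, a < x < b -> m <= dF x) ->
  m * (b - a) <= F b - F a.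
Proof.
move=> ab dF' H; have d x := dB (dF' x) (dZ m (did x)).
have : F a - m * a <= F b - m * b; last by lra.
apply: (@is_derive_nondecr R (fun x => F x - m * x) _ a b ab _ (fun x _ => d x)).
  by move=> x _; exact: dcontinuous (d x).
by move=> x /H; rewrite mulr1 subr_ge0.
Qed.

Lemma derive_slope_le (F dF : R -> R) (a b m : R) : a <= b ->
  (forall x, is_derive x 1 F (dF x)) -> (forall x, a < x < b -> dF x <= m) ->
  F b - F a <= m * (b - a).
Proof.
move=> ab dF' H; have := @derive_slope_ge (fun x => - F x) _ a b (- m) ab (fun x => dN (dF' x)).
have Hm x : a < x < b -> - m <= - dF x by move=> /H; rewrite lerN2.
by move=> /(_ Hm); lra.
Qed.

Let h g := C g * S g.
Let hd g := 1 - 2 * `|S g| `^ q.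

Let h_derive g : is_derive g 1 h (hd g).
Proof.
apply: (dEq (dM (eC_derive q1 g) (eS_derive q1 g))).
rewrite mulNr [sp _ _ * S g]mulrC !mul_sp// /hd; have := e_norm q1 g; lra.
Qed.

Let hd_le1 g : -1 <= hd g <= 1.
Proof.
rewrite /hd; have := e_norm q1 g; have := powR_ge0 `|S g| q; have := powR_ge0 `|C g| q.
by move=> *; apply/andP; split; lra.
Qed.

Let h_lip x y : x <= y -> `|h y - h x| <= y - x.
Proof.
move=> xy; rewrite ler_norml; apply/andP; split.
  have := @derive_slope_ge h hd x y (-1) xy h_derive; rewrite mulN1r; apply.
  by move=> u _; case/andP: (hd_le1 u).
have := @derive_slope_le h hd x y 1 xy h_derive; rewrite mul1r; apply.
by move=> u _; case/andP: (hd_le1 u).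
Qed.

(** |C|^q and |S|^q have sum 1 and difference [hd]. If |hd| < 1/2 both exceed 1/4, hence so do |C|
    and |S|, and the product is at least 1/16. *)
Let hd_big g : `|h g| < 1 / 16 -> 1 / 2 <= `|hd g|.
Proof.
have [c1 s1] := abs_e_le1 q1 g; have E := e_norm q1 g.
apply: contraTT; rewrite -ltNge -leNgt ltr_norml /hd => /andP[h1 h2].
have sC : 1 / 4 < `|C g| `^ q by lra.
have sS : 1 / 4 < `|S g| `^ q by lra.
have lo x : `|x| <= 1 -> 1 / 4 < `|x| `^ q -> 1 / 4 <= `|x|.
  move=> x1 xq; apply: le_trans (ltW xq) _; apply: ge1r_powR (ltW q1).
  rewrite x1 andbT normr_gt0; apply/eqP => x0.
  by move: xq; rewrite x0 normr0 powR0 ?gt_eqF//; lra.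
rewrite /h normrM (_ : 1 / 16 = 1 / 4 * (1 / 4)); last by field.
by apply: ler_pM (lo _ c1 sC) (lo _ s1 sS); lra.
Qed.

Let hd_sign a b : a <= b -> (forall x, a <= x <= b -> `|h x| < 1 / 16) ->
  exists2 e : R, e = 1 \/ e = -1 & forall x, a <= x <= b -> 1 / 2 <= e * hd x.
Proof.
move=> ab small.
have ch x : {for x, continuous hd}.
  exact: dcontinuous (dB (dcst x 1) (dZ 2 (dcomp (is_derive_abs_powR (S x) q1) (eS_derive q1 x)))).
have big x : a <= x <= b -> 1 / 2 <= `|hd x| by move=> /small/hd_big.
have aI : a <= a <= b by rewrite lexx.
have [ha|ha] := leP 0 (hd a).
  exists 1; [by left|] => x xI; rewrite [leRHS]mul1r.
  have := big x xI; rewrite ler_normr => /orP[//|hx]; exfalso.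
  have ax : a <= x by case/andP: xI.
  have cN y : {for y, continuous (fun z => - hd z)} by apply: continuousN; exact: ch.
  have [||z /andP[z1 z2] /eqP] := @ivt R (fun z => - hd z) a x 0 ax.
  - exact: cN.
  - by apply/andP; split; lra.
  rewrite oppr_eq0 => /eqP z0; have := big z.
  by rewrite z0 normr0 => /(_ ltac:(apply/andP; split; [|case/andP: xI]; lra)); lra.
exists (-1); [by right|] => x xI; rewrite mulN1r.
have := big x xI; rewrite ler_normr => /orP[hx|//]; exfalso.
have ax : a <= x by case/andP: xI.
have [||z /andP[z1 z2] z0] := @ivt R hd a x 0 ax.
- exact: ch.
- by apply/andP; split; lra.
have := big z.
by rewrite z0 normr0 => /(_ ltac:(apply/andP; split; [|case/andP: xI]; lra)); lra.
Qed.

(* C S is 1-Lipschitz, and has slope at least 1/2 in absolute value wherever it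
   is small: so on a short interval it is comparable to its maximum away from
   the neighbourhood of at most one zero. *)
Lemma cs_quarter f s v a b : 0 < s <= 1 / 64 -> f <= v <= f + s -> f <= a -> b <= f + s ->
  s / 4 <= b - a -> exists2 c : R, a <= c /\ c + s / 16 <= b &
  forall u, c <= u <= c + s / 16 -> `|h v| / 64 <= `|h u|.
Proof.
move=> /andP[s0 s1] /andP[fv vf] fa bf ba.
have lip u : f <= u <= f + s -> `|h u - h v| <= s.
  move=> /andP[fu uf]; have [uv|vu] := leP u v.
    by rewrite distrC; apply: le_trans (h_lip uv) _; lra.
  by apply: le_trans (h_lip (ltW vu)) _; lra.
(* If |h v| is at least 2 s, the Lipschitz bound keeps |h| above half of it on the whole interval.
   Otherwise |h| < 3 s < 1/16 there, and [hd] keeps its sign. *)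
have [big|small] := leP (2 * s) `|h v|.
  exists a; first by split; lra.
  move=> u /andP[u1 u2]; have := lip u ltac:(apply/andP; split; lra).
  by have := lerB_dist (h v) (h u); rewrite (distrC (h v)); lra.
have fs : f <= f + s by lra.
have [|e eE He] := @hd_sign f (f + s) fs.
  move=> u uI; have := lip u uI; have := ler_normD (h u - h v) (h v); rewrite subrK; lra.
have He1 u : `|e * h u| = `|h u|.
  by rewrite normrM; case: eE => ->; rewrite ?normrN normr1 mul1r.
have inc x y : f <= x -> x <= y -> y <= f + s -> (y - x) / 2 <= e * h y - e * h x.
  move=> fx xy yf; have := @derive_slope_ge (fun u => e * h u) _ x y (1 / 2) xy (fun u => dZ e (h_derive u)).
  have H u : x < u < y -> 1 / 2 <= e * hd u.
    by move=> /andP[xu uy]; apply: He; apply/andP; split; lra.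
  by move=> /(_ H); lra.
(* On the side of the midpoint on which [e * h] moves away from 0, at distance at least s / 16, |h|
   is at least s / 32. As |h v| < 2 s, this is where 64 comes from. *)
pose m := (a + b) / 2.
have [hm|hm] := leP 0 (e * h m).
  exists (b - s / 16); first by split; lra.
  move=> u /andP[u1 u2]; have um : s / 16 <= u - m by rewrite /m; lra.
  have := inc m u ltac:(rewrite /m; lra) ltac:(lra) ltac:(lra).
  have := ler_norm (e * h u); rewrite He1; lra.
exists a; first by split; lra.
move=> u /andP[u1 u2]; have um : s / 16 <= m - u by rewrite /m; lra.
have := inc u m ltac:(lra) ltac:(lra) ltac:(rewrite /m; lra).
have := ler_norm (- (e * h u)); rewrite normrN He1; lra.
Qed.

Lemma continuous2_Dq_fq : continuous (fun p : R * R => Dq p.1 (p.1 + p.2)) /\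
  continuous (fun p : R * R => fq p.1 (p.1 + p.2)).
Proof.
have cl (k : R -> R) : (forall x, {for x, continuous k}) -> continuous (fun p : R * R => k p.1).
  by move=> ck p; apply: (@continuous_comp _ _ _ (fun p : R * R => p.1) k); [exact: cvg_fst|exact: ck].
have csum : continuous (fun p : R * R => p.1 + p.2).
  by move=> p; apply: cvgD; [exact: cvg_fst|exact: cvg_snd].
have cr (k : R -> R) : (forall x, {for x, continuous k}) -> continuous (fun p : R * R => k (p.1 + p.2)).
  by move=> ck p; apply: (@continuous_comp _ _ _ (fun p : R * R => p.1 + p.2) k); [exact: csum|exact: ck].
have cC x : {for x, continuous C} by exact: dcontinuous (eC_derive q1 x).
have cS x : {for x, continuous S} by exact: dcontinuous (eS_derive q1 x).
have cX x : {for x, continuous (fun g => sp (q - 1) (C g))} by exact: continuous_spC.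
have cY x : {for x, continuous (fun g => sp (q - 1) (S g))} by exact: continuous_spS.
have ccrs : continuous (fun p : R * R => crs p.1 (p.1 + p.2)).
  move=> p; apply: cvgB; apply: cvgM; [exact: cl|exact: cr|exact: cl|exact: cr].
have cal : continuous (fun p : R * R => al p.1 (p.1 + p.2)).
  move=> p; apply: cvgD; apply: cvgM; [exact: cl|exact: (cr _ cX)|exact: cl|exact: (cr _ cY)].
have cbe : continuous (fun p : R * R => al (p.1 + p.2) p.1).
  move=> p; apply: cvgD; apply: cvgM; [exact: cr|exact: (cl _ cX)|exact: cr|exact: (cl _ cY)].
have cga : continuous (fun p : R * R => ga p.1 (p.1 + p.2)).
  move=> p; apply: cvgB; apply: cvgM; [exact: (cl _ cX)|exact: (cr _ cY)|exact: (cl _ cY)|exact: (cr _ cX)].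
have cdif : continuous (fun p : R * R => p.1 + p.2 - p.1).
  by move=> p; apply: cvgB; [exact: csum|exact: cvg_fst].
have cF : continuous (fun p : R * R => fq p.1 (p.1 + p.2)).
  by move=> p; apply: cvgB; [exact: ccrs|apply: cvgM; [exact: cdif|exact: cbe]].
split=> [|//]; move=> p; apply: cvgB; apply: cvgM.
  - by apply: cvgB; [exact: cvg_cst|exact: cal].
  - by apply: cvgB; [exact: cvg_cst|exact: cbe].
  - by apply: cvgB; [exact: cdif|exact: ccrs].
  - exact: cga.
Qed.

Hypothesis q2 : 2 < q.

Lemma kap_h g : kap g = (q - 1) * `|h g| `^ (q - 2).
Proof. by rewrite /kap /h normrM powRM// mulrA. Qed.

Lemma kap_ge0 g : 0 <= kap g.
Proof. by rewrite kap_h mulr_ge0 ?powR_ge0// subr_ge0 ltW. Qed.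

Lemma kap_le g : kap g <= q - 1.
Proof.
have q2' : 2 < q by []. have [c1 s1] := abs_e_le1 q1 g.
rewrite kap_h ler_piMr//; first by lra.
have h1 : `|h g| <= 1 by rewrite /h normrM mulr_ile1.
have := @ge0_ler_powR R (q - 2) ltac:(lra) `|h g| 1; rewrite !nnegrE powR1; exact.
Qed.

Let c0 : R := (1 / 64) `^ (q - 2).
Let c00 : 0 < c0. Proof. by rewrite powR_gt0. Qed.

Lemma kap_quarter f s v a b : 0 < s <= 1 / 64 -> f <= v <= f + s -> f <= a -> b <= f + s ->
  s / 4 <= b - a -> exists2 c : R, a <= c /\ c + s / 16 <= b &
  forall u, c <= u <= c + s / 16 -> c0 * kap v <= kap u.
Proof.
move=> sI vI fa bf ba; have [c cI H] := cs_quarter sI vI fa bf ba; exists c => // u /H.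
have q2' : 2 < q by [].
move=> hh; rewrite !kap_h mulrCA ler_wpM2l//; first by lra.
rewrite /c0 -powRM//; apply: ge0_ler_powR; rewrite ?nnegrE//; first by lra.
by lra.
Qed.

Let sm g : smooth_at q g. Proof. by rewrite /smooth_at q2. Qed.

Lemma abs_ga_le2 f g : `|ga f g| <= 2.
Proof.
have q11 : q - 1 != 0 by rewrite subr_eq0 gt_eqF.
have b x : `|x| <= 1 -> `|sp (q - 1) x| <= 1.
  have q10 : 0 <= q - 1 by rewrite subr_ge0 ltW.
  by move=> x1; rewrite abs_sp//; have := ge0_ler_powR q10 (normr_ge0 x) ler01 x1; rewrite powR1.
have [c1 s1] := abs_e_le1 q1 f; have [c2 s2] := abs_e_le1 q1 g.
rewrite /ga; apply: le_trans (ler_normB _ _) _; rewrite !normrM.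
have := mulr_ile1 (normr_ge0 _) (normr_ge0 _) (b _ c1) (b _ s2).
have := mulr_ile1 (normr_ge0 _) (normr_ge0 _) (b _ s1) (b _ c2).
lra.
Qed.

Section Short.
Variables (f w : R).
Hypotheses (w0 : 0 < w) (w1 : w <= 1 / 64) (w2 : 2 * (q - 1) * (w * w) <= 1) (w3 : w < Pi).

Let b_bounds x : f <= x <= f + w -> 1 / 2 <= al x f <= 1.
Proof.
move=> /andP[fx xw]; have w1' : w <= 1 / 64 by []; rewrite al_le1 // andbT.
have := @derive_slope_ge (al^~ f) _ f x (-2) fx (fun x => al_derivel q1 x f).
rewrite al_ff // => H; suff : -2 * (x - f) <= al x f - 1 by lra.
by apply: H => u _; have := abs_ga_le2 u f; rewrite ler_norml => /andP[].
Qed.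

Let ga_der x : is_derive x 1 (ga f) (kap x * al x f).
Proof. exact: ga_derive. Qed.

Let ga_mono x y : f <= x -> x <= y -> y <= f + w -> ga f x <= ga f y.
Proof.
move=> fx xy yw; have := @derive_slope_ge (ga f) _ x y 0 xy ga_der; rewrite mul0r subr_ge0; apply.
move=> u /andP[xu uy]; apply: mulr_ge0; first exact: kap_ge0.
have /andP[b1 _] : 1 / 2 <= al u f <= 1 by apply: b_bounds; apply/andP; split; lra.
lra.
Qed.

Let gaff : ga f f = 0. Proof. by rewrite /ga; ring. Qed.

Let ga_ge0 x : f <= x <= f + w -> 0 <= ga f x.
Proof. by move=> /andP[fx xw]; rewrite -gaff ga_mono. Qed.

(** A closed form of the primitive of [ga f] that vanishes at [f]. The derivatives form a ladder:
    [kap x * al x f] for [ga f], then [ga f] for [Gam], [2 * Gam - Dq f] for [fq f], and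
    [kap * fq f] for [Dq f]. *)
Let Gam x := (al f x - al x f + (x - f) * ga f x + Dq f x) / 2.

Let Gam_der x : is_derive x 1 Gam (ga f x).
Proof.
have h1 := dD (dB (al_derive q1 f (sm x)) (al_derivel q1 x f)) (dM (dB (did x) (dcst x f)) (ga_der x)).
apply: (dEq (dM (dD h1 (Dq_derive q1 f (sm x))) (dcst x 2^-1))).
by rewrite /fq gaC; field.
Qed.

Let Gamf : Gam f = 0. Proof. by rewrite /Gam Dq_ff // subrr; ring. Qed.

Let Gam_mono x y : f <= x -> x <= y -> y <= f + w -> Gam x <= Gam y.
Proof.
move=> fx xy yw; have := @derive_slope_ge Gam _ x y 0 xy Gam_der; rewrite mul0r subr_ge0; apply.
by move=> u /andP[xu uy]; apply: ga_ge0; apply/andP; split; lra.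
Qed.

Let Gam_le x : f <= x <= f + w -> Gam x <= (x - f) * ga f x.
Proof.
move=> /andP[fx xw]; rewrite mulrC.
have := @derive_slope_le Gam _ f x (ga f x) fx Gam_der; rewrite Gamf subr0; apply.
by move=> u /andP[xu uy]; apply: ga_mono; lra.
Qed.

Let Dq_ge0 x : f <= x <= f + w -> 0 <= Dq f x.
Proof.
move=> /andP[]; rewrite le_eqVlt => /predU1P[<- _|fx xw]; first by rewrite Dq_ff.
have w3' : w < Pi by [].
by apply/ltW/Dq_gt0 => //; apply/andP; split; lra.
Qed.

Let fq_der x : is_derive x 1 (fq f) (2 * Gam x - Dq f x).
Proof.
apply: (dEq (dB (crs_derive q1 f x) (dM (dB (did x) (dcst x f)) (al_derivel q1 x f)))).
by rewrite gaC /Gam; field.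
Qed.

Let fqf : fq f f = 0. Proof. by rewrite /fq /crs; ring. Qed.

Let fq_le x : f <= x <= f + w -> fq f x <= 2 * (x - f) * (x - f) * ga f x.
Proof.
move=> /andP[fx xw]; have := @derive_slope_le (fq f) _ f x (2 * (x - f) * ga f x) fx fq_der.
rewrite fqf subr0 [leRHS]mulrAC; apply => u /andP[fu ux].
have uI : f <= u <= f + w by apply/andP; split; lra.
have h1 := Dq_ge0 uI; have h2 := Gam_mono (ltW fu) (ltW ux) xw.
have h3 : Gam x <= (x - f) * ga f x by apply: Gam_le; rewrite fx.
lra.
Qed.

(** The smallness of [w] makes [kap * fq] at most [ga], the derivative of [Gam]. Consequently [fq]
    has derivative at least [Gam]. *)
Let Dq_le x : f <= x <= f + w -> Dq f x <= Gam x.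
Proof.
move=> /andP[fx xw].
have d u := dB (Gam_der u) (Dq_derive q1 f (sm u)).
have := @derive_slope_ge (fun u => Gam u - Dq f u) _ f x 0 fx d.
rewrite Gamf Dq_ff // subrr mul0r subr0 subr_ge0; apply => u /andP[fu ux].
have uI : f <= u <= f + w by apply/andP; split; lra.
have h1 := fq_le uI; have h2 := ga_ge0 uI; have k0 := kap_ge0 u; have k1 := kap_le u.
rewrite subr_ge0; apply: le_trans (ler_wpM2l k0 h1) _.
have uw : (u - f) * (u - f) <= w * w by apply: ler_pM; lra.
have : kap u * ((u - f) * (u - f)) <= (q - 1) * (w * w).
  by apply: ler_pM => //; apply: mulr_ge0; lra.
have w2' : 2 * (q - 1) * (w * w) <= 1 by [].
move=> h3; rewrite (_ : kap u * _ = 2 * (kap u * ((u - f) * (u - f))) * ga f u); last by ring.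
by rewrite ler_piMl//; lra.
Qed.

Let fq_slope x y m : f <= x -> x <= y -> y <= f + w -> (forall u, x < u < y -> m <= Gam u) ->
  m * (y - x) <= fq f y - fq f x.
Proof.
move=> fx xy yw H; apply: (derive_slope_ge xy fq_der) => u uI.
have := H u uI; have : Dq f u <= Gam u by apply: Dq_le; case/andP: uI => *; apply/andP; split; lra.
lra.
Qed.

Let fq_mono x y : f <= x -> x <= y -> y <= f + w -> fq f x <= fq f y.
Proof.
move=> fx xy yw; have := @fq_slope x y 0 fx xy yw; rewrite mul0r subr_ge0; apply.
by move=> u /andP[xu uy]; rewrite -Gamf; apply: Gam_mono; lra.
Qed.

(** From above, fq <= 2 w^2 ga and ga <= w kap(v) at a mean value point v. From below one climbs the
    ladder: [kap] is at least [c0 * kap v] on a sixteenth of the arc in its first half, [ga], [Gam]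
    and [fq] inherit this after further steps, and a sixteenth in the last quarter where
    [kap >= c0 * kap g] bounds [Dq]. The losses 2, 16, 8, 8, 16 and the factor 2 from above make
    2^16. *)
Lemma short_decay : w * (kap (f + w) * fq f (f + w)) <= (2 ^+ 16) / c0 ^+ 2 * Dq f (f + w).
Proof.
have w0' : 0 < w by []. have w1' : w <= 1 / 64 by [].
have wI : 0 < w <= 1 / 64 by rewrite w0.
pose g := f + w; rewrite -/g.
have fg : f < g by rewrite /g ltrDl.
have [v /andP[fv vg]] : exists2 v, f < v < g & ga f g - ga f f = kap v * al v f * (g - f).
  apply: (mvt fg); last by move=> x _.
  by move=> x _; exact: dcontinuous (ga_der x).
rewrite gaff subr0 {2}/g addrAC subrr add0r => Ev.
have kv0 := kap_ge0 v; have kg0 := kap_ge0 g.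
have gav : ga f g <= kap v * w.
  rewrite Ev; apply: ler_wpM2r; first exact: ltW.
  rewrite ler_piMr//; have /b_bounds/andP[//] : f <= v <= f + w by apply/andP; split; exact: ltW.
have c0' : 0 < c0 by [].
have [a1 [fa1 a1f] H1] : exists2 c : R, f <= c /\ c + w / 16 <= f + w / 2 &
    forall u, c <= u <= c + w / 16 -> c0 * kap v <= kap u.
  by apply: (@kap_quarter f w v) => //; rewrite /g in vg; [apply/andP; split|..]; lra.
have [a2 [fa2 a2f] H2] : exists2 c : R, f + 3 / 4 * w <= c /\ c + w / 16 <= f + w &
    forall u, c <= u <= c + w / 16 -> c0 * kap g <= kap u.
  by apply: (@kap_quarter f w g) => //; rewrite /g; [apply/andP; split|..]; lra.
have G1 : c0 * kap v / 2 * (w / 16) <= ga f (f + w / 2).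
  have l1 : a1 <= a1 + w / 16 by lra.
  have := @derive_slope_ge (ga f) _ a1 (a1 + w / 16) (c0 * kap v / 2) l1 ga_der.
  rewrite addrAC subrr add0r => H.
  have : ga f (a1 + w / 16) <= ga f (f + w / 2) by apply: ga_mono; lra.
  have : 0 <= ga f a1 by apply: ga_ge0; apply/andP; split; lra.
  suff : c0 * kap v / 2 * (w / 16) <= ga f (a1 + w / 16) - ga f a1 by lra.
  apply: H => u /andP[u1 u2].
  have /andP[b1 _] : 1 / 2 <= al u f <= 1.
    by apply: b_bounds; apply/andP; split; lra.
  have ku : c0 * kap v <= kap u by apply: H1; rewrite (ltW u1) ltW.
  rewrite -[2^-1]div1r; apply: (ler_pM _ _ ku b1); last by exact: divr_ge0.
  by rewrite mulr_ge0// ltW.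
set x1 := c0 * kap v / 2 * (w / 16) in G1.
have G2 : x1 * (w / 8) <= Gam (f + 5 / 8 * w).
  have l1 : f + w / 2 <= f + 5 / 8 * w by lra.
  have := @derive_slope_ge Gam _ _ _ x1 l1 Gam_der.
  rewrite (_ : _ - (f + w / 2) = w / 8); last by field.
  move=> H; have : 0 <= Gam (f + w / 2) by rewrite -Gamf; apply: Gam_mono; lra.
  suff : x1 * (w / 8) <= Gam (f + 5 / 8 * w) - Gam (f + w / 2) by lra.
  by apply: H => u /andP[u1 u2]; apply: le_trans G1 _; apply: ga_mono; lra.
set x2 := x1 * (w / 8) in G2.
have G3 : x2 * (w / 8) <= fq f (f + 3 / 4 * w).
  have := @fq_slope (f + 5 / 8 * w) (f + 3 / 4 * w) x2 ltac:(lra) ltac:(lra) ltac:(lra).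
  rewrite (_ : _ - (f + 5 / 8 * w) = w / 8); last by field.
  move=> H; have : 0 <= fq f (f + 5 / 8 * w) by rewrite -fqf; apply: fq_mono; lra.
  suff : x2 * (w / 8) <= fq f (f + 3 / 4 * w) - fq f (f + 5 / 8 * w) by lra.
  by apply: H => u /andP[u1 u2]; apply: le_trans G2 _; apply: Gam_mono; lra.
set x3 := x2 * (w / 8) in G3.
have wn n : 0 <= w / n%:R by rewrite divr_ge0// ltW.
have x30 : 0 <= x3.
  apply: mulr_ge0 (wn _); apply: mulr_ge0 (wn _); apply: mulr_ge0 (wn _).
  by rewrite divr_ge0// mulr_ge0// ltW.
have fq0 x : f <= x -> x <= g -> 0 <= fq f x by move=> fx xg; rewrite -fqf; apply: fq_mono.
have D' u := Dq_derive q1 f (sm u).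
have Dmono x y : f <= x -> x <= y -> y <= g -> Dq f x <= Dq f y.
  move=> fx xy yg; have := @derive_slope_ge (Dq f) _ x y 0 xy D'; rewrite mul0r subr_ge0; apply.
  by move=> u /andP[xu uy]; apply: mulr_ge0; [exact: kap_ge0|apply: fq0; lra].
have G4 : c0 * kap g * x3 * (w / 16) <= Dq f g.
  have l1 : a2 <= a2 + w / 16 by lra.
  have := @derive_slope_ge (Dq f) _ a2 (a2 + w / 16) (c0 * kap g * x3) l1 D'.
  rewrite addrAC subrr add0r => H.
  have : Dq f (a2 + w / 16) <= Dq f g by apply: Dmono; rewrite ?/g; lra.
  have : 0 <= Dq f a2 by apply: Dq_ge0; apply/andP; split; lra.
  suff : c0 * kap g * x3 * (w / 16) <= Dq f (a2 + w / 16) - Dq f a2 by lra.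
  apply: H => u /andP[u1 u2].
  have ku : c0 * kap g <= kap u by apply: H2; rewrite (ltW u1) ltW.
  apply: ler_pM => //; first by rewrite mulr_ge0// ltW.
  by apply: le_trans G3 _; apply: fq_mono; lra.
apply: (@le_trans _ _ ((2 ^+ 16) / c0 ^+ 2 * (c0 * kap g * x3 * (w / 16)))); last first.
  by apply: ler_wpM2l G4; apply: divr_ge0; apply: exprn_ge0 => //; exact: ltW.
have fqg : fq f g <= 2 * w * w * (kap v * w).
  have gI : f <= g <= f + w by rewrite (ltW fg) /g lexx.
  apply: le_trans (fq_le gI) _; rewrite {1 2}/g (addrC f) addrK.
  by apply: ler_wpM2l gav; rewrite !mulr_ge0// ltW.
apply: le_trans (ler_wpM2l (ltW w0') (ler_wpM2l kg0 fqg)) _.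
rewrite /x3 /x2 /x1 le_eqVlt; apply/orP; left; apply/eqP; field.
by rewrite gt_eqF.
Qed.

End Short.

(** [Dq] vanishes at s = 2 Pi, but there fq = - 2 Pi. So [Dq + (|fq| - fq)] is positive on a compact
    set, and its minimum bounds [Dq] wherever fq >= 0. *)
Lemma long_bound w : 0 < w <= 2 * Pi -> exists2 m : R, 0 < m &
  forall f s, -(2 * Pi) <= f <= 0 -> w <= s <= 2 * Pi -> 0 <= fq f (f + s) -> m <= Dq f (f + s).
Proof.
move=> /andP[w0 w2]; have Pi0' : 0 < Pi by [].
have [cD cF] := continuous2_Dq_fq.
pose G (p : R * R) := Dq p.1 (p.1 + p.2) + (`|fq p.1 (p.1 + p.2)| - fq p.1 (p.1 + p.2)).
have cG : continuous G.
  move=> p; apply: cvgD; first exact: cD.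
  by apply: cvgB; [apply: cvg_norm; exact: cF|exact: cF].
pose K : set (R * R) := `[-(2 * Pi), 0] `*` `[w, 2 * Pi].
have K0 : (K !=set0)%classic.
  by exists (0, w); split; rewrite /= in_itv/= lexx ?andbT//; lra.
have cK : compact K by apply: compact_setX; exact: segment_compact.
have [] := @compact_EVT_min _ _ G K K0 cK; first exact: continuous_subspaceT.
move=> [f0 s0] /[!inE] -[/= ]; rewrite !in_itv/= => /andP[f1 f2] /andP[s1 s2] Hmin.
exists (G (f0, s0)).
  rewrite /G /=; have := s2; rewrite le_eqVlt => /predU1P[->|s3].
    rewrite /fq /Dq /Wq /al /ga /crs !eCD2Pi // !eSD2Pi //.
    have E : C f0 * sp (q - 1) (C f0) + S f0 * sp (q - 1) (S f0) = 1 := al_ff q1 f0.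
    rewrite E (_ : C f0 * S f0 - S f0 * C f0 - (f0 + 2 * Pi - f0) * 1 = - (2 * Pi)); last by ring.
    rewrite normrN gtr0_norm; last by lra.
    rewrite (_ : sp (q - 1) (C f0) * _ - _ = 0); [lra|ring].
  have := ler_norm (fq f0 (f0 + s0)); rewrite -subr_ge0.
  have : 0 < Dq f0 (f0 + s0) by apply: Dq_gt0 => //; apply/andP; split; lra.
  lra.
move=> f s fI sI F0; have := Hmin (f, s); rewrite inE /K /= => H.
apply: le_trans (H _) _; first by split; rewrite /= in_itv/=.
by rewrite /G/= ger0_norm// subrr addr0.
Qed.

Lemma decay_bound : exists2 K : R, 0 < K & forall f s, -(2 * Pi) < f < 0 -> 0 < s < 2 * Pi ->
  s * (kap (f + s) * fq f (f + s)) <= K * Dq f (f + s).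
Proof.
have Pi0' : 0 < Pi by []. have q2' : 2 < q by []. have c0' : 0 < c0 by [].
have iq : 0 < (2 * (q - 1))^-1 by rewrite invr_gt0; lra.
pose w := Num.min (Num.min (1 / 64) (2 * (q - 1))^-1) (Pi / 2).
have w0 : 0 < w by rewrite /w !lt_min divr_gt0// iq divr_gt0.
have w1 : w <= 1 / 64 by rewrite /w !ge_min lexx.
have w2 : w <= (2 * (q - 1))^-1 by rewrite /w !ge_min lexx orbT.
have w3 : w <= Pi / 2 by rewrite /w !ge_min lexx orbT.
have [|m m0 Hm] := @long_bound w; first by rewrite w0; lra.
(* [K1] serves short arcs. On long ones [K2] comes from s <= 2 Pi, kap <= q - 1, fq <= 2 + 4 Pi and
   Dq >= m. *)
pose K1 := 2 ^+ 16 / c0 ^+ 2; pose K2 := 2 * Pi * ((q - 1) * (2 + 4 * Pi)) / m.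
have K10 : 0 < K1 by rewrite divr_gt0 ?exprn_gt0.
have K20 : 0 < K2.
  by apply: divr_gt0 => //; apply: mulr_gt0; [lra|apply: mulr_gt0; lra].
exists (K1 + K2); first exact: addr_gt0.
move=> f s fI /andP[s0 s2].
have D0 : 0 < Dq f (f + s) by apply: Dq_gt0 => //; apply/andP; split; lra.
have [sw|ws] := leP s w.
  have ss : 2 * (q - 1) * (s * s) <= 1.
    have : 2 * (q - 1) * s <= 1.
      by rewrite -ler_pdivlMl ?mulr1; [exact: le_trans w2|lra].
    have : s <= 1 by lra.
    have q10 : 0 < 2 * (q - 1) by lra.
    move=> s1 hh; rewrite mulrA; apply: mulr_ile1 => //; last exact: ltW.
    by apply: mulr_ge0; exact: ltW.
  have := @short_decay f s s0 (le_trans sw w1) ss ltac:(lra).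
  rewrite -/K1 mulrDl; have : 0 <= K2 * Dq f (f + s) by apply: mulr_ge0; exact: ltW.
  lra.
have [F0|F0] := leP 0 (fq f (f + s)); last first.
  apply: (@le_trans _ _ 0); last by apply: mulr_ge0; [apply: addr_ge0|]; exact: ltW.
  by apply: mulr_ge0_le0; [exact: ltW|apply: mulr_ge0_le0; [exact: kap_ge0|exact: ltW]].
have mD : m <= Dq f (f + s).
  by apply: Hm => //; [case/andP: fI => /ltW -> /ltW ->|apply/andP; split; exact: ltW].
have cb x y : `|crs x y| <= 2 /\ `|al x y| <= 2.
  have q11 : q - 1 != 0 by rewrite gt_eqF//; lra.
  have q10 : 0 <= q - 1 by lra.
  have b z : `|z| <= 1 -> `|sp (q - 1) z| <= 1.
    by move=> x1; rewrite abs_sp//; have := ge0_ler_powR q10 (normr_ge0 z) ler01 x1; rewrite powR1.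
  have [c1 s1] := abs_e_le1 q1 x; have [c3 s3] := abs_e_le1 q1 y.
  split.
    apply: le_trans (ler_normB _ _) _; rewrite !normrM.
    have := mulr_ile1 (normr_ge0 _) (normr_ge0 _) c1 s3.
    have := mulr_ile1 (normr_ge0 _) (normr_ge0 _) s1 c3; lra.
  apply: le_trans (ler_normD _ _) _; rewrite !normrM.
  have := mulr_ile1 (normr_ge0 _) (normr_ge0 _) c1 (b _ c3).
  have := mulr_ile1 (normr_ge0 _) (normr_ge0 _) s1 (b _ s3); lra.
have fb : fq f (f + s) <= 2 + 4 * Pi.
  rewrite /fq [f + s - f]addrAC subrr add0r.
  have [+ _] := cb f (f + s); have [_ +] := cb (f + s) f.
  rewrite !ler_norml => /andP[a1 _] /andP[_ c1].
  have : s * - al (f + s) f <= 2 * Pi * 2.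
    apply: (@le_trans _ _ (s * 2)); first by apply: ler_wpM2l; lra.
    by lra.
  lra.
apply: (@le_trans _ _ (K2 * m)); last first.
  by apply: ler_pM; [exact: ltW|exact: ltW|rewrite lerDr ltW|].
rewrite /K2 divfK ?gt_eqF//; apply: ler_pM; [lra| |lra|].
  by apply: mulr_ge0 => //; exact: kap_ge0.
by apply: ler_pM => //; [exact: kap_ge0|exact: kap_le].
Qed.

(** [decay_bound] says that s^(- K) D(f, f + s) is nonincreasing in s, which is the decay inequality
    with N - 1 = K. *)
Lemma decay_exists : exists2 N : R, 1 < N & jacobian_decay q N.
Proof.
have [K K0 H] := decay_bound; have Pi0' : 0 < Pi by [].
exists (K + 1); first by lra.
move=> f s t fI /andP[s0 s2] /andP[t0 t1]; rewrite addrK.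
pose u (x : R) := x `^ (- K) * Dq f (f + x).
have u' (x : R) : 0 < x -> is_derive x 1 u (- K * x `^ (- K - 1) * 1 * Dq f (f + x) +
    x `^ (- K) * (kap (f + x) * fq f (f + x) * (0 + 1))).
  move=> x0; apply: (dM (@dpowR R (- K) (fun x => x) x _ x0 (did x))).
  exact: (@dcomp R (Dq f) (fun x => f + x) x _ _ (Dq_derive q1 f (sm _)) (dD (dcst x f) (did x))).
have ts : t * s < s by rewrite gtr_pMl.
have ts0 : 0 < t * s by rewrite mulr_gt0.
have : - u (t * s) <= - u s.
  apply: (@is_derive_nondecr R (fun x => - u x) _ (t * s) s (ltW ts)).
  - by move=> x /andP[x0 _]; apply: dcontinuous (dN (u' x _)); exact: lt_le_trans x0.
  - by move=> x /andP[x0 _]; apply: dN (u' x _); exact: lt_trans x0.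
  - move=> x /andP[x1 x2]; have x0 : 0 < x by exact: lt_trans x1.
    have := H f x fI ltac:(apply/andP; split; lra).
    have -> : x `^ (- K) = x `^ (- K - 1) * x.
      rewrite -[X in _ * X](powRr1 (ltW x0)) -powRD ?subrK//.
      by rewrite (gt_eqF x0) implybT.
    move=> hh; have p0 := powR_gt0 (- K - 1) x0.
    rewrite (_ : - _ = x `^ (- K - 1) * (K * Dq f (f + x) - x * (kap (f + x) * fq f (f + x)))); last by ring.
    by apply: mulr_ge0; [exact: ltW|rewrite subr_ge0].
rewrite lerN2 /u powRM; [|exact: ltW..] => hh.
have tK := powR_gt0 K t0; have sK := powR_gt0 (- K) s0.
rewrite -(ler_pM2l sK) mulrCA; apply: le_trans (ler_wpM2l (ltW tK) hh) _.
by rewrite !powRN !mulrA divff ?gt_eqF// mul1r.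
Qed.

End Doubling.

(** * Distortion coefficients *)

Section Bracket.
Context {R : realType}.
Implicit Types K N t r x y : R.

Lemma sinh_mul_le t x : 0 <= t <= 1 -> 0 <= x -> Defs.sinh (t * x) <= t * Defs.sinh x.
Proof.
move=> /andP[t0 t1] x0; rewrite -subr_ge0.
have dE k y : is_derive y 1 (fun y => expR (k * y)) (expR (k * y) * (k * 1)).
  exact: (dcomp (is_derive_expR (k * y)) (dZ k (did y))).
have dS k y : is_derive y 1 (fun y => Defs.sinh (k * y)) (k * (expR (k * y) + expR (- (k * y))) / 2).
  rewrite /Defs.sinh; have h := dE (- k) y.
  have := dM (dB (dE k y) h) (dcst y 2^-1).
  rewrite (_ : (fun z : R => _) = fun y => (expR (k * y) - expR (- (k * y))) / 2).
    by move=> H; apply: (dEq H); rewrite mulNr; field.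
  by apply/funext => z; rewrite mulNr.
pose F y := t * Defs.sinh (1 * y) - Defs.sinh (t * y).
have dF y := dB (dZ t (dS 1 y)) (dS t y).
have : F 0 <= F x.
  apply: (@is_derive_nondecr R F _ 0 x x0 _ (fun y _ => dF y)).
    by move=> y _; exact: dcontinuous (dF y).
  move=> y /andP[y0 _]; rewrite mul1r.
  have u1 : expR (t * y) <= expR y by rewrite ler_expR ler_piMl// ltW.
  have u2 : expR (- y) * expR (- (t * y)) <= 1.
    by rewrite -expRD -[leRHS]expR0 ler_expR; have := mulr_ge0 t0 (ltW y0); lra.
  have E1 : expR y * expR (- y) = 1 by rewrite -expRD subrr expR0.
  have E2 : expR (t * y) * expR (- (t * y)) = 1 by rewrite -expRD subrr expR0.
  (* The product equals 2 cosh(y) - 2 cosh(t y), and the derivative of [F] is t / 2 times it. *)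
  have : 0 <= (expR y - expR (t * y)) * (1 - expR (- y) * expR (- (t * y))).
    by apply: mulr_ge0; rewrite subr_ge0.
  have -> : (expR y - expR (t * y)) * (1 - expR (- y) * expR (- (t * y))) =
     expR y - expR (t * y) - (expR y * expR (- y)) * expR (- (t * y)) + (expR (t * y) * expR (- (t * y))) * expR (- y) by ring.
  rewrite E1 E2 !mul1r => h; have := mulr_ge0 t0 h; lra.
by rewrite /F !mulr0 mul1r /Defs.sinh oppr0 subrr mul0r mulr0 subrr.
Qed.

Lemma sinh_gt0 x : 0 < x -> 0 < Defs.sinh x.
Proof. by move=> x0; rewrite /Defs.sinh divr_gt0// subr_gt0 ltr_expR; lra. Qed.

Lemma sinh_ge0 x : 0 <= x -> 0 <= Defs.sinh x.
Proof.
by rewrite le_eqVlt => /predU1P[<-|/sinh_gt0/ltW//]; rewrite /Defs.sinh oppr0 subrr mul0r.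
Qed.

Lemma mcp_bracket_N1 K t r : K <= 0 -> mcp_bracket K 1 t r = 1.
Proof. by move=> K0; rewrite /mcp_bracket K0 eqxx. Qed.

Lemma mcp_bracket_at0 K N t : mcp_bracket K N t 0 = 1.
Proof.
have E : s_ K 0 = 0 :> R.
  rewrite /s_; case: ifP => _; first by rewrite mulr0 sin0 mul0r.
  by case: ifP => // _; rewrite mulr0 /Defs.sinh oppr0 subrr !mul0r.
by rewrite /mcp_bracket; case: ifP => // _; rewrite mulr0 mul0r /quot01 E eqxx powR1.
Qed.

Lemma mcp_bracket_0 N t r : 1 < N -> 0 < r -> mcp_bracket 0 N t r = t `^ (N - 1).
Proof.
move=> N1 r0; rewrite /mcp_bracket (gt_eqF N1) andbF /quot01 /s_ ltxx eqxx.
have s0 : 0 < Num.sqrt (N - 1) by rewrite sqrtr_gt0 subr_gt0.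
rewrite [r / _ == 0]gt_eqF ?divr_gt0// andbF; congr (_ `^ _).
by field; rewrite !gt_eqF.
Qed.

Lemma mcp_bracket_neg K N t r (a := Num.sqrt (- K) * (r / Num.sqrt (N - 1))) : K < 0 -> 1 < N -> 0 < r ->
  mcp_bracket K N t r = (Defs.sinh (t * a) / Defs.sinh a) `^ (N - 1).
Proof.
move=> K0 N1 r0; have s0 : 0 < Num.sqrt (N - 1) by rewrite sqrtr_gt0 subr_gt0.
have k0 : 0 < Num.sqrt (- K) by rewrite sqrtr_gt0 oppr_gt0.
have a0 : 0 < a by rewrite mulr_gt0// divr_gt0.
have E x : s_ K x = Defs.sinh (Num.sqrt (- K) * x) / Num.sqrt (- K).
  by rewrite /s_ ltNge (ltW K0)/= (lt_eqF K0).
rewrite /mcp_bracket (gt_eqF N1) andbF /quot01 !E -/a.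
have nz : (Defs.sinh a / Num.sqrt (- K) == 0) = false by rewrite gt_eqF// divr_gt0// sinh_gt0.
rewrite nz andbF; congr (_ `^ _).
rewrite (_ : Num.sqrt (- K) * (t * r / _) = t * a); last by rewrite /a; ring.
by field; rewrite !gt_eqF// sinh_gt0.
Qed.

(** The quotient of hyperbolic sines is at most [t], so K = 0 is the strongest condition among K <=
    0. *)
Lemma mcp_bracket_le K N t r : K <= 0 -> 1 <= N -> 0 <= t <= 1 -> 0 < r ->
  t * mcp_bracket K N t r <= t `^ N.
Proof.
move=> K0 N1 t01 r0; have t0 : 0 <= t by case/andP: t01.
have N0 : 0 < N by apply: lt_le_trans N1.
rewrite -mulr_powRB1//; apply: ler_wpM2l => //.
move: N1; rewrite le_eqVlt => /predU1P[<-|N1]; first by rewrite mcp_bracket_N1// subrr powRr0.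
move: K0; rewrite le_eqVlt => /predU1P[->|K0]; first by rewrite mcp_bracket_0.
rewrite mcp_bracket_neg//; set a := Num.sqrt (- K) * _.
have a0 : 0 < a by rewrite mulr_gt0 ?divr_gt0// sqrtr_gt0 ?oppr_gt0 ?subr_gt0.
apply: ge0_ler_powR; rewrite ?nnegrE//.
- by rewrite subr_ge0 ltW.
- by apply: divr_ge0; apply: sinh_ge0; [apply: mulr_ge0 => //|]; exact: ltW.
- by rewrite ler_pdivrMr ?sinh_gt0// sinh_mul_le// ltW.
Qed.

End Bracket.

Section Contraction.
Context {R : realType}.
Local Notation M := (measurableTypeR R).
Local Notation H := (M * M * M)%type.
Local Notation mu := (@lebesgue_measure R).
Local Notation lebesgue3 := (@lebesgue3 R).
Local Open Scope ereal_scope.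

(* No measurability is needed: both sides are suprema over simple functions. *)
Lemma ge0_le_integral_all d (T : measurableType d) (m : {measure set T -> \bar R}) (D : set T)
    (f g : T -> \bar R) : (forall x, D x -> 0 <= f x <= g x) ->
  \int[m]_(x in D) f x <= \int[m]_(x in D) g x.
Proof.
move=> fg; rewrite !ge0_integralE; last 2 first.
- by move=> x /fg/andP[f0]; exact: le_trans.
- by move=> x /fg/andP[].
apply: ge_ereal_sup => _ [h hf <-]; apply: ereal_sup_ubound; exists h => // x.
apply: le_trans (hf x) _; rewrite !patchE; case: ifPn => // /set_mem /fg /andP[_].
exact.
Qed.

Lemma lebesgue3_point (x : H) : measurable [set x] /\ lebesgue3 [set x] = 0.
Proof.
have m1 : measurable ([set x.1] : set (M * M)).
  have -> : [set x.1] = [set x.1.1] `*` [set x.1.2].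
    by apply/seteqP; split=> [y ->//|[a b] [/= -> ->]]; case: x.1.
  exact: (measurableX (measurable_set1 _) (measurable_set1 _)).
have m2 : measurable ([set x.2] : set M) by exact: measurable_set1.
have -> : [set x] = [set x.1] `*` [set x.2].
  by apply/seteqP; split=> [y ->//|[a b] [/= -> ->]]; case: x {m1 m2}.
split; first exact: measurableX.
by apply: etrans (@product_measure1E _ _ _ _ R (mu \x mu) mu _ _ m1 m2) _; rewrite [X in _ * X]lebesgue_measure_set1 mule0.
Qed.

End Contraction.

(** * From the Jacobian inequality to the contraction property *)

Section Sufficient.
Context {R : realType}.
Local Notation M := (measurableTypeR R).
Local Notation H := (M * M * M)%type.
Local Notation mu := (@lebesgue_measure R).
Local Notation lebesgue3 := (@lebesgue3 R).
Variables (p q : R).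
Hypotheses (p1 : 1 < p) (q1 : 1 < q) (pq : p^-1 + q^-1 = 1).
Local Notation d := (heis_dist p).

Lemma dist_eq0 (x y : H) : d x y = 0 -> x = y.
Proof.
rewrite -(dist_left p (hinv x)) heis_Vmul => E.
have [l [f [w [l0 dl vE]]]] := reach_all p1 q1 pq (heis_mul (hinv x) y).
move: vE; rewrite -dl E; move=> vE.
have v0 : heis_mul (hinv x) y = (0, 0, 0).
  rewrite vE /harc; case: ifP => _; first by rewrite !mul0r oppr0 mul0r.
  by rewrite mul0r /expF !mul0r expr2 mul0r mul0r mul0r.
by have := heis_mulA x (hinv x) y; rewrite v0 heis_mul0 heis_mulV heis_0mul.
Qed.

Lemma decay_MCP (K N : R) : K <= 0 -> MCP_defined K N -> jacobian_decay q N -> heis_MCP p K N.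
Proof.
move=> K0 KN J g Om t mOm _ _ t01.
have N1 : 1 <= N by case: KN => [/ltW//|[_ ->]].
have N0 : 0 < N by exact: lt_le_trans ltr01 N1.
apply: le_trans (contract p1 q1 pq g J t01 N0 mOm).
have tN : 0 <= t `^ N by exact: powR_ge0.
(* At the base point the convention 0 / 0 = 1 makes the integrand [t], which may exceed t^N; the
   indicator of that null point absorbs it. *)
apply: (@le_trans _ _ (\int[lebesgue3]_(y in Om) ((t `^ N)%:E + (\1_[set g] y)%:E))%E).
  apply: ge0_le_integral_all => y _.
  rewrite -EFinD !lee_fin; have t0 : 0 <= t by case/andP: t01.
  have b0 : 0 <= t * mcp_bracket K N t (d g y).
    by rewrite mulr_ge0// /mcp_bracket; case: ifP => // _; exact: powR_ge0.
  rewrite b0/=; have [yg|yg] := eqVneq y g.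
    subst y; have := dist_left p g (0, 0, 0) (0, 0, 0); rewrite heis_mul0 (dist00 p1 q1 pq) => ->; rewrite mcp_bracket_at0 mulr1 indicE mem_set//.
    by case/andP: t01 => _ t1; apply: le_trans t1 _; rewrite lerDr.
  rewrite indicE memNset ?addr0; last by move=> /eqP; rewrite (negbTE yg).
  apply: mcp_bracket_le => //; rewrite lt_neqAle dist_ge0 andbT eq_sym.
  by apply: contra_neq yg => /dist_eq0.
have [m1 l1] := lebesgue3_point g.
rewrite ge0_integralD//; last first.
  by apply/measurable_EFinP; exact: measurable_indic.
rewrite integral_cst// integral_indic//.
have -> : lebesgue3 ([set g] `&` Om) = 0%E.
  apply/eqP; rewrite eq_le measure_ge0 andbT -l1.
  exact: (le_measure lebesgue3 (mem_set (measurableI _ _ m1 mOm)) (mem_set m1) (fun y => @proj1 _ _)).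
by rewrite adde0.
Qed.

End Sufficient.

(** * Localization *)

Section Box.
Context {R : realType}.
Local Notation M := (measurableTypeR R).
Local Notation H := (M * M * M)%type.
Local Notation mu := (@lebesgue_measure R).
Local Notation lebesgue3 := (@lebesgue3 R).

(** The complement is open, hence a countable union of cubes with rational centres and radii 1 / (n
    + 1), and cubes are measurable for the product sigma-algebra. *)
Lemma closed_measurable3 (K : set (R * R * R)) : closed K -> measurable (K : set H).
Proof.
move=> cK; rewrite -(setCK K); apply: measurableC.
pose B (w : rat * rat * rat * nat) : set H :=
  (ball (ratr w.1.1.1 : R) w.2.+1%:R^-1 `*` ball (ratr w.1.1.2 : R) w.2.+1%:R^-1) `*` ball (ratr w.1.2 : R) w.2.+1%:R^-1.
have mB w : measurable (B w).
  have mb (x e : R) : measurable (ball x e : set M) by exact: measurable_ball.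
  by apply: measurableX; [apply: measurableX|]; exact: mb.
have -> : ~` K = \bigcup_w (if pselect (B w `<=` ~` K) then B w else set0).
  apply/seteqP; split; last by move=> x [w _]; case: pselect => // h /h.
  move=> [[x y] z] Kx.
  have /nbhs_ballP[e /= e0 be] : nbhs (x, y, z) (~` K : set (R * R * R)).
    by apply: open_nbhs_nbhs; split => //; exact: closed_openC.
  have [n ne] : exists n : nat, n.+1%:R^-1 < e / 2 :> R.
    have [|n hn] := @ltr_add_invr R 0 (e / 2); first by rewrite divr_gt0.
    by exists n; rewrite add0r in hn.
  have n0 : 0 < n.+1%:R^-1 :> R by rewrite invr_gt0.
  have near (v u : R) : 0 < v -> exists a : rat, `|ratr a - u| < v.
    move=> v0; have [|a] := @rat_in_itvoo R (u - v) (u + v); first by lra.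
    by rewrite in_itv/= => /andP[a1 a2]; exists a; rewrite ltr_norml; apply/andP; split; lra.
  have [a ha] := near _ x n0; have [b hb] := near _ y n0; have [c hc] := near _ z n0.
  exists (a, b, c, n) => //; case: pselect => [h|[]].
    by split; [split|]; rewrite /ball/=.
  have tri (u v k : R) : `|u - v| < n.+1%:R^-1 -> `|u - k| < n.+1%:R^-1 -> `|v - k| < e.
    move: ne; move: (n.+1%:R^-1) => m ne.
    by rewrite !ltr_norml => /andP[? ?] /andP[? ?]; apply/andP; split; lra.
  move=> [[x' y'] z'] [[/= h1 h2] h3]; apply: be; split; [split|]; rewrite /ball/=.
  - exact: tri ha h1.
  - exact: tri hb h2.
  - exact: tri hc h3.
apply: countable_bigcupT_measurable; first by exact: countableP.
by move=> w; case: pselect => h; [exact: mB|exact: measurable0].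
Qed.

Local Open Scope ereal_scope.

Lemma int_itv (k a b : R) : (0 <= k)%R -> (a <= b)%R ->
  \int[mu]_x (k * \1_`[a, b] x)%:E = (k * (b - a))%:E.
Proof.
move=> k0 ab; have mI : measurable (`[a, b]%classic : set M) by exact: measurable_itv.
under eq_integral do rewrite EFinM.
rewrite ge0_integralZl//; last first.
  by apply/measurable_EFinP; exact: measurable_indic.
rewrite integral_indic// setIT [X in _ * X]lebesgue_measure_itv/= lte_fin.
by have [ab'|ba] := ltP a b; [|have -> : a = b by apply/eqP; rewrite eq_le ab ba]; rewrite ?subrr.
Qed.

Lemma int_box (D : set M) (c a1 b1 a2 b2 a3 b3 : R) : (0 <= c)%R ->
  (a1 <= b1)%R -> (a2 <= b2)%R -> (a3 <= b3)%R -> `[a1, b1]%classic `<=` D ->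
  \int[mu]_(x in D) \int[mu]_y \int[mu]_z (c * \1_`[a1, b1] x * \1_`[a2, b2] y * \1_`[a3, b3] z)%:E =
  (c * (b1 - a1) * (b2 - a2) * (b3 - a3))%:E.
Proof.
move=> c0 ab1 ab2 ab3 sub; rewrite integral_mkcond.
transitivity (\int[mu]_x (c * (b3 - a3) * (b2 - a2) * \1_`[a1, b1] x)%:E).
  apply: eq_integral => x _; rewrite patchE.
  transitivity (\int[mu]_y (c * \1_`[a1, b1] x * (b3 - a3) * \1_`[a2, b2] y)%:E).
    case: ifPn => xD.
      apply: eq_integral => y _; rewrite int_itv ?mulr_ge0//.
      by congr (_%:E); ring.
    rewrite indicE memNset; last by move=> h; exact: (negP xD (mem_set (sub x h))).
    by rewrite mulr0 !mul0r; under eq_integral do rewrite mul0r; rewrite integral0.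
  by rewrite int_itv ?mulr_ge0 ?subr_ge0//; congr (_%:E); ring.
by rewrite int_itv ?mulr_ge0 ?subr_ge0//; congr (_%:E); ring.
Qed.

End Box.

Section Local.
Context {R : realType}.
Local Notation M := (measurableTypeR R).
Local Notation H := (M * M * M)%type.
Local Notation mu := (@lebesgue_measure R).
Local Notation lebesgue3 := (@lebesgue3 R).
Variables (p q : R).
Hypotheses (p1 : 1 < p) (q1 : 1 < q) (pq : p^-1 + q^-1 = 1).
Local Notation C := (eC q).
Local Notation S := (eS q).
Local Notation Pi := (Piq q).
Local Notation Dq := (Dq q).
Local Notation expF := (expF q).
Local Notation d := (heis_dist p).
Let Pi0 : 0 < Pi. Proof. exact: Piq_gt0. Qed.

Lemma expF_up f s r : 0 < s < 2 * Pi -> 0 < r -> 0 < (expF f s r).2.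
Proof.
move=> /andP[s0 s2] r0; rewrite /expF /= mulr_gt0 ?divr_gt0 ?exprn_gt0//.
by apply: Wq_gt0 => //; apply/andP; split; lra.
Qed.

Lemma upind_wgt (O : set H) f s r : uexp q (upind O) f s r * wgt q f s r =
  if (0 < r) && (0 < s < 2 * Pi) then \1_O (expF f s r) * (r ^+ 3 * Dq f (f + s)) else 0.
Proof.
rewrite /wgt; case: ifPn => [/andP[r0 sI]|_]; last by rewrite mulr0.
by have := expF_up f sI r0; rewrite /uexp /upind /expF /= => ->.
Qed.

Variables (a1 b1 a2 b2 a3 b3 c : R).
Hypotheses (c0 : 0 <= c) (ab1 : a1 <= b1) (ab2 : a2 <= b2) (ab3 : a3 <= b3).
Hypotheses (a1P : -(2 * Pi) < a1) (b10 : b1 < 0) (a20 : 0 < a2) (b2P : b2 < 2 * Pi) (a30 : 0 < a3).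
Let box f s r := [&& a1 <= f <= b1, a2 <= s <= b2 & a3 <= r <= b3].

Let boxI f s r : c * \1_`[a1, b1] f * \1_`[a2, b2] s * \1_`[a3, b3] r =
  if box f s r then c else 0.
Proof.
have E (u a b : R) : \1_(`[a, b]%classic : set R) u = ((a <= u <= b)%R)%:R :> R.
  rewrite indicE; have [h|h] := boolP (a <= u <= b); first by rewrite mem_set//= in_itv.
  by rewrite memNset//= in_itv/=; exact/negP.
rewrite !E /box; case: (a1 <= f <= b1); case: (a2 <= s <= b2); case: (a3 <= r <= b3) => /=;
  by rewrite ?mulr1 ?mulr0 ?mul0r.
Qed.

Let sub0 : `[a1, b1]%classic `<=` (`](-(2 * Pi)), 0[%classic : set M).
Proof.
move=> u; rewrite /= !in_itv/= => /andP[u1 u2].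
by rewrite (lt_le_trans a1P u1) (le_lt_trans u2 b10).
Qed.

Let boxr f s r : box f s r -> (0 < r) && (0 < s < 2 * Pi).
Proof.
move=> /and3P[_ /andP[s1 s2] /andP[r1 _]].
by rewrite (lt_le_trans a30 r1) (lt_le_trans a20 s1) (le_lt_trans s2 b2P).
Qed.

Lemma area_box_ge (O : set H) : measurable O ->
  (forall f s r, a1 <= f <= b1 -> a2 <= s <= b2 -> a3 <= r <= b3 ->
    O (expF f s r) /\ c <= r ^+ 3 * Dq f (f + s)) ->
  ((c * (b1 - a1) * (b2 - a2) * (b3 - a3))%:E <= lebesgue3 O)%E.
Proof.
move=> mO HO; have mU := @measurable_up R.
have mOU := measurableI _ _ mO mU.
have le1 := le_measure lebesgue3 (mem_set mOU) (mem_set mO) (@subIsetl _ _ _).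
rewrite [leLHS](area3 q1 mO) in le1; apply: le_trans le1; rewrite -(int_box c0 ab1 ab2 ab3 sub0).
apply: ge0_le_integral_all => f fI; apply/andP; split.
  by apply: integral_ge0 => s _; apply: integral_ge0 => r _; rewrite lee_fin !mulr_ge0.
apply: ge0_le_integral_all => s _; apply/andP; split.
  by apply: integral_ge0 => r _; rewrite lee_fin !mulr_ge0.
apply: ge0_le_integral_all => r _; rewrite !lee_fin !mulr_ge0//= upind_wgt boxI.
have [fsr|_] := boolP (box f s r).
  rewrite (boxr fsr); have /and3P[h1 h2 h3] := fsr; have [Of Df] := HO _ _ _ h1 h2 h3.
  by rewrite indicE mem_set// mul1r.
by rewrite -upind_wgt mulr_ge0 ?wgt_ge0// /uexp /upind; case: ifP.
Qed.

Lemma area_box_le (O : set H) : measurable O -> O `<=` [set w | 0 < w.2] ->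
  (forall f s r, -(2 * Pi) < f < 0 -> 0 < s < 2 * Pi -> 0 < r -> O (expF f s r) ->
    [/\ a1 <= f <= b1, a2 <= s <= b2, a3 <= r <= b3 & r ^+ 3 * Dq f (f + s) <= c]) ->
  (lebesgue3 O <= (c * (b1 - a1) * (b2 - a2) * (b3 - a3))%:E)%E.
Proof.
move=> mO OU HO; rewrite -(setIidl OU) (area3 q1 mO) -(int_box c0 ab1 ab2 ab3 sub0).
have w0 f s r : 0 <= uexp q (upind O) f s r * wgt q f s r.
  by rewrite mulr_ge0 ?wgt_ge0// /uexp /upind; case: ifP.
apply: ge0_le_integral_all => f /=; rewrite in_itv/= => fI; apply/andP; split.
  by apply: integral_ge0 => s _; apply: integral_ge0 => r _; rewrite lee_fin.
apply: ge0_le_integral_all => s _; apply/andP; split.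
  by apply: integral_ge0 => r _; rewrite lee_fin.
apply: ge0_le_integral_all => r _; rewrite !lee_fin w0/= upind_wgt boxI.
case: ifPn => [/andP[r0 sI]|_]; last by case: ifP.
have [/set_mem OF|OF] := boolP (expF f s r \in O); last by rewrite indicE (negbTE OF) mul0r; case: ifP.
have [h1 h2 h3 hc] := HO _ _ _ fI sI r0 OF.
by rewrite indicE mem_set// mul1r /box h1 h2 h3.
Qed.

End Local.

(** * Contraction of small boxes *)

Section Necessary.
Context {R : realType}.
Local Notation M := (measurableTypeR R).
Local Notation H := (M * M * M)%type.
Local Notation lebesgue3 := (@lebesgue3 R).
Variables (p q : R).
Hypotheses (p1 : 1 < p) (q1 : 1 < q) (pq : p^-1 + q^-1 = 1).
Local Notation C := (eC q).
Local Notation S := (eS q).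
Local Notation Pi := (Piq q).
Local Notation Dq := (Dq q).
Local Notation expF := (expF q).
Local Notation d := (heis_dist p).
Let Pi0 : 0 < Pi. Proof. exact: Piq_gt0. Qed.

Definition expB (t : R) (w : R * R * R) : R * R * R := expF w.1.1 (t * w.1.2) w.2.

Lemma continuous_expB t : continuous (expB t).
Proof.
have c1 : continuous (fun w : R * R * R => w.1.1).
  by move=> w; apply: (@continuous_comp _ _ _ fst fst); exact: cvg_fst.
have c2 : continuous (fun w : R * R * R => w.1.2).
  by move=> w; apply: (@continuous_comp _ _ _ fst snd); [exact: cvg_fst|exact: cvg_snd].
have c3 : continuous (fun w : R * R * R => w.2) by move=> w; exact: cvg_snd.
have csum : continuous (fun w : R * R * R => w.1.1 + t * w.1.2).
  by move=> w; apply: cvgD; [exact: c1|apply: cvgM; [exact: cvg_cst|exact: c2]].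
have cl (k : R -> R) : (forall x, {for x, continuous k}) -> continuous (fun w : R * R * R => k w.1.1).
  by move=> ck w; apply: (@continuous_comp _ _ _ (fun w : R * R * R => w.1.1) k); [exact: c1|exact: ck].
have cr (k : R -> R) : (forall x, {for x, continuous k}) ->
    continuous (fun w : R * R * R => k (w.1.1 + t * w.1.2)).
  by move=> ck w; apply: (@continuous_comp _ _ _ (fun w : R * R * R => w.1.1 + t * w.1.2) k); [exact: csum|exact: ck].
have cC x : {for x, continuous C} by exact: dcontinuous (eC_derive q1 x).
have cS x : {for x, continuous S} by exact: dcontinuous (eS_derive q1 x).
have k1 : continuous (fun w : R * R * R => w.2 * (C (w.1.1 + t * w.1.2) - C w.1.1)).
  by move=> w; apply: cvgM; [exact: c3|apply: cvgB; [exact: cr|exact: cl]].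
have k2 : continuous (fun w : R * R * R => w.2 * (S (w.1.1 + t * w.1.2) - S w.1.1)).
  by move=> w; apply: cvgM; [exact: c3|apply: cvgB; [exact: cr|exact: cl]].
have k3 : continuous (fun w : R * R * R => w.2 ^+ 2 / 2 * Wq q w.1.1 (w.1.1 + t * w.1.2)).
  move=> w; apply: cvgM.
    by under eq_fun do rewrite expr2; apply: cvgM; [apply: cvgM; exact: c3|exact: cvg_cst].
  apply: cvgB; first by apply: cvgB; [exact: csum|exact: c1].
  by apply: cvgB; apply: cvgM; [exact: cl|exact: cr|exact: cl|exact: cr].
by move=> w; exact: (cvg_pair (cvg_pair (k1 w) (k2 w)) (k3 w)).
Qed.

Definition boxset (a1 b1 a2 b2 a3 b3 : R) : set (R * R * R) :=
  (`[a1, b1] `*` `[a2, b2]) `*` `[a3, b3].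

(** The image of a closed box is compact, hence closed, hence measurable. This is the reason for
    closed boxes as test sets. *)
Lemma measurable_expB t a1 b1 a2 b2 a3 b3 :
  measurable (expB t @` boxset a1 b1 a2 b2 a3 b3 : set H).
Proof.
apply: closed_measurable3; apply: compact_closed; first exact: norm_hausdorff.
apply: continuous_compact; first by apply: continuous_subspaceT; exact: continuous_expB.
by apply: compact_setX; [apply: compact_setX|]; exact: segment_compact.
Qed.

Lemma Dq_near f s e : 0 < e -> exists2 k : R, 0 < k &
  forall f' s', `|f' - f| < k -> `|s' - s| < k -> `|Dq f' (f' + s') - Dq f (f + s)| <= e.
Proof.
move=> e0; have [cD _] := continuous2_Dq_fq q1.
have /cvgrPdist_le/(_ e e0)/nbhs_ballP[k /= k0 Hk] := cD (f, s).
exists k => // f' s' hf hs; rewrite distrC.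
by apply: (Hk (f', s')); split; rewrite /ball/= distrC.
Qed.

(** MCP from the origin is tested on the image of a box in the coordinates (f, s, r). Its
    intermediate set lies in the image of the box with [s] scaled by [t], and in the comparison of
    volumes the side lengths and one factor [t] cancel. The bound [hi] keeps the volume of the test
    set finite. *)
Lemma box_decay K N t beta a1 b1 a2 b2 a3 b3 lo hi hi' : heis_MCP p K N ->
  a1 < b1 -> a2 < b2 -> a3 < b3 ->
  -(2 * Pi) < a1 -> b1 < 0 -> 0 < a2 -> b2 < 2 * Pi -> 0 < a3 -> 0 < t < 1 -> 0 < beta -> 0 < lo ->
  (forall f s r, a1 <= f <= b1 -> a2 <= s <= b2 -> a3 <= r <= b3 ->
    [/\ lo <= r ^+ 3 * Dq f (f + s) <= hi, r ^+ 3 * Dq f (f + t * s) <= hi',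
      beta <= mcp_bracket K N t (r * s) &
      0 < K -> r * s < pi * Num.sqrt ((N - 1) / K)]) ->
  beta * lo <= hi'.
Proof.
move=> mcp ab1 ab2 ab3 a1P b10 a20 b2P a30 /andP[t0 t1] beta0 lo0 HB.
set B := boxset a1 b1 a2 b2 a3 b3.
have BP f s r : B (f, s, r) <-> [/\ a1 <= f <= b1, a2 <= s <= b2 & a3 <= r <= b3].
  by rewrite /B /boxset /=; split=> [[[]]|[]]; rewrite /= !in_itv/=.
have i1 : a1 <= a1 <= b1 by rewrite lexx ltW.
have i2 : a2 <= a2 <= b2 by rewrite lexx ltW.
have i3 : a3 <= a3 <= b3 by rewrite lexx ltW.
have [/andP[w1 w2] w3 _ _] := HB _ _ _ i1 i2 i3.
have hi0 : 0 <= hi by exact: le_trans (ltW lo0) (le_trans w1 w2).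
have region f s r : B (f, s, r) -> [/\ -(2 * Pi) < f < 0, 0 < s < 2 * Pi, 0 < t * s < 2 * Pi & 0 < r].
  move=> /BP[/andP[f1 f2] /andP[s1 s2] /andP[r1 r2]].
  have s0 := lt_le_trans a20 s1; have s2P := le_lt_trans s2 b2P.
  rewrite (lt_le_trans a1P f1) (le_lt_trans f2 b10) s0 s2P (lt_le_trans a30 r1) mulr_gt0//=; split=> //.
  by apply: lt_trans s2P; rewrite gtr_pMl.
have hi'0 : 0 <= hi'.
  have Bw : B (a1, a2, a3) by exact/BP.
  have [_ _ /andP[s1 s2] r0] := region _ _ _ Bw.
  apply: le_trans w3.
  rewrite mulr_ge0 ?exprn_ge0 ?(ltW r0)//; apply/ltW/Dq_gt0 => //.
  by rewrite ltrDl ltrD2l s1.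
pose Om : set H := expB 1 @` B; pose Om' : set H := expB t @` B.
have mOm : measurable Om by exact: measurable_expB.
have mOm' : measurable Om' by exact: measurable_expB.
have up1 : Om `<=` [set w | 0 < w.2].
  move=> _ [[[f s] r] /region[_ sI _ r0] <-]; apply: (expF_up q1) => //.
  by rewrite mul1r.
have upt : Om' `<=` [set w | 0 < w.2].
  by move=> _ [[[f s] r] /region[_ _ sI r0] <-]; apply: (expF_up q1).
have mlo : ((lo * (b1 - a1) * (b2 - a2) * (b3 - a3))%:E <= lebesgue3 Om)%E.
  apply: (area_box_ge q1 (ltW lo0) (ltW ab1) (ltW ab2) (ltW ab3) a1P b10 a20 b2P a30 mOm).
  move=> f s r fI sI rI; have [/andP[l _] _ _ _] := HB f s r fI sI rI; split => //.
  by exists (f, s, r); [exact/BP|rewrite /expB mul1r].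
have mhi : (lebesgue3 Om <= (hi * (b1 - a1) * (b2 - a2) * (b3 - a3))%:E)%E.
  apply: (area_box_le q1 hi0 (ltW ab1) (ltW ab2) (ltW ab3) a1P b10 mOm up1).
  move=> f s r fI sI r0 [[[f' s'] r'] Bw]; rewrite /expB /= mul1r => FE.
  have [f'I s'I _ r'0] := region _ _ _ Bw; move: Bw.
  have [-> -> ->] := expF_inj p1 q1 pq f'I fI s'I sI r'0 r0 FE.
  by move=> /BP[h1 h2 h3]; have [/andP[_ h] _ _ _] := HB _ _ _ h1 h2 h3.
have mhi' : (lebesgue3 Om' <= (hi' * (b1 - a1) * (t * b2 - t * a2) * (b3 - a3))%:E)%E.
  have tab2 : t * a2 <= t * b2 by rewrite ler_pM2l// ltW.
  apply: (area_box_le q1 hi'0 (ltW ab1) tab2 (ltW ab3) a1P b10 mOm' upt).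
  move=> f s r fI sI r0 [[[f' s'] r'] Bw]; rewrite /expB /= => FE.
  have [f'I _ s'I r'0] := region _ _ _ Bw; move: Bw.
  have [-> <- ->] := expF_inj p1 q1 pq f'I fI s'I sI r'0 r0 FE.
  by move=> /BP[h1 h2 h3]; have [_ h _ _] := HB _ _ _ h1 h2 h3; rewrite !ler_pM2l.
have dOm y : Om y -> exists f s r, [/\ B (f, s, r), y = expF f s r & d (0, 0, 0) y = r * s].
  move=> [[[f s] r] Bw <-]; exists f, s, r; rewrite /expB /= mul1r; split=> //.
  have [_ /andP[s1 s2] _ r0] := region _ _ _ Bw.
  by rewrite (dist_expF p1 q1 pq)// !ltW.
have vol0 : 0 < (b1 - a1) * (b2 - a2) * (b3 - a3) by rewrite !mulr_gt0 ?subr_gt0.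
have fin : (0 < lebesgue3 Om < +oo)%E.
  rewrite (le_lt_trans mhi (ltry _)) andbT; apply: lt_le_trans mlo; rewrite lte_fin.
  by rewrite -!mulrA mulr_gt0// mulrA.
have t01 : 0 <= t <= 1 by rewrite !ltW.
have Hdom : 0 < K -> Om `<=` [set y | d (0, 0, 0) y < pi * Num.sqrt ((N - 1) / K)].
  move=> K0 y /dOm[f [s [r [/BP[h1 h2 h3] _ /= ->]]]].
  by have [_ _ _ /(_ K0)] := HB _ _ _ h1 h2 h3.
have mcp' := mcp (0, 0, 0) Om t mOm fin Hdom t01.
(* A point of a geodesic has the intermediate distances to both ends, so [geodesic_pt] determines
   it. *)
have sub : intermediate_set (d : H -> H -> R) (0, 0, 0) Om t `<=` Om'.
  move=> y [gam [hg g0 /dOm[f [s [r [Bw g1 ds]]]] gt]]; exists (f, s, r) => //; rewrite /expB /=.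
  have [_ sI _ r0] := region _ _ _ Bw.
  have tI : 0 < t < 1 by rewrite t0.
  have j0 : 0 <= (0 : R) <= 1 by apply/andP; split; [exact: lexx|exact: ler01].
  have j1 : 0 <= (1 : R) <= 1 by apply/andP; split; [exact: ler01|exact: lexx].
  apply/esym/(geodesic_pt p1 q1 pq sI r0 tI).
    by rewrite -gt -g0 (hg 0 t j0 t01) g0 ds sub0r normrN gtr0_norm.
  by rewrite -g1 -gt (hg t 1 t01 j1) g0 ds distrC gtr0_norm ?subr_gt0.
have ub := le_trans mcp' (le_trans (mu_ext_le mOm' sub) mhi').
have lb : ((t * beta)%:E * lebesgue3 Om <= \int[lebesgue3]_(y in Om) (t * mcp_bracket K N t (d (0%R, 0%R, 0%R) y))%:E)%E.
  rewrite -(integral_cst lebesgue3 mOm); apply: ge0_le_integral_all => y /dOm[f [s [r [/BP[h1 h2 h3] _ ->]]]].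
  have [_ _ hb _] := HB _ _ _ h1 h2 h3.
  by rewrite !lee_fin mulr_ge0 ?(ltW t0) ?(ltW beta0)//= ler_pM2l.
have tb : (0 <= (t * beta)%:E)%E by rewrite lee_fin mulr_ge0// ltW.
have := le_trans (lee_wpmul2l tb mlo) (le_trans lb ub); rewrite -EFinM lee_fin => fine.
have k0 : 0 < t * ((b1 - a1) * (b2 - a2) * (b3 - a3)) by rewrite mulr_gt0.
rewrite -(ler_pM2r k0); apply: le_trans (le_trans fine _).
  by rewrite le_eqVlt; apply/orP; left; apply/eqP; ring.
by rewrite le_eqVlt; apply/orP; left; apply/eqP; ring.
Qed.

Lemma half_min (m1 m2 : R) : 0 < m1 -> 0 < m2 -> exists e : R, [/\ 0 < e, e < m1 & e < m2].
Proof.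
move=> m10 m20; have mm1 : Num.min m1 m2 <= m1 by rewrite ge_min lexx.
have mm2 : Num.min m1 m2 <= m2 by rewrite ge_min lexx orbT.
have mm0 : 0 < Num.min m1 m2 by rewrite lt_min m10.
by exists (Num.min m1 m2 / 2); split; lra.
Qed.

Lemma local_decay K N f0 s0 r0 t beta delta : heis_MCP p K N ->
  -(2 * Pi) < f0 < 0 -> 0 < s0 < 2 * Pi -> 0 < r0 -> 0 < t < 1 -> 0 < beta -> 0 < delta ->
  (forall l, `|l - r0 * s0| < delta -> beta <= mcp_bracket K N t l /\
    (0 < K -> l < pi * Num.sqrt ((N - 1) / K))) ->
  beta * Dq f0 (f0 + s0) <= Dq f0 (f0 + t * s0).
Proof.
move=> mcp /andP[fl fu] /andP[sl su] r00 tI beta0 delta0 Hb; have /andP[t0 t1] := tI.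
pose D0 := Dq f0 (f0 + s0); pose D1 := Dq f0 (f0 + t * s0).
have D00 : 0 < D0 by apply: Dq_gt0 => //; rewrite ltrDl sl ltrD2l.
(* [E rho <= 0] is the outcome of [box_decay] on a box so small that r and the two values of [Dq]
   vary by at most [rho]; the claim is the limit rho = 0 divided by r0^3. *)
pose E rho := beta * ((r0 - rho) ^+ 3 * (D0 - rho)) - (r0 + rho) ^+ 3 * (D1 + rho).
suff : E 0 <= 0.
  by rewrite /E !subr0 !addr0 mulrCA -mulrBr pmulr_rle0 ?subr_le0// exprn_gt0.
have cE : {for 0, continuous E}.
  have dm := dB (dcst 0 r0) (did 0); have dp := dD (dcst 0 r0) (did 0).
  rewrite (_ : E = fun rho => beta * ((r0 - rho) * (r0 - rho) * (r0 - rho) * (D0 - rho)) -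
    (r0 + rho) * (r0 + rho) * (r0 + rho) * (D1 + rho)); last by apply/funext => rho; rewrite /E; ring.
  exact: (dcontinuous (dB (dZ beta (dM (dM (dM dm dm) dm) (dB (dcst 0 D0) (did 0))))
    (dM (dM (dM dp dp) dp) (dD (dcst 0 D1) (did 0))))).
have [rho0 [rho00 rho0r rho0D]] := half_min r00 D00.
apply: (continuous_le0 cE rho00) => rho; rewrite add0r => /andP[rp rrho].
have rr := lt_trans rrho rho0r; have rD := lt_trans rrho rho0D.
rewrite /E subr_le0; clear cE E rho0 rho00 rho0r rho0D rrho.
have [e1 e10 H1] := @Dq_near f0 s0 rho rp; have [e2 e20 H2] := @Dq_near f0 (t * s0) rho rp.
have [m1 [m10 m1e1 m1e2]] := half_min e10 e20.
have f00 : 0 < - f0 by rewrite oppr_gt0.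
have f01 : 0 < f0 + 2 * Pi by rewrite -ltrBlDr sub0r.
have [m2 [m20 m2f m2f']] := half_min f00 f01.
have s01 : 0 < 2 * Pi - s0 by rewrite subr_gt0.
have [m3 [m30 m3s m3s']] := half_min sl s01.
(* When s and r are within [e] of s0 and r0 one has r <= 2 r0, so the length r s changes by at most
   (2 r0 + s0) e and stays within [delta]. *)
have qd : 0 < delta / (2 * r0 + s0) by rewrite divr_gt0// addr_gt0// mulr_gt0.
have [m4 [m40 m4r m4d]] := half_min rp qd.
have [m5 [m50 m51 m52]] := half_min m10 m20.
have [m6 [m60 m63 m64]] := half_min m30 m40.
have [e [e0 em5 em6]] := half_min m50 m60.
have ee1 := lt_trans (lt_trans em5 m51) m1e1; have ee2 := lt_trans (lt_trans em5 m51) m1e2.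
have ef := lt_trans (lt_trans em5 m52) m2f; have ef' := lt_trans (lt_trans em5 m52) m2f'.
have es := lt_trans (lt_trans em6 m63) m3s; have es' := lt_trans (lt_trans em6 m63) m3s'.
have er := lt_trans (lt_trans em6 m64) m4r; have ed := lt_trans (lt_trans em6 m64) m4d.
clear m1 m10 m1e1 m1e2 m2 m20 m2f m2f' m3 m30 m3s m3s' m4 m40 m4r m4d m5 m50 m51 m52 m6 m60 m63 m64 em5 em6.
have ball x y : y - e <= x <= y + e -> `|x - y| <= e.
  by move=> /andP[x1 x2]; rewrite ler_norml lerBrDl x1 lerBlDl x2.
have lt2 x : x - e < x + e by rewrite ltrD2l gtrN.
apply: (box_decay (hi := (r0 + rho) ^+ 3 * (D0 + rho)) mcp (lt2 f0) (lt2 s0) (lt2 r0)) tI beta0 _ _ => //.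
- by rewrite ltrBrDr addrC ltrBlDr.
- by rewrite -ltrBrDl sub0r.
- by rewrite subr_gt0.
- by rewrite -ltrBrDl.
- by rewrite subr_gt0 (lt_trans er).
- by rewrite mulr_gt0 ?exprn_gt0// subr_gt0.
move=> f s r /ball fI /ball sI rI; have /ball rI' := rI; have /andP[ra rb] := rI.
have rho0 : 0 <= r0 - rho by rewrite subr_ge0 ltW.
have rlo : r0 - rho <= r by apply: le_trans ra; rewrite lerD2l lerN2 ltW.
have rhi : r <= r0 + rho by apply: le_trans rb _; rewrite lerD2l ltW.
have r0' : 0 <= r by exact: le_trans rlo.
have clo : (r0 - rho) ^+ 3 <= r ^+ 3 by rewrite lerXn2r// nnegrE.
have chi : r ^+ 3 <= (r0 + rho) ^+ 3 by rewrite lerXn2r// nnegrE (le_trans r0').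
have := H1 f s (le_lt_trans fI ee1) (le_lt_trans sI ee1); rewrite -/D0 ler_distl => /andP[Dl Du].
have tsI : `|t * s - t * s0| < e2.
  rewrite -mulrBr normrM gtr0_norm//; apply: le_lt_trans ee2; apply: le_trans sI.
  by rewrite ler_piMl// ltW.
have := H2 f (t * s) (le_lt_trans fI ee2) tsI; rewrite -/D1 ler_distl => /andP[_ Du1].
have D0r : 0 <= D0 - rho by rewrite subr_ge0 ltW.
have rs : `|r * s - r0 * s0| < delta.
  have -> : r * s - r0 * s0 = r * (s - s0) + s0 * (r - r0) by ring.
  apply: le_lt_trans (ler_normD _ _) _; rewrite !normrM (ger0_norm r0') (gtr0_norm sl).
  apply: (@le_lt_trans _ _ (2 * r0 * e + s0 * e)); last by rewrite -mulrDl mulrC -ltr_pdivlMr// addr_gt0// mulr_gt0.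
  apply: lerD; last by rewrite ler_pM2l.
  by apply: ler_pM => //; apply: le_trans rhi _; rewrite mulr_natl mulr2n lerD2l ltW.
have [hb hK] := Hb _ rs.
split => //.
- apply/andP; split; first by apply: ler_pM => //; exact: exprn_ge0.
  by apply: ler_pM => //; [exact: exprn_ge0|exact: le_trans Dl].
- have [D1p|D1n] := leP 0 (Dq f (f + t * s)).
    by apply: ler_pM => //; exact: exprn_ge0.
  apply: (@le_trans _ _ 0); first by rewrite mulr_ge0_le0 ?exprn_ge0// ltW.
  rewrite mulr_ge0//; first by rewrite exprn_ge0// (le_trans r0').
  have : 0 <= D1.
    by apply/ltW/Dq_gt0 => //; rewrite ltrDl mulr_gt0//= ltrD2l (lt_trans _ su)// gtr_pMl.
  by move=> h; rewrite addr_ge0// ltW.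
Qed.

End Necessary.

(** * Equivalence with the Jacobian inequality *)

Section Equivalence.
Context {R : realType}.
Variables (p q : R).
Hypotheses (p1 : 1 < p) (q1 : 1 < q) (pq : p^-1 + q^-1 = 1).
Local Notation Pi := (Piq q).
Local Notation Dq := (Dq q).
Let Pi0 : 0 < Pi. Proof. exact: Piq_gt0. Qed.

Lemma mcp_bracket_pos (K N t r : R) (a := Num.sqrt K * (r / Num.sqrt (N - 1))) : 0 < K -> 1 < N ->
  sin a != 0 -> mcp_bracket K N t r = (sin (t * a) / sin a) `^ (N - 1).
Proof.
move=> K0 N1 sa; have s0 : 0 < Num.sqrt (N - 1) by rewrite sqrtr_gt0 subr_gt0.
have k0 : 0 < Num.sqrt K by rewrite sqrtr_gt0.
rewrite /mcp_bracket leNgt K0 /quot01 /s_ K0 -/a.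
have nz : (sin a / Num.sqrt K == 0) = false.
  by apply/negbTE; rewrite mulf_neq0// invr_eq0 gt_eqF.
rewrite nz andbF; congr (_ `^ _).
rewrite (_ : Num.sqrt K * (t * r / _) = t * a); last by rewrite /a; ring.
by field; rewrite sa gt_eqF.
Qed.

Lemma half_sin_ratio (a : R) : 0 < a < pi -> [/\ 0 < sin a, 0 < cos (a / 2) &
  sin (1 / 2 * a) / sin a = (2 * cos (a / 2))^-1].
Proof.
move=> /andP[a0 a1]; have s2 : 0 < sin (a / 2) by apply: sin_gt0_pi; apply/andP; split; lra.
have c2 : 0 < cos (a / 2) by apply: cos_gt0_pihalf; apply/andP; split; lra.
have E : sin a = 2 * (sin (a / 2) * cos (a / 2)).
  by rewrite {1}(splitr a) sinD; ring.
rewrite E (_ : 1 / 2 * a = a / 2); last by ring.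
split => //; first by rewrite !mulr_gt0.
by field; rewrite !gt_eqF.
Qed.

(** At t = 1/2 the sine quotient is 1 / (2 cos(a / 2)), which is unbounded as [a] tends to pi.
    Adjusting r gives a fixed arc any length, in particular one close to the critical distance,
    while the ratio of Jacobians stays the same. *)
Lemma MCP_le0 K N : MCP_defined K N -> heis_MCP p K N -> K <= 0.
Proof.
move=> KN mcp; rewrite leNgt; apply/negP => K0.
have N1 : 1 < N by case: KN => // -[]; rewrite leNgt K0.
have Pi0' : 0 < Pi by []. have pi0 := pi_gt0 R.
have D0 : 0 < Dq (- Pi) (- Pi + Pi) by apply: Dq_gt0 => //; apply/andP; split; lra.
have D1 : 0 < Dq (- Pi) (- Pi + 1 / 2 * Pi) by apply: Dq_gt0 => //; apply/andP; split; lra.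
(* A lower bound on the distortion that would force the Jacobian at the midpoint of the half-turn to
   exceed itself by 1. *)
pose beta := (Dq (- Pi) (- Pi + 1 / 2 * Pi) + 1) / Dq (- Pi) (- Pi + Pi).
have beta0 : 0 < beta by rewrite divr_gt0// addr_gt0.
have N10 : 0 < N - 1 by rewrite subr_gt0.
pose b := beta `^ (N - 1)^-1.
have b0 : 0 < b by exact: powR_gt0.
have b20 : 0 < (2 * b)^-1 by rewrite invr_gt0 mulr_gt0.
have [eta eta0 Hcos] := (cts_epsP _ _).1 (dcontinuous (is_derive_cos (pi / 2))) _ b20.
have [m [m0 me mp]] := half_min eta0 (divr_gt0 pi0 (ltr0Sn _ 1)).
have sN0 : 0 < Num.sqrt (N - 1) by rewrite sqrtr_gt0.
have sK0 : 0 < Num.sqrt K by rewrite sqrtr_gt0.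
pose k := Num.sqrt (N - 1) / Num.sqrt K.
have k0 : 0 < k by rewrite divr_gt0.
have pik : pi * Num.sqrt ((N - 1) / K) = pi * k.
  by rewrite sqrtrM ?ltW// sqrtrV ?ltW.
(* The half-turn then has length (pi - m) k. A tolerance of m k keeps [a] in ]pi - 2 m, pi[, so that
   a / 2 is within [eta] of pi / 2. *)
pose r0 := (pi - m) * k / Pi.
have mpi : m < pi by lra.
have r00 : 0 < r0 by rewrite divr_gt0// mulr_gt0// subr_gt0.
have mk : 0 < m * k by rewrite mulr_gt0.
suff : beta * Dq (- Pi) (- Pi + Pi) <= Dq (- Pi) (- Pi + 1 / 2 * Pi).
  rewrite /beta divfK ?gt_eqF//; lra.
apply: (local_decay p1 q1 pq mcp _ _ r00 _ beta0 mk); [by apply/andP; split; lra..|].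
move=> l; rewrite /r0 divfK ?gt_eqF// ltr_norml => /andP[l1 l2].
pose a := l / k; have lE : l = a * k by rewrite /a divfK ?gt_eqF.
have a1 : pi - 2 * m < a by rewrite -(ltr_pM2r k0) -lE; lra.
have a2 : a < pi by rewrite -(ltr_pM2r k0) -lE; lra.
split; last by rewrite pik lE ltr_pM2r.
have a0 : 0 < a by lra.
have [sa ca ratio] : [/\ 0 < sin a, 0 < cos (a / 2) & sin (1 / 2 * a) / sin a = (2 * cos (a / 2))^-1].
  by apply: half_sin_ratio; rewrite a0.
have aE : Num.sqrt K * (l / Num.sqrt (N - 1)) = a.
  by rewrite /a /k; field; rewrite !gt_eqF.
rewrite mcp_bracket_pos ?aE ?gt_eqF// ratio.
have -> : beta = b `^ (N - 1) by rewrite -powRrM mulVf ?gt_eqF// powRr1// ltW.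
apply: ge0_ler_powR; rewrite ?nnegrE ?invr_ge0 ?mulr_ge0 ?(ltW N10) ?(ltW b0) ?(ltW ca)//.
have : `|cos (a / 2) - cos (pi / 2)| <= (2 * b)^-1.
  by apply: Hcos; rewrite ltr_norml; apply/andP; split; lra.
rewrite cos_pihalf subr0 gtr0_norm// => h.
rewrite -[leLHS]invrK lef_pV2 ?posrE ?invr_gt0 ?mulr_gt0//.
apply: (@le_trans _ _ (2 * (2 * b)^-1)); first by rewrite ler_pM2l.
by rewrite invfM mulrA mulfV ?mul1r.
Qed.

(** From y <= sinh y and (1 - x) sinh x <= x: an explicit rate for sinh(t x) / sinh(x) tending to
    [t] as x tends to 0. *)
Lemma sinh_ratio_ge (t x : R) : 0 < t -> 0 < x <= 1 -> t * (1 - x) <= Defs.sinh (t * x) / Defs.sinh x.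
Proof.
move=> t0 /andP[x0 x1]; have lo (y : R) : 0 <= y -> y <= Defs.sinh y.
  move=> y0; rewrite -subr_ge0.
  have dE (k z : R) : is_derive z 1 (fun z => expR (k * z)) (expR (k * z) * (k * 1)).
    exact: (dcomp (is_derive_expR (k * z)) (dZ k (did z))).
  pose F (z : R) := (expR (1 * z) - expR (-1 * z)) * 2^-1 - z.
  have dF z := dB (dM (dB (dE 1 z) (dE (-1) z)) (dcst z 2^-1)) (did z).
  have : F 0 <= F y.
    apply: (@is_derive_nondecr R F _ 0 y y0 _ (fun z _ => dF z)).
      by move=> z _; exact: dcontinuous (dF z).
    by move=> z _; have := expR_ge1Dx (1 * z); have := expR_ge1Dx (-1 * z); lra.
  by rewrite /F !mulr0 subrr mul0r subr0 mul1r mulN1r.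
have x10 : 0 <= 1 - x by rewrite subr_ge0.
have hi : Defs.sinh x * (1 - x) <= x.
  have e1 : 1 - x <= expR (- x) by have := expR_ge1Dx (- x); lra.
  have s0 : 0 <= Defs.sinh x by exact/sinh_ge0/ltW.
  apply: le_trans (ler_wpM2l s0 e1) _; rewrite /Defs.sinh.
  have E1 : expR x * expR (- x) = 1 by rewrite -expRD subrr expR0.
  have E2 : expR (- x) * expR (- x) = expR (- x - x) by rewrite -expRD.
  have := expR_ge1Dx (- x - x); rewrite -E2.
  have -> : (expR x - expR (- x)) / 2 * expR (- x) = (expR x * expR (- x) - expR (- x) * expR (- x)) / 2 by ring.
  by rewrite E1; lra.
rewrite ler_pdivlMr ?sinh_gt0//; apply: le_trans (lo _ (mulr_ge0 (ltW t0) (ltW x0))).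
by rewrite -mulrA [(1 - x) * _]mulrC; apply: ler_wpM2l => //; exact: ltW.
Qed.

(** The Jacobian inequality does not involve r, so for K < 0 it may be derived at small distances,
    where the distortion coefficient approaches t^(N - 1). *)
Lemma MCP_decay K N : MCP_defined K N -> heis_MCP p K N -> jacobian_decay q N.
Proof.
move=> KN mcp f s t fI sI tI; have K0 := MCP_le0 KN mcp.
have /andP[s0 s2] := sI; have /andP[t0 t1] := tI.
have noK (l : R) : 0 < K -> l < pi * Num.sqrt ((N - 1) / K) by rewrite ltNge K0.
have t'0 (x : R) : 0 < t `^ x by exact: powR_gt0.
have [N1|[_ N1]] := KN; last first.
  apply: (local_decay p1 q1 pq mcp fI sI ltr01 tI (t'0 _) ltr01) => l _; split; last exact: noK.
  by rewrite N1 mcp_bracket_N1// subrr powRr0.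
have N10 : 0 < N - 1 by rewrite subr_gt0.
move: (K0); rewrite le_eqVlt => /predU1P[KE|Kn].
  apply: (local_decay p1 q1 pq mcp fI sI ltr01 tI (t'0 _) s0) => l; rewrite mul1r => ls; split; last exact: noK.
  rewrite KE mcp_bracket_0//; move: ls; rewrite ltr_norml => /andP[? _]; lra.
pose c := Num.sqrt (- K) / Num.sqrt (N - 1).
have c0 : 0 < c by rewrite divr_gt0// sqrtr_gt0 ?oppr_gt0.
pose F e := (t * (1 - e)) `^ (N - 1) * Dq f (f + s) - Dq f (f + t * s).
suff : F 0 <= 0 by rewrite /F subr0 mulr1 subr_le0.
have t10 : 0 < t * (1 - 0) by rewrite subr0 mulr1.
have cF := dcontinuous (dB (dM (@dpowR R (N - 1) (fun e => t * (1 - e)) 0 _ t10 (dZ t (dB (dcst 0 1) (did 0))))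
  (dcst 0 (Dq f (f + s)))) (dcst 0 (Dq f (f + t * s)))).
apply: (continuous_le0 cF ltr01) => e; rewrite add0r => /andP[e0 e1]; rewrite /F subr_le0.
(* The lengths considered lie in ]0, e / c[, so the argument [a = c * l] of the hyperbolic sines
   stays in ]0, e[. *)
have r0 : 0 < e / (2 * c) / s by rewrite !divr_gt0// mulr_gt0.
have be0 : 0 < (t * (1 - e)) `^ (N - 1) by rewrite powR_gt0// mulr_gt0// subr_gt0.
have de0 : 0 < e / (2 * c) by rewrite divr_gt0// mulr_gt0.
apply: (local_decay p1 q1 pq mcp fI sI r0 tI be0 de0) => l.
rewrite divfK ?gt_eqF// ltr_distl subrr => /andP[l0 l2]; split; last exact: noK.
have cl0 : 0 < c * l by rewrite mulr_gt0.
have cle : c * l < e.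
  move: l2; rewrite (_ : e / (2 * c) + e / (2 * c) = e / c); last by field; rewrite gt_eqF.
  by rewrite ltr_pdivlMr// mulrC.
rewrite mcp_bracket_neg//; set a := Num.sqrt (- K) * _.
have aE : a = c * l by rewrite /a /c; ring.
have aI : 0 < a <= 1 by rewrite aE cl0 ltW// (lt_trans cle).
have := sinh_ratio_ge t0 aI; rewrite {1}aE => h.
have h0 : t * (1 - e) <= Defs.sinh (t * a) / Defs.sinh a.
  by apply: le_trans h; rewrite ler_pM2l// lerD2l lerN2 ltW.
have te0 : 0 <= t * (1 - e) by rewrite mulr_ge0 ?subr_ge0 ?ltW.
apply: ge0_ler_powR => //; first exact: ltW.
by rewrite nnegrE (le_trans te0).
Qed.

Lemma MCP_iff K N : MCP_defined K N -> heis_MCP p K N <-> K <= 0 /\ jacobian_decay q N.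
Proof.
move=> KN; split=> [mcp|[K0 J]]; last exact: (decay_MCP p1 q1 pq).
by split; [exact: MCP_le0 mcp|exact: MCP_decay mcp].
Qed.

Lemma decay_mono N N' : N <= N' -> jacobian_decay q N -> jacobian_decay q N'.
Proof.
move=> NN J f s t fI sI tI; apply: le_trans (J f s t fI sI tI); apply: ler_wpM2r.
  by apply/ltW/Dq_gt0 => //; case/andP: sI => ? ?; rewrite ltrDl ltrD2l; apply/andP.
by apply: ger_powR; [case/andP: tI => -> /ltW|rewrite lerD2r].
Qed.

(** Continuity of t^(N - 1) in N. Thus the set of admissible exponents contains its infimum. *)
Lemma decay_closed N : (forall N', N < N' -> jacobian_decay q N') -> jacobian_decay q N.
Proof.
move=> J f s t fI sI tI; have /andP[t0 _] := tI.
pose F x := t `^ (x - 1) * Dq f (f + s) - Dq f (f + t * s).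
suff : F N <= 0 by rewrite /F subr_le0.
have cF : {for N, continuous F}.
  have := @dcomp R expR (fun x => (x - 1) * ln t) N _ _ (is_derive_expR ((N - 1) * ln t)) (dM (dB (did N) (dcst N 1)) (dcst N (ln t))).
  move=> d; apply: (dcontinuous (dB (dM (dnear d _) (dcst N (Dq f (f + s)))) (dcst N (Dq f (f + t * s))))).
  by exists 1 => // y _; rewrite /powR gt_eqF.
apply: (continuous_le0 cF ltr01) => x /andP[Nx _]; rewrite subr_le0; exact: J.
Qed.

End Equivalence.

Theorem theoremA (R : realType) (p q : R) :
  1 < p -> p <> 2 -> p^-1 + q^-1 = 1 ->
  (p < 2 ->
     [/\ heis_curv p \is a fin_num,
         ((2 * q + 1)%:E < heis_curv p)%E
       & forall K N : R, MCP_defined K N ->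
           (heis_MCP p K N <-> K <= 0 /\ (heis_curv p <= N%:E)%E)]) /\
  (2 < p -> forall K N : R, MCP_defined K N -> ~ heis_MCP p K N).
Proof.
move=> p1 _ pq; have p0 : 0 < p by exact: lt_trans ltr01 p1.
have pV : p^-1 < 1 by rewrite invf_lt1.
have pV0 : 0 < p^-1 by rewrite invr_gt0.
have qV : q^-1 = 1 - p^-1 by rewrite -pq addrC addKr.
have qV0 : 0 < q^-1 by rewrite qV subr_gt0.
have q0 : 0 < q by rewrite -invr_gt0.
have q1 : 1 < q by rewrite -invf_lt1// qV gtrBl.
split=> [p2|p2 K N KN mcp]; last first.
  have q2 : q < 2.
    rewrite -ltf_pV2 ?posrE// qV.
    have : p^-1 < 2^-1 by rewrite ltf_pV2 ?posrE.
    lra.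
  have N1 : 1 <= N by case: KN => [/ltW//|[_ ->]].
  exact: (no_decay_lt2 q1 q2 N1) (MCP_decay p1 q1 pq KN mcp).
have q2 : 2 < q.
  rewrite -ltf_pV2 ?posrE// qV.
  have : 2^-1 < p^-1 by rewrite ltf_pV2 ?posrE.
  lra.
pose A := [set N : R | jacobian_decay q N].
have lb N : A N -> 2 * q + 1 < N.
  by move=> J; rewrite ltNge; apply/negP => /(decay_mono q1)/(_ J)/(no_decay_gt2 q1 q2).
have [N1 _ JN1] := decay_exists q1 q2.
have hA : has_inf A by split; [exists N1|exists (2 * q + 1) => N /lb/ltW].
pose Np := inf A.
(* Admissibility of the infimum itself makes the lower bound [2 * q + 1] strict for it, and shows
   that the condition on [N] includes equality. *)
have JNp : jacobian_decay q Np.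
refine (@decay_closed R q Np _) => N NpN.
  have NpN0 : 0 < N - Np by rewrite subr_gt0.
  have [N' AN' N'N] := inf_adherent NpN0 hA.
  by apply: (decay_mono q1) AN'; move: N'N; rewrite -/Np addrC subrK => /ltW.
have curvE : heis_curv p = Np%:E.
  apply/eqP; rewrite eq_le; apply/andP; split.
    apply: ereal_inf_lbound; exists Np => //=.
    have Np1 : 1 < Np by apply: lt_trans (lb _ JNp); lra.
    by split=> //; apply/(MCP_iff p1 q1 pq (or_introl Np1)).
  apply: le_ereal_inf_tmp => _ [N [N1' mcp] <-]; rewrite lee_fin.
  apply: inf_lbound; first exact: hA.2.
  exact: (MCP_decay p1 q1 pq (or_introl N1') mcp).
rewrite curvE; split => //; first by rewrite lte_fin; exact: lb.
move=> K N KN; rewrite (MCP_iff p1 q1 pq KN) lee_fin; split=> -[K0 h]; split=> //.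
  by apply: inf_lbound => //; exact: hA.2.
exact: (decay_mono q1) h JNp.
Qed.
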